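(* Let $w,w'>0$ and $u,u'\ge 0$ be fixed with $$\frac{u}{w^2}=\frac{u'}{(w')^2}.$$ Set $a^2=w^2+u^2$, $b^2=(w')^2+(u')^2$ (with $a,b>0$), $\delta=u+u'$, and let $c_{**}>0$ be the solution with $c_{**}^2\ge a^2+b^2$ of $$\delta^2=\frac{2c_{**}^4\,(c_{**}^2-a^2-b^2)}{(c_{**}^2-a^2+b^2)(c_{**}^2+a^2-b^2)} .$$ For each $n$ let $G_n,G_n',\widetilde G_n,\widetilde G_n'$ be independent $n\times n$ GUE matrices, let $D_n=\operatorname{diag}(\operatorname{spec}(\widetilde G_n))$, $D_n'=\operatorname{diag}(\operatorname{spec}(\widetilde G_n'))$, and $$X_n=\sqrt n\,(wG_n+uD_n),\qquad Y_n=\sqrt n\,(w'G_n'+u'D_n').$$ Let $h_n$ be the random hive obtained by applying the octahedron recurrence (defined in the context) to the two minor processes of $X_n$ and $Y_n$, and let $q_n$ be its probability density on the cone of hives. Then, as $n\to\infty$, $$D_{\mathrm{KL}}\Bigl(q_n\,\Big\|\,\operatorname{Density}\bigl(\mathcal H_n(a\sqrt n,\,b\sqrt n,\,c_{**}\sqrt n)\bigr)\Bigr)=O(n\log n),$$ where the implied constant may depend on $w,w',u,u'$ but not on $n$.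
   Context: **Matrices.** A GUE matrix of size $n$ is a random Hermitian matrix with independent $N(0,1)$ diagonal entries and independent $N(0,1/2)$ real and imaginary parts of the entries above the diagonal. $\operatorname{spec}(H)$ is the vector of eigenvalues in non-increasing order. $\mathbb R^n_{\ge}=\{x\in\mathbb R^n:x_1\ge\dots\ge x_n\}$ and $V_n(x)=\prod_{i<j}(x_i-x_j)$ for $x\in\mathbb R^n_\ge$. $D_{\mathrm{KL}}(q\|p)=\int q\log(q/p)$. **Hives.** Let $T_n=\{(x,y)\in\mathbb Z^2:0\le x\le y\le n\}$. A function $h:T_n\to\mathbb R$ is discrete (rhombus) concave if, whenever all points involved lie in $T_n$, $h(x,y)-h(x+1,y)-h(x+1,y+1)+h(x+2,y+1)\le 0$, $-h(x,y)+h(x+1,y)+h(x,y+1)-h(x+1,y+1)\le 0$, $h(x,y)-h(x+1,y+1)-h(x,y+1)+h(x+1,y+2)\le 0$. For $\lambda,\mu,\nu\in\mathbb R^n_\ge$ with $\sum\lambda_i+\sum\mu_i=\sum\nu_i$, $H_n(\lambda,\mu;\nu)$ is the set of discrete concave $h$ with $h(0,i)=\sum_{j\le i}\lambda_j$, $h(i,n)=\sum_{j\le n}\lambda_j+\sum_{j\le i}\mu_j$, $h(i,i)=\sum_{j\le i}\nu_j$ for $0\le i\le n$. The cone of hives is the union of all $H_n(\lambda,\mu;\nu)$, with Lebesgue measure in the coordinates $\lambda_1,\dots,\lambda_n,\mu_1,\dots,\mu_n,\nu_1,\dots,\nu_{n-1}$ and $h(x,y)$, $0<x<y<n$. All densities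 on hives are with respect to this measure. **The law $\mathcal H_n(a,b,c)$.** Let $a,b,c>0$ be the side lengths of a nondegenerate triangle which is acute, or has a right or obtuse angle opposite $c$. If $c^2\ne a^2+b^2$, let $(A,B,C)$ be the real numbers, with either $A,B,C>0$ or ($A,B>0$ and $-C>A+B$), such that $$a^2=\tfrac{A(B+C)}{A+B+C},\quad b^2=\tfrac{B(C+A)}{A+B+C},\quad c^2=\tfrac{C(A+B)}{A+B+C}.$$ If $c^2=a^2+b^2$, put $A=a^2$, $B=b^2$ and interpret $1/C$ as $0$. Then $\mathcal H_n(a,b,c)$ is the probability law on the cone of hives whose density at $h\in H_n(\lambda,\mu;\nu)$ is proportional to $$V_n(\lambda)V_n(\mu)V_n(\nu)\exp\Bigl[-\tfrac12\Bigl(\tfrac{|\lambda|^2}{A}+\tfrac{|\mu|^2}{B}+\tfrac{|\nu|^2}{C}\Bigr)\Bigr].$$ **The hive $h_n$ (octahedron recurrence).** For $1\le k\le n$ let $\lambda^{(k)}$, resp. $\mu^{(k)}$, be the ordered spectrum (non-increasing) of the $k\times k$ northwest principal minor of $X_n$, resp. $Y_n$; set $\lambda=\lambda^{(n)}$, $\mu=\mu^{(n)}$, and let $x_k=(X_n)_{kk}$. Consider the points $i=(i_0,i_1,i_2,i_3)\in\mathbb Z_{\ge0}^4$ with $i_0+i_1+i_2+i_3=n$ and define a real function $F$ on them as follows. If $i_3=0$, $F(i)=\sum_{m=1}^{i_2}\lambda^{(n-i_0)}_m$. If $i_1=0$, $F(i)=\sum_{m=1}^{n-i_0}x_m+\sum_{m=1}^{i_3}\mu^{(n-i_0)}_m$.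 (These agree when $i_1=i_3=0$.) All other values are determined inductively on $i_1+i_3$ by the max-plus octahedron recurrence: for every $p\in\mathbb Z_{\ge0}^4$ with coordinate sum $n-2$, with $e_0,\dots,e_3$ the standard basis, $$F(p+e_1+e_3)+F(p+e_0+e_2)=\max\{F(p+e_0+e_1)+F(p+e_2+e_3),\;F(p+e_0+e_3)+F(p+e_1+e_2)\}.$$ Then $h_n(x,y):=F(0,\,n-y,\,y-x,\,x)$ for $(x,y)\in T_n$; this is a hive in $H_n(\lambda,\mu;\nu)$ for some $\nu\in\mathbb R^n_{\ge}$. (Equivalently: realize the two Gelfand–Tsetlin patterns as hives in $H_n(\Lambda,\lambda;\Lambda+\operatorname{diag}X_n)$ and $H_n(\Lambda+\operatorname{diag}X_n,\mu;\Lambda+\operatorname{diag}X_n+\operatorname{diag}Y_n)$ for an auxiliary $\Lambda$ with sufficiently large gaps, glue them along the common side, and transport by the octahedron recurrence to the opposite triangulation; $\Lambda$ cancels and the hive with boundary $(\lambda,\mu;\nu)$ is $h_n$.) *)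

(* Defs.v *)
From HB Require Import structures.
From mathcomp Require Import all_boot all_order all_algebra.
From mathcomp Require Import all_classical all_reals all_analysis.
From mathcomp Require Import complex.
Import Order.TTheory GRing.Theory Num.Theory.
Import numFieldNormedType.Exports.

Set Implicit Arguments.
Unset Strict Implicit.
Unset Printing Implicit Defensive.

Local Open Scope classical_set_scope.
Local Open Scope ring_scope.
Local Open Scope complex_scope.

(* Lebesgue measure on [R^n] is carried by the library's measurable type
   [n.-tuple R]; [lebesgue_tuple_box] below characterizes it. *)

Section lebesgue_tuple.
Context {R : realType}.

Definition cons_pair n (p : measurableTypeR R * n.-tuple (measurableTypeR R)) : n.+1.-tuple (measurableTypeR R) :=
  [tuple of p.1 :: p.2].

Lemma measurable_cons_pair n : measurable_fun setT (@cons_pair n).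
Proof. by apply: measurable_cons; [exact: measurable_fst|exact: measurable_snd]. Qed.

Definition lebesgue_cons n
    (m : {sigma_finite_measure set (n.-tuple (measurableTypeR R)) -> \bar R}) :
    set (n.+1.-tuple (measurableTypeR R)) -> \bar R :=
  pushforward (lebesgue_measure \x m)%E (@cons_pair n).

Section lebesgue_cons_measure.
Variables (n : nat) (m : {sigma_finite_measure set (n.-tuple (measurableTypeR R)) -> \bar R}).

Let lebesgue_cons0 : lebesgue_cons m set0 = 0%E.
Proof. by rewrite /lebesgue_cons /pushforward preimage_set0 measure0. Qed.

Let lebesgue_cons_ge0 A : (0 <= lebesgue_cons m A)%E.
Proof. by rewrite /lebesgue_cons /pushforward; exact: measure_ge0. Qed.

Let lebesgue_cons_sigma_additive : semi_sigma_additive (lebesgue_cons m).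
Proof.
move=> F mF tF mUF; rewrite /lebesgue_cons /pushforward preimage_bigcup.
apply: measure_semi_sigma_additive.
- by move=> k; rewrite -[X in measurable X]setTI; exact: measurable_cons_pair.
- apply/trivIsetP => /= i j _ _ ij; rewrite -preimage_setI.
  by move/trivIsetP : tF => /(_ _ _ _ _ ij) ->//; rewrite preimage_set0.
- rewrite -preimage_bigcup -[X in measurable X]setTI.
  exact: measurable_cons_pair.
Qed.

HB.instance Definition _ := isMeasure.Build _ _ _
  (lebesgue_cons m) lebesgue_cons0 lebesgue_cons_ge0
  lebesgue_cons_sigma_additive.

Let lebesgue_cons_sigma_finite : sigma_finite setT (lebesgue_cons m).
Proof.
have /sigma_finiteP[F [TF ndF Foo]] := sigma_finiteT (@lebesgue_measure R).
have /sigma_finiteP[G [TG ndG Goo]] := sigma_finiteT m.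
pose g (t : n.+1.-tuple (measurableTypeR R)) :
  measurableTypeR R * n.-tuple (measurableTypeR R) :=
  (thead t, [tuple of behead t]).
have mg : measurable_fun setT g.
  apply/measurable_fun_pairP; split.
    exact: measurable_tnth.
  exact: measurable_behead.
have gK p : g (cons_pair p) = p.
  by case: p => x t; congr pair; apply/val_inj.
exists (fun k => g @^-1` (F k `*` G k)).
  rewrite -preimage_bigcup -[LHS](@preimage_setT _ _ g); congr (g @^-1` _).
  apply/seteqP; split => -[x y] // _.
  have [i _ Fx] : (\bigcup_k F k) x by rewrite -TF.
  have [j _ Gy] : (\bigcup_k G k) y by rewrite -TG.
  exists (maxn i j) => //; split.
    by move: x Fx; exact/subsetPset/ndF/leq_maxl.
  by move: y Gy; exact/subsetPset/ndG/leq_maxr.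
move=> k; have [mFk Fkoo] := Foo k; have [mGk Gkoo] := Goo k; split.
  by rewrite -[X in measurable X]setTI; apply: mg => //; exact: measurableX.
rewrite /lebesgue_cons /pushforward /=.
rewrite (_ : _ @^-1` _ = F k `*` G k).
  by rewrite product_measure1E// lte_mul_pinfty// ge0_fin_numE.
by rewrite -comp_preimage (_ : g \o _ = id) ?preimage_id//; apply/funext.
Qed.

HB.instance Definition _ := Measure_isSigmaFinite.Build _ _ _
  (lebesgue_cons m) lebesgue_cons_sigma_finite.

End lebesgue_cons_measure.

Fixpoint lebesgue_tuple n :
    {sigma_finite_measure set (n.-tuple (measurableTypeR R)) -> \bar R} :=
  match n with
  | 0 => \d_([tuple] : 0.-tuple (measurableTypeR R))
  | n'.+1 => lebesgue_cons (lebesgue_tuple n')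
  end.

Lemma lebesgue_tuple_box n (A : 'I_n -> set (measurableTypeR R)) :
  (forall i, measurable (A i)) ->
  lebesgue_tuple n [set t | forall i, A i (tnth t i)] =
  (\big[*%E/1%E]_(i < n) lebesgue_measure (A i))%E.
Proof.
elim: n A => [|n IHn] A mA.
  by rewrite big_ord0 /= diracE mem_set// => -[].
rewrite big_ord_recl -IHn; last by move=> i; exact: mA.
rewrite /= /lebesgue_cons /pushforward.
rewrite (_ : _ @^-1` _ =
    A ord0 `*` [set t | forall i, A (lift ord0 i) (tnth t i)]); last first.
  apply/seteqP; split => -[x t]/=.
    move=> xtA; split; first exact: (xtA ord0).
    by move=> i; have := xtA (lift ord0 i); rewrite tnthS.
  by move=> [xA tA] i; case: (unliftP ord0 i) => [j|] ->; rewrite ?tnthS.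
rewrite product_measure1E//.
rewrite (_ : [set t | _] = \bigcap_i
    ((@tnth _ (measurableTypeR R) ^~ i) @^-1` A (lift ord0 i))).
  apply: fin_bigcap_measurable => [|i _]; first exact: finite_finset.
  by rewrite -[X in measurable X]setTI; exact: measurable_tnth.
by apply/seteqP; split => t /= tA i; [move=> _|]; exact: tA.
Qed.

End lebesgue_tuple.

Section independence.
Context {R : realType} d (T : measurableType d) (P : probability T R).

Definition mutually_independent (I : finType) (F : I -> set (set T)) : Prop :=
  forall (J : {set I}) (E : I -> set T), (forall i, i \in J -> F i (E i)) ->
    P (\bigcap_(i in [set` J]) E i) =
    (\big[*%E/1%E]_(i in J) P (E i))%E.

Definition generated_sigma (I : Type) (X : I -> T -> R) : set (set T) :=
  <<s \bigcup_i preimage_set_system setT (X i) measurable >>.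

End independence.

Section random_matrices.
Context {R : realType}.

Definition spec n (M : 'M[R[i]]_n) : n.-tuple R :=
  [tuple of sort (fun x y => y <= x)
     [tuple complex.Re (spectral_diag M 0 i) | i < n]].

Definition spec_diag_mx n (M : 'M[R[i]]_n) : 'M[R[i]]_n :=
  diag_mx (\row_i (tnth (spec M) i)%:C).

(* The [n ^ 2] real coordinates of a Hermitian matrix: the real part of the
   entry [(i, j)] for [i <= j], and, for [j < i], the imaginary part of the
   entry [(j, i)] above the diagonal. *)
Definition herm_coord n (M : 'M[R[i]]_n) (k : 'I_n * 'I_n) : R :=
  if (k.1 <= k.2)%N then complex.Re (M k.1 k.2) else complex.Im (M k.2 k.1).

(* [normal_prob] takes the standard deviation as its second argument. *)
Definition is_GUE d (T : measurableType d) (P : probability T R) n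
    (G : T -> 'M[R[i]]_n) : Prop :=
  let X k om := herm_coord (G om) k in
  [/\ forall om, G om \is hermsymmx,
      forall k, measurable_fun setT (X k),
      mutually_independent P
        (fun k => preimage_set_system setT (X k) measurable) &
      forall k A, measurable A -> P (X k @^-1` A) =
        normal_prob 0 (if k.1 == k.2 then 1 else Num.sqrt (1 / 2)) A].

Definition independent_matrices d (T : measurableType d)
    (P : probability T R) n (I : finType) (G : I -> T -> 'M[R[i]]_n) : Prop :=
  mutually_independent P
    (fun i => generated_sigma (fun k om => herm_coord (G i om) k)).

End random_matrices.

Section hives.
Context {R : realType}.

(* Functions on [T_n] are represented by functions on [nat * nat], of which only
   the values at [0 <= x <= y <= n] are relevant. *)
Definition discrete_concave n (h : nat -> nat -> R) : Prop :=
  [/\ forall x y, (x.+1 <= y)%N -> (y.+1 <= n)%N ->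
        h x y - h x.+1 y - h x.+1 y.+1 + h x.+2 y.+1 <= 0,
      forall x y, (x.+1 <= y)%N -> (y.+1 <= n)%N ->
        - h x y + h x.+1 y + h x y.+1 - h x.+1 y.+1 <= 0 &
      forall x y, (x <= y)%N -> (y.+2 <= n)%N ->
        h x y - h x.+1 y.+1 - h x y.+1 + h x.+1 y.+2 <= 0].

Definition nonincreasing n (x : 'I_n -> R) : Prop :=
  forall i j : 'I_n, (i <= j)%N -> x j <= x i.

Definition hive n (la mu nu : 'I_n -> R) (h : nat -> nat -> R) : Prop :=
  discrete_concave n h /\
  forall i : nat, (i <= n)%N ->
    [/\ h 0%N i = \sum_(j < n | (j < i)%N) la j,
        h i n = \sum_(j < n) la j + \sum_(j < n | (j < i)%N) mu j &
        h i i = \sum_(j < n | (j < i)%N) nu j].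

Definition hive_cone n : set (nat -> nat -> R) :=
  [set h | exists la mu nu : 'I_n -> R,
    [/\ nonincreasing la, nonincreasing mu, nonincreasing nu,
        \sum_i la i + \sum_i mu i = \sum_i nu i & hive la mu nu h]].

(* The boundary data recovered from a hive: [h] is in
   [hive (hive_la n h) (hive_mu n h) (hive_nu n h)] for [h] in the cone. *)
Definition hive_la n (h : nat -> nat -> R) (i : 'I_n) := h 0%N i.+1 - h 0%N i.
Definition hive_mu n (h : nat -> nat -> R) (i : 'I_n) := h i.+1 n - h i n.
Definition hive_nu n (h : nat -> nat -> R) (i : 'I_n) := h i.+1 i.+1 - h i i.
Arguments hive_la : clear implicits.
Arguments hive_mu : clear implicits.
Arguments hive_nu : clear implicits.

Definition interior n : finType :=
  {p : 'I_n * 'I_n | (0 < p.1)%N && (p.1 < p.2)%N}.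

(* One index for each of the coordinates [la_1 .. la_n], [mu_1 .. mu_n],
   [nu_1 .. nu_(n-1)] and [h x y] with [0 < x < y < n]. *)
Definition coord_index n : finType :=
  ('I_n + 'I_n + 'I_n.-1 + interior n)%type.

Definition hive_space n := #|coord_index n|.-tuple (measurableTypeR R).

Definition hive_coords n (h : nat -> nat -> R) : hive_space n :=
  [tuple match enum_val k with
         | inl (inl (inl i)) => hive_la n h i
         | inl (inl (inr i)) => hive_mu n h i
         | inl (inr i) => h i.+1 i.+1 - h i i
         | inr p => h (val p).1 (val p).2
         end | k < #|coord_index n|].

Definition coord n (v : hive_space n) (k : coord_index n) : R :=
  tnth v (enum_rank k).

(* The function on [T_n], vanishing at [(0, 0)], with coordinates [v]. *)
Definition hive_of_coords n (v : hive_space n) (x y : nat) : R :=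
  if x == 0%N then \sum_(j < n | (j < y)%N) coord v (inl (inl (inl j)))
  else if y == n then
    \sum_(j < n) coord v (inl (inl (inl j))) +
    \sum_(j < n | (j < x)%N) coord v (inl (inl (inr j)))
  else if x == y then \sum_(j < n.-1 | (j < x)%N) coord v (inl (inr j))
  else if [pick p : interior n | ((val p).1 == x :> nat) &&
                                 ((val p).2 == y :> nat)] is Some p
  then coord v (inr p) else 0.

Definition coord_cone n : set (hive_space n) :=
  [set v | hive_cone n (hive_of_coords v)].
Arguments coord_cone : clear implicits.

Definition is_hive_density d (T : measurableType d) (P : probability T R) n
    (h : T -> nat -> nat -> R) (q : hive_space n -> R) : Prop :=
  [/\ measurable_fun setT (fun om => hive_coords n (h om)),
      measurable_fun (coord_cone n) q,
      forall v, coord_cone n v -> 0 <= q v &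
      forall A, measurable A ->
        P ((fun om => hive_coords n (h om)) @^-1` A) =
        (\int[lebesgue_tuple #|coord_index n|]_(v in A `&` coord_cone n)
          (q v)%:E)%E].

(* Conventions: [0 log (0 / p) = 0], and [q log (q / 0) = +oo] for [q > 0]. *)
Definition KL_integrand (q p : R) : \bar R :=
  if q == 0 then 0%E else if p == 0 then +oo%E else (q * ln (q / p))%:E.

Definition KL n (q p : hive_space n -> R) : \bar R :=
  (\int[lebesgue_tuple #|coord_index n|]_(v in coord_cone n)
    KL_integrand (q v) (p v))%E.

Definition vandermonde n (x : 'I_n -> R) : R :=
  \prod_(i < n) \prod_(j < n | (i < j)%N) (x i - x j).

Definition sqnorm n (x : 'I_n -> R) : R := \sum_i x i ^+ 2.

(* [iC] stands for [1 / C], which is [0] in the right-angled case. *)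
Definition is_triangle_param (a b c A B iC : R) : Prop :=
  if c ^+ 2 == a ^+ 2 + b ^+ 2 then [/\ A = a ^+ 2, B = b ^+ 2 & iC = 0]
  else exists C : R,
    [/\ iC = C^-1,
        [/\ 0 < A, 0 < B & 0 < C] \/ [/\ 0 < A, 0 < B & A + B < - C] &
        [/\ a ^+ 2 = A * (B + C) / (A + B + C),
            b ^+ 2 = B * (C + A) / (A + B + C) &
            c ^+ 2 = C * (A + B) / (A + B + C)]].

(* The parameters are unique for the triangles of interest. *)
Definition triangle_param (a b c : R) : R * R * R :=
  xget (0, 0, 0) [set t | is_triangle_param a b c t.1.1 t.1.2 t.2].

Definition hive_weight (A B iC : R) n (v : hive_space n) : R :=
  let h := hive_of_coords v in
  vandermonde (hive_la n h) * vandermonde (hive_mu n h) *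
  vandermonde (hive_nu n h) *
  expR (- (1 / 2) * (sqnorm (hive_la n h) / A + sqnorm (hive_mu n h) / B +
                     sqnorm (hive_nu n h) * iC)).

Definition hive_law_density (a b c : R) n (v : hive_space n) : R :=
  let: (A, B, iC) := triangle_param a b c in
  hive_weight A B iC v /
  fine (\int[lebesgue_tuple #|coord_index n|]_(w in coord_cone n)
         (hive_weight A B iC w)%:E)%E.

End hives.

Arguments hive_la {R} n h i.
Arguments hive_mu {R} n h i.
Arguments hive_nu {R} n h i.
Arguments hive_coords {R} n h.
Arguments coord_cone {R} n.

Section octahedron.
Context {R : realType}.

(* [octahedron L M i1 i3 i0 i2] is [F(i0, i1, i2, i3)], where [L k m] and
   [M k m] give the values [F(i0, i1, m, 0)] and [F(i0, 0, i2, m)] with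
   [k = n - i0]. *)
Fixpoint octahedron n (L M : nat -> nat -> R) (i1 : nat) :
    nat -> nat -> nat -> R :=
  fix octa i3 i0 i2 {struct i3} :=
    match i3, i1 with
    | 0, _ => L (n - i0)%N i2
    | _.+1, 0 => M (n - i0)%N i3
    | j3.+1, j1.+1 =>
        Num.max (octa j3 i0.+1 i2 + octahedron n L M j1 j3.+1 i0 i2.+1)
                (octahedron n L M j1 j3.+1 i0.+1 i2 + octa j3 i0 i2.+1)
        - octahedron n L M j1 j3 i0.+1 i2.+1
    end.

Definition nw_minor n (M : 'M[R[i]]_n) (k : 'I_n.+1) : 'M[R[i]]_k :=
  mxsub (widen_ord (leq_ord k)) (widen_ord (leq_ord k)) M.

(* Sum of the [m] largest eigenvalues of the northwest [k x k] minor,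
   for [m <= k <= n]. *)
Definition minor_spec_sum n (M : 'M[R[i]]_n) (k m : nat) : R :=
  \sum_(j < m) (spec (nw_minor M (inord k)))`_j.

Definition octahedron_F n (X Y : 'M[R[i]]_n) (i0 i1 i2 i3 : nat) : R :=
  octahedron n (minor_spec_sum X)
    (fun k m => \sum_(j < n | (j < k)%N) complex.Re (X j j) +
                minor_spec_sum Y k m) i1 i3 i0 i2.

Lemma octahedron_F_i3 n (X Y : 'M[R[i]]_n) i0 i1 i2 :
  octahedron_F X Y i0 i1 i2 0 = minor_spec_sum X (n - i0) i2.
Proof. by case: i1. Qed.

(* At [i1 = i3 = 0] the two boundary formulas agree, both being the trace of a
   minor; the first one is used. *)
Lemma octahedron_F_i1 n (X Y : 'M[R[i]]_n) i0 i2 i3 :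
  octahedron_F X Y i0 0 i2 i3.+1 =
  \sum_(j < n | (j < n - i0)%N) complex.Re (X j j) +
  minor_spec_sum Y (n - i0) i3.+1.
Proof. by []. Qed.

Lemma octahedron_F_rec n (X Y : 'M[R[i]]_n) p0 p1 p2 p3 :
  let F := octahedron_F X Y in
  F p0 p1.+1 p2 p3.+1 + F p0.+1 p1 p2.+1 p3 =
  Num.max (F p0.+1 p1.+1 p2 p3 + F p0 p1 p2.+1 p3.+1)
          (F p0.+1 p1 p2 p3.+1 + F p0 p1.+1 p2.+1 p3).
Proof. by rewrite /octahedron_F /= subrK. Qed.

Definition octahedron_hive n (X Y : 'M[R[i]]_n) (x y : nat) : R :=
  octahedron_F X Y 0 (n - y) (y - x) x.

End octahedron.

(* Main.v *)
(* With A = n w^2, B = n w'^2 and kap = u / (w^2 sqrt n) = u' / (w'^2 sqrt n), unitary invariance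
   gives the joint density of the minor spectra of X_n and of the eigenvalues d of its shift:
   besides Vandermonde and Gaussian factors it is exp(kap <type, d>), where the type of a
   Gelfand-Tsetlin pattern is the list of differences of its row sums; the ratio hypothesis
   makes kap common to X_n and Y_n.  The octahedron recurrence is a composition of piecewise
   linear flips that preserve Lebesgue measure.  It turns the two patterns into the hive h_n
   together with a pattern under nu whose type is the sum of the two types.
   If both shifts used the same d, integrating out d and the pattern under nu (a
   Harish-Chandra type identity) would give exactly the density of the hive law with
   parameters (A, B, 1/C).  The true density differs from this coupled one, before integration
   over the hidden variables, by a factor exp(ell) with ell linear in the type of the second
   pattern.  Tilting the coupled density by exp(s ell) and integrating over everything but
   the shifts leaves the mean of exp(kap^2 B s (s - 1) |d - d'|^2 / 2), which is at most
   2^(n/2) for small s (s - 1), because a product of Vandermonde squares decreases when its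
   two arguments are moved apart symmetrically.  Taking s = 1 + eps with eps fixed and using
   convexity bounds the divergence by n ln 2 / (2 eps). *)

From HB Require Import structures.
Require Import Defs.
From mathcomp Require Import all_boot all_order all_algebra all_fingroup.
From mathcomp Require Import all_classical all_reals all_analysis.
From mathcomp Require Import complex measurable_realfun spectral sesquilinear.
From mathcomp Require Import ring lra zify.
Import Order.TTheory GRing.Theory Num.Theory.
Import numFieldNormedType.Exports.

Set Implicit Arguments.
Unset Strict Implicit.
Unset Printing Implicit Defensive.

Local Open Scope classical_set_scope.
Local Open Scope ring_scope.
Import ComplexField.
Local Open Scope complex_scope.
Local Open Scope sesquilinear_scope.

(** * Iterated Lebesgue integrals *)

(** The obstacle is that the true shifts [d] and [d'] are independent: the second pattern then
    enters the density through more than the type of the third one, and the third pattern cannot be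
    integrated out in closed form. The tilt has a concrete meaning: before the recurrence it
    replaces the shift of the second matrix by [d + s (d' - d)]. Since a Gaussian mass of patterns
    is quadratic in the exponent, [s = 0] (coupled) and [s = 1] (true) have equal total mass, so no
    normalising constant has to be evaluated. The cost of [s = 1 + eps] is a factor
    [exp (th |d - d'|^2)] with [th] free of [n], because [kap^2 B = (u' / w')^2]; stretching
    [d - d'] by [sqrt 2] in [n] dimensions absorbs it, whence [sqrt 2 ^ n]. All densities of random
    matrices are derived here from Lebesgue measure on the line: volume computations are reduced to
    maps of one real variable applied in triangular order, with a Gaussian argument for unitary
    maps. *)

Section env_structure.
Variables (R : realType) (K : Type).

(** A named copy of the function space, so that it can carry the sigma-algebra generated by its
    coordinates. The index type may be infinite; only finitely many coordinates are ever
    integrated. *)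
Definition family : Type := K -> R.
HB.instance Definition _ := Pointed.on family.

Let G : set (set family) :=
  \bigcup_(k in [set: K]) preimage_set_system setT (fun e : family => e k) (@measurable _ (measurableTypeR R)).

HB.instance Definition _ := @isMeasurable.Build default_measure_display family <<s G>>
  (@sigma_algebra0 _ setT G) (@sigma_algebraC _ G) (@sigma_algebra_bigcup _ setT G).

Lemma measurable_coord (k : K) :
  measurable_fun [set: family] (fun e : family => e k : measurableTypeR R).
Proof.
move=> _ B mB; apply: sub_sigma_algebra; exists k => //; exists B => //.
Qed.

Lemma measurable_envP d (T : measurableType d) (f : T -> family) :
  (forall k, measurable_fun [set: T] (fun x => f x k : measurableTypeR R)) ->
  measurable_fun [set: T] f.
Proof.
move=> mf.
apply: (@measurability _ _ _ _ _ _ G) => //.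
move=> _ [_ [k _ [B mB <-]] <-].
by rewrite !setTI; have := mf k measurableT B mB; rewrite setTI.
Qed.

End env_structure.

Lemma measurable_comp_fun d1 d2 d3 (T1 : measurableType d1) (T2 : measurableType d2)
    (T3 : measurableType d3) (f : T2 -> T3) (g : T1 -> T2) :
  measurable_fun setT f -> measurable_fun setT g ->
  measurable_fun setT (fun x => f (g x)).
Proof. by move=> mf mg; exact: (measurableT_comp mf mg). Qed.

Section iterated_integral.
Variables (R : realType) (K : eqType).
Local Notation family := (family R K).
Local Notation mu := (@lebesgue_measure R).
Local Open Scope ereal_scope.

Definition upd (e : family) (k : K) (t : R) : family :=
  fun j => if j == k then t else e j.

Lemma updE e k t : upd e k t k = t.
Proof. by rewrite /upd eqxx. Qed.

Lemma updNE e k t j : j != k -> upd e k t j = e j.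
Proof. by rewrite /upd => /negbTE ->. Qed.

Lemma updC e k l t u : k != l -> upd (upd e k t) l u = upd (upd e l u) k t.
Proof.
move=> kl; apply/funext => j; rewrite /upd.
by have [->|//] := eqVneq j l; rewrite eq_sym (negbTE kl).
Qed.

Lemma upd_upd e k t u : upd (upd e k t) k u = upd e k u.
Proof. by apply/funext => j; rewrite /upd; case: eqP. Qed.

Lemma upd_id e k : upd e k (e k) = e.
Proof. by apply/funext => j; rewrite /upd; case: eqP => // ->. Qed.

Lemma measurable_upd d (T : measurableType d) (f : T -> family) k
    (g : T -> measurableTypeR R) :
  measurable_fun setT f -> measurable_fun setT g ->
  measurable_fun setT (fun x => upd (f x) k (g x)).
Proof.
move=> mf mg; apply: measurable_envP => j; rewrite /upd.
case: (j == k) => //.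
exact: (measurableT_comp (@measurable_coord R K j) mf).
Qed.

(** The variables listed in [s] are integrated, the first outermost, and the others stay frozen at
    their values in [e]. Lists of keys turn Fubini into the permutation of a list and avoid a
    separate product space for each set of variables. *)
Fixpoint II (s : seq K) (f : family -> \bar R) (e : family) : \bar R :=
  if s is k :: s' then \int[mu]_t II s' f (upd e k t) else f e.

Lemma II_cat s1 s2 f e : II (s1 ++ s2) f e = II s1 (II s2 f) e.
Proof. by elim: s1 e => //= k s1 IH e; apply: eq_integral => t _. Qed.

Lemma II_ge0 s f e : (forall x, 0 <= f x) -> 0 <= II s f e.
Proof. by move=> f0; elim: s e => //= k s IH e; apply: integral_ge0. Qed.

Lemma eq_II_in s f g e :
  (forall e', (forall j, j \notin s -> e' j = e j) -> f e' = g e') ->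
  II s f e = II s g e.
Proof.
elim: s e => [|k s IH] e fg /=; first exact: fg.
apply: eq_integral => t _; apply: IH => e' He'; apply: fg => j.
by rewrite inE negb_or => /andP[jk js]; rewrite He'// updNE.
Qed.

Lemma eq_II s f g e : (forall e', f e' = g e') -> II s f e = II s g e.
Proof. by move=> fg; apply: eq_II_in => e' _. Qed.

Lemma II_base s f e e' : (forall j, j \notin s -> e j = e' j) ->
  II s f e = II s f e'.
Proof.
elim: s e e' => [|k s IH] e e' ee' /=.
  by congr f; apply/funext => j; exact: ee'.
apply: eq_integral => t _; apply: IH => j js; rewrite /upd.
by case: ifPn => // jk; apply: ee'; rewrite inE negb_or jk.
Qed.

Section param.
Context d (T : measurableType d).

Lemma measurable_II_pair s (f : T -> family -> \bar R) :
  measurable_fun setT (fun p : T * family => f p.1 p.2) ->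
  (forall x e, 0 <= f x e) ->
  measurable_fun setT (fun p : T * family => II s (f p.1) p.2).
Proof.
move=> mf f0; elim: s => [//|k s IH] /=.
pose g := fun q : (T * family) * measurableTypeR R =>
  II s (f q.1.1) (upd q.1.2 k q.2).
have mg : measurable_fun setT g.
  apply: (measurable_comp_fun IH (g := fun q : (T * family) * measurableTypeR R =>
    (q.1.1, upd q.1.2 k q.2))).
  apply: measurable_fun_pair.
    exact: measurable_comp_fun measurable_fst measurable_fst.
  apply: measurable_upd => //.
  exact: measurable_comp_fun measurable_snd measurable_fst.
apply: (measurable_fun_fubini_tonelli_F (m2 := mu) g mg).
by move=> x; apply: II_ge0.
Qed.

Lemma measurable_II_param s (f : T -> family -> \bar R) (b : T -> family) :
  measurable_fun setT (fun p : T * family => f p.1 p.2) ->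
  (forall x e, 0 <= f x e) -> measurable_fun setT b ->
  measurable_fun setT (fun x => II s (f x) (b x)).
Proof.
move=> mf f0 mb.
apply: (measurable_comp_fun (measurable_II_pair s mf f0) (g := fun x => (x, b x))).
exact: measurable_fun_pair.
Qed.

Lemma integral_II (nu : {sigma_finite_measure set T -> \bar R}) s
    (f : T -> family -> \bar R) (b : family) :
  measurable_fun setT (fun p : T * family => f p.1 p.2) ->
  (forall x e, 0 <= f x e) ->
  \int[nu]_x II s (f x) b = II s (fun e => \int[nu]_x f x e) b.
Proof.
move=> mf f0; elim: s b => [//|k s IH] b /=.
pose g := fun q : T * measurableTypeR R => II s (f q.1) (upd b k q.2).
have mg : measurable_fun setT g.
  apply: (measurable_comp_fun (measurable_II_pair s mf f0)
    (g := fun q : T * measurableTypeR R => (q.1, upd b k q.2))).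
  apply: measurable_fun_pair => //.
  by apply: measurable_upd => //; exact: measurable_cst.
have := @fubini_tonelli _ _ _ _ R nu mu g mg.
rewrite /g /= => ->; last by move=> x; apply: II_ge0.
by apply: eq_integral => t _; exact: IH.
Qed.

End param.

Lemma measurable_II s f : measurable_fun setT f -> (forall e, 0 <= f e) ->
  measurable_fun setT (II s f).
Proof.
move=> mf f0; apply: (@measurable_II_param _ family s (fun _ => f) id) => //.
exact: measurableT_comp mf measurable_snd.
Qed.

Lemma measurable_II_upd s f e k : measurable_fun setT f -> (forall e, 0 <= f e) ->
  measurable_fun setT (fun t : measurableTypeR R => II s f (upd e k t)).
Proof.
move=> mf f0; apply: (measurableT_comp (measurable_II s mf f0)).
by apply: measurable_upd => //; exact: measurable_cst.
Qed.

Lemma II_swap1 k s f e : measurable_fun setT f -> (forall e, 0 <= f e) ->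
  II s (II [:: k] f) e = II [:: k] (II s f) e.
Proof.
move=> mf f0; elim: s e => [//|l s IH] e /=.
under eq_integral do rewrite IH /=.
(* With equal keys the inner variable overwrites the outer one on both sides. *)
have [->|kl] := eqVneq k l.
  by apply: eq_integral => t _; apply: eq_integral => u _; rewrite !upd_upd.
have := @fubini_tonelli _ _ _ _ R mu mu (fun q : measurableTypeR R * measurableTypeR R =>
  II s f (upd (upd e l q.1) k q.2)).
move=> -> /=; last 2 first.
- apply: (measurableT_comp (measurable_II s mf f0)).
  by do 2 (apply: measurable_upd => //); exact: measurable_cst.
- by move=> x; apply: II_ge0.
by apply: eq_integral => t _; apply: eq_integral => u _; rewrite updC// eq_sym.
Qed.

Lemma II_swap s1 s2 f e : measurable_fun setT f -> (forall e, 0 <= f e) ->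
  II s1 (II s2 f) e = II s2 (II s1 f) e.
Proof.
move=> mf f0; elim: s2 e => [//|k s2 IH] e.
rewrite (_ : II (k :: s2) f = II [:: k] (II s2 f))//.
have mII := measurable_II s2 mf f0.
rewrite II_swap1//; last by move=> ?; exact: II_ge0.
by rewrite /=; apply: eq_integral => t _; exact: IH.
Qed.

Lemma perm_II s1 s2 f e : measurable_fun setT f -> (forall e, 0 <= f e) ->
  perm_eq s1 s2 -> II s1 f e = II s2 f e.
Proof.
move=> mf f0 s12; suff : forall e, II s1 f e = II s2 f e by [].
apply: (catCA_perm_ind (P := fun s => forall e, II s1 f e = II s f e) _ s12) => //.
move=> a b c H e'; rewrite H !II_cat.
have -> : II (b ++ c) f = II b (II c f) by apply/funext => ?; rewrite II_cat.
have -> : II (a ++ c) f = II a (II c f) by apply/funext => ?; rewrite II_cat.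
have mII := measurable_II c mf f0.
by rewrite II_swap// => ?; exact: II_ge0.
Qed.

Lemma le_II s f g e : measurable_fun setT f -> measurable_fun setT g ->
  (forall e, 0 <= f e) -> (forall e, f e <= g e) -> II s f e <= II s g e.
Proof.
move=> mf mg f0 fg; have g0 e' : 0 <= g e' by exact: le_trans (fg e').
elim: s e => [//|k s IH] e /=.
by apply: ge0_le_integral => //; try (move=> *; exact: II_ge0);
  exact: measurable_II_upd.
Qed.

Lemma IID s f g e : measurable_fun setT f -> measurable_fun setT g ->
  (forall e, 0 <= f e) -> (forall e, 0 <= g e) ->
  II s (fun e => f e + g e) e = II s f e + II s g e.
Proof.
move=> mf mg f0 g0; elim: s e => [//|k s IH] e /=.
under eq_integral do rewrite IH.
by rewrite ge0_integralD//; try (move=> *; exact: II_ge0);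
  exact: measurable_II_upd.
Qed.

Lemma IIZl s (c : \bar R) f e : measurable_fun setT f -> (forall e, 0 <= f e) ->
  0 <= c -> II s (fun e => c * f e) e = c * II s f e.
Proof.
move=> mf f0 c0; elim: s e => [//|k s IH] e /=.
under eq_integral do rewrite IH.
by rewrite ge0_integralZl//; try (move=> *; exact: II_ge0);
  exact: measurable_II_upd.
Qed.

Lemma II0 s e : II s (fun => 0) e = 0.
Proof.
by elim: s e => //= k s IH e; under eq_integral do rewrite IH; exact: integral0.
Qed.

(** With [k] moved innermost, integrands that have the same integral in this single variable can be
    exchanged. *)
Lemma II_key k s f g e : measurable_fun setT f -> measurable_fun setT g ->
  (forall e, 0 <= f e) -> (forall e, 0 <= g e) -> k \in s ->
  (forall e, \int[mu]_t f (upd e k t) = \int[mu]_t g (upd e k t)) ->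
  II s f e = II s g e.
Proof.
move=> mf mg f0 g0 ks fg.
have p : perm_eq s (rem k s ++ [:: k]).
  by rewrite cats1 perm_sym perm_rcons perm_sym perm_to_rem.
by rewrite !(perm_II _ _ _ p)// !II_cat; apply: eq_II => e' /=; exact: fg.
Qed.

End iterated_integral.

(** * Images of measures with a density *)

Section image_of_density.
Local Open Scope ereal_scope.
Context d1 d2 (Y : measurableType d1) (T : measurableType d2) (R : realType).
Variables (nu : {measure set Y -> \bar R}) (w : Y -> R) (phi : Y -> T).
Hypotheses (mw : measurable_fun setT (EFin \o w)) (w0 : forall y, (0 <= w y)%R)
  (mphi : measurable_fun setT phi).

(** The proofs are arguments of the definition so that the measure structure declared below can
    refer to them. *)
Definition image_density of measurable_fun setT (EFin \o w) & (forall y, 0 <= w y)%R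
  & measurable_fun setT phi :=
  fun A : set T => \int[nu]_(y in phi @^-1` A) (w y)%:E.
Local Notation M := (image_density mw w0 mphi).

Let mind A : measurable A ->
  measurable_fun [set: Y] (fun y => (w y)%:E * (\1_A (phi y) : R)%:E).
Proof.
move=> mA; apply: emeasurable_funM => //; apply/measurable_EFinP.
exact: (measurable_comp_fun (measurable_indic mA) mphi).
Qed.

Let ME A : M A = \int[nu]_y ((w y)%:E * (\1_A (phi y))%:E).
Proof.
rewrite /image_density integral_mkcond; apply: eq_integral => y _.
rewrite /patch indicE -[y \in phi @^-1` A]/(phi y \in A).
by case: ifPn => _; rewrite ?mule1 ?mule0.
Qed.

Let M0 : M set0 = 0.
Proof. by rewrite /image_density preimage_set0 integral_set0. Qed.

Let M_ge0 A : 0 <= M A.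
Proof. by apply: integral_ge0 => y _; rewrite lee_fin. Qed.

Let M_sigma_additive : semi_sigma_additive M.
Proof.
move=> F mF tF mUF; rewrite /image_density preimage_bigcup.
have mpre A : measurable A -> measurable (phi @^-1` A).
  by move=> mA; rewrite -[X in measurable X]setTI; exact: mphi.
apply: (semi_sigma_additive_nng_induced (f := EFin \o w)) => //.
- by move=> n; exact: mpre.
- apply/trivIsetP => i j _ _ ij; rewrite -preimage_setI.
  by move/trivIsetP : tF => /(_ _ _ _ _ ij) ->//; rewrite preimage_set0.
- by rewrite -preimage_bigcup; exact: mpre.
Qed.

HB.instance Definition _ := isMeasure.Build _ _ _ M M0 M_ge0 M_sigma_additive.

Import HBNNSimple.

Lemma integral_image_density (f : T -> \bar R) :
  measurable_fun setT f -> (forall x, 0 <= f x) ->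
  \int[M]_x f x = \int[nu]_y ((w y)%:E * f (phi y)).
Proof.
move=> mf f0; pose f_ := nnsfun_approx measurableT mf.
have fcvg x : (f_ n x)%:E @[n --> \oo] --> f x.
  by apply: cvg_nnsfun_approx => //.
have f_nd : forall x, {homo (fun n => (f_ n x)%:E) : a b / (a <= b)%N >-> a <= b}.
  by move=> x a b ab; rewrite lee_fin; exact/lefP/nd_nnsfun_approx.
transitivity (limn (fun n => \int[M]_x (f_ n x)%:E)).
  rewrite -monotone_convergence//.
  - by apply: eq_integral => y _; apply/esym/cvg_lim => //; exact: fcvg.
  - by move=> n; exact/measurable_EFinP/measurable_funP.
  - by move=> n y _; rewrite lee_fin.
transitivity (limn (fun n => \int[nu]_y ((w y)%:E * (f_ n (phi y))%:E))); last first.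
  rewrite -monotone_convergence//.
  - apply: eq_integral => y _; apply/cvg_lim => //.
    by apply: cvgeZl => //; exact: fcvg.
  - move=> n; apply: emeasurable_funM => //; apply/measurable_EFinP.
    exact: measurable_comp_fun mphi.
  - by move=> n y _; rewrite mule_ge0// lee_fin.
  - by move=> y _ a b ab; apply: lee_wpmul2l; [rewrite lee_fin|exact: f_nd].
congr (limn _); apply/funext => n.
transitivity (\sum_(k \in range (f_ n)) k%:E * M (f_ n @^-1` [set k])).
  by rewrite integralT_nnsfun sintegralE.
transitivity (\int[nu]_y (\sum_(k \in range (f_ n))
    k%:E * ((w y)%:E * (\1_(f_ n @^-1` [set k]) (phi y))%:E))); last first.
  apply: eq_integral => y _.
  rewrite [in RHS]fimfunE -fsumEFin// ge0_mule_fsumr//; last first.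
    by move=> k; rewrite lee_fin; exact: nnfun_muleindic_ge0.
  by apply: eq_fsbigr => k _; rewrite EFinM muleCA.
rewrite ge0_integral_fsum//; last 2 first.
- move=> k; apply: emeasurable_funM => //; exact: mind.
- move=> k y _; have [k0|k0] := leP 0%R k.
    by rewrite !mule_ge0// lee_fin.
  rewrite (_ : f_ n @^-1` [set k] = set0) ?indic0 ?mule0//.
  exact: preimage_nnfun0.
apply: eq_fsbigr => k _; have [k0|k0] := leP 0%R k.
  rewrite ge0_integralZl_EFin ?ME//; first by move=> y _; rewrite mule_ge0// lee_fin.
  exact: mind.
rewrite (_ : f_ n @^-1` [set k] = set0); last exact: preimage_nnfun0.
rewrite measure0 mule0; under eq_integral do rewrite indic0 !mule0.
by rewrite integral0.
Qed.

End image_of_density.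

(** * Substitutions on the real line *)

Section real_line.
Local Open Scope ereal_scope.
Variable R : realType.
Local Notation mu := (@lebesgue_measure R).
Local Notation MR := (measurableTypeR R).

Lemma measurable_inv : measurable_fun [set: R] (fun x : R => x^-1%R).
Proof.
have -> : [set: R] = [set 0%R] `|` [set x | x != 0%R].
  by apply/seteqP; split => // x _; have [->|] := eqVneq x 0%R; [left|right].
have oN : open [set x : R | x != 0%R].
  rewrite (_ : [set x | _] = ~` [set 0%R]); last first.
    by apply/seteqP; split => x /= /eqP.
  by apply: closed_openC; exact: closed_eq.
apply/measurable_funU => //; first exact: open_measurable.
split; first exact: measurable_fun_set1.
apply: open_continuous_measurable_fun => // x; rewrite inE/= => x0.
exact: inv_continuous.
Qed.

Lemma integral_shift (f : MR -> \bar R) (a : R) :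
  measurable_fun setT f -> (forall x, 0 <= f x) ->
  \int[mu]_t f (t + a)%R = \int[mu]_t f t.
Proof.
move=> mf f0.
have mph : measurable_fun [set: MR] (fun t : MR => (t + a)%R : MR).
  exact: measurable_funD.
have -> : \int[mu]_t f (t + a)%R = \int[pushforward mu (fun t : MR => (t + a)%R : MR)]_t f t.
  by rewrite ge0_integral_pushforward// preimage_setT.
apply: eq_measure_integral => A mA _.
apply/esym/lebesgue_measure_unique => // _ [[x y]] _ <-.
rewrite -[RHS]/(mu ((fun t : MR => (t + a)%R) @^-1` `]x, y]%classic)).
rewrite (_ : _ @^-1` _ = `]x - a, y - a]%classic)%R.
  rewrite !lebesgue_measure_itv/= !lte_fin ltrD2r -!EFinB.
  by congr (if _ then _%:E else _); ring.
by apply/seteqP; split => t; rewrite /= !in_itv/= ltrBlDr lerBrDr.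
Qed.

Lemma integral_reflect (f : MR -> \bar R) :
  measurable_fun setT f -> (forall x, 0 <= f x) ->
  \int[mu]_t f (- t)%R = \int[mu]_t f t.
Proof.
move=> mf f0.
have mph : measurable_fun [set: MR] (fun t : MR => (- t)%R : MR).
  exact: measurable_funN.
have -> : \int[mu]_t f (- t)%R = \int[pushforward mu (fun t : MR => (- t)%R : MR)]_t f t.
  by rewrite ge0_integral_pushforward// preimage_setT.
by apply: eq_measure_integral => A mA _; exact: lebesgue_measureN.
Qed.

Lemma integral_scale (f : MR -> \bar R) (c : R) : (0 < c)%R ->
  measurable_fun setT f -> (forall x, 0 <= f x) ->
  \int[mu]_t f (c * t)%R = c^-1%:E * \int[mu]_t f t.
Proof.
move=> c0 mf f0; have cn0 : c != 0%R by rewrite gt_eqF.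
have mph : measurable_fun [set: MR] (fun t : MR => (c * t)%R : MR).
  exact: measurable_funM.
suff H : c%:E * \int[mu]_t f (c * t)%R = \int[mu]_t f t.
  by rewrite -H muleA -EFinM mulVf// mul1e.
have -> : \int[mu]_t f (c * t)%R = \int[pushforward mu (fun t : MR => (c * t)%R : MR)]_t f t.
  by rewrite ge0_integral_pushforward// preimage_setT.
have cnn : (0 <= c)%R by exact: ltW.
rewrite -[c]/((NngNum cnn)%:num) -ge0_integral_mscale//.
apply: eq_measure_integral => A mA _.
apply/esym/lebesgue_measure_unique => // _ [[x y]] _ <-.
rewrite -[RHS]/(c%:E * mu ((fun t : MR => (c * t)%R) @^-1` `]x, y]%classic)).
rewrite (_ : _ @^-1` _ = `]x / c, y / c]%classic)%R.
  rewrite !lebesgue_measure_itv/= !lte_fin ltr_pM2r ?invr_gt0//.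
  case: ifPn => _; last by rewrite mule0.
  by rewrite -EFinM; congr EFin; field.
by apply/seteqP; split => t; rewrite /= !in_itv/= ltr_pdivrMr// ler_pdivlMr// ![(t * c)%R]mulrC.
Qed.

(** Uniqueness of Lebesgue measure concerns the whole line, while [m] is controlled on the positive
    half only. The restriction of [m] to that half, divided by [c], is therefore completed with
    Lebesgue measure on the other half. *)
Lemma halfline_unique (m : {measure set MR -> \bar R}) (c : R) : (0 < c)%R ->
  (forall a b : R, (0 <= a)%R -> (a < b)%R ->
     m `]a, b]%classic = (c * (b - a))%:E) ->
  forall f : MR -> \bar R, measurable_fun setT f -> (forall x, 0 <= f x) ->
  \int[m]_(x in `]0%R, +oo[) f x = c%:E * \int[mu]_(x in `]0%R, +oo[) f x.
Proof.
move=> c0 mab f mf f0.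
have mP : measurable (`]0%R, +oo[ : set MR) by exact: measurable_itv.
have mN : measurable (`]-oo, 0%R] : set MR) by exact: measurable_itv.
have ci : (0 <= c^-1)%R by rewrite invr_ge0 ltW.
pose m' := measure_add (mscale (NngNum ci) (mrestr m mP)) (mrestr mu mN).
have m'E A : measurable A -> mu A = m' A.
  apply: lebesgue_measure_unique => _ [[x y]] _ <-.
  rewrite -[RHS]/(measure_add (mscale (NngNum ci) (mrestr m mP)) (mrestr mu mN)
    `]x, y]%classic) measure_addE.
  rewrite -[RHS]/(c^-1%:E * m (`]x, y] `&` `]0%R, +oo[) + mu (`]x, y] `&` `]-oo, 0%R])).
  rewrite -[LHS]/(mu `]x, y]).
  have [yx|xy] := leP y x.
    by rewrite set_itv_ge ?bnd_simp -?leNgt// !set0I !measure0 mule0 adde0.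
  have [y0|y0] := leP y 0%R.
    rewrite (_ : `]x, y] `&` `]0%R, +oo[ = set0) ?measure0 ?mule0 ?add0e.
      rewrite (_ : `]x, y] `&` `]-oo, 0%R] = `]x, y]%classic)//; apply/seteqP; split => t /=.
        by case.
      by rewrite !in_itv/= => /andP[-> ty]; rewrite ty (le_trans ty).
    apply/seteqP; split => t //=; rewrite !in_itv/= andbT => -[/andP[_ ty] t0].
    by have := lt_le_trans t0 (le_trans ty y0); rewrite ltxx.
  have [x0|x0] := leP 0%R x.
    rewrite (_ : `]x, y] `&` `]-oo, 0%R] = set0) ?measure0 ?adde0; last first.
      apply/seteqP; split => t //=; rewrite !in_itv/= => -[/andP[xt _] t0].
      by have := lt_le_trans xt (le_trans t0 x0); rewrite ltxx.
    rewrite (_ : `]x, y] `&` `]0%R, +oo[ = `]x, y]%classic); last first.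
      apply/seteqP; split => t /=; first by case.
      by rewrite !in_itv/= => /andP[xt ->]; rewrite xt (le_lt_trans x0 xt).
    rewrite mab// lebesgue_measure_itv/= lte_fin xy -EFinM.
    by rewrite mulrA mulVf ?mul1r ?gt_eqF.
  rewrite (_ : `]x, y] `&` `]-oo, 0%R] = `]x, 0%R]%classic); last first.
    apply/seteqP; split => t /=; rewrite !in_itv/=.
      by move=> [/andP[-> _] ->].
    by move=> /andP[-> t0]; rewrite t0 (le_trans t0 (ltW y0)).
  rewrite (_ : `]x, y] `&` `]0%R, +oo[ = `]0%R, y]%classic); last first.
    apply/seteqP; split => t /=; rewrite !in_itv/= andbT.
      by move=> [/andP[_ ->] ->].
    by move=> /andP[t0 ->]; rewrite t0 (lt_trans x0 t0).
  rewrite mab// !lebesgue_measure_itv/= !lte_fin xy x0 -!EFinM -EFinD.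
  by congr EFin; field; rewrite gt_eqF.
rewrite (eq_measure_integral (mscale (NngNum (ltW c0)) mu)).
  by rewrite ge0_integral_mscale//; exact: measurable_funTS.
move=> A mA AP; rewrite -[RHS]/(c%:E * mu A) m'E// /m' measure_addE.
rewrite -[X in _ = _ * X]/(c^-1%:E * m (A `&` `]0%R, +oo[) + mu (A `&` `]-oo, 0%R])).
rewrite (_ : A `&` `]-oo, 0%R] = set0) ?measure0 ?adde0; last first.
  apply/seteqP; split => t //= -[/AP]/=; rewrite !in_itv/= andbT => t0 t0'.
  by have := lt_le_trans t0 t0'; rewrite ltxx.
by rewrite setIidl// muleA -EFinM mulfV ?mul1e// gt_eqF.
Qed.

(** Image measures do the work of a substitution theorem: by the fundamental theorem of calculus the
    image under [phi] of the density [dphi] gives []x, y]] the mass [y - x], and [halfline_unique]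
    identifies it. The derivative may vanish at [a]. *)
Lemma subst_halfline (a : R) (phi dphi : R -> R) (f : MR -> \bar R) :
  measurable_fun [set: MR] phi -> measurable_fun [set: MR] dphi ->
  (forall x, a <= x -> is_derive x 1 phi (dphi x))%R ->
  (forall x, a <= x -> {for x, continuous dphi})%R ->
  (forall x, a < x -> 0 < dphi x)%R -> (phi a = 0)%R ->
  (forall M, exists2 x, a < x & M <= phi x)%R ->
  measurable_fun setT f -> (forall x, 0 <= f x) ->
  \int[mu]_(t in `]a, +oo[) ((dphi t)%:E * f (phi t)) =
  \int[mu]_(s in `]0%R, +oo[) f s.
Proof.
move=> mphi mdphi dphiP cdphi dphi0 phia phioo mf f0.
have mA : measurable (`]a, +oo[ : set MR) by exact: measurable_itv.
pose w (t : MR) : R := if (a < t)%R then dphi t else 0%R.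
have mw : measurable_fun [set: MR] (EFin \o w).
  apply/measurable_EFinP; apply: measurable_fun_ifT => //.
  exact: measurable_fun_ltr.
have w0 t : (0 <= w t)%R by rewrite /w; case: ifPn => // /dphi0/ltW.
have cphi x : (a <= x)%R -> {for x, continuous phi}.
  move=> ax; have := dphiP x ax; move=> /@ex_derive.
  by move=> /derivable1_diffP; exact: differentiable_continuous.
have wphi x y : (a <= x)%R -> {within `[x, y], continuous phi}.
  move=> ax; apply: continuous_in_subspaceT => z; rewrite inE/= in_itv/= => /andP[xz _].
  by apply: cphi; exact: le_trans xz.
have incr x y : (a <= x)%R -> (x < y)%R -> (phi x < phi y)%R.
  move=> ax xy; apply: (@gtr0_derive1_lt _ phi x y _ _ true false) => //.
  - by move=> z; rewrite in_itv/= => /andP[xz _]; have [] := dphiP z (ltW (le_lt_trans ax xz)).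
  - move=> z; rewrite in_itv/= => /andP[xz _].
    have az := le_lt_trans ax xz.
    have [_ /= D] := dphiP z (ltW az); rewrite derive1E D; exact: dphi0.
  - exact: wphi.
  - by rewrite in_itv/= lexx ltW.
  - by rewrite in_itv/= lexx ltW.
have incrle x y : (a <= x)%R -> (a <= y)%R -> (phi x <= phi y)%R = (x <= y)%R.
  move=> ax ay; have [xy|yx|->] := ltgtP x y; last by rewrite lexx.
    by rewrite ltW// incr.
  by rewrite leNgt incr.
have incrlt x y : (a <= x)%R -> (a <= y)%R -> (phi x < phi y)%R = (x < y)%R.
  by move=> ax ay; rewrite !ltNge incrle.
have surj s : (0 <= s)%R -> exists2 x, (a <= x)%R & phi x = s.
  move=> s0; have [y ay sy] := phioo s.
  have [|c] := @IVT _ phi a y s (ltW ay) (wphi a y (lexx a)).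
    by rewrite phia ge_min s0/= le_max sy orbT.
  by rewrite in_itv/= => /andP[ac _] <-; exists c.
have mphi' : measurable_fun [set: MR] (phi : MR -> MR) by [].
pose M := image_density mu mw w0 mphi'.
have Mab x y : (0 <= x)%R -> (x < y)%R -> M `]x, y]%classic = (1 * (y - x))%:E.
  move=> x0 xy; have [s as_ sx] := surj x x0.
  have [r ar ry] := surj y (le_trans x0 (ltW xy)).
  have sr : (s < r)%R by rewrite -incrlt// sx ry.
  rewrite /M /image_density; transitivity (\int[mu]_(t in `]s, r]) (dphi t)%:E).
    rewrite [LHS]integral_mkcond [RHS]integral_mkcond; apply: eq_integral => t _.
    rewrite /patch.
    have [at_|ta] := ltP a t; last first.
      rewrite /= /w ltNge ta/= if_same ifF//; apply/negbTE; rewrite notin_setE/= in_itv/=.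
      by apply/negP; rewrite negb_and -leNgt (le_trans ta).
    rewrite (_ : (t \in _) = (t \in `]s, r]%classic)) /= /w ?at_//.
    by apply/idP/idP; rewrite !inE/= !in_itv/= -sx -ry incrlt ?incrle// ltW.
  rewrite integral_itv_obnd_cbnd; last first.
    exact/measurable_funTS/measurable_EFinP.
  rewrite (@continuous_FTC2 _ dphi phi)//.
  - by rewrite sx ry mul1r.
  - apply: continuous_in_subspaceT => z; rewrite inE/= in_itv/= => /andP[xz _].
    by apply: cdphi; exact: le_trans xz.
  - split.
    + by move=> z; rewrite in_itv/= => /andP[xz _]; have [] := dphiP z (ltW (le_lt_trans as_ xz)).
    + by apply: cvg_at_right_filter; exact: cphi.
    + by apply: cvg_at_left_filter; exact: cphi.
  - move=> z; rewrite in_itv/= => /andP[xz _].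
    by have [_ /= D] := dphiP z (ltW (le_lt_trans as_ xz)); rewrite derive1E.
have := @halfline_unique M 1 ltr01 Mab f mf f0; rewrite mul1e => <-.
rewrite [RHS]integral_mkcond; apply/esym.
rewrite (integral_image_density mu mw w0 mphi').
- rewrite [RHS]integral_mkcond; apply: eq_integral => t _; rewrite /patch /w.
  rewrite !mem_setE !in_itv/= !andbT; have [at_|ta] := ltP a t; last by rewrite mul0e.
  by rewrite -phia incrlt ?at_// ltW.
- by apply/(measurable_restrictT f) => //; exact: measurable_funTS.
- by move=> x; rewrite /patch; case: ifPn.
Qed.

End real_line.

(** * Triangular changes of variables in iterated integrals *)

Section iterated_integral_transformations.
Local Open Scope ereal_scope.
Variable R : realType.
Local Notation mu := (@lebesgue_measure R).
Local Notation MR := (measurableTypeR R).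

Lemma II_map (K K' : eqType) (sg : K -> K') s (f : family R K -> \bar R) (b : family R K') :
  injective sg ->
  II (map sg s) (fun e => f (e \o sg)) b = II s f (b \o sg).
Proof.
move=> sgI; elim: s b => [//|k s IH] b /=; apply: eq_integral => t _.
rewrite IH; congr (II s f); apply/funext => j /=; rewrite /upd.
by rewrite (inj_eq sgI).
Qed.

Lemma II_II_swap (K K' : eqType) s s' (f : family R K -> family R K' -> \bar R) b b' :
  measurable_fun setT (fun p : family R K * family R K' => f p.1 p.2) ->
  (forall e e', 0 <= f e e') ->
  II s (fun e => II s' (f e) b') b = II s' (fun e' => II s (f ^~ e') b) b'.
Proof.
move=> mf f0; elim: s b => [//|k s IH] b /=.
under eq_integral do rewrite IH.
rewrite integral_II//; last by move=> *; exact: II_ge0.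
apply: (@measurable_II_param R K _ (MR * family R K')%type s (fun p e => f e p.2)
  (fun p => upd b k p.1)) => //.
- apply: (measurable_comp_fun mf (g := fun p : (MR * family R K') * family R K => (p.2, p.1.2))).
  apply: measurable_fun_pair => //.
  exact: measurable_comp_fun measurable_snd measurable_fst.
- by apply: measurable_upd => //; exact: measurable_cst.
Qed.

Lemma integral_affine (f : MR -> \bar R) (c a : R) : c != 0%R ->
  measurable_fun setT f -> (forall x, 0 <= f x) ->
  \int[mu]_t f (c * t + a)%R = `|c|^-1%:E * \int[mu]_t f t.
Proof.
move=> c0 mf f0.
have mg : measurable_fun [set: MR] (fun t : MR => f (t + a)%R).
  by apply: measurable_comp_fun mf _; exact: measurable_funD.
have [cpos|cneg] := ltP 0%R c.
  rewrite gtr0_norm// (integral_scale (f := fun t => f (t + a)%R))//.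
  by rewrite integral_shift.
have cN : (0 < - c)%R by rewrite oppr_gt0 lt_neqAle c0.
rewrite ler0_norm//.
rewrite -(integral_shift a mf f0) -(integral_scale cN mg)//.
rewrite -[RHS]integral_reflect//.
  by apply: eq_integral => t _; rewrite mulrNN.
by apply: measurable_comp_fun mg _; exact: measurable_funM.
Qed.

Variable K : eqType.
Implicit Type e : family R K.

Lemma II_upd_out (s : seq K) k t (f : family R K -> \bar R) b : k \notin s ->
  II s (fun e => f (upd e k t)) b = II s f (upd b k t).
Proof.
elim: s b => [//|l s IH] b; rewrite inE negb_or => /andP[kl ks] /=.
by apply: eq_integral => v _; rewrite IH// updC// eq_sym.
Qed.

Lemma II_indep (s : seq K) k t (f : family R K -> \bar R) b :
  (forall e, f (upd e k t) = f e) -> II s f (upd b k t) = II s f b.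
Proof.
move=> fk; elim: s b => [//|l s IH] b /=.
apply: eq_integral => v _; have [->|kl] := eqVneq k l; first by rewrite upd_upd.
by rewrite updC.
Qed.

(* The hypotheses say that the Jacobian matrix of [Phi] is triangular for the order of
   the list [s], with diagonal [c]. *)
Lemma II_triangular (s : seq K) (Phi : family R K -> family R K) (c : K -> R)
    (f : family R K -> \bar R) b :
  uniq s -> measurable_fun setT Phi -> (forall k, k \in s -> c k != 0%R) ->
  (forall k e, k \notin s -> Phi e k = e k) ->
  (forall s1 k s2 e e', s = s1 ++ k :: s2 ->
     (forall j, j \notin k :: s2 -> e j = e' j) ->
     Phi e k - c k * e k = Phi e' k - c k * e' k)%R ->
  measurable_fun setT f -> (forall e, 0 <= f e) ->
  II s (fun e => f (Phi e)) b = (\prod_(k <- s) `|c k|^-1)%:E * II s f b.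
Proof.
elim: s Phi f b => [|k s IH] Phi f b /=.
  move=> _ _ _ H1 _ _ _; rewrite big_nil mul1e; congr f.
  by apply/funext => k; exact: H1.
move=> /andP[ks us] mPhi c0 H1 H2 mf f0.
have ck : c k != 0%R by apply: c0; rewrite inE eqxx.
pose g (e : family R K) : R := (Phi e k - c k * e k)%R.
have gE e : Phi e k = (c k * e k + g e)%R by rewrite addrC subrK.
pose h t e := f (upd e k t).
transitivity (\int[mu]_t ((\prod_(k <- s) `|c k|^-1)%:E *
    II s f (upd b k (c k * t + g b)))).
  apply: eq_integral => t _.
  (* Once the outermost variable is fixed, the new value of [k] is the constant [c k * t + g b];
     [Phi'] leaves [k] alone and is triangular in the remaining list. *)
  pose Phi' e := upd (Phi e) k (e k).
  transitivity (II s (fun e => h (c k * t + g b)%R (Phi' e)) (upd b k t)).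
    apply: eq_II_in => e' He'; rewrite /h /Phi' upd_upd; congr f.
    have <- : Phi e' k = (c k * t + g b)%R.
      rewrite gE He'// updE; congr (_ + _)%R.
      apply: (H2 [::] k s) => // j; rewrite inE negb_or => /andP[jk js].
      by rewrite He'// updNE.
    by rewrite upd_id.
  rewrite IH//.
  - congr (_ * _).
    transitivity (II s f (upd (upd b k t) k (c k * t + g b))); last by rewrite upd_upd.
    exact: II_upd_out.
  - apply: measurable_upd => //; exact: measurable_coord.
  - by move=> j js; apply: c0; rewrite inE js orbT.
  - move=> j e js; rewrite /Phi' /upd; have [->//|jk] := eqVneq j k.
    by apply: H1; rewrite inE negb_or jk.
  - move=> s1 j s2 e e' sE ee'; rewrite /Phi' /upd.
    have jk : j != k by apply: contraNneq ks => <-; rewrite sE mem_cat inE eqxx orbT.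
    by rewrite (negbTE jk); apply: (H2 (k :: s1) j s2) => //; rewrite sE.
  - by apply: measurable_comp_fun mf _; apply: measurable_upd => //; exact: measurable_cst.
  - by move=> e; exact: f0.
rewrite ge0_integralZl//; last 3 first.
- apply: (measurable_comp_fun (measurable_II s mf f0)).
  apply: measurable_upd; first exact: measurable_cst.
  by apply: measurable_funD => //; exact: measurable_funM.
- by move=> *; exact: II_ge0.
- by rewrite lee_fin prodr_ge0// => j _; rewrite invr_ge0.
rewrite (integral_affine (f := fun t => II s f (upd b k t)))//.
- by rewrite big_cons EFinM muleA [(_ * `|c k|^-1%:E)]muleC.
- exact: measurable_II_upd.
- by move=> t; exact: II_ge0.
Qed.

Lemma II_unipotent (s : seq K) (Phi : family R K -> family R K)
    (f : family R K -> \bar R) b :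
  uniq s -> measurable_fun setT Phi ->
  (forall k e, k \notin s -> Phi e k = e k) ->
  (forall s1 k s2 e e', s = s1 ++ k :: s2 ->
     (forall j, j \notin k :: s2 -> e j = e' j) ->
     Phi e k - e k = Phi e' k - e' k)%R ->
  measurable_fun setT f -> (forall e, 0 <= f e) ->
  II s (fun e => f (Phi e)) b = II s f b.
Proof.
move=> us mPhi H1 H2 mf f0.
rewrite (@II_triangular s Phi (fun=> 1%R))//.
- by rewrite big1 ?mul1e// => i _; rewrite normr1 invr1.
- by move=> s1 k s2 e e' sE ee'; rewrite !mul1r; exact: (H2 s1 k s2).
Qed.

Lemma integral_lebesgue_tuple n (s : n.-tuple K) (f : n.-tuple MR -> \bar R) b :
  uniq s -> measurable_fun setT f -> (forall t, 0 <= f t) ->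
  \int[lebesgue_tuple n]_t f t = II s (fun e => f [tuple e (tnth s i) | i < n]) b.
Proof.
elim: n s f b => [|n IH] s f b us mf f0.
  rewrite [X in II X](_ : _ = [::]); last by rewrite (tuple0 s).
  rewrite /= integral_dirac// diracT mul1e.
  by congr f; apply/eq_from_tnth => -[].
move: us; case/tupleP: s => k s /= /andP[ks us].
rewrite -[LHS]/(\int[pushforward (lebesgue_measure \x lebesgue_tuple n) (@cons_pair R n)]_t f t).
rewrite ge0_integral_pushforward//; last exact: measurable_cons_pair.
have mfc : measurable_fun setT (f \o @cons_pair R n).
  by apply: measurableT_comp mf _; exact: measurable_cons_pair.
rewrite preimage_setT fubini_tonelli1//; last by move=> x; exact: f0.
apply: eq_integral => x _; rewrite /fubini_F /=.
have mfx : measurable_fun [set: n.-tuple MR] (fun t => f (cons_pair (x, t))).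
  apply: measurable_comp_fun mf _; apply: measurable_comp_fun (@measurable_cons_pair R n) _.
  by apply: measurable_fun_pair => //; exact: measurable_cst.
rewrite (IH s _ (upd b k x) us mfx)//.
apply: eq_II_in => e' He'; congr f; apply/eq_from_tnth => i.
rewrite tnth_mktuple; case: (unliftP ord0 i) => [j ->|->].
  by rewrite !tnthS tnth_mktuple.
by rewrite -[LHS]/x -[tnth _ _]/k He'// updE.
Qed.

End iterated_integral_transformations.

(** * Changing variables from residues to roots of the secular equation *)

Lemma measurable_all d (T : measurableType d) (I : eqType) (s : seq I)
    (p : I -> T -> bool) :
  (forall i, i \in s -> measurable_fun setT (p i)) ->
  measurable_fun setT (fun x => all (p ^~ x) s).
Proof.
elim: s => [|i s IH] ps /=; first exact: measurable_cst.
apply: measurable_and; first by apply: ps; rewrite inE eqxx.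
by apply: IH => j js; apply: ps; rewrite inE js orbT.
Qed.

Lemma measurable_app (R : realType) (K : countType) d (T : measurableType d)
    (f : T -> family R K) (k : K) :
  measurable_fun setT f -> measurable_fun setT (fun x => f x k).
Proof. by move=> mf; exact: (measurable_comp_fun (@measurable_coord R K k) mf). Qed.

(** One syntax-directed step of a measurability proof. The last two clauses match every goal: they
    handle the conditionals and coordinates that no earlier clause recognises. *)
Ltac mstep :=
  match goal with
  | |- measurable_fun _ _ => assumption
  | |- measurable_fun _ (fun _ => ?c) => exact: measurable_cst
  | |- measurable_fun _ (fun x => x) => exact: measurable_id
  | |- measurable_fun _ (fun x => (@?f x, @?g x)) => apply: measurable_fun_pair
  | |- measurable_fun _ (fun x => fst x) => exact: measurable_fst
  | |- measurable_fun _ (fun x => snd x) => exact: measurable_snd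
  | |- measurable_fun _ (fun x => x ?k) => exact: measurable_coord
  | |- measurable_fun _ fst => exact: measurable_fst
  | |- measurable_fun _ snd => exact: measurable_snd
  | |- measurable_fun _ (fun x => fst (@?f x)) => apply: (measurable_comp_fun measurable_fst)
  | |- measurable_fun _ (fun x => snd (@?f x)) => apply: (measurable_comp_fun measurable_snd)
  | |- measurable_fun _ (fun x => upd (@?f x) ?k (@?g x)) => apply: measurable_upd
  | |- measurable_fun _ (fun x => EFin (@?f x)) => apply/measurable_EFinP
  | |- measurable_fun _ (fun x => (@?f x + @?g x)%R) => apply: measurable_funD
  | |- measurable_fun _ (fun x => (- @?f x)%R) => apply: measurable_funN
  | |- measurable_fun _ (fun x => (@?f x * @?g x)%R) => apply: measurable_funM
  | |- measurable_fun _ (fun x => (@?f x ^-1)%R) => apply: (measurable_comp_fun (@measurable_inv _))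
  | |- measurable_fun _ (fun x => (@?f x ^+ ?n)%R) => apply: measurable_funX
  | |- measurable_fun _ (fun x => `| @?f x |%R) =>
      apply: (measurableT_comp (@normr_measurable _ setT))
  | |- measurable_fun _ (fun x => expR (@?f x)) => apply: (measurable_comp_fun (@measurable_expR _))
  | |- measurable_fun _ (fun x => Num.max (@?f x) (@?g x)) => apply: measurable_maxr
  | |- measurable_fun _ (fun x => (@?f x * @?g x)%E) => apply: emeasurable_funM
  | |- measurable_fun _ (fun x => (@?f x + @?g x)%E) => apply: emeasurable_funD
  | |- measurable_fun _ (fun x => (@?f x < @?g x)%R) => apply: measurable_fun_ltr
  | |- measurable_fun _ (fun x => (@?f x <= @?g x)%R) => apply: measurable_fun_ler
  | |- measurable_fun _ (fun x => (@?f x && @?g x)) => apply: measurable_and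
  | |- measurable_fun _ (fun x => all (@?p x) ?s) => apply: measurable_all => ? ?
  | |- measurable_fun _ (fun x => bigop.body ?i ?s (@?F x)) =>
      first [apply: measurable_sum => ? | apply: measurable_prod => ? ? | apply: emeasurable_sum => ?]
  | |- measurable_fun _ _ => apply: measurable_fun_ifT
  | |- measurable_fun _ _ => apply: measurable_app
  end.
Ltac mR := repeat mstep.

Section secular.
Variable R : realType.
Local Notation lam := (@lebesgue_measure R).
Local Notation MR := (measurableTypeR R).
Local Notation env := (family R nat).
Variable mu : nat -> R.

Fixpoint vdm (s : seq R) : R :=
  if s is x :: s' then (\prod_(y <- s') (x - y)) * vdm s' else 1.

(** The [n] poles are [mu j] for [a < j <= a + n], and the [n + 1] roots will be [la i] for
    [a <= i <= a + n]; the offset [a] lets an induction drop the largest root and the largest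
    pole. *)
Definition decr a n := forall i j, (a < i)%N -> (i < j)%N -> (j <= a + n)%N -> mu j < mu i.

Definition interl a n (la : env) :=
  all (fun j => (la j.+1 < mu j.+1) && (mu j.+1 < la j)) (iota a n).

Definition secular a n (z : R) (e : env) : R :=
  z - e a - \sum_(j <- iota a.+1 n) e j / (z - mu j).

(** Partial fractions of the old function times [(z - t) / (z - m)], which adds the root [t] and the
    pole [m = mu a.+1]. The old constant sits at key [a.+1]; shifted, it moves to [a] and leaves its
    place to the residue at [m]. *)
Definition secular_step a n (t : R) (e : env) : env := fun k =>
  let m := mu a.+1 in
  if k == a then e a.+1 + t - m
  else if k == a.+1 then (t - m) * secular a.+1 n m e
  else if k \in iota a.+2 n then e k * ((t - mu k) / (m - mu k)) else e k.

(* The variables [x] (key [a]) and [r_j] such that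
   [prod (z - la_i) / prod (z - mu_j) = z - x - sum r_j / (z - mu_j)]. *)
Fixpoint secular_coef a n (la : env) : env :=
  if n is n'.+1 then secular_step a n' (la a) (secular_coef a.+1 n' la) else la.

Lemma decrS a n : decr a n.+1 -> decr a.+1 n.
Proof. by move=> H i j ai ij jn; apply: H => //; lia. Qed.

Lemma secular_coefP a n la z : decr a n ->
  (forall j, j \in iota a.+1 n -> z != mu j) ->
  \prod_(i <- iota a n.+1) (z - la i) =
  (\prod_(j <- iota a.+1 n) (z - mu j)) * secular a n z (secular_coef a n la).
Proof.
elim: n a z => [|n IH] a z md zm.
  by rewrite /= !big_cons !big_nil /secular big_nil subr0 mul1r mulr1.
rewrite [iota a n.+2]/= big_cons -[_ :: iota _ _]/(iota a.+1 n.+1).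
rewrite (IH a.+1 z (decrS md)); last by move=> j js; apply: zm; rewrite inE js orbT.
rewrite [iota a.+1 n.+1]/= big_cons mulrCA -mulrA [RHS]mulrCA; congr (_ * _).
set e := secular_coef a.+1 n la.
have zm0 : z - mu a.+1 != 0 by rewrite subr_eq0; apply: zm; rewrite inE eqxx.
rewrite /= -/e /secular /= big_cons.
rewrite {1 2}/secular_step eqxx (gtn_eqF (leqnn a.+1)) eqxx.
have -> : \sum_(j <- iota a.+2 n) secular_step a n (la a) e j / (z - mu j) =
    \sum_(j <- iota a.+2 n) e j / (z - mu j) * ((la a - mu j) / (mu a.+1 - mu j)).
  apply: eq_big_seq => j js; rewrite /secular_step js.
  move: js; rewrite mem_iota => /andP[aj _].
  by rewrite !gtn_eqF//; [rewrite mulrAC | lia].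
rewrite /secular.
have H : \sum_(j <- iota a.+2 n) e j / (z - mu j) * ((la a - mu j) / (mu a.+1 - mu j)) =
   (z - la a) / (z - mu a.+1) * \sum_(j <- iota a.+2 n) e j / (z - mu j)
   - (mu a.+1 - la a) / (z - mu a.+1) * \sum_(j <- iota a.+2 n) e j / (mu a.+1 - mu j).
  rewrite !mulr_sumr -sumrB; apply: eq_big_seq => j js.
  have zj : z - mu j != 0 by rewrite subr_eq0; apply: zm; rewrite inE js orbT.
  have mj : mu a.+1 - mu j != 0.
    move: js; rewrite mem_iota => /andP[aj jn].
    by rewrite subr_eq0 gt_eqF//; apply: md; lia.
  by field; rewrite zj mj zm0.
rewrite H; field; exact: zm0.
Qed.

Lemma interlS a n la : interl a n.+1 la =
  [&& la a.+1 < mu a.+1, mu a.+1 < la a & interl a.+1 n la].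
Proof. by rewrite /interl /= andbA. Qed.

Lemma prod_decr_gt0 a n (z : R) : decr a n.+1 -> mu a.+1 <= z ->
  0 < \prod_(j <- iota a.+2 n) (z - mu j).
Proof.
move=> md mz; rewrite big_seq prodr_gt0// => j; rewrite mem_iota => /andP[aj jn].
by rewrite subr_gt0; apply: lt_le_trans mz; apply: md; lia.
Qed.

Lemma interl_lt a n la j : decr a n -> interl a n la -> j \in iota a.+1 n ->
  la j < mu j.
Proof.
move=> _ /allP H; rewrite mem_iota => /andP[aj jn].
have := H j.-1; rewrite mem_iota prednK; last by lia.
by case/(_ _)/andP => //; lia.
Qed.

(** In the product formula at [z = mu a.+1] every factor other than [mu a.+1 - la a.+1] is
    positive. *)
Lemma secular_sign a n la : decr a n.+1 -> interl a.+1 n la ->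
  (0 < secular a.+1 n (mu a.+1) (secular_coef a.+1 n la)) = (la a.+1 < mu a.+1).
Proof.
move=> md il; have P0 := prod_decr_gt0 md (lexx _).
have H := @secular_coefP a.+1 n la (mu a.+1) (decrS md).
rewrite -(pmulr_rgt0 _ P0) -H; last first.
  by move=> j; rewrite mem_iota => /andP[aj jn]; rewrite gt_eqF//; apply: md; lia.
rewrite [iota a.+1 n.+1]/= big_cons pmulr_lgt0 ?subr_gt0//.
rewrite big_seq prodr_gt0// => j js; rewrite subr_gt0.
apply: (lt_trans (interl_lt (decrS md) il js)).
by move: js; rewrite mem_iota => /andP[aj jn]; apply: md; lia.
Qed.

Lemma secular_coef_gt0 a n la : decr a n -> interl a n la ->
  all (fun j => 0 < secular_coef a n la j) (iota a.+1 n).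
Proof.
elim: n a => [//|n IH] a md; rewrite interlS => /and3P[l1 l2 il].
apply/allP => j; rewrite [iota a.+1 n.+1]/= inE => /predU1P[->|js] /=.
  rewrite /secular_step gtn_eqF// eqxx.
  by apply: mulr_gt0; [rewrite subr_gt0|rewrite secular_sign].
have := IH _ (decrS md) il => /allP/(_ j js) rj.
have js' := js; rewrite mem_iota in js' => //; move: js' => /andP[aj jn].
rewrite /secular_step !gtn_eqF ?js//; try lia.
have H : mu j < mu a.+1 by apply: md; lia.
by rewrite mulr_gt0// divr_gt0 ?subr_gt0// (lt_trans H).
Qed.

(** Splits off the largest root and the largest pole. The three factors on the right are what one
    step of the change of variables contributes: a derivative, a rescaling of residues, and the
    induction hypothesis. *)
Lemma vdm_ratio a n la : decr a n.+1 -> mu a.+1 < la a ->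
  vdm [seq la i | i <- iota a n.+2] / vdm [seq mu j | j <- iota a.+1 n.+1] =
  secular a.+1 n (la a) (secular_coef a.+1 n la) *
  (\prod_(j <- iota a.+2 n) ((la a - mu j) / (mu a.+1 - mu j))) *
  (vdm [seq la i | i <- iota a.+1 n.+1] / vdm [seq mu j | j <- iota a.+2 n]).
Proof.
move=> md ml.
have vdmS i k (f : nat -> R) : vdm [seq f j | j <- iota i k.+1] =
    \prod_(j <- iota i.+1 k) (f i - f j) * vdm [seq f j | j <- iota i.+1 k].
  by rewrite /= big_map.
rewrite (vdmS a) (vdmS a.+1 n mu) secular_coefP ?prodf_div; last 2 first.
- exact: decrS.
- move=> j; rewrite mem_iota => /andP[aj jn]; rewrite gt_eqF//.
  by apply: lt_trans ml; apply: md; lia.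
by rewrite invfM; ring.
Qed.

Lemma measurable_secular d (T : measurableType d) a n (z : T -> MR) (e : T -> env) :
  measurable_fun setT z -> measurable_fun setT e ->
  measurable_fun setT (fun p => secular a n (z p) (e p)).
Proof. by move=> mz me; rewrite /secular; mR. Qed.

(** The derivative in [z] of [(z - mu a) * secular a n z e], which is the residue at [mu a] as a
    function of the added root [z] once the other residues have their final values. *)
Definition dsecular a n (z : R) (e : env) : R :=
  secular a n z e +
  (z - mu a) * (1 + \sum_(j <- iota a.+1 n) e j / (z - mu j) ^+ 2).

Lemma measurable_dsecular d (T : measurableType d) a n (z : T -> MR) (e : T -> env) :
  measurable_fun setT z -> measurable_fun setT e ->
  measurable_fun setT (fun p => dsecular a n (z p) (e p)).
Proof. by move=> mz me; rewrite /dsecular /secular; mR. Qed.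

Lemma is_derive_cauchy (s : seq nat) (e : env) (x : R) :
  (forall j, j \in s -> x - mu j != 0) ->
  is_derive x 1 (fun z : R => \sum_(j <- s) e j / (z - mu j))
    (- \sum_(j <- s) e j / (x - mu j) ^+ 2).
Proof.
elim: s => [|k s IH] xs.
  rewrite (_ : (fun z => _) = cst 0); last by apply/funext => z; rewrite big_nil.
  by rewrite big_nil oppr0; exact: is_derive_cst.
have xk : x - mu k != 0 by apply: xs; rewrite inE eqxx.
have {}IH := IH (fun j js => xs j (mem_behead (s := k :: s) js)).
rewrite (_ : (fun z => _) = (fun z => e k * (z - mu k)^-1) +
    (fun z : R => \sum_(j <- s) e j / (z - mu j))); last first.
  by apply/funext => z; rewrite big_cons.
rewrite big_cons opprD; apply: is_deriveD.
have D1 : is_derive x 1 (fun z : R => z - mu k) 1.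
  by apply: is_derive_eq; rewrite subr0.
have D2 := @is_deriveV R (fun z : R => z - mu k) x 1 1 xk D1.
have D3 := @is_deriveZ R R R (fun z : R => (z - mu k)^-1) (e k) x 1 _ D2.
apply: is_derive_eq.
by rewrite /= !scaleNr scalerN /GRing.scale /= mulr1.
Qed.

Lemma is_derive_secular a n (e : env) (x : R) :
  (forall j, j \in iota a.+1 n -> x - mu j != 0) ->
  is_derive x 1 (fun z : R => (z - mu a) * secular a n z e) (dsecular a n x e).
Proof.
move=> xs; have D := is_derive_cauchy e xs.
have D1 : is_derive x 1 (fun z : R => z - mu a) 1.
  by apply: is_derive_eq; rewrite subr0.
have D2 : is_derive x 1 (fun z : R => z - e a) 1.
  by apply: is_derive_eq; rewrite subr0.
have D3 : is_derive x 1 (fun z : R => secular a n z e)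
    (1 - - \sum_(j <- iota a.+1 n) e j / (x - mu j) ^+ 2).
  exact: is_deriveB.
have := is_deriveM D1 D3; move=> D4; apply: is_derive_eq.
by rewrite /dsecular /GRing.scale /= opprK mulr1 addrC.
Qed.

Lemma continuous_cauchy (s : seq nat) (e : env) (p : nat) (x : R) :
  (forall j, j \in s -> x - mu j != 0) ->
  {for x, continuous (fun z : R => \sum_(j <- s) e j / (z - mu j) ^+ p)}.
Proof.
move=> xs; elim: s xs => [|k s IH] xs.
  rewrite (_ : (fun z => _) = cst 0); last by apply/funext => z; rewrite big_nil.
  exact: cst_continuous.
have xk : x - mu k != 0 by apply: xs; rewrite inE eqxx.
have {}IH := IH (fun j js => xs j (mem_behead (s := k :: s) js)).
rewrite (_ : (fun z => _) = (fun z => e k * ((z - mu k) ^+ p)^-1) \+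
    (fun z : R => \sum_(j <- s) e j / (z - mu j) ^+ p)); last first.
  by apply/funext => z; rewrite /= big_cons.
apply: continuousD => //; apply: continuousM; first exact: cst_continuous.
apply: continuousV; first by rewrite expf_neq0.
apply: (@continuous_comp _ _ _ (fun z : R => z - mu k) (fun z : R => z ^+ p)).
  by apply: continuousB => //; exact: cst_continuous.
exact: exprn_continuous.
Qed.

Lemma continuous_secular a n (e : env) (x : R) :
  (forall j, j \in iota a.+1 n -> x - mu j != 0) ->
  {for x, continuous (fun z => secular a n z e)}.
Proof.
move=> xs; apply: continuousB.
  by apply: continuousB => //; exact: cst_continuous.
have := @continuous_cauchy _ e 1 x xs.
by rewrite (_ : (fun z => _) = (fun z : R => \sum_(j <- iota a.+1 n) e j / (z - mu j))).
Qed.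

Lemma continuous_dsecular a n (e : env) (x : R) :
  (forall j, j \in iota a.+1 n -> x - mu j != 0) ->
  {for x, continuous (fun z => dsecular a n z e)}.
Proof.
move=> xs; apply: continuousD; first exact: continuous_secular.
apply: continuousM; first by apply: continuousB => //; exact: cst_continuous.
by apply: continuousD; [exact: cst_continuous|exact: continuous_cauchy].
Qed.

(** To the right of [mu a] the secular function increases with slope at least 1, so it is positive
    on a half-line. There [(t - mu a) * secular a n t e] increases from 0 to infinity, and
    [subst_halfline] applies. *)
Lemma secular_subst a n (e : env) (f : MR -> \bar R) : decr a.-1 n.+1 -> (0 < a)%N ->
  all (fun j => 0 < e j) (iota a.+1 n) ->
  measurable_fun setT f -> (forall x, 0 <= f x)%E ->
  (\int[lam]_t ((if (mu a < t) && (0 < secular a n t e) then `|dsecular a n t e|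
     else 0)%R%:E * f ((t - mu a) * secular a n t e)%R) =
   \int[lam]_(s in `]0%R, +oo[) f s)%E.
Proof.
move=> md a0 /allP e0 mf f0; set m := mu a.
have mj x j : m <= x -> j \in iota a.+1 n -> 0 < x - mu j.
  move=> mx; rewrite mem_iota => /andP[aj jn]; rewrite subr_gt0.
  by apply: lt_le_trans mx; apply: md; lia.
have mjn x j : m <= x -> j \in iota a.+1 n -> x - mu j != 0.
  by move=> mx js; rewrite gt_eqF// mj.
pose S x := secular a n x e.
have Sle x y : m <= x -> x <= y -> y - x <= S y - S x.
  move=> mx xy; rewrite /S /secular.
  have H : \sum_(j <- iota a.+1 n) e j / (y - mu j) <= \sum_(j <- iota a.+1 n) e j / (x - mu j).
    rewrite !big_seq; apply: ler_sum => j js.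
    rewrite ler_wpM2l//; first exact/ltW/e0.
    rewrite lef_pV2 ?posrE ?mj//; first by rewrite lerD2r.
    exact: le_trans xy.
  move: H; set A := \sum_(_ <- _) _; set B := \sum_(_ <- _) _; lra.
have cS x : m <= x -> {for x, continuous S}.
  by move=> mx; apply: continuous_secular => j; exact: mjn.
(* The left end [m0] is [m] itself if the secular function is already nonnegative there, and its
   zero otherwise; the slope bound puts that zero in [[m, m - S m]]. *)
have [m0 mm0 [Sm0 m0E]] : exists2 m0, m <= m0 &
    0 <= S m0 /\ (m0 - m) * S m0 = 0 /\ forall t, (m < t) && (0 < S t) = (m0 < t).
  have [Sm|Sm] := leP 0 (S m).
    exists m => //; split => //; rewrite subrr mul0r; split => // t.
    have [mt|//] := ltP m t; rewrite /=.
    have := Sle m t (lexx _) (ltW mt); lra.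
  have [|||m0] := @IVT R S m (m - S m) 0.
  - by rewrite lerBrDl; lra.
  - apply: continuous_in_subspaceT => z; rewrite inE/= in_itv/= => /andP[mz _].
    exact: cS.
  - have := Sle m (m - S m) (lexx _) => H; have {H} := H _.
    rewrite ge_min le_max (ltW Sm) /= => H; apply/orP; right.
    by have : m <= m - S m by [lra]; move=> /H; lra.
  rewrite in_itv/= => /andP[mm0 _] Sm0; exists m0 => //; rewrite Sm0 mulr0.
  split => //; split => // t; apply/andP/idP => [[mt St]|m0t].
    rewrite ltNge; apply/negP => tm0; have := Sle t m0 (ltW mt) tm0; lra.
  by split; [exact: le_lt_trans m0t|have := Sle m0 t mm0 (ltW m0t); lra].
case: m0E => m0E tE.
have H1 : measurable_fun [set: MR] (fun t : MR => (t - m) * S t).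
  apply: measurable_funM; first by mR.
  exact: (@measurable_secular _ MR a n id (fun=> e)).
have H2 : measurable_fun [set: MR] (fun t : MR => dsecular a n t e).
  exact: (@measurable_dsecular _ MR a n id (fun=> e)).
have H3 x : m0 <= x -> is_derive x 1 (fun t => (t - m) * S t) (dsecular a n x e).
  by move=> m0x; apply: is_derive_secular => j; apply: mjn; exact: le_trans m0x.
have H4 x : m0 <= x -> {for x, continuous (fun t => dsecular a n t e)}.
  by move=> m0x; apply: continuous_dsecular => j; apply: mjn; exact: le_trans m0x.
have H5 x : m0 < x -> 0 < dsecular a n x e.
  move=> m0x; have := tE x; rewrite m0x => /andP[mx Sx].
  apply: ltr_pwDl => //; rewrite mulr_ge0 ?subr_ge0 ?(ltW mx)// addr_ge0// big_seq sumr_ge0//.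
  by move=> j js; rewrite divr_ge0 ?sqr_ge0// ltW// e0.
have H6 M : exists2 x, m0 < x & M <= (x - m) * S x.
  exists (m0 + 1 + `|M|); first by rewrite -addrA ltrDl ltr_pwDl.
  have H : m0 + 1 + `|M| - m0 <= S (m0 + 1 + `|M|) - S m0.
    by apply: Sle; rewrite // -addrA lerDl addr_ge0.
  have MM := ler_norm M; have M0 := normr_ge0 M.
  move: (S (m0 + 1 + `|M|)) H => Z H; nra.
rewrite -(subst_halfline H1 H2 H3 H4 H5 m0E H6 mf f0).
rewrite [RHS]integral_mkcond; apply: eq_integral => t _.
rewrite /patch mem_setE in_itv/= andbT -/(S t) tE.
case: ifPn => // m0t; last by rewrite mul0e.
by rewrite gtr0_norm// H5.
Qed.

Definition interl_weight a n (la : env) : R :=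
  if interl a n la then
    vdm [seq la i | i <- iota a n.+1] / vdm [seq mu j | j <- iota a.+1 n]
  else 0.

(** The Jacobian between roots and residues is a ratio of Vandermonde products. Induction on the
    number of poles: for a fixed largest root [t] the other roots are traded for the coefficients of
    the smaller function, these are rescaled to their final values by a triangular map, and [t] is
    traded for the residue at [m]. *)
Theorem secular_change a n (G : env -> \bar R) b : decr a n ->
  measurable_fun setT G -> (forall e, 0 <= G e)%E ->
  II (iota a n.+1)
    (fun la => (interl_weight a n la)%:E * G (secular_coef a n la))%E b =
  II (iota a n.+1)
    (fun r => (if all (fun j => 0 < r j)%R (iota a.+1 n) then 1 else 0)%:E * G r)%E b.
Proof.
elim: n a G b => [|n IH] a G b md mG G0.
  by apply: eq_II => e; rewrite /interl_weight /= big_nil mul1r divr1.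
set m := mu a.+1; set s2 := iota a.+2 n.
pose sec z e := secular a.+1 n z e; pose dsec z e := dsecular a.+1 n z e.
have md' := decrS md.
have mj x j : m <= x -> j \in s2 -> 0 < x - mu j.
  move=> mx; rewrite mem_iota => /andP[aj jn]; rewrite subr_gt0.
  by apply: lt_le_trans mx; apply: md; lia.
pose c t j : R := (t - mu j) / (m - mu j).
have c0 t j : m < t -> j \in s2 -> 0 < c t j.
  by move=> mt js; rewrite divr_gt0// mj// ltW.
pose pos (e : env) := all (fun j => 0 < e j) s2.
(* Here [e] holds the final residues on [s2] and the constant at key [a.+1]; the constant moves to
   [a], and the residue at [m] is computed from [t]. *)
pose place (t : R) (e : env) : env := upd (upd e a (e a.+1)) a.+1 ((t - m) * sec t e).
pose H (t : R) (e : env) : \bar R := ((if pos e then 1 else 0)%:E *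
  ((if (m < t)%R && (0 < sec t e)%R then `|dsec t e|%R else 0%R)%:E * G (place t e)))%E.
have H0 t e : (0 <= H t e)%E.
  by rewrite /H !mule_ge0//; [case: ifP|case: ifP].
have mpos d (T : measurableType d) (e : T -> env) : measurable_fun setT e ->
    measurable_fun setT (fun p => pos (e p)).
  by move=> me; rewrite /pos; mR.
have mplace d (T : measurableType d) (z : T -> MR) (e : T -> env) :
    measurable_fun setT z -> measurable_fun setT e ->
    measurable_fun setT (fun p => place (z p) (e p)).
  move=> mz me; apply: measurable_upd; first by mR.
  by apply: measurable_funM; [mR|exact: measurable_secular].
have mH : measurable_fun setT (fun p : MR * env => H p.1 p.2).
  apply: emeasurable_funM; first by apply/measurable_EFinP; apply: measurable_fun_ifT; [exact: mpos|mR|mR].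
  apply: emeasurable_funM; last first.
    by apply: (measurable_comp_fun mG); exact: mplace.
  apply/measurable_EFinP; apply: measurable_fun_ifT; [|mR|mR].
    apply: measurable_and; first by mR.
    by apply: measurable_fun_ltr; [mR|apply: measurable_secular; mR].
  by apply: measurable_dsecular; mR.
have inner t : II (iota a.+1 n.+1) (fun la => (interl_weight a n.+1 la)%:E *
    G (secular_coef a n.+1 la))%E (upd b a t) = II (iota a.+1 n.+1) (H t) b.
  have -> : II (iota a.+1 n.+1) (H t) b = II (iota a.+1 n.+1) (H t) (upd b a t).
    apply/esym; apply: II_indep => e; rewrite /H.
    have E j : (a < j)%N -> upd e a t j = e j by move=> aj; rewrite updNE// gtn_eqF.
    have -> : pos (upd e a t) = pos e.
      by apply: eq_in_all => j; rewrite mem_iota => /andP[aj _]; rewrite E// ltnW.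
    have sE z : \sum_(j <- s2) upd e a t j / (z - mu j) = \sum_(j <- s2) e j / (z - mu j).
      by apply: eq_big_seq => j; rewrite mem_iota => /andP[aj _]; rewrite E// ltnW.
    have -> : sec t (upd e a t) = sec t e by rewrite /sec /secular E// sE.
    have -> : dsec t (upd e a t) = dsec t e.
      rewrite /dsec /dsecular /secular E// sE; congr (_ + _ * (_ + _)).
      by apply: eq_big_seq => j; rewrite mem_iota => /andP[aj _]; rewrite E// ltnW.
    rewrite /place (_ : sec t (upd e a t) = sec t e); last by rewrite /sec /secular E// sE.
    by rewrite E// upd_upd.
  have [mt|tm] := ltP m t; last first.
    have -> : II (iota a.+1 n.+1) (H t) (upd b a t) = II (iota a.+1 n.+1) (fun=> 0%E) (upd b a t).
      by apply: eq_II => e; rewrite /H ltNge tm /= mul0e mule0.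
    apply: eq_II_in => la Hla; rewrite /interl_weight interlS.
    have -> : la a = t by rewrite Hla ?updE// mem_iota ltnn.
    by rewrite [mu _ < t]ltNge tm /= andbF mul0e.
  (* The triangular part of [secular_step]. It satisfies [sec t (Phi e) = sec m e], so the residue
     at [m] can be read from the new coefficients. *)
  pose Phi (e : env) : env := fun k =>
    if k == a.+1 then e k + (t - m) else if k \in s2 then e k * c t k else e k.
  have aS2 : a.+1 \in s2 = false by rewrite mem_iota ltnn.
  have mPhi d (T : measurableType d) (e : T -> env) : measurable_fun setT e ->
      measurable_fun setT (fun p => Phi (e p)).
    move=> me; apply: measurable_envP => k; rewrite /Phi; case: (k == a.+1); first by mR.
    by case: (k \in s2); mR.
  have PhiA e : Phi e a.+1 = e a.+1 + (t - m) by rewrite /Phi eqxx.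
  have PhiS e j : j \in s2 -> Phi e j = e j * c t j.
    by move=> js; rewrite /Phi js; case: eqP js => // ->; rewrite aS2.
  have secPhi e : sec t (Phi e) = sec m e.
    rewrite /sec /secular PhiA.
    have -> : \sum_(j <- s2) Phi e j / (t - mu j) = \sum_(j <- s2) e j / (m - mu j).
      apply: eq_big_seq => j js; rewrite PhiS// /c.
      by field; rewrite !gt_eqF// mj// ltW.
    ring.
  have dsecPhi e : dsec t (Phi e) = sec t e.
    rewrite /dsec /dsecular -/(sec t (Phi e)) secPhi /sec /secular -/m -/s2.
    have -> : \sum_(j <- s2) Phi e j / (t - mu j) ^+ 2 =
        \sum_(j <- s2) e j / ((t - mu j) * (m - mu j)).
      apply: eq_big_seq => j js; rewrite PhiS// /c.
      by field; rewrite !gt_eqF// mj// ltW.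
    have -> : \sum_(j <- s2) e j / (t - mu j) =
        \sum_(j <- s2) e j / (m - mu j) - (t - m) * \sum_(j <- s2) e j / ((t - mu j) * (m - mu j)).
      rewrite mulr_sumr -sumrB; apply: eq_big_seq => j js.
      by field; rewrite !gt_eqF// mj// ltW.
    ring.
  have posPhi e : pos (Phi e) = pos e.
    by apply: eq_in_all => j js; rewrite PhiS// pmulr_lgt0// c0.
  have stepE e : place t (Phi e) = secular_step a n t e.
    apply/funext => k; rewrite /place /upd /secular_step secPhi.
    have [->|ka] := eqVneq k a.+1; first by rewrite gtn_eqF.
    case: (k == a); first by rewrite PhiA addrA.
    by rewrite /Phi (negbTE ka).
  pose C := \prod_(j <- s2) c t j.
  have C0 : 0 < C by rewrite /C big_seq prodr_gt0// => j; exact: c0.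
  pose G' e : \bar R := ((if 0 < sec m e then `|sec t e| * C else 0)%:E *
    G (secular_step a n t e))%E.
  have mG' : measurable_fun setT G'.
    apply: emeasurable_funM.
      have ms z : measurable_fun setT (fun e : env => sec z e).
        by apply: measurable_secular; mR.
      apply/measurable_EFinP; apply: measurable_fun_ifT; [|mR|mR].
        by apply: measurable_fun_ltr; [mR|exact: ms].
      exact: ms.
    rewrite (_ : (fun _ => _) = (fun e => G (place t (Phi e)))); last first.
      by apply/funext => e; rewrite stepE.
    apply: (measurable_comp_fun mG); apply: mplace; first exact: measurable_cst.
    exact: (mPhi _ env id).
  transitivity (II (iota a.+1 n.+1) (fun la => (interl_weight a.+1 n la)%:E *
      G' (secular_coef a.+1 n la))%E (upd b a t)).
    apply: eq_II_in => la Hla; have lat : la a = t by rewrite Hla ?updE// mem_iota ltnn.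
    rewrite /interl_weight interlS lat mt.
    case: (boolP (interl a.+1 n la)) => il; last by rewrite !andbF !mul0e.
    rewrite /G' /sec secular_sign// /= !andbT.
    case: (boolP (la a.+1 < m)) => lm; last by rewrite !mul0e mule0.
    rewrite vdm_ratio ?lat// muleA -EFinM; congr (_%:E * G _)%E.
    rewrite ger0_norm; last first.
      have P0 := prod_decr_gt0 md (ltW mt).
      rewrite -(pmulr_rge0 _ P0) -(@secular_coefP a.+1 n la t md'); last first.
        by move=> j js; have := mj t j (ltW mt) js; rewrite subr_gt0 => /gt_eqF->.
      rewrite [iota a.+1 n.+1]/= big_cons mulr_ge0 ?subr_ge0 ?(ltW (lt_trans lm mt))//.
      rewrite big_seq prodr_ge0// => j js; rewrite subr_ge0 ltW//.
      apply: (lt_trans (interl_lt md' il js)).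
      by have := mj t j (ltW mt) js; rewrite subr_gt0.
    by rewrite mulrC.
  rewrite IH//; last first.
    move=> e; rewrite /G' mule_ge0//; case: ifP => // _.
    by rewrite lee_fin mulr_ge0// ltW.
  transitivity (II (iota a.+1 n.+1) (fun e => C%:E * H t (Phi e))%E (upd b a t)).
    apply: eq_II => e; rewrite /H /G' posPhi secPhi dsecPhi stepE mt /=.
    rewrite -/(pos e) [RHS]muleCA; congr (_ * _)%E; rewrite [RHS]muleA -EFinM.
    by case: ifP => _; rewrite ?mulr0// mulrC.
  have mHt : measurable_fun setT (H t).
    apply: (measurable_comp_fun mH (g := fun e => (t, e))).
    by apply: measurable_fun_pair => //; exact: measurable_cst.
  rewrite IIZl//; last 2 first.
  - by apply: (measurable_comp_fun mHt); exact: (mPhi _ env id).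
  - by rewrite lee_fin ltW.
  (* The Jacobian of [Phi] cancels the product [C] that came from the ratio of Vandermonde
     products. *)
  rewrite (@II_triangular _ _ (iota a.+1 n.+1) Phi
    (fun k => if k == a.+1 then 1 else c t k))//.
  - rewrite [iota a.+1 n.+1]/= big_cons eqxx normr1 invr1 mul1r.
    rewrite (eq_big_seq (fun k => (c t k)^-1)); last first.
      move=> k ks; rewrite ifF; first by rewrite gtr0_norm// c0.
      by apply/negbTE/eqP => ka; move: ks; rewrite ka -/s2 aS2.
    rewrite -/s2 prodfV muleA -EFinM mulfV ?mul1e//.
    by rewrite gt_eqF.
  - exact: iota_uniq.
  - exact: (mPhi _ env id).
  - move=> k; rewrite [iota a.+1 n.+1]/= inE => /predU1P[->|ks].
      by rewrite eqxx oner_neq0.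
    by case: (k == a.+1); [exact: oner_neq0|rewrite gt_eqF// c0].
  - move=> k e; rewrite [iota a.+1 n.+1]/= inE negb_or => /andP[/negbTE ka /negbTE ks].
    by rewrite /Phi ka ks.
  - move=> s1 k s3 e e' sE _.
    have : k \in iota a.+1 n.+1 by rewrite sE mem_cat inE eqxx orbT.
    rewrite [iota a.+1 n.+1]/= inE => /predU1P[->|ks].
      by rewrite !PhiA eqxx !mul1r; ring.
    rewrite !PhiS// ifF; last by apply/negbTE/eqP => ka; rewrite ka aS2 in ks.
    by ring.
rewrite [iota a n.+2]/= -[_ :: _ :: _]/(a :: iota a.+1 n.+1).
rewrite -[LHS]/(\int[lam]_t II (iota a.+1 n.+1) _ (upd b a t))%E.
transitivity (\int[lam]_t II (iota a.+1 n.+1) (H t) b)%E.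
  by apply: eq_integral => t _; exact: inner.
rewrite integral_II//.
set P := fun r : env => (_ * G r)%E.
have mP : measurable_fun setT P.
  apply: emeasurable_funM => //; apply/measurable_EFinP; apply: measurable_fun_ifT; mR.
have P0 e : (0 <= P e)%E by rewrite /P mule_ge0//; case: ifP.
transitivity (II (iota a.+1 n.+1)
   (fun e => \int[lam]_r P (upd (upd e a (e a.+1)) a.+1 r))%E b).
  apply: eq_II => e; rewrite /H.
  pose K (r : MR) := G (upd (upd e a (e a.+1)) a.+1 r).
  have mK : measurable_fun setT K.
    by apply: (measurable_comp_fun mG); apply: measurable_upd => //; exact: measurable_cst.
  case: (boolP (pos e)) => pe; last first.
    under eq_integral do rewrite mul0e.
    rewrite integral0 [RHS]integral0_eq// => r _; rewrite /P ifF ?mul0e//.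
    apply/negbTE; move: pe; apply: contra => /allP A; apply/allP => j js.
    have := A j; rewrite [iota a.+1 n.+1]/= inE js orbT => /(_ isT).
    move: js; rewrite mem_iota => /andP[aj _].
    by rewrite !updNE// gtn_eqF// ltnW.
  under eq_integral do rewrite mul1e.
  have := @secular_subst a.+1 n e K md isT pe mK (fun r => G0 _); rewrite -/m => ->.
  rewrite integral_mkcond; apply: eq_integral => r _; rewrite /patch mem_setE in_itv/= andbT.
  rewrite /P (_ : all _ _ = (0 < r)); last first.
    rewrite [iota a.+1 n.+1]/= /= updE; case: (0 < r) => //=.
    move: pe; rewrite /pos => pe; rewrite -[RHS]pe; apply: eq_in_all => j js.
    move: js; rewrite mem_iota => /andP[aj _].
    by rewrite !updNE// gtn_eqF// ltnW.
  by case: ifP => _; rewrite ?mul1e ?mul0e.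
rewrite [iota a.+1 n.+1]/= [LHS]/=; apply: eq_integral => x _.
transitivity (II s2 (fun e => \int[lam]_r P (upd (upd e a x) a.+1 r))%E (upd b a.+1 x)).
  apply: eq_II_in => e He; apply: eq_integral => r _.
  by rewrite [e a.+1]He ?updE// mem_iota ltnn.
rewrite -integral_II//; last first.
  apply: (measurable_comp_fun mP (g := fun p : MR * env => upd (upd p.2 a x) a.+1 p.1)).
  by mR.
apply: eq_integral => r _.
rewrite (@II_upd_out R _ s2 a x (fun e => P (upd e a.+1 r)) (upd b a.+1 x)); last first.
  by rewrite mem_iota negb_and -leqNgt leqnSn.
rewrite II_upd_out; last by rewrite mem_iota ltnn.
rewrite -[RHS]/(II s2 P (upd (upd b a x) a.+1 r)); congr (II s2 P _).
by apply/funext => j; rewrite /upd; case: (j == a.+1); case: (j == a).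
Qed.

End secular.

(** * Spectra of Hermitian matrices and of their principal minors *)

Section sorted_roots.
Variable R : realType.

Lemma measurable_of_le d (T : measurableType d) (f : T -> R) :
  (forall c, measurable_fun setT (fun x => f x <= c)) -> measurable_fun setT f.
Proof.
move=> mf; apply: (measurability _ (RGenOInfty.measurableE R)).
move=> _ [_ [c ->] <-]; rewrite setTI.
rewrite (_ : _ @^-1` _ = (fun x => f x <= c) @^-1` [set false]).
  by have := mf c measurableT [set false]; rewrite setTI; exact.
by apply/seteqP; split => x /=; rewrite in_itv/= andbT ltNge; case: (f x <= c).
Qed.

Lemma prod_XaddC_ge0 (s : seq R) : all (fun y => 0 <= y) s ->
  forall j, 0 <= (\prod_(y <- s) ('X + y%:P))`_j.
Proof.
elim: s => [_ j|y s IH /= /andP[y0 s0] j].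
  by rewrite big_nil coef1; case: eqP.
rewrite big_cons mulrDl coefD coefXM coefCM addr_ge0//; last first.
  by rewrite mulr_ge0// IH.
by case: eqP => // _; exact: IH.
Qed.

Lemma horner_gt0 (p : {poly R}) z : p \is monic -> 0 < z ->
  (forall j, 0 <= p`_j) -> 0 < p.[z].
Proof.
move=> pm z0 p0; rewrite horner_coef.
have /monicP pl := pm; have sp : (0 < size p)%N.
  by rewrite lt0n size_poly_eq0 monic_neq0.
rewrite -(prednK sp) big_ord_recr/= ltr_wpDl//.
  by apply: sumr_ge0 => i _; rewrite mulr_ge0// exprn_ge0// ltW.
by rewrite -lead_coefE pl mul1r exprn_gt0.
Qed.

(** A test for the largest root in terms of coefficients, which depend measurably on a matrix. If no
    root exceeds [c], then [p(X + c)] is a product of factors [X + (c - y)] with [c - y >= 0];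
    conversely a monic polynomial with nonnegative coefficients has no root [a - c > 0]. *)
Lemma head_roots_le (a c : R) s : sorted (fun x y => y <= x) (a :: s) ->
  (a <= c) = all (fun j => 0 <= ((\prod_(y <- a :: s) ('X - y%:P)) \Po ('X + c%:P))`_j)
    (iota 0 (size s).+2).
Proof.
move=> srt; have E : (\prod_(y <- a :: s) ('X - y%:P)) \Po ('X + c%:P) =
    \prod_(y <- [seq c - y | y <- a :: s]) ('X + y%:P).
  rewrite big_map rmorph_prod.
  apply: eq_bigr => y _; rewrite -[LHS]/(('X - y%:P) \Po ('X + c%:P)).
  by rewrite comp_polyB comp_polyX comp_polyC polyCB addrA.
rewrite E; apply/idP/allP => [ac j _|H].
  apply: prod_XaddC_ge0; apply/allP => _ /mapP[y ys ->]; rewrite subr_ge0.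
  apply: le_trans ac; move: ys; rewrite inE => /predU1P[->//|ys].
  have := order_path_min _ srt => /(_ _)/allP; apply => //.
  by move=> x u v /= xu vx; exact: le_trans vx xu.
rewrite leNgt; apply/negP => ca.
have : 0 < (\prod_(y <- [seq c - y | y <- a :: s]) ('X + y%:P)).[a - c].
  apply: horner_gt0; last first.
  - move=> j; have [jn|jn] := ltnP j (size s).+2; first by apply: H; rewrite mem_iota.
    rewrite nth_default//; apply: leq_trans jn.
    have -> : \prod_(y <- [seq c - y | y <- a :: s]) ('X + y%:P) =
       \prod_(y <- [seq y - c | y <- a :: s]) ('X - y%:P).
      rewrite !big_map; apply: eq_bigr => y _; rewrite -polyCN opprB.
      by [].
    by rewrite size_prod_XsubC size_map.
  - by rewrite subr_gt0.
  - apply: monic_prod => y _; rewrite -[y]opprK polyCN; exact: monicXsubC.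
by rewrite /= big_cons hornerM hornerD hornerX hornerC addrA subrK subrr mul0r ltxx.
Qed.

(** The largest root is measurable by [head_roots_le]; the induction continues with the quotient by
    its linear factor. *)
Lemma measurable_sorted_roots d (T : measurableType d) n (s : T -> seq R) :
  (forall x, size (s x) = n) -> (forall x, sorted (fun y z => z <= y) (s x)) ->
  (forall j, measurable_fun setT (fun x => (\prod_(y <- s x) ('X - y%:P))`_j)) ->
  forall i, measurable_fun setT (fun x => (s x)`_i).
Proof.
elim: n s => [|n IH] s sn srt ms i.
  rewrite (_ : (fun x => _) = cst 0) ?measurable_cst//.
  by apply/funext => x; rewrite (size0nil (sn x)) nth_nil.
pose a x := (s x)`_0; pose t x := behead (s x).
have sE x : s x = a x :: t x by move: (sn x); rewrite /a /t; case: (s x).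
have tn x : size (t x) = n by rewrite size_behead sn.
pose chi x := \prod_(y <- s x) ('X - y%:P).
have schi x : size (chi x) = n.+2 by rewrite size_prod_XsubC sn.
have ma : measurable_fun setT a.
  apply: measurable_of_le => c.
  rewrite (_ : (fun x => _) = (fun x => all (fun j =>
     0 <= \sum_(i < n.+2) (chi x)`_i * (('X + c%:P) ^+ i)`_j) (iota 0 n.+2))); last first.
    apply/funext => x; rewrite (@head_roots_le _ _ (t x)); last by rewrite -sE.
    rewrite -sE tn; apply: eq_all => j; congr (0 <= _).
    rewrite -/(chi x) comp_polyE coef_sum schi.
    by apply: eq_bigr => k _; rewrite coefZ.
  apply: measurable_all => j _; apply: measurable_fun_ler; first exact: measurable_cst.
  by apply: measurable_sum => k; apply: measurable_funM; [exact: ms|exact: measurable_cst].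
pose Q x := \prod_(y <- t x) ('X - y%:P).
have chiE x : chi x = ('X - (a x)%:P) * Q x by rewrite /chi sE big_cons.
(* Coefficients of the quotient by [X - a], from the top degree downwards. *)
have mQ j : measurable_fun setT (fun x => (Q x)`_j).
  have [m] := ubnP (n.+1 - j)%N; elim: m j => // m IHm j jm.
  have [jn|jn] := ltnP n j.
    rewrite (_ : (fun x => _) = cst 0) ?measurable_cst//.
    by apply/funext => x; rewrite nth_default// size_prod_XsubC tn.
  rewrite (_ : (fun x => _) = (fun x => (chi x)`_j.+1 + a x * (Q x)`_j.+1)); last first.
    by apply/funext => x; rewrite chiE mulrBl coefB coefXM coefCM /= subrK.
  apply: measurable_funD; first exact: ms.
  by apply: measurable_funM => //; apply: IHm; lia.
case: i => [//|i].
rewrite (_ : (fun x => _) = (fun x => (t x)`_i)); last by apply/funext => x; rewrite sE.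
apply: IH => // x; have := srt x; rewrite sE /=; exact: path_sorted.
Qed.

End sorted_roots.

(** * Measurability of characteristic polynomials *)

Section complex_measurability.
Variable R : realType.
Context d (T : measurableType d).

Definition cmeas (f : T -> R[i]) :=
  measurable_fun setT (fun x => complex.Re (f x)) /\
  measurable_fun setT (fun x => complex.Im (f x)).

Lemma cmeas_cst c : cmeas (fun=> c).
Proof. by split; exact: measurable_cst. Qed.

Lemma cmeasD f g : cmeas f -> cmeas g -> cmeas (fun x => f x + g x).
Proof.
move=> [f1 f2] [g1 g2]; split.
  rewrite (_ : (fun x => _) = (fun x => complex.Re (f x) + complex.Re (g x))).
    exact: measurable_funD.
  by apply/funext => x; case: (f x) => ? ?; case: (g x).
rewrite (_ : (fun x => _) = (fun x => complex.Im (f x) + complex.Im (g x))).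
  exact: measurable_funD.
by apply/funext => x; case: (f x) => ? ?; case: (g x).
Qed.

Lemma cmeasM f g : cmeas f -> cmeas g -> cmeas (fun x => f x * g x).
Proof.
move=> [f1 f2] [g1 g2]; split.
  rewrite (_ : (fun x => _) = (fun x => complex.Re (f x) * complex.Re (g x) -
      complex.Im (f x) * complex.Im (g x))).
    by apply: measurable_funB; exact: measurable_funM.
  by apply/funext => x; case: (f x) => ? ?; case: (g x).
rewrite (_ : (fun x => _) = (fun x => complex.Re (f x) * complex.Im (g x) +
    complex.Im (f x) * complex.Re (g x))).
  by apply: measurable_funD; exact: measurable_funM.
by apply/funext => x; case: (f x) => ? ?; case: (g x).
Qed.

Lemma cmeas_sum (I : Type) (s : seq I) (f : I -> T -> R[i]) :
  (forall i, cmeas (f i)) -> cmeas (fun x => \sum_(i <- s) f i x).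
Proof.
move=> mf; elim: s => [|i s IH].
  rewrite (_ : (fun x => _) = fun=> 0); first exact: cmeas_cst.
  by apply/funext => x; rewrite big_nil.
rewrite (_ : (fun x => _) = fun x => f i x + \sum_(i <- s) f i x); first exact: cmeasD.
by apply/funext => x; rewrite big_cons.
Qed.

Definition pmeas (p : T -> {poly R[i]}) := forall j, cmeas (fun x => (p x)`_j).

Lemma pmeasM p q : pmeas p -> pmeas q -> pmeas (fun x => p x * q x).
Proof.
move=> mp mq j; rewrite (_ : (fun x => _) = (fun x => \sum_(i < j.+1) (p x)`_i * (q x)`_(j - i))).
  by apply: cmeas_sum => i; apply: cmeasM.
by apply/funext => x; rewrite coefM.
Qed.

Lemma pmeas_prod (I : Type) (s : seq I) (p : I -> T -> {poly R[i]}) :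
  (forall i, pmeas (p i)) -> pmeas (fun x => \prod_(i <- s) p i x).
Proof.
move=> mp; elim: s => [|i s IH].
  rewrite (_ : (fun x => _) = fun=> 1); first by move=> j; exact: cmeas_cst.
  by apply/funext => x; rewrite big_nil.
rewrite (_ : (fun x => _) = fun x => p i x * \prod_(i <- s) p i x); first exact: pmeasM.
by apply/funext => x; rewrite big_cons.
Qed.

Lemma pmeas_char_poly n (A : T -> 'M[R[i]]_n) :
  (forall i j, cmeas (fun x => A x i j)) -> pmeas (fun x => char_poly (A x)).
Proof.
move=> mA k; rewrite (_ : (fun x => _) = (fun x => \sum_(s : 'S_n)
   ((-1) ^+ s * \prod_i (char_poly_mx (A x)) i (s i))`_k)); last first.
  by apply/funext => x; rewrite /char_poly /determinant coef_sum.
apply: cmeas_sum => s.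
have H : pmeas (fun x => (-1) ^+ s * \prod_i (char_poly_mx (A x)) i (s i)).
  apply: pmeasM; first by move=> j; exact: cmeas_cst.
  apply: pmeas_prod => i j.
  rewrite (_ : (fun x => _) = (fun x => ('X *+ (i == s i))`_j + (- (j == 0)%N%:R) * A x i (s i))).
    apply: cmeasD; first exact: cmeas_cst.
    by apply: cmeasM; [exact: cmeas_cst|exact: mA].
  apply/funext => x; rewrite !mxE coefB coefC.
  by case: (j == 0)%N; rewrite /= ?mulr1n ?mulr0n ?mulN1r ?oppr0 ?mul0r ?subr0 ?addr0.
exact: H.
Qed.

End complex_measurability.

(** * Ordered spectra and Schur complements *)

Section spectrum.
Variable R : realType.
Local Notation C := R[i].

Lemma conjC_conjc (x : C) : x^* = Num.conj x.
Proof. by []. Qed.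

Lemma hermsymmxP n (M : 'M[C]_n) :
  reflect (forall i j, M i j = (M j i)^*) (M \is hermsymmx).
Proof.
apply: (iffP (is_hermitianmxP _ _ _)) => [H i j|H].
  by rewrite {1}H expr0 scale1r !mxE conjC_conjc.
by apply/matrixP => i j; rewrite expr0 scale1r !mxE H conjC_conjc.
Qed.

Lemma spec_sorted n (M : 'M[C]_n) : sorted (fun x y => y <= x) (spec M).
Proof. by apply: sort_sorted => x y; exact: le_total. Qed.

(** The spectral theorem lists the eigenvalues in no particular order; permuting the rows of the
    unitary matrix sorts them. *)
Lemma spec_diagonalize n (M : 'M[C]_n) : M \is hermsymmx ->
  exists2 U : 'M[C]_n, U \is unitarymx & M = U^t* *m spec_diag_mx M *m U.
Proof.
move=> Mh; set P := spectralmx M; set D := spectral_diag M.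
have PU : P \is unitarymx := spectral_unitarymx M.
have ME : M = P^t* *m diag_mx D *m P.
  by rewrite -invmx_unitary//; apply/orthomx_spectralP; exact: hermitian_normalmx.
have Dreal i : D 0 i = (complex.Re (D 0 i))%:C.
  have /mxOverP/(_ 0 i) := hermitian_spectral_diag_real Mh.
  by move=> /RRe_real.
have : perm_eq (spec M) [tuple complex.Re (D 0 i) | i < n].
  by rewrite /spec /= perm_sort.
move=> /tuple_permP[p pE].
have specE i : tnth (spec M) i = complex.Re (D 0 (p i)).
  rewrite (tnth_nth 0) pE /= (nth_map i) ?size_enum_ord//.
  by rewrite nth_ord_enum tnth_mktuple.
exists (row_perm p P).
  apply/unitarymxP/matrixP => i j; rewrite !mxE.
  have /unitarymxP/matrixP/(_ (p i) (p j)) := PU; rewrite !mxE (inj_eq perm_inj) => <-.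
  by apply: eq_bigr => k _; rewrite !mxE.
rewrite {1}ME; apply/matrixP => i j; rewrite !mxE (reindex_inj (@perm_inj _ p))/=.
apply: eq_bigr => k _; rewrite !mxE; congr (_ * _).
rewrite (bigD1 (p k))//= [in RHS](bigD1 k)//= !mxE !eqxx !mulr1n specE -Dreal.
congr (_ + _); rewrite !big1// => l lk; rewrite !mxE (negbTE lk) ?mulr0//.
Qed.

Lemma char_poly_similar n (U D : 'M[C]_n) : U \is unitarymx ->
  char_poly (U^t* *m D *m U) = char_poly D.
Proof.
move=> UU; have UV : U^t* *m U = 1%:M.
  by apply: mulmx1C; apply/unitarymxP.
rewrite /char_poly.
have -> : char_poly_mx (U^t* *m D *m U) =
    map_mx polyC (U^t*) *m char_poly_mx D *m map_mx polyC U.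
  rewrite /char_poly_mx mulmxBr mulmxBl -!map_mxM; congr (_ - _).
  by rewrite mul_mx_scalar -scalemxAl -map_mxM UV map_mx1 scalemx1.
rewrite !det_mulmx mulrC mulrA -det_mulmx -map_mxM.
by have /unitarymxP-> := UU; rewrite map_mx1 det1 mul1r.
Qed.

Lemma char_poly_diag n (D : 'rV[C]_n) :
  char_poly (diag_mx D) = \prod_i ('X - (D 0 i)%:P).
Proof.
rewrite char_poly_trig ?diag_mx_is_trig//.
by apply: eq_bigr => i _; rewrite mxE eqxx mulr1n.
Qed.

Lemma char_poly_spec n (M : 'M[C]_n) : M \is hermsymmx ->
  char_poly M = \prod_(x <- spec M) ('X - (x%:C)%:P).
Proof.
move=> Mh; have [U UU {1}->] := spec_diagonalize Mh.
rewrite char_poly_similar// char_poly_diag big_tuple.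
by apply: eq_bigr => i _; rewrite mxE.
Qed.

Lemma spec_unique n (M : 'M[C]_n) (s : seq R) : M \is hermsymmx ->
  sorted (fun x y => y <= x) s ->
  char_poly M = \prod_(x <- s) ('X - (x%:C)%:P) -> spec M = s :> seq R.
Proof.
move=> Mh ss; rewrite char_poly_spec// => E.
apply: (sorted_eq (leT := fun x y => y <= x)) => //.
- by move=> x y z /= xy zx; exact: le_trans zx xy.
- by move=> x y; rewrite andbC => /le_anti.
- exact: spec_sorted.
- have H : perm_eq [seq x%:C | x <- spec M] [seq x%:C | x <- s].
    by apply: prod_XsubC_eq; rewrite !big_map.
  have := perm_map (@complex.Re R) H; rewrite -!map_comp.
  by rewrite !(eq_map (g := id)) ?map_id.
Qed.

Lemma spec_char_poly n (M N : 'M[C]_n) : M \is hermsymmx -> N \is hermsymmx ->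
  char_poly M = char_poly N -> spec M = spec N.
Proof.
move=> Mh Nh E; apply/val_inj/spec_unique => //; first exact: spec_sorted.
by rewrite E char_poly_spec.
Qed.

Lemma map_poly_prod_real (s : seq R) :
  map_poly (real_complex R) (\prod_(x <- s) ('X - x%:P)) =
  \prod_(x <- s) ('X - (x%:C)%:P).
Proof.
rewrite rmorph_prod; apply: eq_bigr => x _.
by rewrite rmorphB /= map_polyX map_polyC.
Qed.

Lemma measurable_spec d (T : measurableType d) n (M : T -> 'M[C]_n) :
  (forall x, M x \is hermsymmx) -> (forall i j, cmeas (fun x => M x i j)) ->
  forall i, measurable_fun setT (fun x => (spec (M x))`_i).
Proof.
move=> Mh mM; apply: (@measurable_sorted_roots _ _ _ n) => [x|x|j].
- by rewrite size_tuple.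
- exact: spec_sorted.
have [H _] := pmeas_char_poly mM j.
apply: (eq_measurable_fun _ _ H) => x _.
by rewrite char_poly_spec// -map_poly_prod_real coef_map.
Qed.

Lemma horner_char_poly n (A : 'M[C]_n) z : (char_poly A).[z] = \det (z%:M - A).
Proof.
rewrite /char_poly -[LHS]/(horner_eval z _) -det_map_mx; congr (\det _).
apply/matrixP => i j; rewrite !mxE -[LHS]/(('X *+ (i == j) - (A i j)%:P).[z]).
by rewrite hornerD hornerN hornerC hornerMn hornerX.
Qed.

Lemma det_schur n (A : 'M[C]_n) (b : 'cV[C]_n) (c : 'rV[C]_n) (d : 'M[C]_1) :
  A \in unitmx ->
  \det (block_mx A b c d) = \det A * (d - c *m invmx A *m b) 0 0.
Proof.
move=> Au; have -> : block_mx A b c d =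
    block_mx A 0 c (d - c *m invmx A *m b) *m block_mx 1%:M (invmx A *m b) 0 1%:M.
  rewrite mulmx_block !mulmx1 !mulmx0 ?mul0mx !addr0 mulmxA mulmxV// mul1mx.
  by rewrite ?mulmxA addrC subrK.
by rewrite det_mulmx det_lblock det_ublock !det1 !mulr1 det_mx11.
Qed.

Lemma poly_eq_large (p q : {poly C}) (B : R) :
  (forall z : R, B < z -> p.[z%:C] = q.[z%:C]) -> p = q.
Proof.
move=> H; apply/eqP; rewrite -subr_eq0; apply/negPn/negP => r0.
pose s := [seq (B + k.+1%:R)%:C | k <- iota 0 (size (p - q)%R)].
have : (size s < size (p - q)%R)%N.
  apply: max_poly_roots => //.
    apply/allP => _ /mapP[k _ ->]; rewrite rootE hornerD hornerN H ?subrr//.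
    by rewrite ltrDl.
  rewrite map_inj_uniq ?iota_uniq// => i j /complexI/addrI/eqP.
  by rewrite eqr_nat => /eqP[].
by rewrite size_map size_iota ltnn.
Qed.

End spectrum.

(** * Gaussian integrals and polar coordinates in the plane *)

Section gaussian_integrals.
Local Open Scope ereal_scope.
Variable R : realType.
Local Notation mu := (@lebesgue_measure R).
Local Notation MR := (measurableTypeR R).

(** The integral of [exp (- t^2 / (2 v))], that is, the square root of [2 pi v]. *)
Definition gauss_const (v : R) : R := (normal_peak (Num.sqrt v))^-1%R.

Lemma gauss_const_gt0 v : (0 < v)%R -> (0 < gauss_const v)%R.
Proof. by move=> v0; rewrite invr_gt0 normal_peak_gt0// gt_eqF// sqrtr_gt0. Qed.

Lemma gauss_mgf (v c : R) : (0 < v)%R ->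
  \int[mu]_t (expR (- (t ^+ 2 / (2 * v)) + c * t))%:E =
  (gauss_const v * expR (c ^+ 2 * v / 2))%:E.
Proof.
move=> v0; have s0 : Num.sqrt v != 0%R by rewrite gt_eqF// sqrtr_gt0.
pose K : R := (gauss_const v * expR (c ^+ 2 * v / 2))%R.
have K0 : (0 <= K)%R by rewrite mulr_ge0 ?expR_ge0// ltW// gauss_const_gt0.
rewrite -[RHS]mule1 -(integral_normal_pdf (c * v) (Num.sqrt v)) -ge0_integralZl//.
- apply: eq_integral => t _; rewrite -EFinM normal_pdfE//; congr (_%:E).
  rewrite /K /gauss_const mulrACA mulVf ?gt_eqF ?normal_peak_gt0// mul1r.
  rewrite /normal_fun -expRD sqr_sqrtr ?ltW//; congr expR.
  by field; rewrite gt_eqF.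
- by apply/measurable_EFinP; exact: measurable_normal_pdf.
- by move=> t _; rewrite lee_fin normal_pdf_ge0.
Qed.

Lemma polar_scaling (g : MR -> \bar R) (b : R) : (0 < b)%R ->
  measurable_fun setT g -> (forall x, 0 <= g x) ->
  \int[mu]_x \int[mu]_y g (x ^+ 2 + y ^+ 2)%R =
  b%:E * \int[mu]_x \int[mu]_y g (b * (x ^+ 2 + y ^+ 2))%R.
Proof.
move=> b0 mg g0; pose r := Num.sqrt b; have r0 : (0 < r)%R by rewrite sqrtr_gt0.
have rr : (r * r)%R = b by rewrite -expr2 sqr_sqrtr// ltW.
have mg2 : measurable_fun [set: MR * MR] (fun p : MR * MR => g (p.1 ^+ 2 + p.2 ^+ 2)%R).
  by apply: (measurable_comp_fun mg); mR.
have mI : measurable_fun [set: MR] (fun x : MR => \int[mu]_y g (x ^+ 2 + y ^+ 2)%R).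
  exact: (measurable_fun_fubini_tonelli_F (m2 := mu) _ mg2).
have E x : \int[mu]_y g (b * (x ^+ 2 + y ^+ 2))%R =
    r^-1%:E * \int[mu]_y g ((r * x) ^+ 2 + y ^+ 2)%R.
  rewrite -(@integral_scale _ (fun y => g ((r * x) ^+ 2 + y ^+ 2)%R) r)//.
    by apply: eq_integral => y _; rewrite -rr; congr g; ring.
  by apply: (measurable_comp_fun mg); mR.
under [in RHS]eq_integral do rewrite E.
rewrite ge0_integralZl//; last 3 first.
- apply: (measurable_comp_fun mI) => //; mR.
- by move=> x _; exact: integral_ge0.
- by rewrite lee_fin invr_ge0 ltW.
rewrite (integral_scale (f := fun x => \int[mu]_y g (x ^+ 2 + y ^+ 2)%R) r0)//; last first.
  by move=> x; exact: integral_ge0.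
rewrite !muleA -!EFinM -rr.
by rewrite mulfK ?gt_eqF// divff ?gt_eqF// mul1e.
Qed.

Lemma le_integral2 (g h : MR * MR -> \bar R) :
  measurable_fun setT g -> measurable_fun setT h ->
  (forall p, 0 <= g p) -> (forall p, g p <= h p) ->
  \int[mu]_x \int[mu]_y g (x, y) <= \int[mu]_x \int[mu]_y h (x, y).
Proof.
move=> mg mh g0 gh; have h0 p : 0 <= h p by exact: le_trans (gh p).
have := @fubini_tonelli1 _ _ _ _ R mu mu g mg g0; rewrite /fubini_F => <-.
have := @fubini_tonelli1 _ _ _ _ R mu mu h mh h0; rewrite /fubini_F => <-.
by apply: ge0_le_integral.
Qed.

Lemma integral2_prod (u v : MR -> R) :
  measurable_fun [set: MR] (u : _ -> R) -> measurable_fun [set: MR] (v : _ -> R) ->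
  (forall x, 0 <= u x)%R -> (forall x, 0 <= v x)%R ->
  \int[mu]_x \int[mu]_y (u x * v y)%:E =
  \int[mu]_x (u x)%:E * \int[mu]_x (v x)%:E.
Proof.
move=> mu' mv u0 v0.
under eq_integral => x _.
  under eq_integral do rewrite EFinM.
  rewrite ge0_integralZl//; first over.
  - by apply/measurable_EFinP.
  - by move=> y _; rewrite lee_fin.
  - by rewrite lee_fin.
rewrite /= ge0_integralZr//.
- by apply/measurable_EFinP.
- by move=> x _; rewrite lee_fin.
- by apply: integral_ge0 => x _; rewrite lee_fin.
Qed.

(** The image of Lebesgue measure under [x^2 + y^2] gives []0, b]] a mass proportional to [b], so it
    is a multiple of Lebesgue measure on the half-line as soon as the unit disc has finite positive
    mass. *)
Lemma polar_integral : exists2 c : R, (0 < c)%R & forall g : MR -> \bar R,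
  measurable_fun setT g -> (forall x, 0 <= g x) ->
  \int[mu]_x \int[mu]_y g (x ^+ 2 + y ^+ 2)%R =
  c%:E * \int[mu]_(r in `]0%R, +oo[) g r.
Proof.
pose phi (p : MR * MR) : MR := (p.1 ^+ 2 + p.2 ^+ 2)%R.
have mphi : measurable_fun setT phi by rewrite /phi; mR.
have mw : measurable_fun setT (EFin \o (fun _ : MR * MR => 1%R : R)).
  exact: measurable_cst.
pose m : {measure set MR -> \bar R} :=
  image_density (mu \x mu)%E mw (fun=> ler01) mphi.
have mE (g : MR -> \bar R) : measurable_fun setT g -> (forall x, 0 <= g x) ->
    \int[m]_r g r = \int[mu]_x \int[mu]_y g (x ^+ 2 + y ^+ 2)%R.
  move=> mg g0; rewrite (integral_image_density _ mw (fun=> ler01) mphi)//.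
  under eq_integral do rewrite mul1e.
  by rewrite fubini_tonelli1//; exact: (measurable_comp_fun mg mphi).
have mA (A : set MR) : measurable A ->
    m A = \int[mu]_x \int[mu]_y (\1_A (x ^+ 2 + y ^+ 2)%R)%:E.
  move=> Am; rewrite -(mE (EFin \o \1_A)).
  - by rewrite integral_indic// setIT.
  - by apply/measurable_EFinP; exact: measurable_indic.
  - by move=> x; rewrite lee_fin.
have mscale (b : R) : (0 < b)%R -> m `]0%R, b]%classic = b%:E * m `]0%R, 1%R]%classic.
  move=> b0; rewrite !mA//.
  rewrite (polar_scaling (g := fun r => (\1_`]0%R, b]%classic r)%:E) b0); last 2 first.
  - by apply/measurable_EFinP; exact: measurable_indic.
  - by move=> x; rewrite lee_fin.
  apply: (congr1 (fun z => b%:E * z)).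
  apply: eq_integral => x _; apply: eq_integral => y _.
  congr (_%:E); rewrite !indicE; congr ((_ : bool)%:R).
  by rewrite !mem_setE !in_itv/= pmulr_rgt0// ger_pMr.
have mind A : measurable A -> measurable_fun [set: MR] (\1_A : MR -> R).
  by move=> Am; exact: measurable_indic.
have m1 A : measurable A ->
    measurable_fun setT (fun p : MR * MR => (\1_A (p.1 ^+ 2 + p.2 ^+ 2)%R : R)%:E).
  move=> Am; apply/measurable_EFinP.
  by apply: (measurable_comp_fun (mind _ Am)); mR.
have finm : m `]0%R, 1%R]%classic \is a fin_num.
  rewrite ge0_fin_numE// mA//.
  (* On the unit disc the indicator is at most [exp (1 - x^2 - y^2)], whose integral is a product of
     Gaussian ones. *)
  apply: (@le_lt_trans _ _ (\int[mu]_x \int[mu]_y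
    (expR (1 - x ^+ 2) * expR (- y ^+ 2))%:E)).
    apply: (@le_integral2 (fun p => (\1_`]0%R, 1%R]%classic (p.1 ^+ 2 + p.2 ^+ 2)%R)%:E)
      (fun p => (expR (1 - p.1 ^+ 2) * expR (- p.2 ^+ 2))%:E)).
    - exact: m1.
    - by mR.
    - by move=> p; rewrite lee_fin.
    - move=> p; rewrite lee_fin -expRD indicE mem_setE in_itv/=.
      case: (ltP 0%R (p.1 ^+ 2 + p.2 ^+ 2)%R) => [_|_] /=; last exact: expR_ge0.
      case: (boolP (p.1 ^+ 2 + p.2 ^+ 2 <= 1)%R) => p1 /=; last exact: expR_ge0.
      by rewrite -[leLHS]expR0 ler_expR; lra.
  rewrite (integral2_prod (u := fun x => expR (1 - x ^+ 2)%R)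
      (v := fun y => expR (- y ^+ 2)%R)); try by [move=> x; exact: expR_ge0 | mR].
  have E c0 : \int[mu]_x (expR (c0 - x ^+ 2))%:E =
      (expR c0)%:E * (gauss_const (1 / 2))%:E.
    rewrite -[X in _ * X%:E]mulr1 -[X in (_ * X)%R]expR0.
    have -> : (0 = 0 ^+ 2 * (1 / 2) / 2 :> R)%R by rewrite expr0n /= !mul0r.
    rewrite -gauss_mgf; last by lra.
    rewrite -ge0_integralZl//; last by mR.
    apply: eq_integral => x _; rewrite -EFinM -expRD; congr ((expR _)%:E).
    by field.
  under [X in _ * X]eq_integral do rewrite -sub0r.
  by rewrite !E -!EFinM ltry.
have posm : 0 < m `]0%R, 1%R]%classic.
  (* The square with both sides []0, 1/2]] lies in the unit disc. *)
  pose B : set R := `]0%R, (1 / 2)%R]%classic.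
  have mB : measurable B by exact: measurable_itv.
  rewrite mA//.
  apply: (@lt_le_trans _ _ (\int[mu]_x \int[mu]_y
    (\1_B x * \1_B y)%:E)).
    rewrite (integral2_prod (mind _ mB) (mind _ mB))//.
    have -> : \int[mu]_x (\1_B x)%:E = (1 / 2)%:E.
      rewrite integral_indic// setIT.
      rewrite -[LHS]/(mu `]0%R, (1 / 2)%R]%classic).
      by rewrite lebesgue_measure_itv/= lte_fin ifT ?oppr0 ?adde0//; lra.
    by rewrite -EFinM lte_fin; lra.
  apply: (@le_integral2
    (fun p => (\1_B p.1 * \1_B p.2)%:E)
    (fun p => (\1_`]0%R, 1%R]%classic (p.1 ^+ 2 + p.2 ^+ 2)%R)%:E)).
  - apply/measurable_EFinP; apply: measurable_funM.
      by apply: (measurable_comp_fun (mind _ _)) => //; mR.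
    by apply: (measurable_comp_fun (mind _ _)) => //; mR.
  - exact: m1.
  - by move=> p; rewrite lee_fin mulr_ge0.
  - move=> [x y]; rewrite lee_fin !indicE /B !mem_setE !in_itv/=.
    case: (boolP (0 < x <= 1 / 2)%R) => [/andP[x0 x1]|_]; last by rewrite mul0r.
    case: (boolP (0 < y <= 1 / 2)%R) => [/andP[y0 y1]|_]; last by rewrite mulr0.
    by rewrite (_ : (_ && _) = true) ?mulr1//; apply/andP; split; nra.
have m0 : m `]-oo, 0%R]%classic = 0.
  rewrite mA//; apply: integral0_eq => x _.
  apply/eqP; rewrite eq_le integral_ge0 ?andbT; last by move=> y _; rewrite lee_fin.
  apply: (@le_trans _ _ (\int[mu]_y (\1_[set 0%R] y)%:E)).
    apply: ge0_le_integral => //.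
    - apply/measurable_EFinP; apply: (measurable_comp_fun (mind _ _)) => //; mR.
    - by apply/measurable_EFinP; exact: mind.
    - move=> y _; rewrite lee_fin !indicE !mem_setE in_itv/=.
      case: (boolP (x ^+ 2 + y ^+ 2 <= 0)%R) => // xy; rewrite mem_set//=.
      by apply/eqP; rewrite -sqrf_eq0 eq_le sqr_ge0 andbT; have := sqr_ge0 (x : R); lra.
  rewrite integral_indic// setIT -[leLHS]/(mu [set 0%R]).
  by rewrite lebesgue_measure_set1.
have mE1 t : (0 < t)%R -> m `]0%R, t]%classic = (fine (m `]0%R, 1%R]%classic) * t)%:E.
  by move=> t0; rewrite mscale// mulrC EFinM fineK.
exists (fine (m `]0%R, 1%R]%classic)); first by rewrite -lte_fin fineK.
move=> g mg g0; rewrite -mE// -(@halfline_unique _ m)//.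
- rewrite -(setUv `]0%R, +oo[%classic) ge0_integral_setU//=; last 3 first.
  + exact: measurableC.
  + by rewrite setUv.
  + by apply/disj_set2P; rewrite setICr.
  rewrite setCitvr (_ : \int[m]_(x in `]-oo, 0%R]) g x = 0) ?adde0//.
  by apply: null_set_integral => //; exact: measurable_funTS.
- by rewrite -lte_fin fineK.
- move=> a b; rewrite le_eqVlt => /predU1P[<-|a0] ab.
    by rewrite subr0 mE1.
  have -> : `]a, b]%classic = `]0%R, b]%classic `\` `]0%R, a]%classic :> set R.
    apply/seteqP; split => x /=; rewrite !in_itv/=.
      move=> /andP[ax xb]; split; first by rewrite (lt_trans a0 ax).
      by apply/negP; rewrite negb_and -ltNge ax orbT.
    by move=> [/andP[x0 ->] /negP]; rewrite x0 /= -ltNge andbT.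
  rewrite measureD//; last first.
    by have H := mE1 b (lt_trans a0 ab); rewrite [X in X < _]H ltry.
  rewrite setIidr; last first.
    by move=> x /=; rewrite !in_itv/= => /andP[-> xa]; rewrite (le_trans xa)// ltW.
  have Hb := mE1 b (lt_trans a0 ab); have Ha := mE1 a a0.
  by rewrite [X in X - _]Hb [X in _ - X]Ha -EFinB mulrBr.
Qed.
End gaussian_integrals.

(** * Linear isometries preserve Lebesgue measure *)

Section isometries.
Local Open Scope ereal_scope.
Variables (R : realType) (K : countType).
Local Notation MR := (measurableTypeR R).
Local Notation env := (family R K).
Variable s : seq K.
Hypothesis us : uniq s.

(** Translation, and below it reflection, in the keys of [s]; elsewhere the value comes from the
    argument over which [II_addenv] and [II_revenv] integrate. *)
Definition addenv (x y : env) : env := fun k => if k \in s then (x k + y k)%R else x k.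
Definition revenv (x y : env) : env := fun k => if k \in s then (x k - y k)%R else y k.

Lemma measurable_addenv d (T : measurableType d) (f g : T -> env) :
  measurable_fun setT f -> measurable_fun setT g ->
  measurable_fun setT (fun x => addenv (f x) (g x)).
Proof.
move=> mf mg; apply: measurable_envP => k; rewrite /addenv; case: (k \in s).
  by apply: measurable_funD; exact: measurable_app.
exact: measurable_app.
Qed.

Lemma measurable_revenv d (T : measurableType d) (f g : T -> env) :
  measurable_fun setT f -> measurable_fun setT g ->
  measurable_fun setT (fun x => revenv (f x) (g x)).
Proof.
move=> mf mg; apply: measurable_envP => k; rewrite /revenv; case: (k \in s).
  by apply: measurable_funB; exact: measurable_app.
exact: measurable_app.
Qed.

Lemma II_addenv (v : env) f b : measurable_fun setT f -> (forall e, 0 <= f e) ->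
  II s (fun e => f (addenv e v)) b = II s f b.
Proof.
move=> mf f0; apply: (II_unipotent (Phi := fun e => addenv e v)) => //.
- by apply: measurable_addenv; [exact: measurable_id|exact: measurable_cst].
- by move=> k e ks; rewrite /addenv (negbTE ks).
- by move=> s1 k s2 e e' sE _; rewrite /addenv; case: ifP => _; ring.
Qed.

Lemma II_revenv (v : env) f b : measurable_fun setT f -> (forall e, 0 <= f e) ->
  II s (fun e => f (revenv v e)) b = II s f b.
Proof.
move=> mf f0; rewrite (II_triangular (c := fun=> (-1)%R) (Phi := revenv v))//.
- by rewrite big1 ?mul1e// => k _; rewrite normrN normr1 invr1.
- by apply: measurable_revenv; [exact: measurable_cst|exact: measurable_id].
- by move=> k e ks; rewrite /revenv (negbTE ks).
- move=> s1 k s2 e e' sE _; rewrite /revenv sE mem_cat inE eqxx orbT /=; ring.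
Qed.

Variable wt : K -> R.
Hypothesis wt_gt0 : forall k, (0 < wt k)%R.

Lemma II_gaussian (c : K -> R) b :
  II s (fun e => (expR (\sum_(k <- s) (- (wt k * e k ^+ 2 / 2) + c k * e k)))%:E) b =
  ((\prod_(k <- s) gauss_const (wt k)^-1) *
   expR (\sum_(k <- s) c k ^+ 2 / (2 * wt k)))%:E.
Proof.
elim: s us b => [|k s' IH] /= => [_ b|/andP[ks us'] b].
  by rewrite !big_nil expR0 mulr1.
have E t : II s' (fun e => (expR (\sum_(k <- k :: s')
      (- (wt k * e k ^+ 2 / 2) + c k * e k)))%:E) (upd b k t) =
   ((\prod_(k <- s') gauss_const (wt k)^-1) *
     expR (\sum_(k <- s') c k ^+ 2 / (2 * wt k)))%:E *
   (expR (- (t ^+ 2 / (2 * (wt k)^-1)) + c k * t))%:E.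
  rewrite -(@II_upd_out _ _ s' k t)// muleC -(IH us' b) -IIZl//; last first.
    by mR.
  apply: eq_II => e; rewrite big_cons updE -EFinM -expRD; congr (_%:E); congr expR; congr (_ + _)%R.
    by have := wt_gt0 k; move: (wt k) => x x0; field; rewrite gt_eqF.
  by apply: eq_big_seq => j js; rewrite updNE//; apply: contraNneq ks => <-.
under eq_integral do rewrite E.
rewrite ge0_integralZl//; last 2 first.
- by mR.
- rewrite lee_fin mulr_ge0 ?expR_ge0// prodr_ge0// => j _.
  by rewrite ltW// gauss_const_gt0// invr_gt0.
rewrite gauss_mgf ?invr_gt0// -EFinM !big_cons expRD; congr (_%:E).
have -> : (c k ^+ 2 * (wt k)^-1 / 2 = c k ^+ 2 / (2 * wt k))%R.
  by have := wt_gt0 k; move: (wt k) => x x0; field; rewrite gt_eqF.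
ring.
Qed.

Lemma II_gauss_fin : exists2 c : R, (0 < c)%R & forall b,
  II s (fun e => (expR (- \sum_(k <- s) wt k * e k ^+ 2))%:E) b = c%:E.
Proof.
elim: s us => [|k s' IH] /= => [_|/andP[ks us']].
  by exists 1%R => // b; rewrite big_nil oppr0 expR0.
have [c c0 H] := IH us'.
have g0 : (0 < gauss_const (2 * wt k)^-1)%R by rewrite gauss_const_gt0// invr_gt0 mulr_gt0.
exists (gauss_const (2 * wt k)^-1 * c)%R => [|b']; first by rewrite mulr_gt0.
have E t : II s' (fun e => (expR (- \sum_(k <- k :: s') wt k * e k ^+ 2))%:E) (upd b' k t) =
   c%:E * (expR (- (t ^+ 2 / (2 * (2 * wt k)^-1)) + 0 * t))%:E.
  rewrite -(@II_upd_out _ _ s' k t)// muleC -(H b') -IIZl//; last first.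
    by mR.
  apply: eq_II => e; rewrite big_cons updE -EFinM -expRD; congr ((expR _)%:E).
  rewrite opprD mul0r addr0; congr (_ + _)%R.
    by have := wt_gt0 k; move: (wt k) => x x0; field; rewrite gt_eqF.
  by congr (- _)%R; apply: eq_big_seq => j js; rewrite updNE//; apply: contraNneq ks => <-.
under eq_integral do rewrite E.
rewrite ge0_integralZl//; last 2 first.
- by mR.
- by rewrite lee_fin ltW.
by rewrite gauss_mgf ?invr_gt0 ?mulr_gt0// expr0n mul0r mul0r expR0 mulr1 -EFinM mulrC.
Qed.

(** A proof without determinants. The double integral of [f (L x) * g y], with [g] the Gaussian of
    the preserved form, becomes that of [f y * g x] in three moves: translate [x] by a preimage of
    [y], translate [y] by [- L x], and replace [x] by [v - x] with [v] a preimage of [y]. The mass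
    of [g] is then divided out. *)
Lemma II_isometry (L : env -> env) f b :
  measurable_fun setT L ->
  (forall e k, k \notin s -> L e k = e k) ->
  (forall e e', {in s, e =1 e'} -> {in s, L e =1 L e'}) ->
  (forall e v k, k \in s -> L (addenv e v) k = (L e k + L v k)%R) ->
  (forall y, exists x, {in s, L x =1 y}) ->
  (forall e, \sum_(k <- s) wt k * L e k ^+ 2 = \sum_(k <- s) wt k * e k ^+ 2)%R ->
  measurable_fun setT f -> (forall e, 0 <= f e) ->
  II s (fun e => f (L e)) b = II s f b.
Proof.
move=> mL Lout Lloc Ladd Lsurj Liso mf f0.
pose q (e : env) := (\sum_(k <- s) wt k * e k ^+ 2)%R.
pose g (e : env) : \bar R := (expR (- q e))%:E.
have mg : measurable_fun setT g by rewrite /g /q; mR.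
have g0 e : 0 <= g e by rewrite lee_fin expR_ge0.
have [c c0 gE] := II_gauss_fin.
have mfL : measurable_fun setT (fun e => f (L e)) by exact: measurable_comp_fun mf mL.
suff H : c%:E * II s (fun e => f (L e)) b = c%:E * II s f b.
  have : c^-1%:E * (c%:E * II s (fun e => f (L e)) b) = c^-1%:E * (c%:E * II s f b) by rewrite H.
  by rewrite !muleA -EFinM mulVf ?gt_eqF// !mul1e.
pose D : env -> env -> \bar R := fun x y => f (L x) * g y.
have mD : measurable_fun setT (fun p : env * env => D p.1 p.2).
  apply: emeasurable_funM; first exact: measurable_comp_fun mfL measurable_fst.
  exact: measurable_comp_fun mg measurable_snd.
pose D' : env -> env -> \bar R := fun x y => f (addenv (L x) y) * g y.
have mD' : measurable_fun setT (fun p : env * env => D' p.1 p.2).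
  apply: emeasurable_funM; last exact: measurable_comp_fun mg measurable_snd.
  apply: (measurable_comp_fun mf); apply: measurable_addenv; last exact: measurable_snd.
  exact: measurable_comp_fun mL measurable_fst.
transitivity (II s (fun x => II s (D x) b) b).
  rewrite -IIZl//; last by rewrite lee_fin ltW.
  apply: eq_II => x; rewrite /D IIZl// muleC; congr (_ * _).
  by rewrite -(gE b).
rewrite II_II_swap//; last by move=> x y; rewrite mule_ge0.
transitivity (II s (fun y => II s (fun x => D' x y) b) b).
  apply: eq_II => y; have [v vy] := Lsurj y.
  rewrite -(II_addenv v)//; last 2 first.
  - exact: (measurable_comp_fun mD (measurable_fun_pair (@measurable_id _ _ _) (@measurable_cst _ _ _ _ _ _))).
  - by move=> x; rewrite mule_ge0.
  apply: eq_II => x; congr (f _ * _); apply/funext => k; rewrite /addenv.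
  case: ifPn => [ks|ks]; last by rewrite !Lout// /addenv (negbTE ks).
  by have := Ladd x v k ks; rewrite /addenv => ->; rewrite vy.
rewrite -II_II_swap//; last by move=> x y; rewrite mule_ge0.
pose E : env -> env -> \bar R := fun x y => f y * g (revenv y (L x)).
have mE : measurable_fun setT (fun p : env * env => E p.1 p.2).
  apply: emeasurable_funM; first exact: measurable_comp_fun mf measurable_snd.
  apply: (measurable_comp_fun mg); apply: measurable_revenv; first exact: measurable_snd.
  exact: measurable_comp_fun mL measurable_fst.
transitivity (II s (fun x => II s (E x) b) b).
  apply: eq_II_in => x xb.
  pose v : env := fun k => (- L x k)%R.
  rewrite -(II_addenv v (f := D' x)); last 2 first.
  - exact: (measurable_comp_fun mD' (measurable_fun_pair (@measurable_cst _ _ _ _ _ _) (@measurable_id _ _ _))).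
  - by move=> y; rewrite mule_ge0.
  apply: eq_II_in => y yb; congr (f _ * g _).
    apply/funext => k; rewrite /addenv /v; case: (boolP (k \in s)) => ks; first by lra.
    by rewrite Lout// xb// yb.
  apply/funext => k; rewrite /addenv /revenv /v; case: ifPn => ks//.
  by rewrite Lout// xb// yb.
rewrite II_II_swap//; last by move=> x y; rewrite mule_ge0.
rewrite -IIZl//; last by rewrite lee_fin ltW.
apply: eq_II_in => y yb; have [v vy] := Lsurj y.
rewrite -(II_revenv v (f := E ^~ y)); last 2 first.
- exact: (measurable_comp_fun mE (measurable_fun_pair (@measurable_id _ _ _) (@measurable_cst _ _ _ _ _ _))).
- by move=> x; rewrite mule_ge0.
rewrite muleC -(gE b) -IIZl//.
apply: eq_II => x; congr (_ * (expR (- _))%:E).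
rewrite -[RHS]Liso; apply: eq_big_seq => k ks; congr (_ * _ ^+ 2)%R.
have := Ladd (revenv v x) x k ks.
rewrite (Lloc (addenv (revenv v x) x) v)//; last first.
  by move=> j js; rewrite /addenv /revenv js; ring.
by rewrite vy// => ky; rewrite /revenv ks ky; ring.
Qed.
End isometries.

(** * Bordering a Hermitian matrix *)

Section bordered_matrices.
Variable R : realType.
Local Notation C := R[i].
Local Notation env := (family R (nat * nat)).
Local Notation renv := (family R nat).

Definition normsq (z : C) : R := complex.Re z ^+ 2 + complex.Im z ^+ 2.

Lemma normsqE z : (normsq z)%:C = z^* * z.
Proof. by case: z => a b; rewrite /normsq; simpc; congr (_ +i* _); ring. Qed.

(** As in [herm_coord], the key [(i, j)] with [i <= j] holds the real part of that entry, and the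
    transposed key the imaginary part. *)
Definition hent (e : env) (i j : nat) : C :=
  if (i < j)%N then e (i, j) +i* e (j, i)
  else if i == j then (e (i, i))%:C else e (j, i) -i* e (i, j).

Definition mat (e : env) n : 'M[C]_n := \matrix_(i, j) hent e i j.

Lemma hentC e i j : hent e i j = (hent e j i)^*.
Proof.
rewrite /hent eq_sym; have [ij|ij|->] := ltngtP i j; rewrite ?opprK//.
  by rewrite -[RHS]/(e (i, j) +i* - - e (j, i)) opprK.
by rewrite -[RHS]/(e (j, j) +i* - 0) oppr0.
Qed.

Lemma mat_herm e n : mat e n \is hermsymmx.
Proof. by apply/hermsymmxP => i j; rewrite !mxE hentC. Qed.

Lemma herm_coord_mat e n (k : 'I_n * 'I_n) :
  herm_coord (mat e n) k = e (k.1 : nat, k.2 : nat).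
Proof.
case: k => i j; rewrite /herm_coord /= !mxE /hent.
by have [ij|ij|ij] := ltngtP i j => //=; rewrite ij.
Qed.

Lemma mat_eq e e' n : (forall i j, (i < n)%N -> (j < n)%N -> e (i, j) = e' (i, j)) ->
  mat e n = mat e' n.
Proof.
by move=> H; apply/matrixP => i j; rewrite !mxE /hent !H.
Qed.

Definition bcol (e : env) n : 'cV[C]_n := \col_i hent e i n.

(** Access by a natural number, with value 0 out of range. *)
Definition getc n (v : 'cV[C]_n) (i : nat) : C := \sum_(j < n | j == i :> nat) v j 0.

Lemma getcE n (v : 'cV[C]_n) (i : 'I_n) : getc v i = v i 0.
Proof.
by rewrite /getc (bigD1 i)//= big1 ?addr0// => j /andP[/eqP/val_inj->]; rewrite eqxx.
Qed.

Lemma mat_border e n :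
  mat e (n + 1) = block_mx (mat e n) (bcol e n) ((bcol e n)^t*) ((e (n, n))%:C%:M).
Proof.
apply/matrixP => i j; rewrite !mxE.
case: splitP => i' ->; rewrite !mxE; case: splitP => j' -> ; rewrite !mxE.
- by [].
- by rewrite ord1 addn0.
- by rewrite ord1 addn0 hentC.
- by rewrite !ord1 /= addn0 /hent ltnn eqxx mulr1n.
Qed.

(** The Schur complement of [z - mat e n] inside [z - mat e n.+1], computed in an eigenbasis of the
    minor. *)
Lemma char_border e n (U : 'M[C]_n) (mu : 'I_n -> R) (z : R) :
  U \is unitarymx -> mat e n = U^t* *m diag_mx (\row_i (mu i)%:C) *m U ->
  (forall i, z != mu i) ->
  (char_poly (mat e n.+1)).[z%:C] =
  ((\prod_i (z - mu i)) *
   (z - e (n, n) - \sum_i normsq ((U *m bcol e n) i 0) / (z - mu i)))%:C.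
Proof.
move=> UU ME zmu; rewrite -addn1 horner_char_poly mat_border.
have UV : U *m U^t* = 1%:M by apply/unitarymxP.
have VU : U^t* *m U = 1%:M by apply: mulmx1C.
pose D := diag_mx (\row_i (z - mu i)%:C).
pose V := diag_mx (\row_i ((z - mu i)^-1)%:C).
have AE : (z%:C)%:M - mat e n = U^t* *m D *m U.
  have -> : D = (z%:C)%:M - diag_mx (\row_i (mu i)%:C).
    apply/matrixP => i j; rewrite !mxE -mulrnBl.
    by rewrite -rmorphB.
  by rewrite mulmxBr mulmxBl -ME mul_mx_scalar -scalemxAl VU scalemx1.
have DV : D *m V = 1%:M.
  rewrite mulmx_diag; apply/matrixP => i j; rewrite !mxE.
  by rewrite -rmorphM /= divff ?subr_eq0.
have AV : (U^t* *m D *m U) *m (U^t* *m V *m U) = 1%:M.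
  by rewrite !mulmxA -[_ *m U *m U^t*]mulmxA UV mulmx1 -[_ *m D *m V]mulmxA DV mulmx1 VU.
have [Au _] := mulmx1_unit AV.
have AI : invmx (U^t* *m D *m U) = U^t* *m V *m U.
  have invE (A B : 'M[C]_n) : A \in unitmx -> A *m B = 1%:M -> invmx A = B.
    by move=> A1 AB; rewrite -[LHS]mulmx1 -AB mulmxA mulVmx// mul1mx.
  exact: invE.
have -> : (z%:C)%:M - block_mx (mat e n) (bcol e n) ((bcol e n)^t*) ((e (n, n))%:C%:M) =
   block_mx (U^t* *m D *m U) (- bcol e n) (- (bcol e n)^t*) ((z - e (n, n))%:C%:M).
  rewrite -AE [(z%:C)%:M in LHS]scalar_mx_block opp_block_mx add_block_mx !add0r.
  by congr block_mx; rewrite -raddfB -rmorphB.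
have detE : \det (U^t* *m D *m U) = \det D.
  by rewrite !det_mulmx mulrC mulrA -det_mulmx UV det1 mul1r.
rewrite det_schur// AI detE.
rewrite !mulNmx mulmxN opprK.
set c := U *m bcol e n.
have -> : (bcol e n)^t* *m (U^t* *m V *m U) *m bcol e n = c^t* *m V *m c.
  by rewrite /c trmx_mul map_mxM !mulmxA.
rewrite det_diag [RHS]rmorphM; congr (_ * _).
  by rewrite [RHS]rmorph_prod; apply: eq_bigr => i _; rewrite !mxE.
rewrite [LHS]mxE [X in X + _]mxE mulr1n [RHS]rmorphB; congr (_ + _).
rewrite [LHS]mxE; congr (- _); rewrite [LHS]mxE [RHS]rmorph_sum; apply: eq_bigr => i _.
rewrite [RHS]rmorphM /= normsqE mulrAC; congr (_ * _).
by rewrite mul_mx_diag [LHS]mxE [X in X * _]mxE [c^T 0 i]mxE [X in _ * X]mxE.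
Qed.

(** The model of a bordered matrix: diagonal minor [mu], border with squared moduli [r], corner
    [r 0]. Poles are numbered from 1, as in [secular] with [a = 0]. *)
Definition arrow (mu : nat -> R) n (r : renv) : env := fun k =>
  if k == (n, n) then r 0%N
  else if k.1 == k.2 then mu k.1.+1
  else if k.2 == n then Num.sqrt (r k.1.+1) else 0.

Lemma mat_arrow mu n r : mat (arrow mu n r) n = diag_mx (\row_i (mu i.+1)%:C).
Proof.
apply/matrixP => i j; rewrite !mxE /hent /arrow !xpair_eqE /=.
have := ltn_ord i; have := ltn_ord j => jn i_n.
rewrite !(ltn_eqF jn) !(ltn_eqF i_n) !(inj_eq val_inj) -!(inj_eq val_inj) /=.
rewrite ?(ltn_eqF jn) ?(ltn_eqF i_n) ?eqxx /=.
have [ij|ij|ij] := ltngtP (i : nat) j; rewrite ?mulr0n ?oppr0//.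
Qed.

Lemma bcol_arrow mu n r i : (bcol (arrow mu n r) n) i 0 = (Num.sqrt (r i.+1))%:C.
Proof.
by rewrite !mxE /hent /arrow !xpair_eqE /= ltn_ord (ltn_eqF (ltn_ord i)) (gtn_eqF (ltn_ord i)) eqxx.
Qed.

Lemma char_arrow (mu : nat -> R) n r (z : R) : (forall i : 'I_n, 0 <= r i.+1) ->
  (forall i : 'I_n, z != mu i.+1) ->
  (char_poly (mat (arrow mu n r) n.+1)).[z%:C] =
  ((\prod_(i < n) (z - mu i.+1)) *
   (z - r 0%N - \sum_(i < n) r i.+1 / (z - mu i.+1)))%:C.
Proof.
move=> r0 zmu; rewrite (@char_border _ n 1%:M (fun i => mu i.+1))//.
- have -> : arrow mu n r (n, n) = r 0%N by rewrite /arrow eqxx.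
  congr (_ * (_ - _))%:C; apply: eq_bigr => i _; congr (_ / _).
  by rewrite mul1mx bcol_arrow /normsq /= sqr_sqrtr// expr0n addr0.
- by apply/unitarymxP; rewrite mul1mx trmx1 map_mx1.
- by rewrite mat_arrow trmx1 map_mx1 mul1mx mulmx1.
Qed.

Lemma large_bound n (mu : nat -> R) : exists B : R, forall z, B < z -> forall i, (i < n)%N -> z != mu i.
Proof.
exists (\sum_(i < n) `|mu i|) => z Bz i i_n; rewrite gt_eqF//.
apply: le_lt_trans Bz; rewrite (bigD1 (Ordinal i_n))//= (le_trans (ler_norm _))// lerDl.
exact: sumr_ge0.
Qed.

(** The points [mu i] exclude only finitely many [z], so characteristic polynomials can be compared
    away from the poles. *)
Lemma poly_ext_large n (mu : nat -> R) (p q : {poly C}) :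
  (forall z : R, (forall i, (i < n)%N -> z != mu i) -> p.[z%:C] = q.[z%:C]) -> p = q.
Proof.
have [B HB] := large_bound n mu => H.
by apply: (@poly_eq_large _ _ _ B) => z Bz; apply: H; exact: HB.
Qed.

Definition bcoef n (U : 'M[C]_n) (e : env) : renv := fun j =>
  if j is i.+1 then normsq (getc (U *m bcol e n) i) else e (n, n).

(** In an eigenbasis of the minor only the squared moduli of the border enter the characteristic
    polynomial. *)
Lemma spec_border n (U : 'M[C]_n) (e : env) :
  U \is unitarymx -> mat e n = U^t* *m spec_diag_mx (mat e n) *m U ->
  spec (mat e n.+1) =
  spec (mat (arrow (fun j => (spec (mat e n))`_j.-1) n (bcoef U e)) n.+1).
Proof.
move=> UU ME; set mu := fun j => _.
have ME' : mat e n = U^t* *m diag_mx (\row_i (mu i.+1)%:C) *m U.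
  have <- : spec_diag_mx (mat e n) = diag_mx (\row_i (mu i.+1)%:C); last exact: ME.
  by rewrite /spec_diag_mx; congr diag_mx; apply/rowP => i; rewrite [LHS]mxE [RHS]mxE (tnth_nth 0).
apply: spec_char_poly; [exact: mat_herm|exact: mat_herm|].
apply: (@poly_ext_large n.+1 mu) => z zmu.
rewrite [RHS]char_arrow; last 2 first.
- by move=> i; rewrite /bcoef addr_ge0// sqr_ge0.
- by move=> i; apply: zmu; rewrite ltnS.
have zmu' : forall i : 'I_n, z != mu i.+1 by move=> i; apply: zmu; rewrite ltnS.
rewrite [LHS](char_border UU ME' zmu').
congr (_ * (_ - _))%:C; apply: eq_bigr => i _.
by rewrite /bcoef getcE.
Qed.

Lemma spec_arrow_coef n (mu : nat -> R) (la : renv) :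
  decr mu 0 n -> interl mu 0 n la ->
  spec (mat (arrow mu n (secular_coef mu 0 n la)) n.+1) = [seq la i | i <- iota 0 n.+1] :> seq R.
Proof.
move=> md il; have /allP rpos := secular_coef_gt0 md il.
apply: spec_unique; first exact: mat_herm.
  rewrite /= path_map; apply/(pathP 0%N) => i; rewrite size_iota => i_n.
  have /allP/(_ i) := il; rewrite mem_iota i_n => /(_ isT)/andP[l1 l2].
  have -> : nth 0%N (0%N :: iota 1 n) i = i.
    by rewrite -[_ :: _]/(iota 0 n.+1) nth_iota// ltnS ltnW.
  by rewrite nth_iota// add1n /= ltW// (lt_trans l1).
apply: (@poly_ext_large n.+1 mu) => z zmu.
rewrite [LHS]char_arrow; last 2 first.
- by move=> i; rewrite ltW// rpos// mem_iota/= add1n ltnS.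
- by move=> i; apply: zmu; rewrite ltnS.
rewrite horner_prod.
have -> : \prod_(x <- [seq la i | i <- iota 0 n.+1]) ('X - x%:C%:P).[z%:C] =
    (\prod_(i <- iota 0 n.+1) (z - la i))%:C.
  rewrite big_map rmorph_prod; apply: eq_bigr => i _.
  by rewrite hornerXsubC rmorphB.
rewrite (secular_coefP la md); last first.
  by move=> j; rewrite mem_iota => /andP[j1 jn]; apply: zmu; rewrite -[_.+1]add1n.
congr (_ * _)%:C.
  by rewrite -[iota 1 n]/(iota (1 + 0) n) iotaDl big_map -val_enum_ord big_map big_enum.
rewrite /secular; congr (_ - _ - _).
by rewrite -[iota 1 n]/(iota (1 + 0) n) iotaDl big_map -val_enum_ord big_map big_enum.
Qed.

Definition specenv n (M : 'M[C]_n) : renv := fun i => (spec M)`_i.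

Lemma cmeas_hent d (T : measurableType d) (e : T -> env) i j : measurable_fun setT e ->
  cmeas (fun x => hent (e x) i j).
Proof.
by move=> me; rewrite /hent; split; case: (ltngtP i j) => ij /=; mR.
Qed.

Lemma measurable_spec_mat d (T : measurableType d) (e : T -> env) n i :
  measurable_fun setT e -> measurable_fun setT (fun x => (spec (mat (e x) n))`_i).
Proof.
move=> me; apply: measurable_spec => [x|k l]; first exact: mat_herm.
rewrite (_ : (fun x => _) = fun x => hent (e x) k l); first exact: cmeas_hent.
by apply/funext => x; rewrite mxE.
Qed.

Lemma measurable_specenv d (T : measurableType d) (e : T -> env) n :
  measurable_fun setT e -> measurable_fun setT (fun x => specenv (mat (e x) n)).
Proof. by move=> me; apply: measurable_envP => i; exact: measurable_spec_mat. Qed.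

Lemma measurable_sqrt d (T : measurableType d) (f : T -> R) :
  measurable_fun setT f -> measurable_fun setT (fun x => Num.sqrt (f x)).
Proof.
apply: (measurable_comp_fun (f := @Num.sqrt R)).
by apply: continuous_measurable_fun; exact: sqrt_continuous.
Qed.

Lemma measurable_arrow mu n : measurable_fun setT (arrow mu n).
Proof.
apply: measurable_envP => k; rewrite /arrow; case: (k == (n, n)); first by mR.
by case: (k.1 == k.2); [mR|case: (k.2 == n); [apply: measurable_sqrt|]; mR].
Qed.

End bordered_matrices.

(** * Squared moduli as coordinates *)

Section polar_coordinates.
Local Open Scope ereal_scope.
Variables (R : realType) (K : countType) (px py : nat -> K).
Local Notation MR := (measurableTypeR R).
Local Notation lam := (@lebesgue_measure R).

Definition polar_const : R := s2val (cid2 (polar_integral R)).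

Lemma polar_const_gt0 : (0 < polar_const)%R.
Proof. by rewrite /polar_const; case: cid2. Qed.

Lemma polar_constP (g : MR -> \bar R) : measurable_fun setT g -> (forall x, 0 <= g x) ->
  \int[lam]_x \int[lam]_y g (x ^+ 2 + y ^+ 2)%R =
  polar_const%:E * \int[lam]_(r in `]0%R, +oo[) g r.
Proof. by rewrite /polar_const; case: cid2 => c c0 H; exact: H. Qed.

Definition pair_keys (s : seq nat) := flatten [seq [:: px j; py j] | j <- s].

Lemma II_polar (s : seq nat) (psi : family R nat -> \bar R) (w : family R nat) (b : family R K) :
  uniq s -> uniq (pair_keys s) -> measurable_fun setT psi -> (forall r, 0 <= psi r) ->
  II (pair_keys s) (fun e => psi (fun j => if j \in s then (e (px j) ^+ 2 + e (py j) ^+ 2)%R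
    else w j)) b =
  (polar_const ^+ size s)%:E *
  II s (fun r => (if all (fun j => 0 < r j)%R s then 1 else 0)%:E * psi r) w.
Proof.
move=> us up mpsi psi0; elim: s w b us up => [|i s IH] w b.
  by move=> _ _; rewrite /= expr0 !mul1e.
rewrite [pair_keys _]/= => /= /andP[is' us] /and3P[pxi pyi up].
set T := fun r : family R nat => (if all (fun j => 0 < r j)%R s then 1 else 0)%:E * psi r.
have mT : measurable_fun setT T by rewrite /T; mR.
have T0 r : 0 <= T r by rewrite /T mule_ge0//; case: ifP.
pose g (t : MR) : \bar R := II s T (upd w i t).
have mg : measurable_fun setT g by apply: measurable_II_upd.
have g0 t : 0 <= g t by apply: II_ge0.
transitivity (\int[lam]_x \int[lam]_y ((polar_const ^+ size s)%:E * g (x ^+ 2 + y ^+ 2)%R)).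
  apply: eq_integral => x _; apply: eq_integral => y _.
  rewrite -(IH _ (upd (upd b (px i) x) (py i) y))//.
  move: pxi; rewrite inE negb_or => /andP[pxy pxi].
  apply: eq_II_in => e eb; congr psi; apply/funext => j; rewrite inE.
  have [->|ji] /= := eqVneq j i; last by case: ifP => // _; rewrite updNE.
  by rewrite (negbTE is') updE eb// updNE// updE eb// updE.
have mgp : measurable_fun [set: MR] (fun t : MR => (polar_const ^+ size s)%:E * g t).
  by apply: emeasurable_funM => //; exact: measurable_cst.
have c0 : 0 <= (polar_const ^+ size s)%:E :> \bar R.
  by rewrite lee_fin exprn_ge0// ltW// polar_const_gt0.
rewrite (@polar_constP (fun t => (polar_const ^+ size s)%:E * g t))//; last first.
  by move=> t; rewrite mule_ge0.
rewrite ge0_integralZl//; last exact: measurable_funTS.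
rewrite muleA -EFinM exprS; congr (_ * _).
rewrite integral_mkcond; apply: eq_integral => t _.
rewrite /patch mem_setE in_itv/= andbT.
have E : forall r, (forall j, j \notin s -> r j = upd w i t j) ->
    (if all (fun j => 0 < r j)%R (i :: s) then 1 else 0)%:E * psi r =
    (if (0 < t)%R then 1 else 0)%:E * T r.
  move=> r rw; rewrite /T /= rw// updE; case: (0 < t)%R => /=; first by rewrite mul1e.
  by rewrite !mul0e.
rewrite (eq_II_in (g := fun r => (if (0 < t)%R then 1 else 0)%:E * T r))//.
rewrite IIZl//; last by case: ifP.
by case: ifP => _; rewrite ?mul1e ?mul0e.
Qed.

End polar_coordinates.

(** * The joint density of the spectra of all minors *)

Section border_integral.
Variable R : realType.
Local Notation C := R[i].
Local Notation env := (family R (nat * nat)).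
Local Notation renv := (family R nat).

(** Keys of the real and imaginary parts of the border entry that goes with the pole of index [j],
    counted from 1. *)
Definition bx n (j : nat) : nat * nat := (j.-1, n).
Definition by_ n (j : nat) : nat * nat := (n, j.-1).
Definition bvec n := pair_keys (bx n) (by_ n) (iota 1 n).
Definition bkeys n : seq (nat * nat) := (n, n) :: bvec n.

Lemma mem_bvec n k : (k \in bvec n) =
  ((k.2 == n) && (k.1 < n)%N) || ((k.1 == n) && (k.2 < n)%N).
Proof.
case: k => a c; apply/flattenP/orP => /=.
  move=> [l /mapP[j]]; rewrite mem_iota => /andP[j1 jn] ->.
  by rewrite !inE /bx /by_ !xpair_eqE => /orP[]/andP[/eqP-> /eqP->]; [left|right];
    rewrite eqxx /=; lia.
move=> H; exists [:: bx n (if c == n then a else c).+1; by_ n (if c == n then a else c).+1].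
  by apply: map_f; rewrite mem_iota; case: H => /andP[/eqP-> cn]; rewrite ?eqxx ?(ltn_eqF cn)/=; lia.
rewrite !inE /bx /by_ /= !xpair_eqE.
by case: H => /andP[/eqP-> cn]; rewrite ?(ltn_eqF cn) !eqxx ?orbT.
Qed.

Lemma uniq_bvec n : uniq (bvec n).
Proof.
rewrite /bvec /pair_keys; have : {subset iota 1 n <= iota 1 n} by [].
move: (iota_uniq 1 n); elim: {1 2 4}(iota 1 n) => [//|j s IH] /= /andP[js us] sub.
have jn := sub j (mem_head _ _); rewrite mem_iota in jn.
have notin k : (k == bx n j) || (k == by_ n j) -> k \notin flatten [seq [:: bx n j; by_ n j] | j <- s].
  move=> kj; apply/flattenP => -[_ /mapP[l ls ->]]; have := sub l; rewrite inE ls orbT mem_iota.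
  move=> /(_ isT) ln; have lj : l != j by apply: contraNneq js => <-.
  rewrite !inE; case/orP: kj => /eqP->; rewrite /bx /by_ !xpair_eqE => /orP[]/andP[/eqP ? /eqP ?];
    by case/eqP: lj; lia.
rewrite inE negb_or !notin ?eqxx ?orbT// andbT IH//; last first.
  by move=> l ls; apply: sub; rewrite inE ls orbT.
by rewrite !andbT; apply/eqP => -[? _]; lia.
Qed.

Definition rotate n (U : 'M[C]_n) (e : env) : env := fun k =>
  if (k.2 == n) && (k.1 < n)%N then complex.Re (getc (U *m bcol e n) k.1)
  else if (k.1 == n) && (k.2 < n)%N then complex.Im (getc (U *m bcol e n) k.2)
  else e k.

Lemma getc_out n (v : 'cV[C]_n) i : (n <= i)%N -> getc v i = 0.
Proof.
by move=> ni; rewrite /getc big1// => j /eqP jE; have := ltn_ord j; rewrite jE ltnNge ni.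
Qed.

Lemma bcolE (e : env) n (i : 'I_n) : bcol e n i 0 = e (i : nat, n) +i* e (n, i : nat).
Proof. by rewrite mxE /hent ltn_ord. Qed.

Lemma bcol_rotate n (U : 'M[C]_n) e : bcol (rotate U e) n = U *m bcol e n.
Proof.
apply/colP => i; rewrite bcolE /rotate /= eqxx ltn_ord (ltn_eqF (ltn_ord i)) /= !getcE.
by case: ((U *m bcol e n) i 0).
Qed.

Lemma bcol_eq n (e e' : env) : {in bvec n, e =1 e'} -> bcol e n = bcol e' n.
Proof.
move=> H; apply/colP => i; rewrite !bcolE !H// mem_bvec /= eqxx ltn_ord ?orbT//.
Qed.

Lemma getc_bcol n (e : env) i : (i < n)%N -> getc (bcol e n) i = e (i, n) +i* e (n, i).
Proof. by move=> i_n; rewrite (@getcE _ _ _ (Ordinal i_n)) bcolE. Qed.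

Lemma big_pair_keys (K : countType) (px py : nat -> K) s (f : K -> R) :
  \sum_(k <- pair_keys px py s) f k = \sum_(j <- s) (f (px j) + f (py j)).
Proof.
rewrite big_flatten big_map; apply: eq_bigr => j _.
by rewrite big_cons big_seq1.
Qed.

Lemma sum_normsq_col n (v : 'cV[C]_n) :
  (\sum_i normsq (v i 0))%:C = (v^t* *m v) 0 0.
Proof.
rewrite rmorph_sum mxE; apply: eq_bigr => i _.
by rewrite -[LHS]/((normsq (v i 0))%:C) normsqE !mxE.
Qed.

Lemma sum_bvec_sqr n (e : env) :
  \sum_(k <- bvec n) e k ^+ 2 = \sum_(i < n) normsq (bcol e n i 0).
Proof.
rewrite big_pair_keys (iotaDl 1 0) big_map -val_enum_ord big_map big_enum.
by apply: eq_bigr => i _; rewrite bcolE.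
Qed.

Lemma measurable_rotate n (U : 'M[C]_n) : measurable_fun setT (rotate U).
Proof.
have cm i : cmeas (fun e : env => getc (U *m bcol e n) i).
  rewrite (_ : (fun e => _) =
      fun e : env => \sum_(j < n) (j == i :> nat)%:R * \sum_k U j k * hent e k n).
    apply: cmeas_sum => j; apply: cmeasM; first exact: cmeas_cst.
    apply: cmeas_sum => k; apply: cmeasM; first exact: cmeas_cst.
    by apply: cmeas_hent; mR.
  apply/funext => e; rewrite /getc big_mkcond; apply: eq_bigr => j _.
  rewrite !mxE; case: eqP => _; rewrite ?mul1r ?mul0r//.
  by apply: eq_bigr => k _; rewrite mxE.
apply: measurable_envP => k; rewrite /rotate.
case: ((k.2 == n) && (k.1 < n)%N); first by case: (cm k.1).
by case: ((k.1 == n) && (k.2 < n)%N); [case: (cm k.2)|mR].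
Qed.

Lemma II_rotate n (U : 'M[C]_n) (f : env -> \bar R) b : U \is unitarymx ->
  measurable_fun setT f -> (forall e, 0 <= f e)%E ->
  II (bvec n) (fun e => f (rotate U e)) b = II (bvec n) f b.
Proof.
move=> UU mf f0; have UV : U *m U^t* = 1%:M by apply/unitarymxP.
have VU : U^t* *m U = 1%:M by apply: mulmx1C.
have rotE k : k \in bvec n -> forall e,
   rotate U e k = if k.2 == n then complex.Re (getc (U *m bcol e n) k.1)
                  else complex.Im (getc (U *m bcol e n) k.2).
  rewrite mem_bvec /rotate => /orP[]/andP[/eqP kE kn] e; first by rewrite kE eqxx kn.
  by rewrite kE eqxx kn (ltn_eqF kn).
apply: (II_isometry (uniq_bvec n) (wt := fun=> 1)) => //.
- exact: measurable_rotate.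
- move=> e k; rewrite mem_bvec /rotate negb_or => /andP[/negbTE-> /negbTE->].
  by [].
- move=> e e' ee' k ks; have E := bcol_eq ee'.
  by rewrite (rotE k ks e) (rotE k ks e') E.
- move=> e v k ks; rewrite !rotE//.
  have -> : bcol (addenv (bvec n) e v) n = bcol e n + bcol v n.
    apply/colP => i; rewrite [RHS]mxE !bcolE /addenv !mem_bvec /= eqxx ltn_ord orbT.
    by simpc.
  rewrite mulmxDr.
  have gD (x y : 'cV[C]_n) i : getc (x + y) i = getc x i + getc y i.
    by rewrite /getc -big_split; apply: eq_bigr => j _; rewrite mxE.
  rewrite !gD; case: ifP => _.
    by case: (getc (U *m bcol e n) k.1) => ? ?; case: (getc (U *m bcol v n) k.1).
  by case: (getc (U *m bcol e n) k.2) => ? ?; case: (getc (U *m bcol v n) k.2).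
- move=> y; exists (rotate (U^t*) y) => k ks; rewrite rotE// bcol_rotate mulmxA UV mul1mx.
  move: ks; rewrite mem_bvec => /orP[]/andP[/eqP kE kn].
    by rewrite kE eqxx getc_bcol//= -{1}kE -surjective_pairing.
  by rewrite (ltn_eqF kn) getc_bcol//= -{1}kE -surjective_pairing.
- move=> e; under eq_bigr do rewrite mul1r; under [RHS]eq_bigr do rewrite mul1r.
  rewrite !sum_bvec_sqr bcol_rotate; apply: (@complexI R).
  rewrite !sum_normsq_col trmx_mul map_mxM !mulmxA.
  by rewrite -[_ *m U^t* *m U]mulmxA VU mulmx1.
Qed.

Definition eigs (e : env) n : nat -> R := fun j => (spec (mat e n))`_j.-1.

(** For a fixed minor, a unitary rotation of the border diagonalises the minor, squared moduli
    replace the border entries, and [secular_change] replaces the moduli by the eigenvalues of the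
    larger matrix. *)
Lemma border_change n (phi : renv -> \bar R) (e : env) :
  measurable_fun setT phi -> (forall r, 0 <= phi r)%E -> decr (eigs e n) 0 n ->
  II (bkeys n) (fun e' => phi (specenv (mat e' n.+1))) e =
  ((polar_const R ^+ n)%:E *
   II (iota 0 n.+1) (fun la => (interl_weight (eigs e n) 0 n la)%:E * phi la) (fun=> 0%R))%E.
Proof.
move=> mphi phi0 md; set mu := eigs e n.
have [U UU ME] := spec_diagonalize (mat_herm e n).
pose psi (r : renv) := phi (specenv (mat (arrow mu n r) n.+1)).
have mpsi : measurable_fun setT psi.
  by apply: (measurable_comp_fun mphi); apply: measurable_specenv; exact: measurable_arrow.
have psi0 r : (0 <= psi r)%E by exact: phi0.
pose nrm (e' : env) : renv := fun j => if j \in iota 1 n then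
   e' (bx n j) ^+ 2 + e' (by_ n j) ^+ 2 else if j == 0%N then e' (n, n) else 0.
have mnrm : measurable_fun setT nrm.
  apply: measurable_envP => j; rewrite /nrm; case: (j \in iota 1 n); first by mR.
  by case: (j == 0)%N; mR.
transitivity (II (bkeys n) (fun e' => psi (nrm (rotate U e'))) e).
  apply: eq_II_in => e' ee'.
  have matE : mat e' n = mat e n.
    apply: mat_eq => i j i_n jn; apply: ee'.
    by rewrite inE mem_bvec xpair_eqE /= (ltn_eqF i_n) (ltn_eqF jn).
  rewrite /psi; congr phi; rewrite /specenv.
  have <- : bcoef U e' = nrm (rotate U e').
    apply/funext => -[|i] /=; first by rewrite /nrm mem_iota /= /rotate /= ltnn andbF.
    rewrite /nrm mem_iota /= add1n ltnS; case: ltnP => i_n.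
      by rewrite /rotate /= eqxx i_n (ltn_eqF i_n).
    by rewrite getc_out// /normsq expr0n addr0.
  by rewrite (@spec_border _ n U e') ?matE.
rewrite [LHS]/=.
transitivity (\int[lebesgue_measure]_t ((polar_const R ^+ n)%:E * II (iota 1 n)
   (fun r => (if all (fun j => 0 < r j)%R (iota 1 n) then 1 else 0)%:E * psi r)
   (upd (fun=> 0%R) 0%N t)))%E.
  apply: eq_integral => t _.
  rewrite (@II_rotate n U (fun e' => psi (nrm e')))//; last exact: measurable_comp_fun mpsi mnrm.
  have := @II_polar R _ (bx n) (by_ n) (iota 1 n) psi (upd (fun=> 0%R) 0%N t) (upd e (n, n) t)
     (iota_uniq _ _) (uniq_bvec n) mpsi psi0.
  rewrite size_iota => <-.
  apply: eq_II_in => e' ee'; congr psi; apply/funext => j; rewrite /nrm.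
  case: (j \in _) => //; have [->|j0] := eqVneq j 0%N; last by rewrite updNE.
  by rewrite updE ee' ?updE// mem_bvec /= ltnn andbF.
have mT : measurable_fun setT (fun r : renv =>
    (if all (fun j => 0 < r j)%R (iota 1 n) then 1 else 0)%:E * psi r)%E by mR.
have T0 (r : renv) :
    (0 <= (if all (fun j => 0 < r j)%R (iota 1 n) then 1 else 0)%:E * psi r)%E.
  by rewrite mule_ge0//; case: ifP.
rewrite ge0_integralZl//; last 3 first.
- exact: measurable_II_upd.
- by move=> t _; exact: II_ge0.
- by rewrite lee_fin exprn_ge0// ltW// polar_const_gt0.
congr (_ * _)%E.
rewrite -[LHS]/(II (iota 0 n.+1) (fun r =>
  (if all (fun j => 0 < r j)%R (iota 1 n) then 1 else 0)%:E * psi r)%E (fun=> 0)).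
rewrite -(secular_change (mu := mu))//; apply: eq_II_in => la la0.
rewrite /interl_weight; case: ifPn => [il|_]; last by rewrite !mul0e.
congr (_ * _)%E; rewrite /psi; congr phi; apply/funext => i.
rewrite /specenv (spec_arrow_coef md il).
have [i_n|ni] := ltnP i n.+1.
  by rewrite (nth_map 0%N) ?size_iota// nth_iota.
by rewrite nth_default ?size_map ?size_iota// la0// mem_iota /= add0n -leqNgt.
Qed.

Fixpoint Mkeys n : seq (nat * nat) :=
  if n is n'.+1 then Mkeys n' ++ bkeys n' else [::].

Fixpoint GTkeys n : seq (nat * nat) :=
  if n is n'.+1 then GTkeys n' ++ [seq (n'.+1, m) | m <- iota 0 n'.+1] else [::].

(** The rows above [n] are 0, which is the base point of the pattern integrals in [star]. *)
Definition gtspec n (e : env) : env := fun k =>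
  if (k.1 <= n)%N then (spec (mat e k.1))`_k.2 else 0.

Definition gtrow (g : env) k : renv := fun m => g (k, m).

Definition gtint n (g : env) :=
  all (fun k => interl (fun j => g (k, j.-1)) 0 k (gtrow g k.+1)) (iota 1 n.-1).

Definition gtvdm n (g : env) := vdm [seq g (n, m) | m <- iota 0 n].

(* The density of the eigenvalues of all principal minors. *)
Definition gtweight n (g : env) : R := if gtint n g then gtvdm n g else 0.

Fixpoint star_const n : R :=
  if n is n'.+1 then star_const n' * polar_const R ^+ n' else 1.

Lemma star_const_gt0 n : 0 < star_const n.
Proof. by elim: n => //= n IH; rewrite mulr_gt0// exprn_gt0// polar_const_gt0. Qed.

Lemma dec_chain (f : nat -> R) a m :
  (forall j, (a <= j)%N -> (j < m)%N -> f j.+1 < f j) ->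
  forall i j, (a <= i)%N -> (i < j)%N -> (j <= m)%N -> f j < f i.
Proof.
move=> H i j ai; elim: j => // j IH; rewrite ltnS leq_eqVlt => /predU1P[ij|ij] jm.
  by rewrite -ij; apply: H; lia.
by apply: lt_trans (IH ij (ltnW jm)); apply: H => //; lia.
Qed.

Lemma gtint_decr n g : gtint n g -> decr (fun j => g (n, j.-1)) 0 n.
Proof.
case: n => [|[|n]] H; [by move=> i j; lia|by move=> i j; lia|].
have /allP/(_ n.+1) := H; rewrite mem_iota /= add1n ltnSn => /(_ isT)/allP il.
move=> [|i] [|j]//= _ ij jn.
apply: (@dec_chain (fun i => g (n.+2, i)) 0 n.+1); try lia.
move=> l _ ln; have := il l; rewrite mem_iota /= add0n ln => /(_ isT)/andP[/lt_trans]; exact.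
Qed.

Lemma vdm_gt0 s (f : nat -> R) : sorted ltn s ->
  (forall i j, i \in s -> j \in s -> (i < j)%N -> f j < f i) -> 0 < vdm [seq f i | i <- s].
Proof.
elim: s => [|i s IH] //= si dec; rewrite mulr_gt0//; last first.
  by apply: IH => [|a c ais cs]; [exact: path_sorted si|apply: dec; rewrite inE ?ais ?cs orbT].
rewrite big_map big_seq prodr_gt0// => j js; rewrite subr_gt0.
apply: dec; rewrite ?inE ?eqxx ?js ?orbT//.
have := order_path_min ltn_trans si; move/allP; exact.
Qed.

Lemma interl_weight_ge0 (mu : nat -> R) n la : 0 <= interl_weight mu 0 n la.
Proof.
rewrite /interl_weight; case: ifP => // /allP il.
have H j : (j < n)%N -> la j.+1 < mu j.+1 /\ mu j.+1 < la j.
  by move=> jn; have := il j; rewrite mem_iota add0n jn => /(_ isT)/andP.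
rewrite divr_ge0// ltW//; apply: vdm_gt0.
- exact: iota_ltn_sorted.
- move=> i j; rewrite !mem_iota => _ /andP[_ jn] ij.
  apply: (@dec_chain la 0 n); try lia.
  move=> l _ ln; have [h1 h2] := H l ln.
  exact: lt_trans h2.
- exact: iota_ltn_sorted.
- move=> i j; rewrite !mem_iota => /andP[i1 _] /andP[_ jn] ij.
  apply: (@dec_chain mu 1 n); try lia.
  move=> [//|l] _ ln; have [h1 h2] := H l (ltnW ln); have [h3 h4] := H _ ln.
  exact: lt_trans h1.
Qed.

Lemma gtvdm_gt0 n g : gtint n g -> 0 < gtvdm n g.
Proof.
move=> /gtint_decr H; rewrite /gtvdm (vdm_gt0 (f := fun m => g (n, m)))//.
  exact: iota_ltn_sorted.
move=> i j; rewrite !mem_iota => _ /andP[_ jn] ij.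
by apply: (H i.+1 j.+1) => //; lia.
Qed.

Lemma gtweight_ge0 n g : 0 <= gtweight n g.
Proof. by rewrite /gtweight; case: ifP => // /gtvdm_gt0/ltW. Qed.

(** Each border contributes the ratio of the Vandermonde products of consecutive rows; in their
    product all but the top row cancel. *)
Lemma gtweightS n g :
  gtweight n.+1 g =
  gtweight n g * interl_weight (fun j => g (n, j.-1)) 0 n (gtrow g n.+1).
Proof.
have intS : gtint n.+1 g = gtint n g && interl (fun j => g (n, j.-1)) 0 n (gtrow g n.+1).
  case: n => [//|n]; rewrite /gtint.
  have -> : iota 1 n.+2.-1 = iota 1 n ++ [:: n.+1].
    by rewrite -[n.+2.-1]/(n.+1) -{1}[n.+1]addn1 iotaD add1n.
  by rewrite all_cat /= andbT.
rewrite /gtweight intS /interl_weight; case: ifPn => [/andP[H ->]|].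
  rewrite H mulrC /gtvdm.
  have -> : [seq g (n, j.-1) | j <- iota 1 n] = [seq g (n, m) | m <- iota 0 n].
    by rewrite (iotaDl 1 0) -map_comp.
  by rewrite mulfVK// gt_eqF//; exact: gtvdm_gt0.
by rewrite negb_and => /orP[/negbTE->|/negbTE->]; rewrite ?mul0r ?mulr0.
Qed.

Lemma measurable_vdm d (T : measurableType d) (s : seq nat) (f : T -> nat -> R) :
  (forall i, measurable_fun setT (fun x => f x i)) ->
  measurable_fun setT (fun x => vdm [seq f x i | i <- s]).
Proof.
move=> mf; elim: s => [|i s IH] /=; first exact: measurable_cst.
apply: measurable_funM => //.
rewrite (_ : (fun x => _) = fun x => \prod_(j <- s) (f x i - f x j)).
  by apply: measurable_prod => j _; exact: measurable_funB.
by apply/funext => x; rewrite big_map.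
Qed.

Lemma measurable_gtweight n : measurable_fun setT (gtweight n).
Proof.
apply: measurable_fun_ifT; last exact: measurable_cst.
  by rewrite /gtint; apply: measurable_all => k _; rewrite /interl /gtrow; mR.
by apply: measurable_vdm => i; mR.
Qed.

Lemma gtweight_eq n g g' : (forall k m, (k <= n)%N -> g (k, m) = g' (k, m)) ->
  gtweight n g = gtweight n g'.
Proof.
move=> H; rewrite /gtweight.
have -> : gtint n g = gtint n g'.
  apply: eq_in_all => k; rewrite mem_iota => /andP[k1 kn].
  apply: eq_in_all => j _; rewrite /gtrow !H//; lia.
have -> // : gtvdm n g = gtvdm n g'.
by rewrite /gtvdm; congr vdm; apply: eq_map => m; exact: H.
Qed.

Lemma measurable_gtspec n : measurable_fun setT (gtspec n).
Proof.
apply: measurable_envP => k; rewrite /gtspec; case: (k.1 <= n)%N; last exact: measurable_cst.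
by apply: measurable_spec_mat; exact: measurable_id.
Qed.

(** What a function contributes on [N] is dominated by [+oo] times the indicator of [N], whose
    integral is [+oo * 0 = 0]. *)
Lemma eq_II_null (K : countType) s (N : family R K -> bool) (f g : family R K -> \bar R) b :
  measurable_fun setT N -> measurable_fun setT f -> measurable_fun setT g ->
  (forall e, 0 <= f e)%E -> (forall e, 0 <= g e)%E ->
  (forall e, ~~ N e -> f e = g e) ->
  II s (fun e => (if N e then 1 else 0)%:E) b = 0%E -> II s f b = II s g b.
Proof.
move=> mN mf mg f0 g0 fg N0.
have H h : measurable_fun setT h -> (forall e, 0 <= h e)%E ->
    II s h b = II s (fun e => if N e then 0 else h e)%E b.
  move=> mh h0.
  have mh1 : measurable_fun setT (fun e => if N e then 0 else h e)%E.
    by apply: measurable_fun_ifT => //; exact: measurable_cst.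
  have mh2 : measurable_fun setT (fun e => if N e then h e else 0)%E.
    by apply: measurable_fun_ifT => //; exact: measurable_cst.
  transitivity (II s (fun e => (if N e then 0 else h e) + (if N e then h e else 0))%E b).
    by apply: eq_II => e; case: (N e); rewrite ?add0e ?adde0.
  rewrite IID//; [|by move=> e; case: (N e)|by move=> e; case: (N e)].
  rewrite [X in (_ + X)%E](_ : _ = 0%E) ?adde0//.
  apply/eqP; rewrite eq_le II_ge0 ?andbT; last by move=> e; case: (N e).
  have mN' : measurable_fun setT (fun e => (if N e then 1 else 0 : R)%:E).
    apply/measurable_EFinP; apply: measurable_fun_ifT => //; exact: measurable_cst.
  apply: (@le_trans _ _ (II s (fun e => +oo * (if N e then 1 else 0)%:E)%E b)).
    apply: le_II => //.
    - by apply: emeasurable_funM => //; exact: measurable_cst.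
    - by move=> e; case: (N e).
    - by move=> e; case: (N e); rewrite ?mule1 ?mule0// leey.
  rewrite IIZl// ?N0 ?mule0// => e; by case: (N e).
rewrite (H f)// (H g)//; apply: eq_II => e; case: (boolP (N e)) => // /fg.
by [].
Qed.

(** Induction adding one border at a time. [border_change] requires the minor to have a simple
    spectrum; matrices with a repeated eigenvalue are negligible by the induction hypothesis itself,
    applied to their indicator, since strict interlacing excludes ties. *)
Theorem star n (F : env -> \bar R) b :
  measurable_fun setT F -> (forall g, 0 <= F g)%E ->
  II (Mkeys n) (fun e => F (gtspec n e)) b =
  ((star_const n)%:E *
   II (GTkeys n) (fun g => (gtweight n g)%:E * F g) (fun=> 0%R))%E.
Proof.
elim: n F b => [|n IH] F b mF F0.
  rewrite /= /gtweight /gtint /gtvdm /= !mul1e; congr F.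
  have s0 : size (spec (mat b 0)) = 0%N by rewrite size_tuple.
  apply/funext => -[[|k] m] //.
  by rewrite -[LHS]/((spec (mat b 0))`_m) (size0nil s0) nth_nil.
rewrite -[Mkeys n.+1]/(Mkeys n ++ bkeys n) II_cat.
pose row := [seq (n.+1, m) | m <- iota 0 n.+1].
rewrite -[GTkeys n.+1]/(GTkeys n ++ row) [star_const _]/=.
pose iw (g : env) := interl_weight (fun j => g (n, j.-1)) 0 n (gtrow g n.+1).
pose F1 (g : env) : \bar R := ((iw g)%:E * F g)%E.
pose F' (g : env) : \bar R := ((polar_const R ^+ n)%:E * II row F1 g)%E.
have iw0 g : (0 <= (iw g)%:E)%E by rewrite lee_fin interl_weight_ge0.
have miw : measurable_fun setT iw.
  apply: measurable_fun_ifT; last exact: measurable_cst.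
    by rewrite /interl /gtrow; mR.
  apply: measurable_funM.
    by apply: (@measurable_vdm _ _ _ (fun g : env => gtrow g n.+1)) => i; rewrite /gtrow; mR.
  apply: (measurable_comp_fun (@measurable_inv R)).
  by apply: (@measurable_vdm _ _ _ (fun (g : env) j => g (n, j.-1))) => i; mR.
have mF1 : measurable_fun setT F1.
  by apply: emeasurable_funM => //; apply/measurable_EFinP.
have F10 g : (0 <= F1 g)%E by rewrite mule_ge0.
have mF' : measurable_fun setT F'.
  by apply: emeasurable_funM; [exact: measurable_cst|exact: measurable_II].
have F'0 g : (0 <= F' g)%E.
  by rewrite mule_ge0 ?II_ge0// lee_fin exprn_ge0// ltW// polar_const_gt0.
pose N (g : env) := ~~ all (fun i => g (n, i.+1) < g (n, i)) (iota 0 n.-1).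
have mN : measurable_fun setT N.
  by apply: (measurable_comp_fun (f := negb)) => //; mR.
transitivity (II (Mkeys n) (fun e => F' (gtspec n e)) b).
  apply: (@eq_II_null _ _ (fun e => N (gtspec n e))).
  - exact: measurable_comp_fun mN (measurable_gtspec n).
  - apply: measurable_II; last by move=> e; exact: F0.
    exact: measurable_comp_fun mF (measurable_gtspec n.+1).
  - exact: measurable_comp_fun mF' (measurable_gtspec n).
  - by move=> e; apply: II_ge0.
  - by move=> e; exact: F'0.
  - move=> e; rewrite negbK => /allP simple.
    have md : decr (eigs e n) 0 n.
      move=> [|i] [|j]// _ ij jn; rewrite /eigs /=.
      apply: (@dec_chain (fun i => (spec (mat e n))`_i) 0 n.-1); try lia.
      move=> l _ ln; have := simple l; rewrite mem_iota add0n ln => /(_ isT).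
      by rewrite /gtspec /= leqnn.
    pose setrow (la : renv) : env := fun k => if k.1 == n.+1 then la k.2 else gtspec n e k.
    have mset : measurable_fun setT setrow.
      apply: measurable_envP => k; rewrite /setrow; case: (k.1 == n.+1); last exact: measurable_cst.
      exact: measurable_coord.
    transitivity (II (bkeys n) (fun e' => F (setrow (specenv (mat e' n.+1)))) e).
      apply: eq_II_in => e' ee'; congr F; apply/funext => -[k m].
      rewrite /setrow /gtspec /=; case: (eqVneq k n.+1) => [->|kn]; first by rewrite leqnn.
      rewrite leq_eqVlt (negbTE kn) ltnS /=; case: ifP => // kle.
      congr (_`_ _); congr (tval (spec _)).
      apply: mat_eq => i j ik jk; apply: ee'.
      rewrite inE mem_bvec xpair_eqE /= !(ltn_eqF (leq_trans _ kle))//.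
    rewrite (border_change (phi := fun la => F (setrow la)))//; last exact: measurable_comp_fun mF mset.
    rewrite /F'; congr (_ * _)%E.
    pose f (la : renv) := ((interl_weight (eigs e n) 0 n la)%:E * F (setrow la))%E.
    have sgI : injective (fun m : nat => (n.+1, m)) by move=> i j [].
    have := II_map (iota 0 n.+1) f (gtspec n e) sgI.
    have -> : gtspec n e \o (fun m : nat => (n.+1, m)) = (fun=> 0%R).
      by apply/funext => m; rewrite /gtspec /= ltnn.
    move=> <-; apply: eq_II_in => g' gg'.
    have out k : k.1 != n.+1 -> g' k = gtspec n e k.
      by move=> kn; apply: gg'; apply: contra kn => /mapP[m _ ->].
    rewrite /f /F1; congr (_%:E * F _)%E.
      rewrite /iw; congr (interl_weight _ _ _ _); apply/funext => j.
      by rewrite out ?ltn_eqF// /gtspec /= leqnn.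
    apply/funext => -[k m]; rewrite /setrow /=; case: eqVneq => [->//|kn].
    by rewrite out.
  - rewrite (IH (fun g => (if N g then 1 else 0)%:E)); last 2 first.
    + by apply/measurable_EFinP; apply: measurable_fun_ifT => //; exact: measurable_cst.
    + by move=> g; case: (N g).
    transitivity ((star_const n)%:E * II (GTkeys n) (fun _ : env => 0) (fun=> 0%R))%E.
      congr (_ * _)%E; apply: eq_II => g.
      rewrite /gtweight; case: ifPn => [/gtint_decr dec|_]; last by rewrite mul0e.
      rewrite (_ : N g = false) ?mule0//; apply/negbTE; rewrite negbK; apply/allP => i.
      by rewrite mem_iota => /andP[_ i_n]; apply: (dec i.+1 i.+2) => //; lia.
    by rewrite II0 mule0.
rewrite IH// II_cat EFinM -muleA; congr (_ * _)%E.
rewrite -IIZl//; last 3 first.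
- apply: measurable_II; last by move=> g; rewrite mule_ge0// lee_fin gtweight_ge0.
  by apply: emeasurable_funM => //; apply/measurable_EFinP; exact: measurable_gtweight.
- by move=> g; apply: II_ge0 => g'; rewrite mule_ge0// lee_fin gtweight_ge0.
- by rewrite lee_fin exprn_ge0// ltW// polar_const_gt0.
apply: eq_II => g; rewrite /F' muleCA; congr (_ * _)%E.
rewrite -IIZl//; last by rewrite lee_fin gtweight_ge0.
apply: eq_II_in => g' gg'; rewrite gtweightS /F1 EFinM -muleA; congr (_%:E * _)%E.
apply: gtweight_eq => k m kn; symmetry; apply: gg'.
by apply/negP => /mapP[j _ [kE _]]; rewrite kE ltnn in kn.
Qed.

End border_integral.

(** * Volumes and Gaussian averages of Gelfand-Tsetlin patterns *)

Section interlacing_volume.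
Variable R : realType.
Local Notation MR := (measurableTypeR R).
Local Notation lam := (@lebesgue_measure R).

Lemma integral_poly_itv (p q : {poly R}) (a b : R) : a < b -> q^`() = p ->
  (\int[lam]_t (if (a < t) && (t < b) then p.[t] else 0)%:E)%E = (q.[b] - q.[a])%:E.
Proof.
move=> ab dq.
rewrite (_ : (\int[lam]_t _)%E = (\int[lam]_(t in `]a, b[) (p.[t])%:E)%E); last first.
  rewrite [RHS]integral_mkcond; apply: eq_integral => t _.
  by rewrite /patch mem_setE in_itv/=; case: ifP.
rewrite -(@integral_itv_bndoo _ a b _ true false); last first.
  apply/measurable_EFinP/measurable_funTS.
  by apply: continuous_measurable_fun; exact: continuous_horner.
rewrite (@continuous_FTC2 _ (horner p) (horner q))//.
- by apply: continuous_subspaceT; exact: continuous_horner.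
- split.
  + by move=> x _; exact: derivable_horner.
  + by apply: cvg_at_right_filter; exact: continuous_horner.
  + by apply: cvg_at_left_filter; exact: continuous_horner.
- by move=> x _; rewrite -derivE dq.
Qed.

Variables (n : nat) (la : nat -> R).

(* Vandermonde rows in the variables [- e i], the rows in [s] being integrated
   over [la i.+1 < e i < la i]. *)
Let M (s : seq nat) (e : family R nat) : 'M[R]_n := \matrix_(i, j)
  if (i : nat) \in s then ((- la i.+1) ^+ j.+1 - (- la i) ^+ j.+1) / j.+1%:R
  else (- e i) ^+ j.

Let ok (e : family R nat) i := (la i.+1 < e i) && (e i < la i).

Hypothesis dec : forall i, (i < n)%N -> la i.+1 < la i.

Let II_det s s2 b : uniq (s ++ s2) -> {subset s <= iota 0 n} ->
  II s (fun e => (if all (ok e) s then \det (M s2 e) else 0)%:E) b =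
  (\det (M (s ++ s2) b))%:E.
Proof.
elim: s b => [//|k s IH] b /= /andP[kss us] sub.
have kn : (k < n)%N by have := sub k (mem_head _ _); rewrite mem_iota add0n.
have ks : k \notin s by move: kss; rewrite mem_cat negb_or => /andP[].
pose K := Ordinal kn.
pose A := M (k :: s ++ s2) b.
pose c (j : 'I_n) := cofactor A K j.
(* Row [K] is the only one that contains the integrated variable, so the determinant is the
   polynomial [p] in it, with antiderivative [q]. *)
pose p : {poly R} := \sum_j (c j * (-1) ^+ j) *: 'X^j.
pose q : {poly R} := \sum_(j < n) (c j * (-1) ^+ j / j.+1%:R) *: 'X^(j.+1).
have dq : q^`() = p.
  rewrite /q /p raddf_sum; apply: eq_bigr => j _ /=.
  by rewrite derivZ derivXn -scalerMnr scalerMnl -mulr_natr divfK// pnatr_eq0.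
have cofE t j : cofactor (M (s ++ s2) (upd b k t)) K j = c j.
  rewrite /c /cofactor; congr (_ * \det _); apply/matrixP => i l; rewrite !mxE.
  rewrite inE [X in _ = if X || _ then _ else _](_ : _ = false); last first.
    by apply/negbTE; have := neq_lift K i; rewrite eq_sym -(inj_eq val_inj).
  rewrite /=; case: ifP => // _; rewrite updNE//.
  by have := neq_lift K i; rewrite eq_sym -(inj_eq val_inj).
transitivity (\int[lam]_t (if (la k.+1 < t) && (t < la k) then p.[t] else 0)%:E)%E.
  apply: eq_integral => t _.
  have -> : II s (fun e => (if ok e k && all (ok e) s then \det (M s2 e) else 0)%:E)
      (upd b k t) = (if ((la k.+1 < t) && (t < la k))%R then
       II s (fun e => (if all (ok e) s then \det (M s2 e) else 0)%:E) (upd b k t) else 0)%E.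
    case: ifPn => okt.
      apply: eq_II_in => e eb; have -> // : ok e k = true.
      by rewrite /ok eb// updE.
    rewrite -[RHS](II0 s (upd b k t)); apply: eq_II_in => e eb.
    have -> // : ok e k = false.
    by rewrite /ok eb// updE (negbTE okt).
  case: ifP => // _; rewrite IH//; last by move=> j js; apply: sub; rewrite inE js orbT.
  congr (_%:E); rewrite (expand_det_row _ K) horner_sum; apply: eq_bigr => j _.
  rewrite cofE hornerZ hornerXn !mxE /= (negbTE kss) updE.
  by rewrite [(- t) ^+ j]exprNn mulrC mulrA.
rewrite (integral_poly_itv (dec kn) dq); congr (_%:E).
rewrite (expand_det_row _ K) /q !horner_sum -sumrB; apply: eq_bigr => j _.
rewrite -/A -/(c j) !hornerZ !hornerXn !mxE /= inE eqxx /=.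
rewrite [(- la k.+1) ^+ _]exprNn [(- la k) ^+ _]exprNn [(-1) ^+ j.+1]exprS.
by set d := _^-1; ring.
Qed.

(** Subtracting each row of the Vandermonde matrix from the next leaves a single nonzero entry in
    the first column; expanding along it gives the matrix of differences. *)
Lemma det_vandermonde_diff :
  \det (\matrix_(i < n, j < n) ((- la i.+1) ^+ j.+1 - (- la i) ^+ j.+1)) =
  \prod_(i < n.+1) \prod_(j < n.+1 | (i < j)%N) (la i - la j) :> R.
Proof.
pose V : 'M[R]_n.+1 := Vandermonde n.+1 (\row_(i < n.+1) (- la i)).
have VE : \det V^T = \prod_(i < n.+1) \prod_(j < n.+1 | (i < j)%N) (la i - la j).
  rewrite det_tr det_Vandermonde; apply: eq_bigr => i _; apply: eq_bigr => j _.
  by rewrite !mxE opprK addrC.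
pose T : 'M[R]_n.+1 := \matrix_(i, j) ((i == j)%:R - (i == j.+1 :> nat)%:R).
have T1 : \det T = 1.
  rewrite det_trig.
    by rewrite big1// => i _; rewrite mxE eqxx ltn_eqF ?subr0.
  apply/is_trig_mxP => i j ij; rewrite mxE -(inj_eq val_inj)/=.
  by rewrite (ltn_eqF ij) (ltn_eqF (leqW ij)) subr0.
have TV i j : (T *m V^T) i j = if i == ord0 then (- la 0%N) ^+ j else
    (- la i) ^+ j - (- la i.-1) ^+ j.
  rewrite mxE; under eq_bigr do rewrite !mxE mulrBl.
  rewrite sumrB (bigD1 i)//= eqxx mul1r big1 ?addr0; last first.
    by move=> l li; rewrite eq_sym (negbTE li) mul0r.
  case: eqVneq => [->|i0]; first by rewrite big1 ?subr0// => l _; rewrite mul0r.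
  have i1 : (i.-1 < n.+1)%N by apply: leq_ltn_trans (ltn_ord i); exact: leq_pred.
  have ip : (0 < i)%N by rewrite lt0n.
  congr (_ - _); rewrite (bigD1 (Ordinal i1))//= prednK// eqxx mul1r big1 ?addr0//.
  move=> l; rewrite -(inj_eq val_inj) /= => li.
  by case: eqP => [il|]; rewrite ?mul0r//; case/eqP: li; rewrite il.
rewrite -VE -[RHS]mul1r -T1 -det_mulmx (expand_det_col _ ord0) big_ord_recl.
rewrite [X in _ = _ + X]big1 ?addr0; last first.
  by move=> i _; rewrite TV /= !expr0 subrr mul0r.
rewrite TV eqxx expr0 mul1r /cofactor addn0 expr0 mul1r; congr (\det _).
by apply/matrixP => i j; rewrite [LHS]mxE [RHS]mxE [RHS]mxE TV.
Qed.

Lemma vdmE (m : nat) (f : nat -> R) :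
  vdm [seq f i | i <- iota 0 m] = \prod_(i < m) \prod_(j < m | (i < j)%N) (f i - f j).
Proof.
suff H a : vdm [seq f i | i <- iota a m] =
    \prod_(i < m) \prod_(j < m | (i < j)%N) (f (a + i)%N - f (a + j)%N) by rewrite H.
elim: m a => [|m IH] a; first by rewrite /= big_ord0.
rewrite /= big_ord_recl IH; congr (_ * _).
  rewrite big_map [RHS]big_mkcond big_ord_recl /= mul1r addn0.
  rewrite (_ : iota a.+1 m = [seq (a.+1 + i)%N | i <- iota 0 m]); last by rewrite -iotaDl addn0.
  rewrite big_map -val_enum_ord big_map big_enum /=.
  by apply: eq_bigr => j _; rewrite /bump add1n addnS.
apply: eq_bigr => i _; rewrite [RHS]big_mkcond big_ord_recl /= mul1r [LHS]big_mkcond.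
by apply: eq_bigr => j _; rewrite /bump !add1n ltnS !addSnnS.
Qed.

(** The Vandermonde determinant is linear in each row, so every variable is integrated within its
    own row; the denominators [j.+1] collect into [n!]. *)
Lemma II_interlacing b :
  II (iota 0 n) (fun e => (if all (fun i => (la i.+1 < e i) && (e i < la i)) (iota 0 n)
    then vdm [seq e i | i <- iota 0 n] else 0)%:E) b =
  (vdm [seq la i | i <- iota 0 n.+1] / n`!%:R)%:E.
Proof.
transitivity (II (iota 0 n) (fun e =>
    (if all (ok e) (iota 0 n) then \det (M [::] e) else 0)%:E) b).
  apply: eq_II => e; case: ifP => // _; congr (_%:E).
  rewrite vdmE -[RHS]det_tr.
  have -> : (M [::] e)^T = Vandermonde n (\row_(i < n) (- e i)).
    by apply/matrixP => i j; rewrite !mxE.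
  rewrite det_Vandermonde; apply: eq_bigr => i _; apply: eq_bigr => j _.
  by rewrite !mxE opprK addrC.
rewrite II_det ?cats0 ?iota_uniq//; congr (_%:E).
rewrite vdmE -det_vandermonde_diff.
pose D : 'rV[R]_n := \row_j (j.+1%:R^-1).
have -> : M (iota 0 n) b = (\matrix_(i < n, j < n) ((- la i.+1) ^+ j.+1 - (- la i) ^+ j.+1)) *m diag_mx D.
  rewrite mul_mx_diag; apply/matrixP => i j; rewrite !mxE mem_iota /= add0n ltn_ord.
  by [].
rewrite det_mulmx det_diag; congr (_ * _).
under eq_bigr do rewrite mxE.
by rewrite prodfV -natr_prod fact_prod big_add1 /= big_mkord.
Qed.

End interlacing_volume.

(** * Volume of the patterns with a given top row *)

Section gelfand_tsetlin_volume.
Variable R : realType.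
Local Notation env := (family R (nat * nat)).

Definition gtdecr n (g : env) := all (fun i => g (n, i.+1) < g (n, i)) (iota 0 n.-1).

Lemma gtint_gtdecr n g : gtint n g -> gtdecr n g.
Proof.
move=> /gtint_decr dec; apply/allP => i; rewrite mem_iota => /andP[_ i_n].
by apply: (dec i.+1 i.+2) => //; lia.
Qed.

Lemma gtdecr_vdm n g : gtdecr n g -> 0 < gtvdm n g.
Proof.
move=> /allP dec; rewrite /gtvdm (vdm_gt0 (f := fun m => g (n, m)))//.
  exact: iota_ltn_sorted.
move=> i j; rewrite !mem_iota => _ /andP[_ jn] ij.
apply: (@dec_chain _ (fun m => g (n, m)) 0 n.-1); try lia.
by move=> l _ ln; apply: dec; rewrite mem_iota.
Qed.

Fixpoint vol_const n : R := if n is n'.+1 then vol_const n' / n'`!%:R else 1.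

Lemma vol_const_gt0 n : 0 < vol_const n.
Proof. by elim: n => //= n IH; rewrite divr_gt0// ltr0n fact_gt0. Qed.

Definition rowkeys n : seq (nat * nat) := [seq (n, m) | m <- iota 0 n].

Lemma measurable_gtdecr n : measurable_fun setT (gtdecr n).
Proof. by rewrite /gtdecr; mR. Qed.

Lemma measurable_gtint n : measurable_fun setT (@gtint R n).
Proof. by rewrite /gtint; apply: measurable_all => k _; rewrite /interl /gtrow; mR. Qed.

Lemma measurable_gtvdm n : measurable_fun setT (@gtvdm R n).
Proof. by apply: measurable_vdm => i; mR. Qed.

Lemma gtintS n (g : env) : (0 < n)%N ->
  gtint n.+1 g = gtint n g &&
    all (fun i => (g (n.+1, i.+1) < g (n, i)) && (g (n, i) < g (n.+1, i))) (iota 0 n).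
Proof.
case: n => [//|n] _; rewrite /gtint.
have -> : iota 1 n.+2.-1 = iota 1 n ++ [:: n.+1].
  by rewrite -[n.+2.-1]/(n.+1) -{1}[n.+1]addn1 iotaD add1n.
by rewrite all_cat /= andbT.
Qed.

Lemma II_local (K : countType) (D : pred K) s (f : family R K -> \bar R) b b' :
  (forall e e', (forall k, ~~ D k -> e k = e' k) -> f e = f e') ->
  (forall k, ~~ D k -> b k = b' k) -> II s f b = II s f b'.
Proof.
move=> fD; elim: s b b' => [|k s IH] b b' bb' /=; first exact: fD.
apply: eq_integral => t _; apply: IH => j jD; rewrite /upd; case: ifP => // _.
exact: bb'.
Qed.

(** The rows below the top one are integrated out, [F] being blind to them. The induction hypothesis
    removes the rows below the last but one and leaves a Vandermonde factor of that row, which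
    [II_interlacing] then integrates. *)
Lemma II_gtint_vol n (F : env -> \bar R) b : (0 < n)%N ->
  measurable_fun setT F -> (forall g, 0 <= F g)%E ->
  (forall g g', (forall k, k \notin GTkeys n.-1 -> g k = g' k) -> F g = F g') ->
  II (GTkeys n) (fun g => (if gtint n g then 1 else 0)%:E * F g)%E b =
  ((vol_const n)%:E * II (rowkeys n) (fun g => (if gtdecr n g then gtvdm n g else 0)%:E * F g) b)%E.
Proof.
elim: n F b => [//|[|n] IH] F b _ mF F0 Floc.
  rewrite /= fact0 divr1 mul1e; apply: eq_integral => t _.
  by rewrite /gtint /gtdecr /gtvdm /= big_nil mulr1.
have mT : measurable_fun setT (fun g : env => (if gtint n.+2 g then 1 else 0 : R)%:E * F g)%E.
  apply: emeasurable_funM => //; apply/measurable_EFinP; apply: measurable_fun_ifT.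
  - exact: measurable_gtint.
  - exact: measurable_cst.
  - exact: measurable_cst.
rewrite -[GTkeys n.+2]/(GTkeys n.+1 ++ rowkeys n.+2) II_cat.
pose itl (g : env) := all (fun i => (g (n.+2, i.+1) < g (n.+1, i)) && (g (n.+1, i) < g (n.+2, i))) (iota 0 n.+1).
have mitl : measurable_fun setT itl by rewrite /itl; mR.
pose H (g : env) := ((if itl g then 1 else 0)%:E * F g)%E.
have mH : measurable_fun setT H.
  apply: emeasurable_funM => //; apply/measurable_EFinP; apply: measurable_fun_ifT => //;
  exact: measurable_cst.
have H0 g : (0 <= H g)%E by rewrite mule_ge0//; case: ifP.
have rowN k : k \in rowkeys n.+2 -> k.1 = n.+2 by move=> /mapP[j _ ->].
have rowN' k : k \in rowkeys n.+1 -> k.1 = n.+1 by move=> /mapP[j _ ->].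
have GTle m k : k \in GTkeys m -> (k.1 <= m)%N.
  elim: m => [//|m IHm] /=; rewrite mem_cat => /orP[/IHm/leqW//|].
  by move=> /(@mapP _ _ (fun m' => (m.+1, m')) (iota 0 m.+1))[j _ ->].
have mIIH : measurable_fun setT (II (rowkeys n.+2) H) by exact: measurable_II.
have IIH0 g : (0 <= II (rowkeys n.+2) H g)%E by exact: II_ge0.
transitivity (II (GTkeys n.+1) (fun g => (if gtint n.+1 g then 1 else 0)%:E *
    II (rowkeys n.+2) H g)%E b).
  apply: eq_II => g; rewrite -(IIZl _ _ mH H0); last by rewrite lee_fin; case: ifP.
  apply: eq_II_in => g' gg'; rewrite gtintS// /H -/(itl g').
  have -> : gtint n.+1 g' = gtint n.+1 g.
    apply: eq_in_all => k; rewrite mem_iota => /andP[k1 kn].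
    apply: eq_in_all => j _; rewrite /gtrow !gg'//; apply/negP => /rowN /=; lia.
  by case: (gtint n.+1 g); case: (itl g'); rewrite /= ?mul1e ?mul0e.
rewrite [LHS](IH _ _ (ltn0Sn _) mIIH IIH0); last first.
  move=> g g' gg'; apply: (@II_local _ (mem (GTkeys n))) => [e e' ee'|]; last exact: gg'.
  have Erow k j : (n < k)%N -> e (k, j) = e' (k, j).
    by move=> nk; apply: ee'; apply/negP => /GTle /=; lia.
  rewrite /H (Floc e e'); last first.
    by move=> k kn; apply: ee'; apply: contra kn; rewrite /= mem_cat => ->.
  have -> // : itl e = itl e'.
  by apply: eq_in_all => j _; rewrite !Erow.
have vE : (vol_const n.+2)%:E = ((vol_const n.+1)%:E * (n.+1`!%:R^-1)%:E)%E by rewrite -EFinM.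
rewrite [in RHS]vE -[RHS]muleA; congr (_ * _)%E.
have mD m : measurable_fun setT (fun g : env => if gtdecr m g then gtvdm m g else 0).
  apply: measurable_fun_ifT; [exact: measurable_gtdecr|exact: measurable_gtvdm|exact: measurable_cst].
have D0 m (g : env) : (0 <= (if gtdecr m g then gtvdm m g else 0)%:E :> \bar R)%E.
  by rewrite lee_fin; case: ifP => // /gtdecr_vdm/ltW.
have mDF m f : measurable_fun setT f -> measurable_fun setT
    (fun g : env => (if gtdecr m g then gtvdm m g else 0)%:E * f g)%E.
  by move=> mf; apply: emeasurable_funM => //; apply/measurable_EFinP.
have DF0 m f : (forall g, 0 <= f g)%E -> forall g : env,
    (0 <= (if gtdecr m g then gtvdm m g else 0)%:E * f g)%E.
  by move=> f0 g; rewrite mule_ge0.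
transitivity (II (rowkeys n.+1) (II (rowkeys n.+2)
    (fun g => (if gtdecr n.+1 g then gtvdm n.+1 g else 0)%:E * H g)%E) b).
  apply: eq_II => g; rewrite -(IIZl _ _ mH H0); last exact: D0.
  apply: eq_II_in => g' gg'; congr (_%:E * _)%E.
  have E j : g' (n.+1, j) = g (n.+1, j) by apply: gg'; apply/negP => /rowN /=; lia.
  have -> : gtdecr n.+1 g' = gtdecr n.+1 g by apply: eq_in_all => j _; rewrite !E.
  by case: ifP => // _; rewrite /gtvdm; congr vdm; apply: eq_map => j; rewrite E.
rewrite (II_swap _ _ _ (mDF _ _ mH) (DF0 _ _ H0)) -(IIZl _ _ (mDF _ _ mF) (DF0 _ _ F0)); last first.
  by rewrite lee_fin invr_ge0.
apply: eq_II_in => g gb.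
have Floc' g' : (forall k, k \notin rowkeys n.+1 -> g' k = g k) -> F g' = F g.
  move=> gg'; apply: Floc => k kn; apply: gg'; apply: contra kn => kr.
  by rewrite mem_cat kr orbT.
have itlP g' i : itl g' -> (i < n.+1)%N ->
    g' (n.+2, i.+1) < g' (n.+1, i) /\ g' (n.+1, i) < g' (n.+2, i).
  by move=> /allP/(_ i) + i_n; rewrite mem_iota add0n i_n => /(_ isT)/andP.
have itl1 g' : itl g' -> gtdecr n.+1 g'.
  move=> il; apply/allP => i; rewrite mem_iota => /andP[_ i_n].
  have [|h1 _] := itlP g' i il; first by lia.
  by have [|_ h2] := itlP g' i.+1 il; [lia|apply: lt_trans h2 h1].
have itl2 g' : itl g' -> gtdecr n.+2 g'.
  move=> il; apply/allP => i; rewrite mem_iota => /andP[_ i_n].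
  by have [|h1 h2] := itlP g' i il; [lia|apply: lt_trans h1 h2].
pose J (g' : env) := (if itl g' then gtvdm n.+1 g' else 0)%:E : \bar R.
have mJ : measurable_fun setT J.
  apply/measurable_EFinP; apply: measurable_fun_ifT => //; exact: measurable_gtvdm.
have J0 g' : (0 <= J g')%E.
  by rewrite lee_fin; case: ifP => // /itl1/gtdecr_vdm/ltW.
transitivity (II (rowkeys n.+1) (fun g' => F g * J g')%E g).
  apply: eq_II_in => g' gg'; rewrite /H Floc'// /J; case: (boolP (itl g')) => [il|_].
    by rewrite (itl1 _ il) mul1e muleC.
  by rewrite mul0e !mule0.
rewrite (IIZl _ _ mJ J0)// [RHS]muleA [RHS]muleC; congr (_ * _)%E.
case: ifPn => [/allP dec|ndec]; last first.
  rewrite mule0 -(II0 (rowkeys n.+1) g); apply: eq_II_in => g' gg'; rewrite /J.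
  have E : gtdecr n.+2 g' = gtdecr n.+2 g.
    by apply: eq_in_all => j _; rewrite !gg'//; apply/negP => /rowN' /=; lia.
  by case: ifPn => // /itl2; rewrite E (negbTE ndec).
have dec' i : (i < n.+1)%N -> g (n.+2, i.+1) < g (n.+2, i).
  by move=> i_n; apply: dec; rewrite mem_iota.
have sgI : injective (fun m : nat => (n.+1, m)) by move=> i j [].
rewrite -EFinM mulrC -(II_interlacing dec' (fun m => g (n.+1, m))).
rewrite -(II_map _ _ _ sgI); apply: eq_II_in => g' gg'.
have E j : g' (n.+2, j) = g (n.+2, j) by apply: gg'; apply/negP => /rowN' /=; lia.
rewrite /J /itl; congr (if _ then _ else _)%:E.
by apply: eq_in_all => i _; rewrite !E.
Qed.

End gelfand_tsetlin_volume.

(** * Unitary invariance and Gaussian averages over patterns *)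

Section hermitian_coordinates.
Variable R : realType.
Local Notation C := R[i].
Local Notation renv := (family R nat).
Local Notation env := (family R (nat * nat)).

Lemma mem_Mkeys n k : (k \in Mkeys n) = (k.1 < n)%N && (k.2 < n)%N.
Proof.
elim: n k => [//|n IH] k /=; rewrite mem_cat IH inE mem_bvec.
by case: k => i j; rewrite xpair_eqE /=; lia.
Qed.

Lemma uniq_Mkeys n : uniq (Mkeys n).
Proof.
elim: n => [//|n IH] /=; rewrite cat_uniq IH /= uniq_bvec mem_bvec /= ltnn !andbF /= andbT.
rewrite negb_or mem_Mkeys /= ltnn /=; apply/hasPn => -[i j].
by rewrite mem_bvec mem_Mkeys /=; lia.
Qed.

(** The multiplicity of a coordinate in the trace form: an entry off the diagonal occurs a second
    time, conjugated. *)
Definition wt (k : nat * nat) : R := if k.1 == k.2 then 1 else 2.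

Lemma wt_gt0 k : 0 < wt k.
Proof. by rewrite /wt; case: ifP. Qed.

Definition hdot n (e f : env) : R := \sum_(k <- Mkeys n) wt k * (e k * f k).

Lemma sum_iota m (F : nat -> R) : \sum_(i <- iota 0 m) F i = \sum_(i < m) F i.
Proof. by rewrite -val_enum_ord big_map big_enum. Qed.

Lemma sum_iotaS m (F : nat -> R) :
  \sum_(i <- iota 0 m.+1) F i = \sum_(i <- iota 0 m) F i + F m.
Proof. by rewrite !sum_iota big_ord_recr. Qed.

Lemma hdotE n (e f : env) : (hdot n e f)%:C = \tr (mat e n *m mat f n).
Proof.
have -> : \tr (mat e n *m mat f n) = \sum_(i < n) \sum_(j < n) hent e i j * hent f j i.
  apply: eq_bigr => i _; rewrite mxE; apply: eq_bigr => j _; by rewrite !mxE.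
elim: n => [|n IH]; first by rewrite /hdot big_nil big_ord0.
transitivity ((hdot n e f)%:C + (\sum_(i < n) (hent e i n * hent f n i + hent e n i * hent f i n) +
    hent e n n * hent f n n)); last first.
  rewrite IH big_ord_recr /=; under [X in _ = X + _]eq_bigr do rewrite big_ord_recr /=.
  by rewrite !big_split /= big_ord_recr /=; ring.
rewrite /hdot /= big_cat big_cons /= rmorphD; congr (_ + _).
rewrite rmorphD addrC; congr (_ + _); last first.
  by rewrite /hent ltnn eqxx /wt eqxx mul1r rmorphM.
rewrite big_pair_keys (iotaDl 1 0) big_map sum_iota rmorph_sum; apply: eq_bigr => i _.
rewrite /hent /bx /by_ /wt /= ltn_ord (ltn_eqF (ltn_ord i)) (gtn_eqF (ltn_ord i)) (leq_gtF (ltnW (ltn_ord i))).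
by simpc; congr (_ +i* _); ring.
Qed.

Lemma mxtrace_spec n (M : 'M[C]_n) : M \is hermsymmx ->
  \tr M = (\sum_(x <- spec M) x)%:C.
Proof.
move=> Mh; have [U UU {1}->] := spec_diagonalize Mh.
have /unitarymxP UV := UU.
rewrite mxtrace_mulC mulmxA UV mul1mx big_tuple rmorph_sum /spec_diag_mx.
by rewrite mxtrace_diag; apply: eq_bigr => i _; rewrite mxE.
Qed.

Lemma mxtrace_spec2 n (M : 'M[C]_n) : M \is hermsymmx ->
  \tr (M *m M) = (\sum_(x <- spec M) x ^+ 2)%:C.
Proof.
move=> Mh; have [U UU ME] := spec_diagonalize Mh.
have /unitarymxP UV := UU; set D := spec_diag_mx M in ME.
have -> : M *m M = U^t* *m (D *m D) *m U.
  by rewrite ME -!mulmxA (mulmxA U) UV mul1mx.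
rewrite mxtrace_mulC mulmxA UV mul1mx big_tuple rmorph_sum /D /spec_diag_mx mulmx_diag.
by rewrite mxtrace_diag; apply: eq_bigr => i _; rewrite !mxE -expr2 rmorphXn.
Qed.

Lemma sum_spec n (M : 'M[C]_n) (F : R -> R) :
  \sum_(x <- spec M) F x = \sum_(m <- iota 0 n) F (spec M)`_m.
Proof.
by rewrite (big_nth 0) size_tuple /index_iota subn0.
Qed.

Definition gtype (g : env) k := \sum_(m <- iota 0 k.+1) g (k.+1, m) - \sum_(m <- iota 0 k) g (k, m).

Definition rsq n (g : env) := \sum_(m <- iota 0 n) g (n, m) ^+ 2.

Lemma rowsum_gtspec n (e : env) k : (k <= n)%N ->
  \sum_(m <- iota 0 k) gtspec n e (k, m) = \sum_(i <- iota 0 k) e (i, i).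
Proof.
move=> kn; under eq_bigr do rewrite /gtspec /= kn.
rewrite -(sum_spec (mat e k) id); apply: (@complexI R).
rewrite -mxtrace_spec ?mat_herm// sum_iota rmorph_sum; apply: eq_bigr => i _.
by rewrite mxE /hent ltnn eqxx.
Qed.

(** The traces of consecutive minors differ by a diagonal entry. *)
Lemma gtype_gtspec n (e : env) k : (k < n)%N -> gtype (gtspec n e) k = e (k, k).
Proof.
move=> kn; rewrite /gtype !rowsum_gtspec ?(ltnW kn)//.
by rewrite sum_iotaS addrC addKr.
Qed.

Lemma rsq_gtspec n (e : env) : rsq n (gtspec n e) = hdot n e e.
Proof.
rewrite /rsq; under eq_bigr do rewrite /gtspec /= leqnn.
rewrite -(sum_spec (mat e n) (fun x => x ^+ 2)); apply: (@complexI R).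
by rewrite -mxtrace_spec2 ?mat_herm// hdotE.
Qed.

Lemma sum_Mkeys_diag n (F : nat -> R) :
  \sum_(k <- Mkeys n) (if k.1 == k.2 then F k.1 else 0) = \sum_(i <- iota 0 n) F i.
Proof.
elim: n => [|n IH]; first by rewrite !big_nil.
rewrite sum_iotaS /= big_cat IH big_cons /= eqxx; congr (_ + _).
rewrite [X in _ + X]big_seq big1 ?addr0// => -[i j]; rewrite mem_bvec /= => H.
by case: eqP => // ij; exfalso; move: H; rewrite ij; lia.
Qed.

Definition hcoord n (M : 'M[C]_n) (k : nat * nat) : R :=
  if insub k.1 is Some i then if insub k.2 is Some j then herm_coord M (i, j) else 0 else 0.

Lemma hcoordE n (M : 'M[C]_n) (i j : 'I_n) : hcoord M (i : nat, j : nat) = herm_coord M (i, j).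
Proof. by rewrite /hcoord /= !valK. Qed.

Definition conjenv n (U : 'M[C]_n) (e : env) : env := fun k =>
  if (k.1 < n)%N && (k.2 < n)%N then hcoord (U *m mat e n *m U^t*) k else e k.

Lemma mat_hcoord n (M : 'M[C]_n) (e : env) : M \is hermsymmx ->
  (forall i j : 'I_n, e (i : nat, j : nat) = herm_coord M (i, j)) -> mat e n = M.
Proof.
move=> /hermsymmxP Mh He; apply/matrixP => i j; rewrite mxE /hent !He /herm_coord /= leqnn.
have [ij|ij|/val_inj->] := ltngtP i j.
- by case: (M i j).
- by rewrite [RHS]Mh; case: (M j i).
- have := Mh j j; case: (M j j) => a b; rewrite conjC_conjc => -[] bE.
  by have -> : b = 0 by lra.
Qed.

Lemma conj_herm n (U M : 'M[C]_n) : M \is hermsymmx -> U *m M *m U^t* \is hermsymmx.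
Proof.
move=> /is_hermitianmxP; rewrite expr0 scale1r => ME; apply/is_hermitianmxP.
rewrite expr0 scale1r !trmx_mul !map_mxM -ME mulmxA; congr (_ *m _ *m _).
by apply/matrixP => i j; rewrite !mxE /= conjCK.
Qed.

Lemma mat_conjenv n (U : 'M[C]_n) e : mat (conjenv U e) n = U *m mat e n *m U^t*.
Proof.
apply: mat_hcoord; first exact: conj_herm (mat_herm _ _).
by move=> i j; rewrite /conjenv /= !ltn_ord hcoordE.
Qed.

Lemma cmeas_conj n (U : 'M[C]_n) i j : cmeas (fun e : env => (U *m mat e n *m U^t*) i j).
Proof.
rewrite (_ : (fun e => _) = fun e : env =>
    \sum_(k < n) (\sum_(l < n) U i l * hent e l k) * (U^t*) k j).
  apply: cmeas_sum => k; apply: cmeasM; last exact: cmeas_cst.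
  by apply: cmeas_sum => l; apply: cmeasM; [exact: cmeas_cst|apply: cmeas_hent; mR].
apply/funext => e; rewrite mxE; apply: eq_bigr => k _; congr (_ * _).
by rewrite mxE; apply: eq_bigr => l _; rewrite mxE.
Qed.

Lemma measurable_conjenv n (U : 'M[C]_n) : measurable_fun setT (conjenv U).
Proof.
apply: measurable_envP => k; rewrite /conjenv.
case: (_ && _); last exact: measurable_coord.
rewrite /hcoord; case: insub => [i|]; last exact: measurable_cst.
case: insub => [j|]; last exact: measurable_cst.
rewrite /herm_coord /=; case: (i <= j)%N; [by case: (cmeas_conj U i j)|by case: (cmeas_conj U j i)].
Qed.

Lemma herm_coordD n (M N : 'M[C]_n) k : herm_coord (M + N) k = herm_coord M k + herm_coord N k.
Proof.
rewrite /herm_coord; case: ifP => _; rewrite mxE.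
  by case: (M k.1 k.2) => ? ?; case: (N k.1 k.2).
by case: (M k.2 k.1) => ? ?; case: (N k.2 k.1).
Qed.

Lemma mat_addenv n (e v : env) : mat (addenv (Mkeys n) e v) n = mat e n + mat v n.
Proof.
apply/matrixP => i j; rewrite !mxE /hent /addenv !mem_Mkeys /= !ltn_ord /=.
by case: (ltngtP i j) => ij; simpc => //; congr (_ +i* _); ring.
Qed.

(** Conjugation preserves the trace form, so [II_isometry] applies with the weights [wt]. *)
Lemma II_conjenv n (U : 'M[C]_n) (f : env -> \bar R) b : U \is unitarymx ->
  measurable_fun setT f -> (forall e, 0 <= f e)%E ->
  II (Mkeys n) (fun e => f (conjenv U e)) b = II (Mkeys n) f b.
Proof.
move=> UU mf f0; have UV : U *m U^t* = 1%:M by apply/unitarymxP.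
have VU : U^t* *m U = 1%:M by apply: mulmx1C.
have inM k : k \in Mkeys n -> exists i j : 'I_n, k = (i : nat, j : nat).
  by case: k => i j; rewrite mem_Mkeys => /andP[i_n jn]; exists (Ordinal i_n), (Ordinal jn).
have coordE e (i j : 'I_n) : conjenv U e (i : nat, j : nat) = herm_coord (U *m mat e n *m U^t*) (i, j).
  by rewrite /conjenv /= !ltn_ord hcoordE.
apply: (II_isometry (uniq_Mkeys n) wt_gt0) => //.
- exact: measurable_conjenv.
- by move=> e k; rewrite mem_Mkeys /conjenv => /negbTE->.
- move=> e e' ee' k /inM[i [j ->]]; rewrite !coordE.
  have -> // : mat e n = mat e' n.
  by apply: mat_eq => a c an cn; apply: ee'; rewrite mem_Mkeys an cn.
- move=> e v k /inM[i [j ->]]; rewrite !coordE mat_addenv mulmxDr mulmxDl.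
  exact: herm_coordD.
- move=> y; exists (conjenv (U^t*) y) => k /inM[i [j ->]]; rewrite coordE mat_conjenv.
  have -> : (U^t*)^t* = U by apply/matrixP => a c; rewrite !mxE /= conjCK.
  rewrite !mulmxA UV mul1mx -mulmxA UV mulmx1.
  by rewrite herm_coord_mat.
- move=> e; apply: (@complexI R).
  transitivity ((hdot n (conjenv U e) (conjenv U e))%:C).
    by congr (_%:C); apply: eq_bigr => k _; rewrite expr2.
  transitivity ((hdot n e e)%:C); last by congr (_%:C); apply: eq_bigr => k _; rewrite expr2.
  rewrite !hdotE mat_conjenv -!mulmxA [U^t* *m (U *m _)]mulmxA VU mul1mx.
  by rewrite mxtrace_mulC -!mulmxA VU mulmx1.
Qed.

Lemma star_inv n (F : env -> \bar R) : measurable_fun setT F -> (forall g, 0 <= F g)%E ->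
  II (GTkeys n) (fun g => (gtweight n g)%:E * F g)%E (fun=> 0%R) =
  (((star_const R n)^-1)%:E * II (Mkeys n) (fun e => F (gtspec n e)) (fun=> 0%R))%E.
Proof.
move=> mF F0; rewrite star// muleA -EFinM mulVf ?mul1e// gt_eqF//.
exact: star_const_gt0.
Qed.

Definition gt_gauss_const n (A : R) : R :=
  (star_const R n)^-1 * \prod_(k <- Mkeys n) gauss_const (wt k / A)^-1.

Lemma gt_gauss_const_gt0 n A : 0 < A -> 0 < gt_gauss_const n A.
Proof.
move=> A0; rewrite mulr_gt0 ?invr_gt0 ?star_const_gt0// prodr_gt0// => k _.
by rewrite gauss_const_gt0// invr_gt0 divr_gt0// wt_gt0.
Qed.

Lemma measurable_gtype k : measurable_fun setT (fun g : env => gtype g k).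
Proof. by rewrite /gtype; mR. Qed.

Lemma measurable_rsq k : measurable_fun setT (@rsq k).
Proof. by rewrite /rsq; mR. Qed.

Lemma measurable_gtypes n (d : nat -> R) :
  measurable_fun setT (fun g : env => \sum_(i <- iota 0 n) gtype g i * d i).
Proof.
apply: measurable_sum => i; apply: measurable_funM; last exact: measurable_cst.
exact: measurable_gtype.
Qed.

(** Pulled back to matrices by [star], [rsq] becomes the trace of the square and the type becomes
    the diagonal, so the integral is a product of Gaussian integrals in one variable. *)
Lemma II_gt_gauss n (A kap : R) (d : nat -> R) : 0 < A ->
  II (GTkeys n) (fun g => (gtweight n g)%:E *
    (expR (- (rsq n g / (2 * A)) + kap * \sum_(i <- iota 0 n) gtype g i * d i))%:E)%E (fun=> 0) =
  (gt_gauss_const n A * expR (kap ^+ 2 * A / 2 * \sum_(i <- iota 0 n) d i ^+ 2))%:E.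
Proof.
move=> A0.
rewrite (@star_inv _ (fun g => (expR (- (rsq n g / (2 * A)) +
   kap * \sum_(i <- iota 0 n) gtype g i * d i))%:E)); last 2 first.
- apply/measurable_EFinP; apply: (measurable_comp_fun (@measurable_expR _)).
  apply: measurable_funD; last by apply: measurable_funM; [exact: measurable_cst|exact: measurable_gtypes].
  apply: measurable_funN; apply: measurable_funM; [exact: measurable_rsq|exact: measurable_cst].
- by move=> g; rewrite lee_fin expR_ge0.
rewrite /gt_gauss_const -(mulrA (star_const R n)^-1) [RHS]EFinM; congr (_ * _)%E.
pose c (k : nat * nat) : R := if k.1 == k.2 then kap * d k.1 else 0.
have w0 k : 0 < wt k / A by rewrite divr_gt0 ?wt_gt0.
have A1 : A != 0 by rewrite gt_eqF.
transitivity (II (Mkeys n) (fun e : env => (expR (\sum_(k <- Mkeys n)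
    (- (wt k / A * e k ^+ 2 / 2) + c k * e k)))%:E) (fun=> 0)).
  apply: eq_II => e; congr (_%:E); congr expR.
  rewrite rsq_gtspec big_split /=; congr (_ + _).
    rewrite /hdot mulr_suml -sumrN; apply: eq_bigr => k _.
    by field.
  have -> : \sum_(k <- Mkeys n) c k * e k =
      \sum_(k <- Mkeys n) (if k.1 == k.2 then kap * (e (k.1, k.1) * d k.1) else 0).
    apply: eq_bigr => -[i j] _; rewrite /c /=; case: eqP => [->|_]; last by rewrite mul0r.
    by ring.
  rewrite (sum_Mkeys_diag n (fun i => kap * (e (i, i) * d i))) mulr_sumr.
  rewrite big_seq [RHS]big_seq; apply: eq_bigr => i; rewrite mem_iota => /andP[_ i_n].
  by rewrite gtype_gtspec.
rewrite (II_gaussian (uniq_Mkeys n) w0); congr (_ * expR _)%:E.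
have -> : \sum_(k <- Mkeys n) c k ^+ 2 / (2 * (wt k / A)) =
    \sum_(k <- Mkeys n) (if k.1 == k.2 then kap ^+ 2 * A / 2 * d k.1 ^+ 2 else 0).
  apply: eq_bigr => -[i j] _; rewrite /c /wt /=; case: eqP => _.
    by field.
  by rewrite expr0n mul0r.
by rewrite (sum_Mkeys_diag n (fun i => kap ^+ 2 * A / 2 * d i ^+ 2)) mulr_sumr.
Qed.

Definition decrn n (d : nat -> R) := all (fun i => d i.+1 < d i) (iota 0 n.-1).

Definition vdm2 n (d : nat -> R) : R :=
  if decrn n d then vdm [seq d i | i <- iota 0 n] ^+ 2 else 0.

Lemma vdm2_ge0 n d : 0 <= vdm2 n d.
Proof. by rewrite /vdm2; case: ifP => // _; exact: sqr_ge0. Qed.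

Lemma measurable_vdm2 n : measurable_fun setT (vdm2 n : renv -> R).
Proof.
apply: measurable_fun_ifT; [by rewrite /decrn; mR| |exact: measurable_cst].
by apply: measurable_funX; apply: measurable_vdm => i; mR.
Qed.

Definition spec_const n : R := star_const R n * vol_const R n.

Lemma spec_const_gt0 n : 0 < spec_const n.
Proof. by rewrite mulr_gt0 ?star_const_gt0 ?vol_const_gt0. Qed.

Lemma GTkeys_le m k : k \in GTkeys m -> (k.1 <= m)%N.
Proof.
elim: m => [//|m IHm] /=; rewrite mem_cat => /orP[/IHm/leqW//|].
by move=> /(@mapP _ _ (fun m' => (m.+1, m')) (iota 0 m.+1))[j _ ->].
Qed.

(** One Vandermonde factor comes from [star], the other from the volume of the patterns below the
    spectrum. *)
Lemma II_spec n (phi : renv -> \bar R) b : (0 < n)%N ->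
  measurable_fun setT phi -> (forall r, 0 <= phi r)%E ->
  II (Mkeys n) (fun e => phi (specenv (mat e n))) b =
  ((spec_const n)%:E * II (iota 0 n) (fun d => (vdm2 n d)%:E * phi d) (fun=> 0%R))%E.
Proof.
move=> n0 mphi phi0.
have mrow : measurable_fun setT (fun g : env => gtrow g n).
  by apply: measurable_envP => i; rewrite /gtrow; mR.
have mphin : measurable_fun setT (fun g : env => phi (gtrow g n)).
  exact: measurable_comp_fun mphi mrow.
transitivity (II (Mkeys n) (fun e => phi (gtrow (gtspec n e) n)) b).
  by apply: eq_II => e; congr phi; apply/funext => i; rewrite /gtrow /gtspec /= leqnn.
rewrite (@star _ _ (fun g => phi (gtrow g n)))// /spec_const EFinM -muleA; congr (_ * _)%E.
pose V (g : env) : R := if gtdecr n g then gtvdm n g else 0.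
have V0 g : 0 <= V g by rewrite /V; case: ifP => // /gtdecr_vdm/ltW.
have mV : measurable_fun setT V.
  by apply: measurable_fun_ifT; [exact: measurable_gtdecr|exact: measurable_gtvdm|exact: measurable_cst].
transitivity (II (GTkeys n) (fun g => (if gtint n g then 1 else 0)%:E *
    ((V g)%:E * phi (gtrow g n)))%E (fun=> 0)).
  apply: eq_II => g; rewrite muleA -EFinM /gtweight /V; congr (_%:E * _)%E.
  by case: ifPn => [/gtint_gtdecr->|_]; rewrite ?mul1r ?mul0r.
rewrite (II_gtint_vol (F := fun g => (V g)%:E * phi (gtrow g n))%E)//; last 3 first.
- by apply: emeasurable_funM => //; apply/measurable_EFinP.
- by move=> g; rewrite mule_ge0// lee_fin.
- move=> g g' gg'; have E m : g (n, m) = g' (n, m).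
    by apply: gg'; apply/negP => /GTkeys_le /=; lia.
  congr (_%:E * phi _)%E; last by apply/funext => i; exact: E.
  rewrite /V; have -> : gtdecr n g = gtdecr n g' by apply: eq_in_all => j _; rewrite !E.
  by case: ifP => // _; rewrite /gtvdm; congr vdm; apply: eq_map => j; exact: E.
congr (_ * _)%E.
have sgI : injective (fun m : nat => (n, m)) by move=> i j [].
rewrite -[RHS](II_map (iota 0 n) (fun d => (vdm2 n d)%:E * phi d)%E (fun=> 0) sgI).
apply: eq_II => g; rewrite muleA -EFinM; congr (_%:E * _)%E.
by rewrite /V /vdm2 /gtdecr /decrn /gtvdm /=; case: ifP => // _; rewrite ?mul0r// expr2.
Qed.

(* Harish-Chandra type identity: averaging [exp (kap tr (M D))] over the
   conjugates of [D] amounts to averaging over all minors of [M], by unitary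
   invariance of the Lebesgue measure on Hermitian matrices. *)
Definition type_gauss n (v kap : R) (g : env) : \bar R :=
  II (iota 0 n) (fun d => (vdm2 n d * expR (- (\sum_(i <- iota 0 n) d i ^+ 2 / (2 * v)) +
    kap * \sum_(i <- iota 0 n) gtype g i * d i))%:E) (fun=> 0).

Lemma type_gauss_ge0 n v kap g : (0 <= type_gauss n v kap g)%E.
Proof. by apply: II_ge0 => d; rewrite lee_fin mulr_ge0 ?vdm2_ge0 ?expR_ge0. Qed.

Lemma measurable_type_gauss n v kap : measurable_fun setT (type_gauss n v kap).
Proof.
apply: measurable_II_param; last exact: measurable_cst.
  apply/measurable_EFinP; apply: measurable_funM.
    exact: (measurable_comp_fun (measurable_vdm2 n) measurable_snd).
  by rewrite /gtype; mR.
by move=> g d; rewrite lee_fin mulr_ge0 ?vdm2_ge0 ?expR_ge0.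
Qed.

Definition herm_gauss_const n (v : R) : R :=
  (spec_const n)^-1 * \prod_(k <- Mkeys n) gauss_const (wt k / v)^-1.

Lemma herm_gauss_const_gt0 n v : 0 < v -> 0 < herm_gauss_const n v.
Proof.
move=> v0; rewrite mulr_gt0 ?invr_gt0 ?spec_const_gt0// prodr_gt0// => k _.
by rewrite gauss_const_gt0// invr_gt0 divr_gt0// wt_gt0.
Qed.

Lemma measurable_hdot d (T : measurableType d) (e f : T -> env) n :
  measurable_fun setT e -> measurable_fun setT f ->
  measurable_fun setT (fun x => hdot n (e x) (f x)).
Proof. by move=> me mf; rewrite /hdot; mR. Qed.

(** With [d] realised as the spectrum of a Hermitian [N], the pairing of the type with [d] is
    [tr (M D)] for [D] the diagonalised [N]. Conjugating [M] by the eigenbasis of [N] keeps its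
    spectrum and makes the pairing [tr (M N)]; the integral over [N] is then Gaussian and produces
    [kap^2 v tr (M^2) / 2]. *)
Lemma II_type_gauss n (v kap : R) (f : renv -> \bar R) : (0 < n)%N -> 0 < v ->
  measurable_fun setT f -> (forall r, 0 <= f r)%E ->
  II (GTkeys n) (fun g => (gtweight n g)%:E * (f (gtrow g n) * type_gauss n v kap g))%E (fun=> 0) =
  ((herm_gauss_const n v)%:E * II (GTkeys n) (fun g => (gtweight n g)%:E *
     (f (gtrow g n) * (expR (kap ^+ 2 * v / 2 * rsq n g))%:E))%E (fun=> 0%R))%E.
Proof.
move=> n0 v0 mf f0.
have mrow : measurable_fun setT (fun g : env => gtrow g n).
  by apply: measurable_envP => i; rewrite /gtrow; mR.
have mfrow : measurable_fun setT (fun g : env => f (gtrow g n)).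
  exact: measurable_comp_fun mf mrow.
pose W (g : env) (d : renv) : R := expR (- (\sum_(i <- iota 0 n) d i ^+ 2 / (2 * v)) +
    kap * \sum_(i <- iota 0 n) gtype g i * d i).
have mW : measurable_fun setT (fun p : env * renv => W p.1 p.2) by rewrite /W /gtype; mR.
have mvW : measurable_fun setT (fun p : env * renv => (vdm2 n p.2 * W p.1 p.2)%:E).
  apply/measurable_EFinP; apply: measurable_funM => //.
  exact: (measurable_comp_fun (measurable_vdm2 n) measurable_snd).
have vW0 (g : env) (d : renv) : (0 <= (vdm2 n d * W g d)%:E)%E.
  by rewrite lee_fin mulr_ge0 ?vdm2_ge0 ?expR_ge0.
have mtg : measurable_fun setT (type_gauss n v kap).
  exact: (measurable_II_param (iota 0 n) mvW vW0 (@measurable_cst _ _ _ _ _ _)).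
have tg0 g : (0 <= type_gauss n v kap g)%E by apply: II_ge0 => d; exact: vW0.
have tgE g : type_gauss n v kap g = (((spec_const n)^-1)%:E *
    II (Mkeys n) (fun N => (W g (specenv (mat N n)))%:E) (fun=> 0%R))%E.
  rewrite (@II_spec n (fun d => (W g d)%:E))//; last 2 first.
  - apply/measurable_EFinP; exact: (measurable_comp_fun mW
      (measurable_fun_pair (@measurable_cst _ _ _ _ _ _) (@measurable_id _ _ _))).
  - by move=> d; rewrite lee_fin expR_ge0.
  rewrite muleA -EFinM mulVf ?gt_eqF ?spec_const_gt0// mul1e.
  by apply: eq_II => d; rewrite -EFinM.
rewrite (@star_inv n (fun g => f (gtrow g n) * type_gauss n v kap g)%E); last 2 first.
- exact: emeasurable_funM.
- by move=> g; rewrite mule_ge0.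
rewrite (@star_inv n (fun g => f (gtrow g n) * (expR (kap ^+ 2 * v / 2 * rsq n g))%:E)%E); last 2 first.
- apply: emeasurable_funM => //; apply/measurable_EFinP.
  apply: (measurable_comp_fun (@measurable_expR _)); apply: measurable_funM; [exact: measurable_cst|exact: measurable_rsq].
- by move=> g; rewrite mule_ge0// lee_fin expR_ge0.
rewrite [RHS]muleCA; congr (_ * _)%E.
pose h (M N : env) : \bar R := (f (gtrow (gtspec n M) n) *
  (expR (- (hdot n N N / (2 * v)) + kap * \sum_(i <- iota 0 n) M (i, i) * specenv (mat N n) i))%:E)%E.
pose h' (M N : env) : \bar R := (f (gtrow (gtspec n M) n) *
  (expR (- (hdot n N N / (2 * v)) + kap * hdot n M N))%:E)%E.
have mfg : measurable_fun setT (fun p : env * env => f (gtrow (gtspec n p.1) n)).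
  exact: (measurable_comp_fun mfrow (measurable_comp_fun (@measurable_gtspec R n) measurable_fst)).
have mh : measurable_fun setT (fun p : env * env => h p.1 p.2).
  apply: emeasurable_funM => //; apply/measurable_EFinP.
  apply: (measurable_comp_fun (@measurable_expR _)); apply: measurable_funD.
    by mR; apply: measurable_hdot; exact: measurable_snd.
  apply: measurable_funM; first exact: measurable_cst.
  apply: measurable_sum => i; apply: measurable_funM; first by mR.
  by rewrite /specenv; apply: measurable_spec_mat; exact: measurable_snd.
have mh' : measurable_fun setT (fun p : env * env => h' p.1 p.2).
  apply: emeasurable_funM => //; apply/measurable_EFinP.
  apply: (measurable_comp_fun (@measurable_expR _)); apply: measurable_funD.
    by mR; apply: measurable_hdot; exact: measurable_snd.
  apply: measurable_funM; first exact: measurable_cst.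
  by apply: measurable_hdot; [exact: measurable_fst|exact: measurable_snd].
have h0 M N : (0 <= h M N)%E by rewrite mule_ge0// lee_fin expR_ge0.
have h0' M N : (0 <= h' M N)%E by rewrite mule_ge0// lee_fin expR_ge0.
have specsq N : \sum_(i <- iota 0 n) specenv (mat N n) i ^+ 2 = hdot n N N.
  by rewrite -rsq_gtspec /rsq; apply: eq_bigr => i _; rewrite /gtspec /= leqnn.
have mWM (M : env) : measurable_fun setT (fun N : env => (W (gtspec n M) (specenv (mat N n)))%:E).
  apply/measurable_EFinP; apply: (measurable_comp_fun mW (measurable_fun_pair _ _)).
    exact: measurable_cst.
  exact: measurable_specenv (@measurable_id _ _ _).
have mhM M : measurable_fun setT (h M).
  exact: (measurable_comp_fun mh (measurable_fun_pair (@measurable_cst _ _ _ _ _ _) (@measurable_id _ _ _))).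
have mhN N : measurable_fun setT (h ^~ N).
  exact: (measurable_comp_fun mh (measurable_fun_pair (@measurable_id _ _ _) (@measurable_cst _ _ _ _ _ _))).
transitivity (((spec_const n)^-1)%:E * II (Mkeys n) (fun M => II (Mkeys n) (h M) (fun=> 0%R)) (fun=> 0%R))%E.
  rewrite -IIZl//; last 3 first.
  - exact: (measurable_II_param (Mkeys n) mh h0 (@measurable_cst _ _ _ _ _ _)).
  - by move=> M; exact: II_ge0.
  - by rewrite lee_fin invr_ge0 ltW// spec_const_gt0.
  apply: eq_II => M; rewrite tgE muleCA; congr (_ * _)%E.
  rewrite -(IIZl _ _ (mWM M))//; last by move=> N; rewrite lee_fin expR_ge0.
  apply: eq_II => N; congr (_ * _)%E; congr (_%:E); congr expR; congr (_ + kap * _).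
    by rewrite -specsq mulr_suml.
  rewrite big_seq [RHS]big_seq; apply: eq_bigr => i; rewrite mem_iota => /andP[_ i_n].
  by rewrite gtype_gtspec.
rewrite /herm_gauss_const EFinM -muleA; congr (_ * _)%E.
rewrite II_II_swap//.
transitivity (II (Mkeys n) (fun N => II (Mkeys n) (h' ^~ N) (fun=> 0)) (fun=> 0)).
  apply: eq_II => N; have [U UU NE] := spec_diagonalize (mat_herm N n).
  rewrite -(@II_conjenv n U (h ^~ N))//.
  apply: eq_II => M; rewrite /h /h'; congr (f _ * _)%E.
    have spE : spec (mat (conjenv U M) n) = spec (mat M n).
      apply: spec_char_poly; [exact: mat_herm|exact: mat_herm|].
      have := @char_poly_similar R n (U^t*) (mat M n); rewrite trmxC_unitary trmxCK => /(_ UU) <-.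
      by rewrite mat_conjenv.
    apply/funext => i.
    rewrite -[LHS]/(if (n <= n)%N then (spec (mat (conjenv U M) n))`_i else 0).
    by rewrite -[RHS]/(if (n <= n)%N then (spec (mat M n))`_i else 0) spE.
  congr (_%:E); congr expR; congr (_ + kap * _).
  set D := spec_diag_mx (mat N n) in NE.
  apply: (@complexI R); rewrite hdotE [in RHS]NE !mulmxA [RHS]mxtrace_mulC !mulmxA -mat_conjenv.
  rewrite /D /spec_diag_mx mul_mx_diag sum_iota rmorph_sum; apply: eq_bigr => i _.
  by rewrite !mxE /hent ltnn eqxx rmorphM /specenv (tnth_nth 0).
rewrite -II_II_swap// -IIZl//; last 3 first.
- apply: emeasurable_funM; first exact: measurable_comp_fun mfrow (@measurable_gtspec R n).
  apply/measurable_EFinP; apply: (measurable_comp_fun (@measurable_expR _)).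
  apply: measurable_funM; first exact: measurable_cst.
  exact: measurable_comp_fun (measurable_rsq n) (@measurable_gtspec R n).
- by move=> M; rewrite mule_ge0// lee_fin expR_ge0.
- rewrite lee_fin prodr_ge0// => k _.
  by rewrite ltW// gauss_const_gt0// invr_gt0 divr_gt0// wt_gt0.
apply: eq_II => M; rewrite muleCA.
have mexp : measurable_fun setT (fun N => (expR (- (hdot n N N / (2 * v)) + kap * hdot n M N))%:E).
  apply/measurable_EFinP; apply: (measurable_comp_fun (@measurable_expR _)); apply: measurable_funD.
    by mR; apply: measurable_hdot; exact: measurable_id.
  apply: measurable_funM; first exact: measurable_cst.
  by apply: measurable_hdot; [exact: measurable_cst|exact: measurable_id].
rewrite (IIZl _ _ mexp)//.
congr (_ * _)%E.
have w0 k : 0 < wt k / v by rewrite divr_gt0 ?wt_gt0.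
have v1 : v != 0 by rewrite gt_eqF.
transitivity (II (Mkeys n) (fun N : env => (expR (\sum_(k <- Mkeys n)
    (- (wt k / v * N k ^+ 2 / 2) + (kap * wt k * M k) * N k)))%:E) (fun=> 0)).
  apply: eq_II => N; congr (_%:E); congr expR; rewrite big_split /=; congr (_ + _).
    rewrite /hdot mulr_suml -sumrN; apply: eq_bigr => k _.
    by field.
  by rewrite /hdot mulr_sumr; apply: eq_bigr => k _; ring.
rewrite (II_gaussian (uniq_Mkeys n) w0) -EFinM; congr (_ * expR _)%:E.
rewrite rsq_gtspec /hdot mulr_sumr; apply: eq_bigr => k _.
by field; rewrite v1 gt_eqF// wt_gt0.
Qed.

End hermitian_coordinates.

(** * The octahedron recurrence as a volume-preserving map *)

Section rhombi.
Variable R : realType.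
Variables (n : nat) (F : nat -> nat -> nat -> nat -> R).

Hypothesis rel : forall p0 p1 p2 p3, (p0 + p1 + p2 + p3 + 2 = n)%N ->
  F p0 p1.+1 p2 p3.+1 + F p0.+1 p1 p2.+1 p3 =
  Num.max (F p0.+1 p1.+1 p2 p3 + F p0 p1 p2.+1 p3.+1)
          (F p0.+1 p1 p2 p3.+1 + F p0 p1.+1 p2.+1 p3).

(* [rhoad p] is the strict rhombus inequality at [p] with acute direction [a]
   in the face directions other than [d]. *)
Definition rho13 p0 p1 p2 p3 :=
  F p0.+1 p1 p2.+1 p3 + F p0 p1.+2 p2 p3 < F p0.+1 p1.+1 p2 p3 + F p0 p1.+1 p2.+1 p3.
Definition rho12 p0 p1 p2 p3 :=
  F p0.+1 p1 p2 p3.+1 + F p0 p1.+2 p2 p3 < F p0.+1 p1.+1 p2 p3 + F p0 p1.+1 p2 p3.+1.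
Definition rho10 p0 p1 p2 p3 :=
  F p0 p1 p2.+1 p3.+1 + F p0 p1.+2 p2 p3 < F p0 p1.+1 p2.+1 p3 + F p0 p1.+1 p2 p3.+1.
Definition rho31 p0 p1 p2 p3 :=
  F p0.+1 p1 p2.+1 p3 + F p0 p1 p2 p3.+2 < F p0.+1 p1 p2 p3.+1 + F p0 p1 p2.+1 p3.+1.
Definition rho32 p0 p1 p2 p3 :=
  F p0.+1 p1.+1 p2 p3 + F p0 p1 p2 p3.+2 < F p0.+1 p1 p2 p3.+1 + F p0 p1.+1 p2 p3.+1.
Definition rho30 p0 p1 p2 p3 :=
  F p0 p1.+1 p2.+1 p3 + F p0 p1 p2 p3.+2 < F p0 p1 p2.+1 p3.+1 + F p0 p1.+1 p2 p3.+1.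
Definition rho23 p0 p1 p2 p3 :=
  F p0.+1 p1.+1 p2 p3 + F p0 p1 p2.+2 p3 < F p0.+1 p1 p2.+1 p3 + F p0 p1.+1 p2.+1 p3.
Definition rho21 p0 p1 p2 p3 :=
  F p0.+1 p1 p2 p3.+1 + F p0 p1 p2.+2 p3 < F p0.+1 p1 p2.+1 p3 + F p0 p1 p2.+1 p3.+1.
Definition rho20 p0 p1 p2 p3 :=
  F p0 p1.+1 p2 p3.+1 + F p0 p1 p2.+2 p3 < F p0 p1.+1 p2.+1 p3 + F p0 p1 p2.+1 p3.+1.

Let max_lra (x y z : R) : z = Num.max x y -> [/\ x <= z, y <= z & z = x \/ z = y].
Proof. by move=> ->; case: (leP x y) => xy; split; [|lra|right|lra|lra|left]. Qed.

(** After [F p0.+1 p1 p2.+1 p3] is added to both sides of the two inequalities on the right, the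
    term attaining the maximum in the recurrence gives [rho13]; since the maximum dominates both
    terms, the converse holds too. *)
Lemma rho1_local p0 p1 p2 p3 : (p0 + p1 + p2 + p3 + 2 = n)%N ->
  rho13 p0 p1 p2 p3 <-> rho12 p0 p1 p2 p3 /\ rho10 p0 p1 p2 p3.
Proof.
move=> pn; have [h1 h2 h3] := max_lra (rel pn); rewrite /rho13 /rho12 /rho10.
by split=> [?|[? ?]]; [split|case: h3 => ?]; lra.
Qed.

Lemma rho3_local p0 p1 p2 p3 : (p0 + p1 + p2 + p3 + 2 = n)%N ->
  rho31 p0 p1 p2 p3 <-> rho32 p0 p1 p2 p3 /\ rho30 p0 p1 p2 p3.
Proof.
move=> pn; have [h1 h2 h3] := max_lra (rel pn); rewrite /rho31 /rho32 /rho30.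
by split=> [?|[? ?]]; [split|case: h3 => ?]; lra.
Qed.

Lemma rho2_local p0 p1 p2 p3 : (p0 + p1 + p2 + p3 + 2 = n)%N ->
  rho20 p0 p1 p2 p3 <-> rho21 p0 p1 p2 p3 /\ rho23 p0 p1 p2 p3.
Proof.
move=> pn; have [h1 h2 h3] := max_lra (rel pn); rewrite /rho20 /rho21 /rho23.
by split=> [?|[? ?]]; [split|case: h3 => ?]; lra.
Qed.

Definition rho_initial := forall p0 p1 p2 p3, (p0 + p1 + p2 + p3 + 2 = n)%N ->
  (p3 = 0%N -> rho13 p0 p1 p2 p3 /\ rho23 p0 p1 p2 p3) /\
  (p1 = 0%N -> rho21 p0 p1 p2 p3 /\ rho31 p0 p1 p2 p3).

Definition rho_final := forall p0 p1 p2 p3, (p0 + p1 + p2 + p3 + 2 = n)%N ->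
  (p0 = 0%N -> [/\ rho10 p0 p1 p2 p3, rho20 p0 p1 p2 p3 & rho30 p0 p1 p2 p3]) /\
  (p2 = 0%N -> rho12 p0 p1 p2 p3 /\ rho32 p0 p1 p2 p3).

(** The inequalities with acute direction 1 and 3 are carried from one octahedron to the next by
    induction on [p3] and on [p1]; those with acute direction 2 follow by induction on [p1 + p3]. *)
Lemma rho_forward : rho_initial -> rho_final.
Proof.
move=> H.
have H1 p3 p0 p1 p2 : (p0 + p1 + p2 + p3 + 2 = n)%N -> rho13 p0 p1 p2 p3.
  elim: p3 p0 p1 p2 => [|p3 IH] p0 p1 p2 pn; first by have [/(_ erefl)[]] := H _ _ _ _ pn.
  have n0 : (p0.+1 + p1 + p2 + p3 + 2 = n)%N by lia.
  have n1 : (p0 + p1.+1 + p2 + p3 + 2 = n)%N by lia.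
  have n2 : (p0 + p1 + p2.+1 + p3 + 2 = n)%N by lia.
  have [_ a0] := (rho1_local n0).1 (IH _ _ _ n0).
  have [a2 _] := (rho1_local n2).1 (IH _ _ _ n2).
  have [_ _ h] := max_lra (rel n1); move: a0 a2; rewrite /rho13 /rho10 /rho12.
  by case: h => ? ? ?; lra.
have H3 p1 p0 p2 p3 : (p0 + p1 + p2 + p3 + 2 = n)%N -> rho31 p0 p1 p2 p3.
  elim: p1 p0 p2 p3 => [|p1 IH] p0 p2 p3 pn; first by have [_ /(_ erefl)[]] := H _ _ _ _ pn.
  have n0 : (p0.+1 + p1 + p2 + p3 + 2 = n)%N by lia.
  have n1 : (p0 + p1 + p2 + p3.+1 + 2 = n)%N by lia.
  have n2 : (p0 + p1 + p2.+1 + p3 + 2 = n)%N by lia.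
  have [_ a0] := (rho3_local n0).1 (IH _ _ _ n0).
  have [a2 _] := (rho3_local n2).1 (IH _ _ _ n2).
  have [_ _ h] := max_lra (rel n1); move: a0 a2; rewrite /rho31 /rho30 /rho32.
  by case: h => ? ? ?; lra.
have H2 m p0 p1 p2 p3 : (p1 + p3 = m)%N -> (p0 + p1 + p2 + p3 + 2 = n)%N ->
    rho21 p0 p1 p2 p3 /\ rho23 p0 p1 p2 p3.
  elim: m p0 p1 p2 p3 => [|m IH] p0 p1 p2 p3 pm pn.
    have [a1 a2] := H _ _ _ _ pn.
    by split; [apply: (a2 _).1; lia|apply: (a1 _).2; lia].
  split.
    case: p1 pm pn => [|p1] pm pn; first by have [_ /(_ erefl)[]] := H _ _ _ _ pn.
    have n0 : (p0.+1 + p1 + p2 + p3 + 2 = n)%N by lia.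
    have n2 : (p0 + p1 + p2.+1 + p3 + 2 = n)%N by lia.
    have := (rho2_local n0).2 (IH p0.+1 p1 p2 p3 ltac:(lia) n0).
    have [h1 h2 _] := max_lra (rel n2); rewrite /rho20 /rho21; lra.
  case: p3 pm pn => [|p3] pm pn; first by have [/(_ erefl)[]] := H _ _ _ _ pn.
  have n0 : (p0.+1 + p1 + p2 + p3 + 2 = n)%N by lia.
  have n2 : (p0 + p1 + p2.+1 + p3 + 2 = n)%N by lia.
  have := (rho2_local n0).2 (IH p0.+1 p1 p2 p3 ltac:(lia) n0).
  have [h1 h2 _] := max_lra (rel n2); rewrite /rho20 /rho23; lra.
move=> p0 p1 p2 p3 pn; split=> _.
  have [_ a] := (rho1_local pn).1 (H1 _ _ _ _ pn).
  have [_ c] := (rho3_local pn).1 (H3 _ _ _ _ pn).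
  by split=> //; apply: (rho2_local pn).2; exact: H2 pn.
have [a _] := (rho1_local pn).1 (H1 _ _ _ _ pn).
by have [c _] := (rho3_local pn).1 (H3 _ _ _ _ pn).
Qed.

(** The recurrence is unchanged when the directions 1, 3 are exchanged with 0, 2, so the same
    argument runs backwards, by induction on [p0] and on [p0 + p2]. *)
Lemma rho_backward : rho_final -> rho_initial.
Proof.
move=> H.
have H2 p0 p1 p2 p3 : (p0 + p1 + p2 + p3 + 2 = n)%N -> rho20 p0 p1 p2 p3.
  elim: p0 p1 p2 p3 => [|p0 IH] p1 p2 p3 pn; first by have [/(_ erefl)[]] := H _ _ _ _ pn.
  have n1 : (p0 + p1.+1 + p2 + p3 + 2 = n)%N by lia.
  have n2 : (p0 + p1 + p2.+1 + p3 + 2 = n)%N by lia.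
  have n3 : (p0 + p1 + p2 + p3.+1 + 2 = n)%N by lia.
  have [a1 _] := (rho2_local n1).1 (IH _ _ _ n1).
  have [_ a3] := (rho2_local n3).1 (IH _ _ _ n3).
  have [_ _ h] := max_lra (rel n2); move: a1 a3; rewrite /rho20 /rho21 /rho23.
  by case: h => ? ? ?; lra.
have H1 m p0 p1 p2 p3 : (p0 + p2 = m)%N -> (p0 + p1 + p2 + p3 + 2 = n)%N ->
    rho12 p0 p1 p2 p3 /\ rho10 p0 p1 p2 p3.
  elim: m p0 p1 p2 p3 => [|m IH] p0 p1 p2 p3 pm pn.
    have [a1 a2] := H _ _ _ _ pn.
    split; first by apply: (a2 _).1; lia.
    by have [|//] := a1; lia.
  split.
    case: p2 pm pn => [|p2] pm pn; first by have [_ /(_ erefl)[]] := H _ _ _ _ pn.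
    have n1 : (p0 + p1.+1 + p2 + p3 + 2 = n)%N by lia.
    have n3 : (p0 + p1 + p2 + p3.+1 + 2 = n)%N by lia.
    have := (rho1_local n3).2 (IH p0 p1 p2 p3.+1 ltac:(lia) n3).
    have [h1 h2 _] := max_lra (rel n1); rewrite /rho12 /rho13; lra.
  case: p0 pm pn => [|p0] pm pn; first by have [/(_ erefl)[]] := H _ _ _ _ pn.
  have n1 : (p0 + p1.+1 + p2 + p3 + 2 = n)%N by lia.
  have n3 : (p0 + p1 + p2 + p3.+1 + 2 = n)%N by lia.
  have := (rho1_local n3).2 (IH p0 p1 p2 p3.+1 ltac:(lia) n3).
  have [h1 h2 _] := max_lra (rel n1); rewrite /rho10 /rho13; lra.
have H3 m p0 p1 p2 p3 : (p0 + p2 = m)%N -> (p0 + p1 + p2 + p3 + 2 = n)%N ->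
    rho32 p0 p1 p2 p3 /\ rho30 p0 p1 p2 p3.
  elim: m p0 p1 p2 p3 => [|m IH] p0 p1 p2 p3 pm pn.
    have [a1 a2] := H _ _ _ _ pn.
    split; first by apply: (a2 _).2; lia.
    by have [|//] := a1; lia.
  split.
    case: p2 pm pn => [|p2] pm pn; first by have [_ /(_ erefl)[]] := H _ _ _ _ pn.
    have n1 : (p0 + p1.+1 + p2 + p3 + 2 = n)%N by lia.
    have n3 : (p0 + p1 + p2 + p3.+1 + 2 = n)%N by lia.
    have := (rho3_local n1).2 (IH p0 p1.+1 p2 p3 ltac:(lia) n1).
    have [h1 h2 _] := max_lra (rel n3); rewrite /rho32 /rho31; lra.
  case: p0 pm pn => [|p0] pm pn; first by have [/(_ erefl)[]] := H _ _ _ _ pn.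
  have n1 : (p0 + p1.+1 + p2 + p3 + 2 = n)%N by lia.
  have n3 : (p0 + p1 + p2 + p3.+1 + 2 = n)%N by lia.
  have := (rho3_local n1).2 (IH p0 p1.+1 p2 p3 ltac:(lia) n1).
  have [h1 h2 _] := max_lra (rel n3); rewrite /rho30 /rho31; lra.
move=> p0 p1 p2 p3 pn; have [a1 a3] := (rho2_local pn).1 (H2 _ _ _ _ pn).
split=> _; split=> //.
  by apply: (rho1_local pn).2; exact: H1 pn.
by apply: (rho3_local pn).2; exact: H3 pn.
Qed.

End rhombi.

(** * The recurrence as a sequence of flips *)

Section flips.
Variables (R : realType) (n : nat).
Local Notation env := (family R (nat * nat)).

(** Column [n] corresponds to empty partial sums: it is fixed at 0 and is no variable. *)
Definition cellval (e : env) s r : R := if (s < n)%N then e (s, r) else 0.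

Definition oct (e : env) i0 i1 i2 i3 : R :=
  octahedron n (fun k m => cellval e (n - m) k) (fun k j => cellval e (n - k) (k - j)) i1 i3 i0 i2.

Lemma oct_rel e p0 p1 p2 p3 :
  oct e p0 p1.+1 p2 p3.+1 + oct e p0.+1 p1 p2.+1 p3 =
  Num.max (oct e p0.+1 p1.+1 p2 p3 + oct e p0 p1 p2.+1 p3.+1)
          (oct e p0.+1 p1 p2 p3.+1 + oct e p0 p1.+1 p2.+1 p3).
Proof. by rewrite /oct /= subrK. Qed.

Lemma oct_i3 e i0 i1 i2 : oct e i0 i1 i2 0 = cellval e (n - i2) (n - i0).
Proof. by rewrite /oct; case: i1. Qed.

Lemma oct_i1 e i0 i2 i3 : (i0 + i2 + i3 = n)%N -> oct e i0 0 i2 i3 = cellval e i0 i2.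
Proof.
move=> E; case: i3 E => [|i3] E; first by rewrite oct_i3; congr cellval; lia.
by rewrite /oct /=; congr cellval; lia.
Qed.

(* The point [(i0, i1, i2, i3)] in the coordinates [s = i0 + i1], [r = i1 + i2],
   [t = i1]: the recurrence keeps [(s, r)] and increments [t]. *)
Definition octc e s r t := oct e (s - t) t (r - t) (n + t - (s + r)).

(** The recurrence solved for the next value at the cell [k]. The four neighbours are read from the
    current environment, so the order of the flips decides their levels. *)
Definition flip (k : nat * nat) (e : env) : env :=
  upd e k (Num.max (cellval e k.1.+1 k.2 + cellval e k.1.-1 k.2)
                   (cellval e k.1 k.2.-1 + cellval e k.1 k.2.+1) - e k).

Definition flippable j (k : nat * nat) := [&& (k.1 + k.2 <= n + j)%N, (j < k.1)%N & (j < k.2)%N].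

(** The level [t] reached at [(s, r)] after [j] rounds: it starts at [max 0 (s + r - n)], on an
    initial facet, and stops at [min s r], on a final one. *)
Definition level j s r := minn (maxn j (s + r - n)) (minn s r).

Definition step j m e := let k := (m %/ n, m %% n)%N in if flippable j k then flip k e else e.

(** Cells are visited in decreasing order of [s * n + r], so that at each flip the neighbours at
    [s.+1] and [r.+1] are already one level above those at [s.-1] and [r.-1]. *)
Fixpoint sweep j c e := if c is c'.+1 then step j (n * n - c) (sweep j c' e) else e.

Fixpoint sweeps j e := if j is j'.+1 then sweep j' (n * n) (sweeps j' e) else e.

Lemma cval_flip e s r : (s < n)%N -> cellval (flip (s, r) e) s r =
  Num.max (cellval e s.+1 r + cellval e s.-1 r) (cellval e s r.-1 + cellval e s r.+1) - cellval e s r.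
Proof.
by move=> sn; rewrite [LHS]/cellval sn [LHS]updE /=; congr (_ - _); rewrite /cellval sn.
Qed.

Lemma sweepP j c e0 e : (c <= n * n)%N ->
  (forall s r, (s <= n)%N -> (r <= n)%N -> cellval e s r = octc e0 s r (level j s r)) ->
  forall s r, (s <= n)%N -> (r <= n)%N -> cellval (sweep j c e) s r =
    octc e0 s r (if flippable j (s, r) && (n * n - c <= s * n + r)%N then j.+1 else level j s r).
Proof.
move=> cn He; elim: c cn => [|c IH] cn s r sn rn /=.
  rewrite He//; congr octc; case: ifP => // /andP[/and3P[/= a1 a2 a3] a4].
  by exfalso; nia.
set m := (n * n - c.+1)%N; have mE : (n * n - c = m.+1)%N by rewrite /m; lia.
have n0 : (0 < n)%N by lia.
have mn : (m < n * n)%N by rewrite /m; lia.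
have IHc := IH (ltnW cn); rewrite mE in IHc; rewrite /step -/m.
set k := (m %/ n, m %% n)%N; have kE := divn_eq m n.
have rank_eq s' r' : (s' < n)%N -> (r' < n)%N -> (s' * n + r' == m)%N = ((s', r') == k).
  move=> s'n r'n; rewrite /k xpair_eqE; apply/eqP/andP => [<-|[/eqP-> /eqP->]]; last by [].
  by rewrite divnMDl// divn_small// addn0 modnMDl modn_small.
have small s' r' : flippable j (s', r') -> (s' < n)%N && (r' < n)%N.
  by move=> /and3P[/= ? ? ?]; lia.
case: ifPn => fk; last first.
  rewrite IHc//; congr octc; case: (boolP (flippable j (s, r))) => //= fsr.
  have /andP[sn' rn'] := small _ _ fsr.
  rewrite [(m <= _)%N]leq_eqVlt [(m == _)%N]eq_sym rank_eq//.
  by case: eqP fsr => [->|//]; rewrite (negbTE fk).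
have /and3P[/= f1 f2 f3] := fk; have /andP[k1n k2n] := small _ _ fk.
have [skE|skn] := eqVneq (s, r) k; last first.
  have -> : cellval (flip k (sweep j c e)) s r = cellval (sweep j c e) s r.
    by rewrite /cellval /flip updNE.
  rewrite IHc//; congr octc; case: (boolP (flippable j (s, r))) => //= fsr.
  have /andP[sn' rn'] := small _ _ fsr.
  by rewrite [(m <= _)%N]leq_eqVlt [(m == _)%N]eq_sym rank_eq// (negbTE skn).
rewrite skE fk /=.
have [sE rE] : s = (m %/ n)%N /\ r = (m %% n)%N by case: skE.
have rk : (s * n + r = m)%N by rewrite sE rE -kE.
rewrite -sE -rE in f1 f2 f3 k1n k2n.
have -> : (m <= s * n + r)%N by rewrite rk.
have vk := cval_flip (sweep j c e) r k1n; rewrite skE in vk.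
rewrite vk !IHc; try lia.
have -> : (m < s * n + r)%N = false by rewrite rk ltnn.
have -> : flippable j (s.-1, r) && (m < s.-1 * n + r)%N = false.
  by apply/negbTE; rewrite negb_and; apply/orP; right; nia.
have -> : flippable j (s, r.-1) && (m < s * n + r.-1)%N = false.
  by apply/negbTE; rewrite negb_and; apply/orP; right; nia.
have -> : (if flippable j (s.+1, r) && (m < s.+1 * n + r)%N then j.+1 else level j s.+1 r) = j.+1.
  have -> : (m < s.+1 * n + r)%N by nia.
  by rewrite andbT; case: ifPn => //; rewrite /flippable /level /=; lia.
have -> : (if flippable j (s, r.+1) && (m < s * n + r.+1)%N then j.+1 else level j s r.+1) = j.+1.
  have -> : (m < s * n + r.+1)%N by nia.
  by rewrite andbT; case: ifPn => //; rewrite /flippable /level /=; lia.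
rewrite andbF.
have -> : level j s.-1 r = j by rewrite /level; lia.
have -> : level j s r.-1 = j by rewrite /level; lia.
have -> : level j s r = j by rewrite /level; lia.
have := @oct_rel e0 (s.-1 - j) j (r.-1 - j) (n + j - (s + r)).
rewrite /octc.
have -> : ((s.-1 - j).+1 = s - j)%N by lia.
have -> : ((r.-1 - j).+1 = r - j)%N by lia.
have -> : (s - j.+1 = s.-1 - j)%N by lia.
have -> : (r - j.+1 = r.-1 - j)%N by lia.
have -> : (s.+1 - j.+1 = s - j)%N by lia.
have -> : (r.+1 - j.+1 = r - j)%N by lia.
have -> : (n + j.+1 - (s + r) = (n + j - (s + r)).+1)%N by lia.
have -> : (n + j.+1 - (s.+1 + r) = n + j - (s + r))%N by lia.
have -> : (n + j.+1 - (s + r.+1) = n + j - (s + r))%N by lia.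
have -> : (n + j - (s.-1 + r) = (n + j - (s + r)).+1)%N by lia.
have -> : (n + j - (s + r.-1) = (n + j - (s + r)).+1)%N by lia.
by move=> <-; rewrite addrK.
Qed.

Lemma sweepsP j e s r : (s <= n)%N -> (r <= n)%N ->
  cellval (sweeps j e) s r = octc e s r (level j s r).
Proof.
elim: j s r => [|j IH] s r sn rn /=.
  rewrite /octc /level; have [snr|nsr] := leqP (s + r) n.
    have -> : minn (maxn 0 (s + r - n)) (minn s r) = 0%N by lia.
    by rewrite !subn0 oct_i1//; lia.
  have -> : minn (maxn 0 (s + r - n)) (minn s r) = (s + r - n)%N by lia.
  have -> : (n + (s + r - n) - (s + r) = 0)%N by lia.
  by rewrite oct_i3; congr cellval; lia.
rewrite (sweepP (leqnn _) IH)//; congr octc.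
by rewrite subnn leq0n andbT /flippable /level /=; case: ifPn; lia.
Qed.

Definition transport e := sweeps n e.

Lemma transportP e s r : (s <= n)%N -> (r <= n)%N ->
  cellval (transport e) s r = octc e s r (minn s r).
Proof. by move=> sn rn; rewrite sweepsP//; congr octc; rewrite /level; lia. Qed.

Definition colkeys : seq (nat * nat) := [seq (s, r) | s <- iota 0 n, r <- iota 0 n.+1].

(** Preservation of volume together with a measurable left inverse; the inverse will recover the
    second pattern from the transported data. *)
Definition meas_iso (phi : env -> env) :=
  [/\ measurable_fun setT phi,
      (forall f b, measurable_fun setT f -> (forall e, 0 <= f e)%E ->
        II colkeys (fun e => f (phi e)) b = II colkeys f b) &
      exists2 psi, measurable_fun setT psi & cancel phi psi].

Lemma meas_iso_comp phi psi : meas_iso phi -> meas_iso psi -> meas_iso (fun e => phi (psi e)).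
Proof.
move=> [m1 i1 [f1 mf1 c1]] [m2 i2 [f2 mf2 c2]]; split.
- exact: measurable_comp_fun m1 m2.
- move=> f b mf f0; rewrite (i2 (fun e => f (phi e)))//; first exact: i1.
  exact: measurable_comp_fun mf m1.
- exists (fun e => f2 (f1 e)); first exact: measurable_comp_fun mf2 mf1.
  by move=> e; rewrite c1 c2.
Qed.

Lemma meas_iso_id : meas_iso id.
Proof. by split=> //; exists id. Qed.

Lemma measurable_cval d (T : measurableType d) (e : T -> env) s r :
  measurable_fun setT e -> measurable_fun setT (fun x => cellval (e x) s r).
Proof.
by move=> me; rewrite /cellval; case: (s < n)%N; [apply: measurable_app|exact: measurable_cst].
Qed.

Lemma measurable_flip k : measurable_fun setT (flip k).
Proof.
apply: measurable_upd; first exact: measurable_id.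
apply: measurable_funB; last exact: measurable_coord.
by apply: measurable_maxr; apply: measurable_funD; apply: measurable_cval; exact: measurable_id.
Qed.

Lemma cval_upd e k t s r : k != (s, r) -> cellval (upd e k t) s r = cellval e s r.
Proof. by move=> ksr; rewrite /cellval updNE// eq_sym. Qed.

(** A flip is [t -> C - t] in a single variable with [C] free of that variable: an involution that
    preserves length. *)
Lemma flip_iso j k : flippable j k -> meas_iso (flip k).
Proof.
case: k => s r /and3P[/= f1 f2 f3]; set k := (s, r).
pose C (e : env) : R := Num.max (cellval e s.+1 r + cellval e s.-1 r) (cellval e s r.-1 + cellval e s r.+1).
have CE e t : C (upd e k t) = C e.
  by rewrite /C !cval_upd// /k xpair_eqE; apply/negP => /andP[/eqP ? /eqP ?]; lia.
have mC : measurable_fun setT C.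
  by apply: measurable_maxr; apply: measurable_funD; apply: measurable_cval; exact: measurable_id.
split; first exact: measurable_flip.
- move=> f b mf f0; apply: (@II_key _ _ k) => //.
  + exact: measurable_comp_fun mf (measurable_flip k).
  + by apply/allpairsP; exists (s, r); rewrite !mem_iota /=; split => //; lia.
  move=> e.
  have mfu : measurable_fun setT (fun t : measurableTypeR R => f (upd e k t)).
    apply: (measurable_comp_fun mf).
    by apply: measurable_upd; [exact: measurable_cst|exact: measurable_id].
  transitivity (\int[lebesgue_measure]_t f (upd e k (-1 * t + C e)%R))%E.
    apply: eq_integral => t _; congr f; rewrite /flip -/(C (upd e k t)) CE updE upd_upd.
    by congr upd; ring.
  rewrite (integral_affine (f := fun t => f (upd e k t)))//.
  by rewrite normrN normr1 invr1 mul1e.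
- exists (flip k); first exact: measurable_flip.
  have flipE e : flip k e = upd e k (C e - e k) by [].
  by move=> e; rewrite (flipE (flip k e)) (flipE e) CE updE upd_upd opprB addrC subrK upd_id.
Qed.

Lemma step_iso j m : meas_iso (step j m).
Proof.
case: (boolP (flippable j (m %/ n, m %% n)%N)) => fk.
  have -> : step j m = flip (m %/ n, m %% n)%N by apply/funext => e; rewrite /step fk.
  exact: flip_iso fk.
have -> : step j m = id by apply/funext => e; rewrite /step (negbTE fk).
exact: meas_iso_id.
Qed.

Lemma transport_iso : meas_iso transport.
Proof.
rewrite /transport; elim: {1}n => [|j IH] /=; first exact: meas_iso_id.
suff S c : meas_iso (sweep j c) by exact: (meas_iso_comp (S _) IH).
elim: c => [|c IHc] /=; first exact: meas_iso_id.
exact: (meas_iso_comp (step_iso _ _) IHc).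
Qed.

End flips.

(** * Unipotent changes of variables ordered by a rank *)

Section unipotent_rank.
Variables (R : realType) (K : countType).
Local Notation env := (family R K).

(** Sorting the keys by rank turns the rank condition into the list order of [II_unipotent]. *)
Lemma II_unipotent_rank (s : seq K) (rk : K -> nat) (Phi : env -> env)
    (f : env -> \bar R) b :
  uniq s -> measurable_fun setT Phi ->
  (forall k e, k \notin s -> Phi e k = e k) ->
  (forall k e e', k \in s ->
     (forall j, j \notin s \/ (rk j < rk k)%N -> e j = e' j) ->
     Phi e k - e k = Phi e' k - e' k) ->
  measurable_fun setT f -> (forall e, 0 <= f e)%E ->
  II s (fun e => f (Phi e)) b = II s f b.
Proof.
move=> us mPhi Pout Ploc mf f0.
pose le := relpre rk leq.
have letot : total le by move=> x y; exact: leq_total.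
have letr : transitive le by move=> x y z; exact: leq_trans.
have perm : perm_eq s (sort le s) by rewrite perm_sym perm_sort.
have mfP : measurable_fun setT (fun e => f (Phi e)) by exact: measurable_comp_fun mf mPhi.
rewrite (perm_II _ mfP _ perm)// (perm_II _ mf _ perm)//.
apply: II_unipotent => //.
- by rewrite sort_uniq.
- by move=> k e; rewrite mem_sort; exact: Pout.
- move=> s1 k s2 e e' sE ee'; have ks : k \in s by rewrite -(mem_sort le) sE mem_cat mem_head orbT.
  apply: Ploc => // j H; apply: ee'; apply/negP => jk.
  have js : j \in s by rewrite -(mem_sort le) sE mem_cat jk orbT.
  case: H => [|jrk]; first by rewrite js.
  have : sorted le (s1 ++ k :: s2) by rewrite -sE sort_sorted.
  move=> /cat_sorted2[_] /=; rewrite (path_sortedE letr) => /andP[/allP kall _].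
  move: jk; rewrite inE => /predU1P[jE|/kall]; first by rewrite jE ltnn in jrk.
  by rewrite /le /= leqNgt jrk.
Qed.

End unipotent_rank.

(** * Patterns as differences of column values *)

Section column_coordinates.
Variables (R : realType) (n : nat).
Local Notation env := (family R (nat * nat)).
Local Notation cval := (@cellval R n).

Lemma mem_GTkeys m k : (k \in GTkeys m) = (k.2 < k.1)%N && (k.1 <= m)%N.
Proof.
elim: m k => [|m IH] [k j] /=; first by rewrite in_nil; lia.
rewrite mem_cat IH /=.
have -> : ((k, j) \in [seq (m.+1, m0) | m0 <- iota 0 m.+1]) = (k == m.+1) && (j < m.+1)%N.
  apply/mapP/andP => [[i + [-> ->]]|[/eqP-> jm]]; first by rewrite mem_iota eqxx.
  by exists j => //; rewrite mem_iota.
lia.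
Qed.

Lemma uniq_GTkeys m : uniq (GTkeys m).
Proof.
elim: m => [//|m IH]; rewrite -[GTkeys m.+1]/(GTkeys m ++ rowkeys m.+1) cat_uniq IH andTb.
rewrite map_inj_uniq ?iota_uniq ?andbT; last by move=> i j [].
by apply/hasPn => -[k j] /mapP[i _ [-> _]]; rewrite mem_GTkeys /=; lia.
Qed.

Lemma mem_colkeys k : (k \in colkeys n) = (k.1 < n)%N && (k.2 <= n)%N.
Proof.
case: k => s r; apply/allpairsP/idP => [[[a c] []]|/andP[sn rn]].
  by rewrite !mem_iota => /= ? ? [-> ->]; lia.
exists (s, r); rewrite !mem_iota; split => //=; move: sn rn => /=; lia.
Qed.

Lemma uniq_colkeys : uniq (colkeys n).
Proof. by apply: allpairs_uniq; rewrite ?iota_uniq// => -[? ?] [? ?]. Qed.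

(** Erases the keys outside the pattern, so that a function of the pattern does not see the base
    point of the integral. *)
Definition gate (g : env) : env := fun k => if (k.2 < k.1)%N && (k.1 <= n)%N then g k else 0.

Lemma measurable_gate d (T : measurableType d) (g : T -> env) :
  measurable_fun setT g -> measurable_fun setT (fun x => gate (g x)).
Proof.
move=> mg; apply: measurable_envP => k; rewrite /gate.
by case: (_ && _); [exact: measurable_app|exact: measurable_cst].
Qed.

Lemma II_gate (Y : env -> \bar R) b :
  II (GTkeys n) (fun g => Y (gate g)) b = II (GTkeys n) Y (fun=> 0).
Proof.
transitivity (II (GTkeys n) (fun g => Y (gate g)) (fun k => if k \in GTkeys n then 0 else b k)).
  by apply: II_base => k kn; rewrite (negbTE kn).
rewrite (@II_local _ _ (fun k => k \notin GTkeys n) _ _ _ (fun=> 0)).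
- apply: eq_II_in => g g0; congr Y; apply/funext => k; rewrite /gate -mem_GTkeys.
  by case: ifPn => // kn; rewrite g0.
- move=> e e' ee'; congr Y; apply/funext => k; rewrite /gate -mem_GTkeys.
  by case: ifPn => // kn; apply: ee'; rewrite negbK.
- by move=> k; rewrite negbK => ->.
Qed.

(** The cell that stores an entry of the first pattern; [kmu] and [knu] do the same for the second
    and the third. The last branch of each map keeps it injective on all keys, as [II_map]
    requires. *)
Definition kla (k : nat * nat) := if (k.2 < n)%N then (n - k.2.+1, k.1)%N else (k.2, k.1).
Definition kmu (k : nat * nat) := if (k.2 < k.1)%N && (k.1 <= n)%N
  then (n - k.1, k.1 - k.2.+1)%N else (n + k.1.+1, k.2)%N.
Definition knu (k : nat * nat) := if (k.2 < k.1)%N && (k.1 <= n)%N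
  then (n - k.2.+1, k.1 - k.2.+1)%N else (n + k.1.+1, k.2)%N.

Lemma kla_inj : injective kla.
Proof. by move=> [a c] [a' c']; rewrite /kla /=; do 2 case: ifP => ?; case=> ? ?; congr (_, _); lia. Qed.

Lemma kmu_inj : injective kmu.
Proof. by move=> [a c] [a' c']; rewrite /kmu /=; do 2 case: ifP => ?; case=> ? ?; congr (_, _); lia. Qed.

Lemma knu_inj : injective knu.
Proof. by move=> [a c] [a' c']; rewrite /knu /=; do 2 case: ifP => ?; case=> ? ?; congr (_, _); lia. Qed.

Definition dla (e : env) : env := fun k => if (k.2 < k.1)%N && (k.1 <= n)%N then
  cval e (n - k.2.+1) k.1 - cval e (n - k.2) k.1 else 0.
Definition dmu (e : env) : env := fun k => if (k.2 < k.1)%N && (k.1 <= n)%N then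
  cval e (n - k.1) (k.1 - k.2.+1) - cval e (n - k.1) (k.1 - k.2) else 0.
Definition dnu (e : env) : env := fun k => if (k.2 < k.1)%N && (k.1 <= n)%N then
  cval e (n - k.2.+1) (k.1 - k.2.+1) - cval e (n - k.2) (k.1 - k.2) else 0.

Lemma mem_kla s r : ((s, r) \in map kla (GTkeys n)) = [&& (s < n)%N, (r <= n)%N & (n <= s + r)%N].
Proof.
apply/mapP/idP => [[[k m]]|H].
  by rewrite mem_GTkeys /kla /=; case: ifP => ? ? []; lia.
exists (r, n - s.+1)%N; first by rewrite mem_GTkeys /=; lia.
by rewrite /kla /=; case: ifP => ?; congr (_, _); lia.
Qed.

Lemma mem_kmu s r : ((s, r) \in map kmu (GTkeys n)) = [&& (s < n)%N, (r <= n)%N & (s + r < n)%N].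
Proof.
apply/mapP/idP => [[[k m]]|H].
  by rewrite mem_GTkeys /kmu /= => km; rewrite km => -[]; lia.
exists (n - s, n - s - r.+1)%N; first by rewrite mem_GTkeys /=; lia.
by rewrite /kmu /=; case: ifP => ?; [congr (_, _)|]; lia.
Qed.

Lemma mem_knu s r : ((s, r) \in map knu (GTkeys n)) = [&& (s < n)%N, (r <= n)%N & (r <= s)%N].
Proof.
apply/mapP/idP => [[[k m]]|H].
  by rewrite mem_GTkeys /knu /= => km; rewrite km => -[]; lia.
exists (n - s + r, n - s.+1)%N; first by rewrite mem_GTkeys /=; lia.
by rewrite /knu /=; case: ifP => ?; [congr (_, _)|]; lia.
Qed.

Lemma perm_colkeys : perm_eq (colkeys n) (map kla (GTkeys n) ++ map kmu (GTkeys n)).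
Proof.
apply: uniq_perm; first exact: uniq_colkeys.
  rewrite cat_uniq !map_inj_uniq ?uniq_GTkeys//; [|exact: kmu_inj|exact: kla_inj].
  rewrite /= andbT; apply/hasPn => -[s r]; rewrite mem_kla mem_kmu; lia.
by move=> [s r]; rewrite mem_cat mem_kla mem_kmu mem_colkeys /=; lia.
Qed.

Lemma measurable_cvalc s r : measurable_fun setT (fun e : env => cval e s r).
Proof. by apply: measurable_cval; exact: measurable_id. Qed.

Lemma measurable_dla : measurable_fun setT dla.
Proof.
apply: measurable_envP => k; rewrite /dla; case: (_ && _); last exact: measurable_cst.
by apply: measurable_funB; exact: measurable_cvalc.
Qed.

Lemma measurable_dmu : measurable_fun setT dmu.
Proof.
apply: measurable_envP => k; rewrite /dmu; case: (_ && _); last exact: measurable_cst.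
by apply: measurable_funB; exact: measurable_cvalc.
Qed.

Lemma measurable_dnu : measurable_fun setT dnu.
Proof.
apply: measurable_envP => k; rewrite /dnu; case: (_ && _); last exact: measurable_cst.
by apply: measurable_funB; exact: measurable_cvalc.
Qed.

(** Column values are partial sums of the two patterns, so passing to them is a unipotent change of
    variables. *)
Lemma II_GT_GT (H : env -> env -> \bar R) b :
  measurable_fun setT (fun p : env * env => H p.1 p.2) ->
  (forall g1 g2, 0 <= H g1 g2)%E ->
  II (GTkeys n) (fun g1 => II (GTkeys n) (H g1) (fun=> 0)) (fun=> 0) =
  II (colkeys n) (fun e => H (dla e) (dmu e)) b.
Proof.
move=> mH H0.
pose Phi (e : env) : env := fun k => if k \in colkeys n then
  (if (n <= k.1 + k.2)%N then e k - cval e k.1.+1 k.2 else e k - cval e k.1 k.2.+1) else e k.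
have mPhi : measurable_fun setT Phi.
  apply: measurable_envP => k; rewrite /Phi; case: (_ \in _); last exact: measurable_coord.
  by case: (_ <= _)%N; apply: measurable_funB; [exact: measurable_coord|exact: measurable_cvalc|exact: measurable_coord|exact: measurable_cvalc].
have dlaE e : dla e = gate (fun k => Phi e (kla k)).
  apply/funext => -[k m]; rewrite /dla /gate /=; case: ifP => // km.
  have -> : kla (k, m) = (n - m.+1, k)%N by rewrite /kla /= ifT//; lia.
  rewrite /Phi mem_colkeys /= ifT; last by lia.
  rewrite ifT; last by lia.
  by rewrite {1}/cval ifT; [congr (_ - cval _ _ _)|]; lia.
have dmuE e : dmu e = gate (fun k => Phi e (kmu k)).
  apply/funext => -[k m]; rewrite /dmu /gate /=; case: ifP => // km.
  have -> : kmu (k, m) = (n - k, k - m.+1)%N by rewrite /kmu /= km.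
  rewrite /Phi mem_colkeys /= ifT; last by lia.
  rewrite ifF; last by lia.
  by rewrite {1}/cval ifT; [congr (_ - cval _ _ _)|]; lia.
pose H' (e : env) := H (gate (e \o kla)) (gate (e \o kmu)).
have mgt sg : measurable_fun setT (fun e : env => gate (e \o sg)).
  by apply: measurable_gate; apply: measurable_envP => k; exact: measurable_coord.
have mH' : measurable_fun setT H' by exact: (measurable_comp_fun mH (measurable_fun_pair (mgt _) (mgt _))).
have H'0 e : (0 <= H' e)%E by exact: H0.
transitivity (II (colkeys n) (fun e => H' (Phi e)) b); last first.
  by apply: eq_II => e; rewrite /H' dlaE dmuE.
(* The partial sums of the second pattern start from the full row sums of the first, hence their
   larger rank. *)
pose rk (k : nat * nat) := (if (n <= k.1 + k.2)%N then n - k.1 else n.+1 + (n - k.2))%N.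
rewrite (II_unipotent_rank (rk := rk))//; last 3 first.
- exact: uniq_colkeys.
- by move=> k e kn; rewrite /Phi (negbTE kn).
- move=> [s r] e e' ks ee'; rewrite /Phi ks; move: ks; rewrite mem_colkeys /= => ks.
  have V a c : ((a < n)%N -> (a, c) \notin colkeys n \/ (rk (a, c) < rk (s, r))%N) -> cval e a c = cval e' a c.
    by move=> Hac; rewrite /cval; case: ifP => // an; apply: ee'; exact: Hac.
  case: ifP => sr; (rewrite V; first by lra); rewrite mem_colkeys /rk /= => ?; right; do 2 case: ifP => ?; lia.
rewrite (perm_II _ mH' H'0 perm_colkeys) II_cat /H'.
transitivity (II (map kla (GTkeys n)) (fun e => II (GTkeys n) (H (gate (e \o kla))) (fun=> 0)) b); last first.
  apply: eq_II => e; rewrite -(II_gate _ (e \o kmu)) -(II_map _ _ _ kmu_inj).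
  apply: eq_II_in => e' ee'; congr (H _ _); apply/funext => k; rewrite /gate; case: ifP => // kn.
  symmetry; apply: ee'; case: k kn => k m kn.
  have : kla (k, m) \in map kla (GTkeys n) by rewrite map_f// mem_GTkeys.
  by case: (kla (k, m)) => s r; rewrite mem_kla mem_kmu; lia.
by rewrite (II_map _ (fun g => II (GTkeys n) (H (gate g)) (fun=> 0)) _ kla_inj) (II_gate (fun g => II (GTkeys n) (H g) (fun=> 0))).
Qed.

End column_coordinates.

(** * Supports, types and boundary values under transport *)

Section hive_transport.
Variables (R : realType) (n : nat).
Local Notation env := (family R (nat * nat)).
Local Notation cval := (@cellval R n).
Local Notation T := (@transport R n).

Lemma gtintP m (g : env) : reflect
  (forall k j, (j < k)%N -> (k < m)%N -> g (k.+1, j.+1) < g (k, j) /\ g (k, j) < g (k.+1, j))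
  (gtint m g).
Proof.
apply: (iffP allP) => [H k j jk km|H k].
  have := H k; rewrite mem_iota => /(_ ltac:(lia))/allP/(_ j); rewrite mem_iota /gtrow.
  by move=> /(_ ltac:(lia))/andP[].
rewrite mem_iota => /andP[k1 km]; apply/allP => j; rewrite mem_iota => /andP[_ jk].
by apply/andP; rewrite /gtrow /=; apply: H; lia.
Qed.

(** The facet [i0 = 0] in column coordinates, where [s = i1 = n - y] and [r = i1 + i2 = n - x]. *)
Definition hiveval (e : env) x y := cval e (n - y) (n - x).

(** Strict inequalities, so that they match strict interlacing exactly; what this removes from the
    cone is shown to be null in [II_degenerate]. *)
Definition shive (e : env) := all (fun x => all (fun y =>
  [&& (if (x < y)%N && (y < n)%N then hiveval e x y + hiveval e x.+2 y.+1 < hiveval e x.+1 y + hiveval e x.+1 y.+1 else true),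
      (if (x < y)%N && (y < n)%N then hiveval e x.+1 y + hiveval e x y.+1 < hiveval e x y + hiveval e x.+1 y.+1 else true) &
      (if (x <= y)%N && (y.+1 < n)%N then hiveval e x y + hiveval e x.+1 y.+2 < hiveval e x.+1 y.+1 + hiveval e x y.+1 else true)])
  (iota 0 n)) (iota 0 n).

Lemma shiveP e : reflect
  [/\ forall x y, (x < y)%N -> (y < n)%N -> hiveval e x y + hiveval e x.+2 y.+1 < hiveval e x.+1 y + hiveval e x.+1 y.+1,
      forall x y, (x < y)%N -> (y < n)%N -> hiveval e x.+1 y + hiveval e x y.+1 < hiveval e x y + hiveval e x.+1 y.+1 &
      forall x y, (x <= y)%N -> (y.+1 < n)%N -> hiveval e x y + hiveval e x.+1 y.+2 < hiveval e x.+1 y.+1 + hiveval e x y.+1]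
  (shive e).
Proof.
apply: (iffP allP) => [H|[H1 H2 H3] x _]; last first.
  by apply/allP => y _; apply/and3P; split; case: ifP => // /andP[? ?]; [exact: H1|exact: H2|exact: H3].
have G x y (xn : (x < n)%N) (yn : (y < n)%N) := allP (H x ltac:(rewrite mem_iota; lia)) y ltac:(rewrite mem_iota; lia).
split=> x y xy yn.
- by have := G x y ltac:(lia) ltac:(lia); rewrite xy yn => /and3P[].
- by have := G x y ltac:(lia) ltac:(lia); rewrite xy yn => /and3P[].
- by have := G x y ltac:(lia) ltac:(lia); rewrite xy yn => /and3P[].
Qed.

Lemma measurable_shive : measurable_fun setT shive.
Proof.
have mh x y : measurable_fun setT (fun e : env => hiveval e x y) by exact: measurable_cvalc.
apply: measurable_all => x _; apply: measurable_all => y _.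
have mi (c : bool) a b a' b' a'' b'' a3 b3 : measurable_fun setT (fun e : env =>
   if c then hiveval e a b + hiveval e a' b' < hiveval e a'' b'' + hiveval e a3 b3 else true).
  case: c; last exact: measurable_cst.
  by apply: measurable_fun_ltr; apply: measurable_funD.
by apply: measurable_and; [|apply: measurable_and].
Qed.

Lemma rho_initialP (e : env) : rho_initial n (oct n e) <-> gtint n (dla n e) && gtint n (dmu n e).
Proof.
have laE k j : (j < k)%N -> (k <= n)%N -> dla n e (k, j) = cval e (n - j.+1) k - cval e (n - j) k.
  by move=> jk kn; rewrite /dla /= jk kn.
have muE k j : (j < k)%N -> (k <= n)%N -> dmu n e (k, j) = cval e (n - k) (k - j.+1) - cval e (n - k) (k - j).
  by move=> jk kn; rewrite /dmu /= jk kn.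
have i3 i0 i1 i2 := @oct_i3 R n e i0 i1 i2.
have i1' i0 i2 i3 := @oct_i1 R n e i0 i2 i3.
split=> [H|/andP[/gtintP H1 /gtintP H2] p0 p1 p2 p3 pn].
  apply/andP; split; apply/gtintP => k j jk kn.
    have [|/(_ erefl)[a c] _] := H (n - k.+1)%N (k - j.+1)%N j 0%N; first by lia.
    rewrite !laE; try lia; move: a c; rewrite /rho13 /rho23 !i3.
    have -> : (n - (n - k.+1) = k.+1)%N by lia.
    have -> : (n - (n - k.+1).+1 = k)%N by lia.
    by split; lra.
  have [|_ /(_ erefl)[a c]] := H (n - k.+1)%N 0%N (k - j.+1)%N j; first by lia.
  rewrite !muE; try lia; move: a c; rewrite /rho21 /rho31 !i1'; try lia.
  have -> : ((n - k.+1).+1 = n - k)%N by lia.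
  have -> : ((k - j.+1).+2 = k.+1 - j)%N by lia.
  have -> : ((k - j.+1).+1 = k - j)%N by lia.
  rewrite !subSS.
  by split; lra.
split=> pz; rewrite pz in pn *.
  have [] := H1 (n - p0.+1)%N p2 ltac:(lia) ltac:(lia).
  rewrite !laE; try lia; rewrite /rho13 /rho23 !i3.
  have -> : ((n - p0.+1).+1 = n - p0)%N by lia.
  by split; lra.
have [] := H2 (n - p0.+1)%N p3 ltac:(lia) ltac:(lia).
rewrite !muE; try lia; rewrite /rho21 /rho31 !i1'; try lia.
have -> : (n - (n - p0.+1) = p0.+1)%N by lia.
have -> : (n - (n - p0.+1).+1 = p0)%N by lia.
have -> : ((n - p0.+1).+1 - p3.+1 = p2.+1)%N by lia.
have -> : (n - p0.+1 - p3.+1 = p2)%N by lia.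
have -> : (n - p0.+1 - p3 = p2.+1)%N by lia.
have -> : ((n - p0.+1).+1 - p3 = p2.+2)%N by lia.
have -> : ((n - p0.+1).+1 - p3.+2 = p2)%N by lia.
by split; lra.
Qed.

Lemma oct_i0 e i1 i2 i3 : (i1 + i2 + i3 = n)%N -> oct n e 0 i1 i2 i3 = cval (T e) i1 (i1 + i2).
Proof.
move=> E; rewrite transportP; try lia; rewrite /octc.
by congr oct; lia.
Qed.

Lemma oct_i2 e i0 i1 i3 : (i0 + i1 + i3 = n)%N -> oct n e i0 i1 0 i3 = cval (T e) (i0 + i1) i1.
Proof.
move=> E; rewrite transportP; try lia; rewrite /octc.
by congr oct; lia.
Qed.

Lemma rho_finalP e : rho_final n (oct n e) <-> shive (T e) && gtint n (dnu n (T e)).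
Proof.
have nuE k j : (j < k)%N -> (k <= n)%N -> dnu n (T e) (k, j) =
    cval (T e) (n - j.+1) (k - j.+1) - cval (T e) (n - j) (k - j).
  by move=> jk kn; rewrite /dnu /= jk kn.
split=> [H|/andP[/shiveP[H1 H2 H3] /gtintP Hn] p0 p1 p2 p3 pn].
  apply/andP; split; last first.
    apply/gtintP => k j jk kn.
    have [|_ /(_ erefl)[a c]] := H (n - k.+1)%N (k - j.+1)%N 0%N j; first by lia.
    rewrite !nuE; try lia; move: a c; rewrite /rho12 /rho32 !oct_i2; try lia.
    rewrite !subSS.
    have -> : ((n - k.+1).+1 + (k - j.+1) = n - j.+1)%N by lia.
    have -> : (n - k.+1 + (k - j.+1).+2 = n - j)%N by lia.
    have -> : ((n - k.+1).+1 + (k - j.+1).+1 = n - j)%N by lia.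
    have -> : (n - k.+1 + (k - j.+1).+1 = n - j.+1)%N by lia.
    have -> : (n - k.+1 + (k - j.+1) = n - j.+2)%N by lia.
    have -> : ((k - j.+1).+2 = k.+1 - j)%N by lia.
    have -> : ((k - j.+1).+1 = k - j)%N by lia.
    by split; lra.
  apply/shiveP; split=> x y xy yn.
  - have [|/(_ erefl)[_ _ a] _] := H 0%N (n - y.+1)%N (y - x.+1)%N x; first by lia.
    move: a; rewrite /rho30 !oct_i0 /hiveval; try lia.
    have -> : ((n - y.+1).+1 + (y - x.+1).+1 = n - x)%N by lia.
    have -> : (n - y.+1 + (y - x.+1).+1 = n - x.+1)%N by lia.
    have -> : ((n - y.+1).+1 + (y - x.+1) = n - x.+1)%N by lia.
    have -> : (n - y.+1 + (y - x.+1) = n - x.+2)%N by lia.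
    have -> : ((n - y.+1).+1 = n - y)%N by lia.
    by lra.
  - have [|/(_ erefl)[_ a _] _] := H 0%N (n - y.+1)%N (y - x.+1)%N x; first by lia.
    move: a; rewrite /rho20 !oct_i0 /hiveval; try lia.
    have -> : ((n - y.+1).+1 + (y - x.+1).+1 = n - x)%N by lia.
    have -> : (n - y.+1 + (y - x.+1).+1 = n - x.+1)%N by lia.
    have -> : ((n - y.+1).+1 + (y - x.+1) = n - x.+1)%N by lia.
    have -> : (n - y.+1 + (y - x.+1).+2 = n - x)%N by lia.
    have -> : ((n - y.+1).+1 = n - y)%N by lia.
    by lra.
  - have [|/(_ erefl)[a _ _] _] := H 0%N (n - y.+2)%N (y - x)%N x; first by lia.
    move: a; rewrite /rho10 !oct_i0 /hiveval; try lia.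
    have -> : ((n - y.+2).+2 + (y - x) = n - x)%N by lia.
    have -> : (n - y.+2 + (y - x).+1 = n - x.+1)%N by lia.
    have -> : ((n - y.+2).+1 + (y - x) = n - x.+1)%N by lia.
    have -> : ((n - y.+2).+1 + (y - x).+1 = n - x)%N by lia.
    have -> : ((n - y.+2).+2 = n - y)%N by lia.
    have -> : ((n - y.+2).+1 = n - y.+1)%N by lia.
    by lra.
split=> pz; rewrite pz in pn *.
  have [E1 [E2 E3]] : (n - (p2 + p3).+2 = p1 /\ n - (p2 + p3).+1 = p1.+1 /\ n - (p2 + p3) = p1.+2)%N by lia.
  have [F1 [F2 F3]] : (n - p3 = p1 + p2.+2 /\ n - p3.+1 = p1 + p2.+1 /\ n - p3.+2 = p1 + p2)%N by lia.
  rewrite /rho10 /rho20 /rho30 !oct_i0; try lia.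
  have := H1 p3 (p2 + p3).+1 ltac:(lia) ltac:(lia).
  have := H2 p3 (p2 + p3).+1 ltac:(lia) ltac:(lia).
  have := H3 p3 (p2 + p3)%N ltac:(lia) ltac:(lia).
  rewrite /hiveval E1 E2 E3 F1 F2 F3 !addSn !addnS => h3 h2 h1.
  by split; lra.
have [] := Hn (n - p0.+1)%N p3 ltac:(lia) ltac:(lia).
rewrite !nuE; try lia; rewrite /rho12 /rho32 !oct_i2; try lia.
have -> : (n - p3.+1 = (p0 + p1).+1)%N by lia.
have -> : (n - p3.+2 = p0 + p1)%N by lia.
have -> : (n - p3 = (p0 + p1).+2)%N by lia.
have -> : ((n - p0.+1).+1 - p3.+1 = p1.+1)%N by lia.
have -> : (n - p0.+1 - p3.+1 = p1)%N by lia.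
have -> : (n - p0.+1 - p3 = p1.+1)%N by lia.
have -> : ((n - p0.+1).+1 - p3 = p1.+2)%N by lia.
have -> : ((n - p0.+1).+1 - p3.+2 = p1)%N by lia.
rewrite !addSn !addnS => h1 h2.
by split; lra.
Qed.

(** The strict inequalities on the initial and on the final facets are equivalent, so the support of
    the transported density separates into a condition on the hive and one on the third pattern. *)
Lemma transport_support e :
  gtint n (dla n e) && gtint n (dmu n e) = shive (T e) && gtint n (dnu n (T e)).
Proof.
apply/idP/idP.
  move/rho_initialP => H; apply/rho_finalP; apply: rho_forward => // *; exact: oct_rel.
move/rho_finalP => H; apply/rho_initialP; apply: rho_backward => // *; exact: oct_rel.
Qed.

Lemma cval_n e r : cval e n r = 0. Proof. by rewrite /cellval ltnn. Qed.

Lemma rowsum_dla e k : (k <= n)%N -> \sum_(m <- iota 0 k) dla n e (k, m) = cval e (n - k) k.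
Proof.
move=> kn; rewrite sum_iota.
transitivity (\sum_(m < k) (cval e (n - m.+1) k - cval e (n - m) k)).
  by apply: eq_bigr => m _; rewrite /dla /= ltn_ord kn.
by rewrite -(big_mkord xpredT (fun m => cval e (n - m.+1) k - cval e (n - m) k))
  telescope_sumr// subn0 cval_n subr0.
Qed.

Lemma rowsum_dmu e k : (k <= n)%N ->
  \sum_(m <- iota 0 k) dmu n e (k, m) = cval e (n - k) 0 - cval e (n - k) k.
Proof.
move=> kn; rewrite sum_iota.
transitivity (\sum_(m < k) (cval e (n - k) (k - m.+1) - cval e (n - k) (k - m))).
  by apply: eq_bigr => m _; rewrite /dmu /= ltn_ord kn.
by rewrite -(big_mkord xpredT (fun m => cval e (n - k) (k - m.+1) - cval e (n - k) (k - m)))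
  telescope_sumr// subn0 subnn.
Qed.

Lemma rowsum_dnu e k : (k <= n)%N -> \sum_(m <- iota 0 k) dnu n e (k, m) = cval e (n - k) 0.
Proof.
move=> kn; rewrite sum_iota.
transitivity (\sum_(m < k) (cval e (n - m.+1) (k - m.+1) - cval e (n - m) (k - m))).
  by apply: eq_bigr => m _; rewrite /dnu /= ltn_ord kn.
by rewrite -(big_mkord xpredT (fun m => cval e (n - m.+1) (k - m.+1) - cval e (n - m) (k - m)))
  telescope_sumr// !subn0 subnn cval_n subr0.
Qed.

Lemma transport_r0 e s : (s <= n)%N -> cval (T e) s 0 = cval e s 0.
Proof.
move=> sn; rewrite transportP// /octc minn0 !subn0 oct_i1 ?addn0//; lia.
Qed.

Lemma transport_rn e s : (s <= n)%N -> cval (T e) s n = cval e s n.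
Proof.
move=> sn; rewrite transportP// /octc (minn_idPl sn).
have -> : (n + s - (s + n) = 0)%N by lia.
by rewrite oct_i3 subnn subn0; congr cellval; lia.
Qed.

Lemma transport_s0 e r : (r <= n)%N -> cval (T e) 0 r = cval e 0 r.
Proof.
move=> rn; rewrite transportP// /octc min0n !subn0 oct_i1//; lia.
Qed.

(** Row sums telescope to values on the edge [r = 0], which lies on an initial and on a final facet
    and is left unchanged. *)
Lemma gtype_transport e k : (k < n)%N ->
  gtype (dnu n (T e)) k = gtype (dla n e) k + gtype (dmu n e) k.
Proof.
move=> kn; rewrite /gtype !rowsum_dla ?rowsum_dmu ?rowsum_dnu ?(ltnW kn)//.
by rewrite !transport_r0; try lia; ring.
Qed.

Lemma dla_transport e m : dla n (T e) (n, m) = dla n e (n, m).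
Proof. by rewrite /dla /=; case: ifP => // ?; rewrite !transport_rn; try lia. Qed.

Lemma dmu_transport e m : dmu n (T e) (n, m) = dmu n e (n, m).
Proof. by rewrite /dmu /= subnn; case: ifP => // ?; rewrite !transport_s0; try lia. Qed.

End hive_transport.

(** * Integrating out the third pattern *)

Section third_pattern.
Variables (R : realType) (n : nat).
Local Notation renv := (family R nat).
Local Notation env := (family R (nat * nat)).
Local Notation cval := (@cellval R n).

(** Writes the partial sums of a top row [r] on the diagonal cells, the common edge of the hive and
    the third pattern. *)
Definition plug (e : env) (r : renv) : env := fun k =>
  if (k.1 == k.2) && (k.1 < n)%N then \sum_(j <- iota 0 (n - k.1)) r j else e k.

(** The cells of the hive; [okeys] leaves out the diagonal. The cells with [s > r] belong to the
    third pattern alone. *)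
Definition hkeys := [seq k <- colkeys n | (k.1 <= k.2)%N].
Definition okeys := [seq k <- colkeys n | (k.1 < k.2)%N].

Lemma measurable_plug d (T : measurableType d) (e : T -> env) (r : T -> renv) :
  measurable_fun setT e -> measurable_fun setT r ->
  measurable_fun setT (fun x => plug (e x) (r x)).
Proof.
move=> me mr; apply: measurable_envP => k; rewrite /plug; case: (_ && _); last exact: measurable_app.
by apply: measurable_sum => j; exact: measurable_app.
Qed.

Lemma measurable_gtrow d (T : measurableType d) (g : T -> env) m :
  measurable_fun setT g -> measurable_fun setT (fun x => gtrow (g x) m).
Proof. by move=> mg; apply: measurable_envP => j; rewrite /gtrow; exact: measurable_app. Qed.

Definition hlocal (A : Type) (X : env -> A) := forall e e', {in hkeys, e =1 e'} -> X e = X e'.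

Section pattern_keys.
Variable L : seq (nat * nat).
Hypotheses (uL : uniq L) (subL : {subset L <= GTkeys n}) (topL : {subset rowkeys n <= L})
  (rowL : forall k m j, (k, m) \in L -> (j <= m)%N -> (k, j) \in L).

Definition gateL (g : env) : env := fun k => if k \in L then g k else 0.

Lemma II_gateL (Y : env -> \bar R) b :
  II L (fun g => Y (gateL g)) b = II L Y (fun=> 0).
Proof.
transitivity (II L (fun g => Y (gateL g)) (fun k => if k \in L then 0 else b k)).
  by apply: II_base => k kn; rewrite (negbTE kn).
rewrite (@II_local _ _ (fun k => k \notin L) _ _ _ (fun=> 0)).
- apply: eq_II_in => g g0; congr Y; apply/funext => k; rewrite /gateL.
  by case: ifPn => // kn; rewrite g0.
- move=> e e' ee'; congr Y; apply/funext => k; rewrite /gateL.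
  by case: ifPn => // kn; apply: ee'; rewrite negbK.
- by move=> k; rewrite negbK => ->.
Qed.

(** Used with [L] the whole third pattern and with [L] its top row. Both are closed under moving
    left in a row, which makes the passage to partial sums invertible. *)
Lemma II_patternL (X Y : env -> \bar R) b :
  measurable_fun setT X -> measurable_fun setT Y ->
  (forall e, 0 <= X e)%E -> (forall e, 0 <= Y e)%E -> hlocal X ->
  II (okeys ++ map (knu n) L) (fun e => X e * Y (gateL (dnu n e)))%E b =
  II okeys (fun e => II L (fun g => X (plug e (gtrow g n)) * Y g)%E (fun=> 0)) b.
Proof.
move=> mX mY X0 Y0 Xloc; rewrite II_cat; apply: eq_II => e0.
have inL k m : (k, m) \in L -> (m < k)%N && (k <= n)%N by move=> /subL; rewrite mem_GTkeys.
have knuE k m : (k, m) \in L -> knu n (k, m) = (n - m.+1, k - m.+1)%N.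
  by move=> /inL km; rewrite /knu /= km.
have memK s r : ((s, r) \in map (knu n) L) = (s < n)%N && (r <= s)%N && ((r + (n - s), n - s.+1)%N \in L).
  apply/mapP/idP => [[[k m] km]|/andP[H kL]].
    rewrite knuE// => -[-> ->]; have := inL _ _ km => kmn.
    have -> : (k - m.+1 + (n - (n - m.+1)) = k)%N by lia.
    have -> : (n - (n - m.+1).+1 = m)%N by lia.
    by rewrite km andbT; lia.
  by exists (r + (n - s), n - s.+1)%N => //; rewrite knuE//; congr (_, _); lia.
(* Partial sums along the rows of the pattern, which undo the differences in [dnu]. *)
pose S (e : env) : env := fun k => if k \in map (knu n) L then
  \sum_(j <- iota 0 (n - k.1)) gateL (e \o knu n) ((k.2 + (n - k.1))%N, j) else e k.
have mgL d (T : measurableType d) (g : T -> env) : measurable_fun setT g ->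
    measurable_fun setT (fun x => gateL (g x)).
  move=> mg; apply: measurable_envP => k; rewrite /gateL.
  by case: (_ \in _); [exact: measurable_app|exact: measurable_cst].
have mknu : measurable_fun setT (fun e : env => e \o knu n : env).
  by apply: measurable_envP => k; exact: measurable_coord.
have mS : measurable_fun setT S.
  apply: measurable_envP => k; rewrite /S; case: (_ \in _); last exact: measurable_coord.
  apply: measurable_sum => j; rewrite /gateL; case: (_ \in L); last exact: measurable_cst.
  exact: measurable_coord.
have mXY : measurable_fun setT (fun e => X e * Y (gateL (dnu n e)))%E.
  apply: emeasurable_funM => //; apply: (measurable_comp_fun mY); apply: mgL.
  exact: measurable_dnu.
have XY0 e : (0 <= X e * Y (gateL (dnu n e)))%E by rewrite mule_ge0.
have uK : uniq (map (knu n) L) by rewrite map_inj_uniq//; exact: knu_inj.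
rewrite -(II_unipotent_rank (rk := fun k => (n - k.1)%N) (Phi := S) _ uK)//; last 2 first.
- by move=> k e kn; rewrite /S (negbTE kn).
- move=> [s r] e e' ks ee'; rewrite /S ks /=.
  move: ks; rewrite memK => /andP[/andP[sn rs] kL].
  have -> : (n - s = (n - s.+1).+1)%N by lia.
  rewrite !sum_iotaS; set K := (r + _)%N.
  have KE : K = (r + (n - s))%N by rewrite /K; lia.
  rewrite /gateL KE kL /= knuE//.
  have -> : (n - (n - s.+1).+1 = s)%N by lia.
  have -> : (r + (n - s) - (n - s.+1).+1 = r)%N by lia.
  rewrite !addrK big_seq [RHS]big_seq; apply: eq_bigr => j; rewrite mem_iota => /andP[_ jn].
  have jL : (r + (n - s), j)%N \in L by apply: rowL kL _; lia.
  by rewrite jL knuE//; apply: ee'; right => /=; lia.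
transitivity (II (map (knu n) L) (fun e => X (plug e0 (gtrow (gateL (e \o knu n)) n)) *
    Y (gateL (e \o knu n)))%E e0); last first.
  rewrite (II_map _ (fun g => X (plug e0 (gtrow (gateL g) n)) * Y (gateL g))%E); last exact: knu_inj.
  by rewrite (II_gateL (fun g => X (plug e0 (gtrow g n)) * Y g)%E).
apply: eq_II_in => e ee0; congr (_ * Y _)%E.
  apply: Xloc => -[s r]; rewrite mem_filter mem_colkeys /= => /andP[sr /andP[sn rn]].
  rewrite /S memK /plug /= sn andbT; have [sE|sr'] := eqVneq s r; last first.
    by rewrite ifF ?ee0// ?memK; lia.
  rewrite -sE leqnn /=.
  have sL : (s + (n - s), n - s.+1)%N \in L.
    by apply: topL; apply/mapP; exists (n - s.+1)%N; [rewrite mem_iota|congr (_, _)]; lia.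
  rewrite sL; apply: eq_bigr => j _; rewrite /gtrow; congr gateL.
  by congr (_, _); lia.
have SE k m : (k, m) \in L -> forall e, cval (S e) (n - m.+1) (k - m.+1) =
    \sum_(j <- iota 0 m.+1) gateL (e \o knu n) (k, j).
  move=> km e'; have kmn := inL _ _ km.
  rewrite /cellval ifT; last by lia.
  have E : (k - m.+1 + (n - (n - m.+1)) = k)%N by lia.
  have E2 : (n - (n - m.+1) = m.+1)%N by lia.
  have E3 : (n - (n - m.+1).+1 = m)%N by lia.
  by rewrite /S memK /= E E3 km E2 ifT//; lia.
apply/funext => -[k m]; rewrite /gateL; case: ifPn => // km.
have kmn := inL _ _ km; rewrite /dnu /= kmn SE// sum_iotaS.
have -> : gateL (e \o knu n) (k, m) = e (knu n (k, m)) by rewrite /gateL km.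
case: m km kmn => [|m] km kmn.
  by rewrite subn0 cval_n big_nil add0r subr0.
have km' : (k, m) \in L by exact: rowL km (leqnSn m).
by rewrite SE// addrC addKr.
Qed.

End pattern_keys.

Lemma mem_hkeys k : (k \in hkeys) = [&& (k.1 <= k.2)%N, (k.1 < n)%N & (k.2 <= n)%N].
Proof. by rewrite mem_filter mem_colkeys. Qed.

Lemma mem_okeys k : (k \in okeys) = [&& (k.1 < k.2)%N, (k.1 < n)%N & (k.2 <= n)%N].
Proof. by rewrite mem_filter mem_colkeys. Qed.

Lemma uniq_hkeys : uniq hkeys. Proof. exact/filter_uniq/uniq_colkeys. Qed.
Lemma uniq_okeys : uniq okeys. Proof. exact/filter_uniq/uniq_colkeys. Qed.

Lemma perm_colkeys_nu : perm_eq (colkeys n) (okeys ++ map (knu n) (GTkeys n)).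
Proof.
apply: uniq_perm; first exact: uniq_colkeys.
  rewrite cat_uniq uniq_okeys map_inj_uniq ?uniq_GTkeys//; last exact: knu_inj.
  rewrite andbT; apply/hasPn => -[s r]; rewrite mem_knu mem_okeys /=; lia.
by move=> [s r]; rewrite mem_cat mem_knu mem_colkeys mem_okeys /=; lia.
Qed.

Lemma mem_rowkeys k : (k \in rowkeys n) = (k.1 == n) && (k.2 < n)%N.
Proof.
case: k => k m; apply/mapP/andP => /= [[j + [-> ->]]|[/eqP-> mn]]; first by rewrite mem_iota.
by exists m => //; rewrite mem_iota.
Qed.

Lemma mem_knu_row s r : ((s, r) \in map (knu n) (rowkeys n)) = (s == r) && (s < n)%N.
Proof.
apply/mapP/idP => [[[k m]]|/andP[/eqP<- sn]].
  by rewrite mem_rowkeys /knu /= => /andP[/eqP-> mn]; rewrite mn leqnn /= => -[? ?]; lia.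
exists (n, n - s.+1)%N; first by rewrite mem_rowkeys /=; lia.
by rewrite /knu /=; case: ifP => ?; [congr (_, _)|]; lia.
Qed.

Lemma uniq_rowkeys : uniq (rowkeys n).
Proof. by rewrite map_inj_uniq ?iota_uniq// => i j []. Qed.

Lemma perm_hkeys : perm_eq hkeys (okeys ++ map (knu n) (rowkeys n)).
Proof.
apply: uniq_perm; first exact: uniq_hkeys.
  rewrite cat_uniq uniq_okeys map_inj_uniq ?uniq_rowkeys//; last exact: knu_inj.
  rewrite andbT; apply/hasPn => -[s r]; rewrite mem_knu_row mem_okeys /=; lia.
by move=> [s r]; rewrite mem_cat mem_knu_row mem_hkeys mem_okeys /=; lia.
Qed.

Lemma II_dnu (X Y : env -> \bar R) b :
  measurable_fun setT X -> measurable_fun setT Y ->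
  (forall e, 0 <= X e)%E -> (forall e, 0 <= Y e)%E -> hlocal X ->
  II (colkeys n) (fun e => X e * Y (dnu n e))%E b =
  II okeys (fun e => II (GTkeys n) (fun g => X (plug e (gtrow g n)) * Y g)%E (fun=> 0)) b.
Proof.
move=> mX mY X0 Y0 Xloc.
have mXY : measurable_fun setT (fun e => X e * Y (dnu n e))%E.
  by apply: emeasurable_funM => //; apply: (measurable_comp_fun mY); exact: measurable_dnu.
rewrite (perm_II _ mXY _ perm_colkeys_nu); last by move=> e; rewrite mule_ge0.
rewrite -(@II_patternL (GTkeys n))//.
- apply: eq_II => e; congr (_ * Y _)%E; apply/funext => k; rewrite /gateL mem_GTkeys /dnu.
  by case: ifP.
- exact: uniq_GTkeys.
- by move=> k; rewrite mem_rowkeys mem_GTkeys => /andP[/eqP-> ->] /=.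
- by move=> k m j; rewrite !mem_GTkeys /=; lia.
Qed.

Lemma II_diag (X : env -> \bar R) (Z : renv -> \bar R) b :
  measurable_fun setT X -> measurable_fun setT Z ->
  (forall e, 0 <= X e)%E -> (forall e, 0 <= Z e)%E -> hlocal X ->
  II hkeys (fun e => X e * Z (gtrow (dnu n e) n))%E b =
  II okeys (fun e => II (rowkeys n) (fun g => X (plug e (gtrow g n)) * Z (gtrow g n))%E (fun=> 0)) b.
Proof.
move=> mX mZ X0 Z0 Xloc.
have mXZ : measurable_fun setT (fun e => X e * Z (gtrow (dnu n e) n))%E.
  apply: emeasurable_funM => //; apply: (measurable_comp_fun mZ).
  by apply: measurable_gtrow; exact: measurable_dnu.
rewrite (perm_II _ mXZ _ perm_hkeys); last by move=> e; rewrite mule_ge0.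
rewrite -(@II_patternL (rowkeys n) _ _ _ _ X (fun g => Z (gtrow g n)))//.
- apply: eq_II => e; congr (_ * Z _)%E; apply/funext => m; rewrite /gtrow /gateL mem_rowkeys /dnu /= eqxx leqnn andbT /=.
  by case: ifP.
- exact: uniq_rowkeys.
- by move=> k; rewrite mem_rowkeys mem_GTkeys => /andP[/eqP-> ->] /=.
- by move=> k m j; rewrite !mem_rowkeys /=; lia.
- by apply: (measurable_comp_fun mZ); apply: measurable_gtrow; exact: measurable_id.
Qed.

(** What the third pattern leaves behind once its lower rows and the common shift are integrated
    out: a Vandermonde factor and a Gaussian with positive exponent, the source of a negative
    [1 / C]. *)
Definition nu_weight (v kap : R) (r : renv) : R :=
  if decrn n r then vdm [seq r i | i <- iota 0 n] *
    expR (kap ^+ 2 * v / 2 * \sum_(i <- iota 0 n) r i ^+ 2) else 0.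

Lemma decrn_vdm (r : renv) : decrn n r -> 0 < vdm [seq r i | i <- iota 0 n].
Proof. by move=> H; have := @gtdecr_vdm R n (fun k => r k.2); apply. Qed.

Lemma measurable_nu_weight v kap : measurable_fun setT (nu_weight v kap).
Proof.
apply: measurable_fun_ifT; [by rewrite /decrn; mR| |exact: measurable_cst].
apply: measurable_funM; first by apply: measurable_vdm => i; mR.
by mR.
Qed.

Lemma nu_weight_ge0 v kap r : 0 <= nu_weight v kap r.
Proof.
by rewrite /nu_weight; case: ifP => // /decrn_vdm/ltW H; rewrite mulr_ge0 ?expR_ge0.
Qed.

(** Applies [II_type_gauss] and then the volume of the patterns with a given top row; [X] sees the
    hive alone, hence only the top row of the third pattern. *)
Lemma II_nu_gauss (X : env -> \bar R) (v kap : R) b : (0 < n)%N -> 0 < v ->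
  measurable_fun setT X -> (forall e, 0 <= X e)%E -> hlocal X ->
  II (colkeys n) (fun e => X e * ((if gtint n (dnu n e) then 1 else 0)%:E *
     type_gauss n v kap (dnu n e)))%E b =
  ((@herm_gauss_const R n v * @vol_const R n)%:E *
    II hkeys (fun e => X e * (nu_weight v kap (gtrow (dnu n e) n))%:E) b)%E.
Proof.
move=> n0 v0 mX X0 Xloc.
have C0 : (0 <= (@herm_gauss_const R n v * @vol_const R n)%:E :> \bar R)%E.
  by rewrite lee_fin mulr_ge0 ?ltW ?vol_const_gt0 ?herm_gauss_const_gt0.
have mtg : measurable_fun setT (@type_gauss R n v kap) by exact: measurable_type_gauss.
have tg0 g : (0 <= @type_gauss R n v kap g)%E by exact: type_gauss_ge0.
have mI : measurable_fun setT (fun g : env => (if gtint n g then 1 else 0 : R)%:E).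
  apply/measurable_EFinP; apply: measurable_fun_ifT; [exact: measurable_gtint| |]; exact: measurable_cst.
have I0 g : (0 <= (if gtint n g then 1 else 0 : R)%:E :> \bar R)%E by case: ifP.
rewrite (II_dnu (Y := fun g => (if gtint n g then 1 else 0)%:E * type_gauss n v kap g)%E)//; last 2 first.
- exact: emeasurable_funM.
- by move=> g; rewrite mule_ge0.
rewrite (II_diag (Z := fun r => (nu_weight v kap r)%:E))//; last 2 first.
- by apply/measurable_EFinP; exact: measurable_nu_weight.
- by move=> r; rewrite lee_fin nu_weight_ge0.
have mXp : measurable_fun setT (fun p : env * env => X (plug p.1 (gtrow p.2 n))).
  apply: (measurable_comp_fun mX); apply: measurable_plug; first exact: measurable_fst.
  by apply: measurable_gtrow; exact: measurable_snd.
have mnw : measurable_fun setT (fun g : env => (nu_weight v kap (gtrow g n))%:E).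
  apply/measurable_EFinP; apply: (measurable_comp_fun (measurable_nu_weight v kap)).
  by apply: measurable_gtrow; exact: measurable_id.
rewrite -IIZl//; last 2 first.
- apply: measurable_II_param; [|by move=> e g; rewrite mule_ge0// lee_fin nu_weight_ge0|exact: measurable_cst].
  by apply: emeasurable_funM => //; exact: (measurable_comp_fun mnw measurable_snd).
- by move=> e; apply: II_ge0 => g; rewrite mule_ge0// lee_fin nu_weight_ge0.
apply: eq_II => e.
(* [II_type_gauss] integrates against [gtweight]; the factor [V] compensates its Vandermonde
   product. *)
pose V (r : renv) : R := if decrn n r then (vdm [seq r i | i <- iota 0 n])^-1 else 0.
have V0 r : (0 <= (V r)%:E)%E.
  by rewrite lee_fin /V; case: ifP => // /decrn_vdm H; rewrite invr_ge0 ltW.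
have mV : measurable_fun setT V.
  apply: measurable_fun_ifT; [by rewrite /decrn; mR| |exact: measurable_cst].
  apply: (measurable_comp_fun (@measurable_inv R)).
  by apply: measurable_vdm => i; mR.
pose f r := (X (plug e r) * (V r)%:E)%E.
have mf : measurable_fun setT f.
  apply: emeasurable_funM; last exact/measurable_EFinP.
  by apply: (measurable_comp_fun mX); apply: measurable_plug; [exact: measurable_cst|exact: measurable_id].
have f0 r : (0 <= f r)%E by rewrite mule_ge0.
have gtV g : gtint n g -> ((gtvdm n g)%:E * (V (gtrow g n))%:E = 1)%E.
  move=> gi; have -> : V (gtrow g n) = (gtvdm n g)^-1.
    by have := gtint_gtdecr gi; rewrite /V /decrn /gtdecr /gtrow => ->.
  by rewrite -EFinM mulfV// gt_eqF//; exact: gtvdm_gt0.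
have wE g (y : \bar R) : (0 <= y)%E -> ((gtweight n g)%:E * (f (gtrow g n) * y) =
    (if gtint n g then 1 else 0)%:E * (X (plug e (gtrow g n)) * y))%E.
  move=> y0; rewrite /gtweight; case: ifPn => [gi|_]; last by rewrite !mul0e.
  by rewrite mul1e /f muleA muleCA -!muleA [X in (_ * X)%E]muleA gtV// mul1e.
transitivity (II (GTkeys n) (fun g => (gtweight n g)%:E * (f (gtrow g n) * type_gauss n v kap g))%E (fun=> 0)).
  by apply: eq_II => g; rewrite wE// muleCA.
rewrite II_type_gauss// (EFinM (@herm_gauss_const R n v)) -muleA; congr (_ * _)%E.
transitivity (II (GTkeys n) (fun g => (if gtint n g then 1 else 0)%:E *
    (X (plug e (gtrow g n)) * (expR (kap ^+ 2 * v / 2 * rsq n g))%:E))%E (fun=> 0)).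
  by apply: eq_II => g; rewrite wE// lee_fin expR_ge0.
rewrite (II_gtint_vol (F := fun g => X (plug e (gtrow g n)) * (expR (kap ^+ 2 * v / 2 * rsq n g))%:E)%E)//; last 3 first.
- apply: emeasurable_funM.
    apply: (measurable_comp_fun mX); apply: measurable_plug; first exact: measurable_cst.
    by apply: measurable_gtrow; exact: measurable_id.
  apply/measurable_EFinP; apply: (measurable_comp_fun (@measurable_expR _)).
  apply: measurable_funM; [exact: measurable_cst|exact: measurable_rsq].
- by move=> g; rewrite mule_ge0// lee_fin expR_ge0.
- move=> g g' gg'; have E : gtrow g n = gtrow g' n.
    apply/funext => j; apply: gg'; rewrite mem_GTkeys /=; lia.
  rewrite E; congr (_ * (expR (_ * _))%:E)%E; apply: eq_bigr => j _.
  by have := congr1 (fun r => r j) E; rewrite /gtrow => ->.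
congr (_ * _)%E; apply: eq_II => g; rewrite muleCA; congr (_ * _)%E.
rewrite -EFinM; congr (_%:E); rewrite /nu_weight (_ : decrn n (gtrow g n) = gtdecr n g)//.
by case: ifP => // _; rewrite mul0r.
Qed.

End third_pattern.

(** * Coordinates on the cone of hives *)

Section hive_coordinates.
Variables (R : realType) (n : nat).
Hypothesis n0 : (0 < n)%N.
Local Notation renv := (family R nat).
Local Notation env := (family R (nat * nat)).
Local Notation cval := (@cellval R n).
Local Notation hv := (@hiveval R n).
Local Notation MR := (measurableTypeR R).
Local Notation hspace := (@hive_space R n).

(** The cell holding the boundary partial sum that ends with the given coordinate, or the interior
    value itself. *)
Definition ckey (k : coord_index n) : nat * nat :=
  match k with
  | inl (inl (inl i)) => (n - i.+1, n)%N
  | inl (inl (inr i)) => (0, n - i.+1)%N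
  | inl (inr i) => (n - i.+1, n - i.+1)%N
  | inr p => (n - (val p).2, n - (val p).1)%N
  end.

Lemma ckey_inj : injective ckey.
Proof.
move=> [[[i|i]|i]|[[i j] /= pi]] [[[i'|i']|i']|[[i' j'] /= pi']] /= H;
  have H1 := congr1 fst H; have H2 := congr1 snd H; move: H1 H2 => /= H1 H2 {H};
  have Hi' := ltn_ord i'; have Hi := ltn_ord i; try (exfalso; lia).
- by congr (inl (inl (inl _))); apply/val_inj => /=; lia.
- by congr (inl (inl (inr _))); apply/val_inj => /=; lia.
- by exfalso; case/andP: pi' => /= ? ?; have := ltn_ord j'; lia.
- by congr (inl (inr _)); apply/val_inj => /=; lia.
- by exfalso; case/andP: pi => /= ? ?; have := ltn_ord j; lia.
- have := ltn_ord j; have := ltn_ord j' => jn' jn.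
  congr inr; apply/val_inj => /=; congr (_, _); apply/val_inj => /=; lia.
Qed.

Lemma perm_ckey : perm_eq [seq ckey (enum_val k) | k <- enum 'I_#|coord_index n|] (hkeys n).
Proof.
apply: uniq_perm; last move=> [s r].
- by rewrite map_inj_uniq ?enum_uniq// => i j /ckey_inj/enum_val_inj.
- exact: uniq_hkeys.
rewrite mem_hkeys; apply/mapP/idP => [[k _ ->]|/and3P[/= sr sn rn]].
  case: (enum_val k) => [[[i|i]|i]|[[i j] /= pi]] /=; have := ltn_ord i => Hi; [lia|lia|lia|].
  by case/andP: pi => /= ? ?; have := ltn_ord j; lia.
suff [c ->] : exists c, (s, r) = ckey c by exists (enum_rank c); rewrite ?mem_enum// enum_rankK.
have [rE|rn'] := eqVneq r n.
  have Hi : (n - s.+1 < n)%N by lia.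
  by exists (inl (inl (inl (Ordinal Hi)))); rewrite /= rE; congr (_, _); lia.
have [sE|s0] := eqVneq s 0%N.
  have Hi : (n - r.+1 < n)%N by lia.
  by exists (inl (inl (inr (Ordinal Hi)))); rewrite /= sE; congr (_, _); lia.
have [srE|srn] := eqVneq s r.
  have Hi : (n - r.+1 < n.-1)%N by lia.
  by exists (inl (inr (Ordinal Hi))); rewrite /= srE; congr (_, _); lia.
have Hi : (n - r < n)%N by lia.
have Hj : (n - s < n)%N by lia.
have Hp : (0 < Ordinal Hi)%N && (Ordinal Hi < Ordinal Hj)%N by rewrite /=; lia.
exists (inr (exist (fun p : 'I_n * 'I_n => (0 < p.1)%N && (p.1 < p.2)%N) (Ordinal Hi, Ordinal Hj) Hp)).
by rewrite /=; congr (_, _); lia.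
Qed.

Definition hdiff (e : env) : env := fun k =>
  if k \in hkeys n then
    if k.2 == n then e k - cval e k.1.+1 n
    else if k.1 == 0%N then e k - cval e 0 k.2.+1
    else if k.1 == k.2 then e k - cval e k.1.+1 k.1.+1
    else e k
  else e k.

Lemma measurable_hdiff : measurable_fun setT hdiff.
Proof.
apply: measurable_envP => k; rewrite /hdiff; case: (_ \in _); last exact: measurable_coord.
have mB j1 j2 : measurable_fun setT (fun e : env => e k - cval e j1 j2).
  by apply: measurable_funB; [exact: measurable_coord|exact: measurable_cvalc].
by case: (k.2 == n); [exact: mB|case: (k.1 == 0%N); [exact: mB|case: (k.1 == k.2); [exact: mB|exact: measurable_coord]]].
Qed.

Lemma hive_coords_hdiff e k : tnth (hive_coords n (hv e)) k = hdiff e (ckey (enum_val k)).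
Proof.
rewrite tnth_mktuple; case: (enum_val k) => [[[i|i]|i]|[[i j] /= pi]] /=; rewrite /hdiff mem_hkeys /=;
  have Hi := ltn_ord i.
- rewrite eqxx ifT; last by lia.
  rewrite /hive_la /hiveval /cellval subn0 ltn_subrL n0 /=.
  by rewrite (_ : (n - i.+1).+1 = n - i)%N//; lia.
- rewrite ifT; last by lia.
  rewrite ifF; last by lia.
  rewrite /hive_mu /hiveval /cellval subnn n0 /=.
  by rewrite (_ : (n - i.+1).+1 = n - i)%N//; lia.
- rewrite ifT; last by lia.
  rewrite ifF; last by lia.
  rewrite ifF; last by lia.
  rewrite eqxx /hiveval /cellval (_ : (n - i.+1).+1 = n - i)%N; last by lia.
  by rewrite ifT//; lia.
- case/andP: (pi) => /= ? ?; have Hj := ltn_ord j.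
  rewrite ifT; last by lia.
  rewrite ifF; last by lia.
  rewrite ifF; last by lia.
  rewrite ifF; last by lia.
  by rewrite /hiveval /cellval ifT//; lia.
Qed.

Lemma measurable_tuple_env (s : #|coord_index n|.-tuple (nat * nat)) :
  measurable_fun setT (fun e : env => [tuple e (tnth s i) | i < #|coord_index n|] : hspace).
Proof.
apply/measurable_fun_tnthP => i; rewrite (_ : _ \o _ = fun e : env => e (tnth s i)).
  exact: measurable_coord.
by apply/funext => e /=; rewrite tnth_mktuple.
Qed.

(** The boundary coordinates are differences of consecutive boundary values, a unipotent change when
    cells are ranked by their distance [2 n - s - r] from the corner [(n, n)], where the hive
    vanishes. *)
Lemma integral_hive_space (f : hspace -> \bar R) (b : env) :
  measurable_fun setT f -> (forall v, 0 <= f v)%E ->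
  (\int[lebesgue_tuple #|coord_index n|]_v f v)%E = II (hkeys n) (fun e => f (hive_coords n (hv e))) b.
Proof.
move=> mf f0.
pose s : #|coord_index n|.-tuple (nat * nat) := [tuple ckey (enum_val k) | k < #|coord_index n|].
have ps : perm_eq s (hkeys n) by exact: perm_ckey.
pose G (e : env) := f [tuple e (tnth s i) | i < #|coord_index n|].
have mG : measurable_fun setT G by apply: (measurable_comp_fun mf); exact: measurable_tuple_env.
have G0 e : (0 <= G e)%E by exact: f0.
rewrite (@integral_lebesgue_tuple _ _ _ s f b)//; last by rewrite (perm_uniq ps) uniq_hkeys.
rewrite (perm_II b mG G0 ps) -(II_unipotent_rank (rk := fun k => (n + n - k.1 - k.2)%N) (Phi := hdiff) b (uniq_hkeys n))//.
- apply: eq_II => e; congr f; apply/eq_from_tnth => i.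
  by rewrite hive_coords_hdiff !tnth_mktuple.
- exact: measurable_hdiff.
- by move=> k e kn; rewrite /hdiff (negbTE kn).
move=> [s' r] e e' ks ee'; rewrite /hdiff ks /=.
move: ks; rewrite mem_hkeys /= => /and3P[sr sn rn].
have E (k : nat * nat) : k \in hkeys n -> (n + n - k.1 - k.2 < n + n - s' - r)%N -> e k = e' k.
  by move=> _ H; apply: ee'; right.
case: eqP => [rE|rN].
  rewrite addrAC subrr add0r addrAC subrr add0r /cellval; case: ifP => // H.
  by rewrite E ?mem_hkeys//=; lia.
case: eqP => [sE|sN].
  rewrite addrAC subrr add0r addrAC subrr add0r /cellval n0.
  by rewrite E ?mem_hkeys//=; lia.
case: eqP => [srE|_]; last by rewrite !subrr.
rewrite addrAC subrr add0r addrAC subrr add0r /cellval; case: ifP => // H.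
by rewrite E ?mem_hkeys//=; lia.
Qed.

Lemma sum_telescope m y (h : nat -> R) : (y <= m)%N ->
  \sum_(j < m | (j < y)%N) (h j.+1 - h j) = h y - h 0%N.
Proof.
by move=> ym; rewrite -(big_ord_widen m (fun j => h j.+1 - h j) ym) -(big_mkord xpredT (fun j => h j.+1 - h j)) telescope_sumr.
Qed.

Lemma sum_telescope_all m (h : nat -> R) : \sum_(j < m) (h j.+1 - h j) = h m - h 0%N.
Proof. by rewrite -(big_mkord xpredT (fun j => h j.+1 - h j)) telescope_sumr. Qed.

Lemma coordK (h : nat -> nat -> R) k : Defs.coord (hive_coords n h) k = match k with
  | inl (inl (inl i)) => hive_la n h i
  | inl (inl (inr i)) => hive_mu n h i
  | inl (inr i) => h i.+1 i.+1 - h i i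
  | inr p => h (val p).1 (val p).2 end.
Proof. by rewrite /Defs.coord tnth_mktuple enum_rankK. Qed.

Lemma hive_of_coordsK (h : nat -> nat -> R) x y : h 0%N 0%N = 0 -> (x <= y)%N -> (y <= n)%N ->
  hive_of_coords (hive_coords n h) x y = h x y.
Proof.
move=> h00 xy yn; rewrite /hive_of_coords.
have laE z : (z <= n)%N ->
    \sum_(j < n | (j < z)%N) Defs.coord (hive_coords n h) (inl (inl (inl j))) = h 0%N z.
  by move=> zn; under eq_bigr do rewrite coordK /hive_la; rewrite sum_telescope// h00 subr0.
have muE z : (z <= n)%N ->
    \sum_(j < n | (j < z)%N) Defs.coord (hive_coords n h) (inl (inl (inr j))) = h z n - h 0%N n.
  move=> zn; under eq_bigr do rewrite coordK /hive_mu.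
  by rewrite (sum_telescope (fun j => h j n)).
case: eqP => [->|x0]; first by rewrite laE.
case: eqP => [->|y_n].
  rewrite (_ : \sum_(j < n) _ = h 0%N n); last first.
    by rewrite -[RHS]laE//; apply: eq_bigl => j; rewrite ltn_ord.
  by rewrite muE; [rewrite addrC subrK|lia].
case: eqP => [xE|x_y].
  under eq_bigr do rewrite coordK.
  by rewrite (sum_telescope (fun j => h j j)) ?h00 ?subr0 ?xE//; lia.
case: pickP => [p /andP[/eqP <- /eqP <-]|H]; first by rewrite coordK.
have Hx : (x < n)%N by lia.
have Hy : (y < n)%N by lia.
have Hp : (0 < Ordinal Hx)%N && (Ordinal Hx < Ordinal Hy)%N by rewrite /=; lia.
have := H (exist (fun p : 'I_n * 'I_n => (0 < p.1)%N && (p.1 < p.2)%N) (Ordinal Hx, Ordinal Hy) Hp).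
by rewrite /= !eqxx.
Qed.

Definition tenv (v : hspace) : env := fun k =>
  if k \in hkeys n then hive_of_coords v (n - k.2) (n - k.1) else 0.

Lemma hv00 e : hv e 0 0 = 0. Proof. by rewrite /hiveval /cellval subn0 ltnn. Qed.

Lemma hv_tenv v x y : (x <= y)%N -> (y <= n)%N -> hv (tenv v) x y = hive_of_coords v x y.
Proof.
move=> xy yn; rewrite /hiveval /cellval; case: ifP => H.
  rewrite /tenv mem_hkeys /= ifT; last by lia.
  by congr hive_of_coords; lia.
have -> : x = 0%N by lia.
by rewrite /hive_of_coords eqxx big1// => j; lia.
Qed.

Lemma tenvK e : {in hkeys n, tenv (hive_coords n (hv e)) =1 e}.
Proof.
move=> [s r] ks; rewrite /tenv ks /=; move: ks; rewrite mem_hkeys /= => /and3P[sr sn rn].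
rewrite hive_of_coordsK ?hv00//; try lia.
rewrite /hiveval /cellval !subKn//; last by lia.
by rewrite sn.
Qed.

Lemma measurable_tenv : measurable_fun setT tenv.
Proof.
apply: measurable_envP => k; rewrite /tenv; case: (_ \in _); last exact: measurable_cst.
rewrite /hive_of_coords.
have mc j : measurable_fun setT (fun v : hspace => Defs.coord v j : R) by exact: measurable_tnth.
have ms m (p : pred 'I_m) g : measurable_fun setT (fun v : hspace => \sum_(j < m | p j) Defs.coord v (g j) : R).
  by under eq_fun do rewrite big_mkcond; apply: measurable_sum => j; case: (p j) => //; exact: measurable_cst.
case: (_ == 0%N); first exact: ms.
case: ((n - k.1)%N == n); first by apply: measurable_funD; exact: ms.
case: ((n - k.2)%N == _).
  exact: ms.
by case: pickP => [p _|_]; [exact: mc|exact: measurable_cst].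
Qed.

Lemma integral_tenv (F : env -> \bar R) (b : env) :
  measurable_fun setT F -> (forall e, 0 <= F e)%E -> hlocal n F ->
  (\int[lebesgue_tuple #|coord_index n|]_v F (tenv v))%E = II (hkeys n) F b.
Proof.
move=> mF F0 Floc; rewrite (@integral_hive_space _ b)//.
  by apply: eq_II => e; apply: Floc; exact: tenvK.
exact: (measurable_comp_fun mF measurable_tenv).
Qed.

Definition whive (e : env) := all (fun x => all (fun y =>
  [&& (if (x < y)%N && (y < n)%N then hv e x y + hv e x.+2 y.+1 <= hv e x.+1 y + hv e x.+1 y.+1 else true),
      (if (x < y)%N && (y < n)%N then hv e x.+1 y + hv e x y.+1 <= hv e x y + hv e x.+1 y.+1 else true) &
      (if (x <= y)%N && (y.+1 < n)%N then hv e x y + hv e x.+1 y.+2 <= hv e x.+1 y.+1 + hv e x y.+1 else true)])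
  (iota 0 n)) (iota 0 n).

Definition nondegenerate (e : env) := all (fun x => all (fun y =>
  [&& (if (x < y)%N && (y < n)%N then hv e x y + hv e x.+2 y.+1 != hv e x.+1 y + hv e x.+1 y.+1 else true),
      (if (x < y)%N && (y < n)%N then hv e x.+1 y + hv e x y.+1 != hv e x y + hv e x.+1 y.+1 else true) &
      (if (x <= y)%N && (y.+1 < n)%N then hv e x y + hv e x.+1 y.+2 != hv e x.+1 y.+1 + hv e x y.+1 else true)])
  (iota 0 n)) (iota 0 n).

Lemma shive_whive e : shive n e = whive e && nondegenerate e.
Proof.
rewrite /shive /whive /nondegenerate -all_predI; apply: eq_all => x /=.
rewrite -all_predI; apply: eq_all => y /=.
have E (c : bool) (a b : R) : (if c then a < b else true) =
    (if c then a <= b else true) && (if c then a != b else true).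
  by case: c; rewrite // lt_neqAle andbC.
rewrite !E -!andbA; do !bool_congr.
Qed.

Lemma measurable_whive : measurable_fun setT whive.
Proof.
have mh x y : measurable_fun setT (fun e : env => hv e x y) by exact: measurable_cvalc.
apply: measurable_all => x _; apply: measurable_all => y _.
have mi (c : bool) a b a' b' a'' b'' a3 b3 : measurable_fun setT (fun e : env =>
   if c then hv e a b + hv e a' b' <= hv e a'' b'' + hv e a3 b3 else true).
  case: c; last exact: measurable_cst.
  by apply: measurable_fun_ler; apply: measurable_funD; exact: mh.
by apply: measurable_and; [|apply: measurable_and]; exact: mi.
Qed.

Lemma discrete_concaveP (h : nat -> nat -> R) (e : env) :
  (forall x y, (x <= y)%N -> (y <= n)%N -> hv e x y = h x y) ->
  discrete_concave n h <-> whive e.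
Proof.
move=> hE; split=> [[H1 H2 H3]|/allP H].
  apply/allP => x _; apply/allP => y _; apply/and3P; split; case: ifP => // /andP[xy yn].
  - by have := H1 x y xy yn; rewrite !hE; try lia; lra.
  - by have := H2 x y xy yn; rewrite !hE; try lia; lra.
  - by have := H3 x y xy yn; rewrite !hE; try lia; lra.
have H' x y : (x < n)%N -> (y < n)%N -> _ := fun xn yn => allP (H x ltac:(by rewrite mem_iota)) y ltac:(by rewrite mem_iota).
split=> x y xy yn; have /and3P[] := H' x y ltac:(lia) ltac:(lia); rewrite ?xy ?yn /= => A B C.
- by move: A; rewrite !hE; try lia; lra.
- by move: B; rewrite !hE; try lia; lra.
- by move: C; rewrite !hE; try lia; lra.
Qed.

Lemma discrete_concave_la (h : nat -> nat -> R) y : discrete_concave n h -> (y.+1 < n)%N ->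
  h 0%N y.+2 - h 0%N y.+1 <= h 0%N y.+1 - h 0%N y.
Proof. by move=> [_ H2 H3] yn; have := H2 0%N y.+1 isT yn; have := H3 0%N y isT yn; lra. Qed.

Lemma discrete_concave_mu (h : nat -> nat -> R) x : discrete_concave n h -> (x.+1 < n)%N ->
  h x.+2 n - h x.+1 n <= h x.+1 n - h x n.
Proof.
move=> [H1 H2 _] xn; have := H1 x n.-1 ltac:(lia) ltac:(lia); have := H2 x n.-1 ltac:(lia) ltac:(lia).
by rewrite prednK//; lra.
Qed.

Lemma discrete_concave_nu (h : nat -> nat -> R) x : discrete_concave n h -> (x.+1 < n)%N ->
  h x.+2 x.+2 - h x.+1 x.+1 <= h x.+1 x.+1 - h x x.
Proof. by move=> [H1 _ H3] xn; have := H1 x x.+1 (leqnn _) xn; have := H3 x x (leqnn _) xn; lra. Qed.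

Lemma nonincreasingP (x : nat -> R) : (forall i, (i.+1 < n)%N -> x i.+1 <= x i) ->
  nonincreasing (fun i : 'I_n => x i).
Proof.
move=> H [i Hi] [j Hj] /= ij; elim: j Hj ij => [|j IH] Hj; first by case: i Hi.
rewrite leq_eqVlt => /predU1P[->//|]; rewrite ltnS => ij.
by apply: le_trans (H j Hj) (IH _ ij); lia.
Qed.

(** Sums of two rhombus inequalities make the three boundary sequences monotone, and telescoping
    gives the trace identity, so the rhombus inequalities alone cut out the cone. *)
Lemma coord_coneP (v : hspace) : coord_cone n v <-> whive (tenv v).
Proof.
rewrite -(@discrete_concaveP (hive_of_coords v)); last by move=> x y xy yn; rewrite hv_tenv.
split=> [[la [mu [nu [_ _ _ _ []]]]]//|H].
set h := hive_of_coords v in H *.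
have h00 : h 0%N 0%N = 0 by rewrite /h -hv_tenv// hv00.
exists (hive_la n h), (hive_mu n h), (hive_nu n h); split.
- by apply: (@nonincreasingP (fun i => h 0%N i.+1 - h 0%N i)) => i; exact: discrete_concave_la.
- by apply: (@nonincreasingP (fun i => h i.+1 n - h i n)) => i; exact: discrete_concave_mu.
- by apply: (@nonincreasingP (fun i => h i.+1 i.+1 - h i i)) => i; exact: discrete_concave_nu.
- rewrite /hive_la /hive_mu /hive_nu (sum_telescope_all _ (fun j => h 0%N j)).
  rewrite (sum_telescope_all _ (fun j => h j n)) (sum_telescope_all _ (fun j => h j j)).
  by rewrite h00; ring.
split=> // i i_n; rewrite /hive_la /hive_mu /hive_nu (sum_telescope_all _ (fun j => h 0%N j)).
rewrite (sum_telescope (fun j => h 0%N j))// (sum_telescope (fun j => h j n))// (sum_telescope (fun j => h j j))//.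
by rewrite -/h h00; split; ring.
Qed.

Lemma measurable_coord_cone : measurable (@coord_cone R n).
Proof.
rewrite (_ : coord_cone n = (whive \o tenv) @^-1` [set true]); last first.
  by apply/seteqP; split => v /coord_coneP.
by rewrite -[X in measurable X]setTI; apply: (measurable_comp_fun measurable_whive measurable_tenv).
Qed.

Lemma measurable_nondegenerate : measurable_fun setT nondegenerate.
Proof.
have mh x y : measurable_fun setT (fun e : env => hv e x y) by exact: measurable_cvalc.
apply: measurable_all => x _; apply: measurable_all => y _.
have mi (c : bool) a b a' b' a'' b'' a3 b3 : measurable_fun setT (fun e : env =>
   if c then hv e a b + hv e a' b' != hv e a'' b'' + hv e a3 b3 else true).
  case: c; last exact: measurable_cst.
  by apply: measurable_neg; apply: measurable_fun_eqr; apply: measurable_funD; exact: mh.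
by apply: measurable_and; [|apply: measurable_and]; exact: mi.
Qed.

Lemma II_indicator_all (I : eqType) (s : seq I) (p : I -> env -> bool) L b :
  (forall i, i \in s -> measurable_fun setT (p i)) ->
  (forall i, i \in s -> II L (fun e => (if p i e then 0 else 1)%:E) b = 0%E) ->
  II L (fun e => (if all (p ^~ e) s then 0 else 1)%:E) b = 0%E.
Proof.
elim: s => [|i s IH] mp p0; first by rewrite -[RHS](@II0 R _ L b); apply: eq_II.
have mI (q : env -> bool) : measurable_fun setT q -> measurable_fun setT (fun e => (if q e then 0 else 1 : R)%:E).
  by move=> mq; apply/measurable_EFinP; apply: measurable_fun_ifT => //; exact: measurable_cst.
have I0 (q : env -> bool) e : (0 <= (if q e then 0 else 1 : R)%:E)%E by case: ifP.
have mps : measurable_fun setT (fun e : env => all (p ^~ e) s).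
  by apply: measurable_all => j js; apply: mp; rewrite inE js orbT.
have mpi : measurable_fun setT (p i) by apply: mp; rewrite inE eqxx.
apply/le_anti/andP; split; last by apply: II_ge0 => e; exact: (I0 (fun e => all (p ^~ e) (i :: s))).
apply: (@le_trans _ _ (II L (fun e => (if p i e then 0 else 1)%:E + (if all (p ^~ e) s then 0 else 1)%:E)%E b)).
  apply: le_II => //.
  - by apply: mI; rewrite /=; apply: measurable_and.
  - by apply: emeasurable_funD; apply: mI.
  - by move=> e; exact: (I0 (fun e => all (p ^~ e) (i :: s))).
  - by move=> e /=; case: (p i e); case: (all _ _); rewrite -EFinD lee_fin; lra.
rewrite IID//; try exact: mI; try exact: I0.
rewrite p0 ?inE ?eqxx// IH ?adde0// => j js; [apply: mp|apply: p0]; by rewrite inE js orbT.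
Qed.

Lemma II_indicator_and (p q : env -> bool) L b :
  measurable_fun setT p -> measurable_fun setT q ->
  II L (fun e => (if p e then 0 else 1)%:E) b = 0%E ->
  II L (fun e => (if q e then 0 else 1)%:E) b = 0%E ->
  II L (fun e => (if p e && q e then 0 else 1)%:E) b = 0%E.
Proof.
move=> mp mq p0 q0.
rewrite -(@II_indicator_all bool [:: true; false] (fun c => if c then p else q) L b).
- by apply: eq_II => e /=; rewrite andbT.
- by case.
- by case.
Qed.

(** The integral over the variable [k] alone already vanishes, being that of a set with at most one
    point. *)
Lemma II_hyperplane (f g : env -> R) (k : nat * nat) L b : k \in L ->
  measurable_fun setT f -> measurable_fun setT g ->
  (forall e, exists t0, forall t, f (upd e k t) = g (upd e k t) -> t = t0) ->
  II L (fun e => (if f e != g e then 0 else 1)%:E) b = 0%E.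
Proof.
move=> kL mf mg uniq_t.
have mI : measurable_fun setT (fun e => (if f e != g e then 0 else 1 : R)%:E).
  apply/measurable_EFinP; apply: measurable_fun_ifT; try exact: measurable_cst.
  by apply: measurable_neg; exact: measurable_fun_eqr.
have I0 e : (0 <= (if f e != g e then 0 else 1 : R)%:E)%E by case: ifP.
rewrite (@II_key _ _ k L _ (fun=> 0%E))//; first exact: II0.
move=> e; have [t0 Ht] := uniq_t e; rewrite integral0.
apply/eqP; rewrite eq_le integral_ge0// andbT.
apply: (@le_trans _ _ (\int[lebesgue_measure]_t (\1_[set t0] t)%:E)%E).
  apply: ge0_le_integral => //.
  - apply: (measurable_comp_fun mI); apply: measurable_upd; [exact: measurable_cst|exact: measurable_id].
  - exact/measurable_EFinP.
  - move=> t _; rewrite lee_fin indicE; case: eqP => /= [/Ht->|_]; first by rewrite mem_set.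
    by case: (_ \in _).
rewrite integral_indic// setIT.
by apply: (@le_trans _ _ (lebesgue_measure [set t0])) => //; rewrite lebesgue_measure_set1.
Qed.

Lemma hv_upd e x y x' y' t : (x <= y)%N -> (y <= n)%N -> (0 < y)%N -> (x' <= y')%N -> (y' <= n)%N ->
  hv (upd e (n - y, n - x)%N t) x' y' = if (x' == x) && (y' == y) then t else hv e x' y'.
Proof.
move=> xy yn y0 xy' yn'; rewrite /hiveval /cellval /upd xpair_eqE.
case: ifP => H.
  by rewrite (_ : (n - y' == n - y)%N && (n - x' == n - x)%N = (x' == x) && (y' == y))//; lia.
by rewrite ifF//; lia.
Qed.

(** All three kinds of rhombus contain the vertex [(x.+1, y.+1)], so an equality determines the
    value there from the others. *)
Lemma II_degenerate b : II (hkeys n) (fun e => (if nondegenerate e then 0 else 1)%:E) b = 0%E.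
Proof.
have mh x y : measurable_fun setT (fun e : env => hv e x y) by exact: measurable_cvalc.
have mi (c : bool) a1 b1 a' b' a'' b'' a3 b3 : measurable_fun setT (fun e : env =>
   if c then hv e a1 b1 + hv e a' b' != hv e a'' b'' + hv e a3 b3 else true).
  case: c; last exact: measurable_cst.
  by apply: measurable_neg; apply: measurable_fun_eqr; apply: measurable_funD; exact: mh.
have key x y : (x < n)%N -> (x <= y)%N -> (y < n)%N -> (n - y.+1, n - x.+1)%N \in hkeys n.
  by rewrite mem_hkeys /=; lia.
have Z (c : bool) p : (c -> II (hkeys n) (fun e => (if p e then 0 else 1)%:E) b = 0%E) ->
    II (hkeys n) (fun e => (if (if c then p e else true) then 0 else 1)%:E) b = 0%E.
  by case: c => [->//|_]; exact: II0.
rewrite /nondegenerate; apply: II_indicator_all => x xn.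
  by apply: measurable_all => y _; apply: measurable_and; [|apply: measurable_and]; exact: mi.
apply: II_indicator_all => y yn.
  by apply: measurable_and; [|apply: measurable_and]; exact: mi.
apply: II_indicator_and; [exact: mi|by apply: measurable_and; exact: mi| |].
  apply: Z => /andP[xy yn']; apply: (@II_hyperplane _ _ (n - y.+1, n - x.+1)%N); first by apply: key; lia.
  - by apply: measurable_funD; exact: mh.
  - by apply: measurable_funD; exact: mh.
  move=> e; exists (hv e x y + hv e x.+2 y.+1 - hv e x.+1 y) => t.
  by rewrite !hv_upd; try lia; do 4 (case: ifP => ?; try (exfalso; lia)); lra.
apply: II_indicator_and; [exact: mi|exact: mi| |].
  apply: Z => /andP[xy yn']; apply: (@II_hyperplane _ _ (n - y.+1, n - x.+1)%N); first by apply: key; lia.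
  - by apply: measurable_funD; exact: mh.
  - by apply: measurable_funD; exact: mh.
  move=> e; exists (hv e x.+1 y + hv e x y.+1 - hv e x y) => t.
  by rewrite !hv_upd; try lia; do 4 (case: ifP => ?; try (exfalso; lia)); lra.
apply: Z => /andP[xy yn']; apply: (@II_hyperplane _ _ (n - y.+1, n - x.+1)%N); first by apply: key; lia.
- by apply: measurable_funD; exact: mh.
- by apply: measurable_funD; exact: mh.
move=> e; exists (hv e x y + hv e x.+1 y.+2 - hv e x y.+1) => t.
by rewrite !hv_upd; try lia; do 4 (case: ifP => ?; try (exfalso; lia)); lra.
Qed.

Definition hweight (A B iC : R) (e : env) : R :=
  gtvdm n (dla n e) * gtvdm n (dmu n e) * gtvdm n (dnu n e) *
  expR (- (1 / 2) * (rsq n (dla n e) / A + rsq n (dmu n e) / B + rsq n (dnu n e) * iC)).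

Lemma hive_weightE A B iC v : hive_weight A B iC v = hweight A B iC (tenv v).
Proof.
have laE (i : 'I_n) : hive_la n (hive_of_coords v) i = dla n (tenv v) (n, i : nat).
  have Hi := ltn_ord i; rewrite /hive_la /dla /= Hi leqnn /= -!hv_tenv; try lia.
  by rewrite /hiveval !subn0.
have muE (i : 'I_n) : hive_mu n (hive_of_coords v) i = dmu n (tenv v) (n, i : nat).
  have Hi := ltn_ord i; rewrite /hive_mu /dmu /= Hi leqnn /= -!hv_tenv; try lia.
  by rewrite /hiveval !subnn.
have nuE (i : 'I_n) : hive_nu n (hive_of_coords v) i = dnu n (tenv v) (n, i : nat).
  have Hi := ltn_ord i; rewrite /hive_nu /dnu /= Hi leqnn /= -!hv_tenv; try lia.
  by rewrite /hiveval.
have vE (x : 'I_n -> R) g : (forall i, x i = g (n, i : nat)) -> vandermonde x = gtvdm n g.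
  move=> xg; rewrite /gtvdm (vdmE n (fun i => g (n, i))).
  by apply: eq_bigr => i _; apply: eq_bigr => j _; rewrite !xg.
have sE (x : 'I_n -> R) g : (forall i, x i = g (n, i : nat)) -> sqnorm x = rsq n g.
  by move=> xg; rewrite /sqnorm /rsq sum_iota; apply: eq_bigr => i _; rewrite xg.
rewrite /hive_weight /hweight.
by rewrite !(vE _ _ laE) !(vE _ _ muE) !(vE _ _ nuE) !(sE _ _ laE) !(sE _ _ muE) !(sE _ _ nuE).
Qed.

Lemma hlocal_cval s r : (s <= r)%N -> (r <= n)%N -> hlocal n (fun e : env => cval e s r).
Proof.
move=> sr rn e e' ee'; rewrite /cellval; case: ifP => // sn; apply: ee'.
by rewrite mem_hkeys /= sr sn.
Qed.

Lemma hlocal_hv x y : (x <= y)%N -> (y <= n)%N -> hlocal n (fun e : env => hv e x y).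
Proof. by move=> xy yn; apply: hlocal_cval; lia. Qed.

Lemma hlocal_rows (e e' : env) : {in hkeys n, e =1 e'} -> forall m,
  [/\ dla n e (n, m) = dla n e' (n, m), dmu n e (n, m) = dmu n e' (n, m) &
      dnu n e (n, m) = dnu n e' (n, m)].
Proof.
move=> ee' m; have H s r : (s <= r)%N -> (r <= n)%N -> cval e s r = cval e' s r.
  by move=> sr rn; exact: hlocal_cval.
by rewrite /dla /dmu /dnu /=; case: ifP => // Hm; rewrite !H; try lia.
Qed.

Lemma hlocal_hweight A B iC : hlocal n (hweight A B iC).
Proof.
move=> e e' ee'; rewrite /hweight /gtvdm /rsq.
have E1 : (fun m => dla n e (n, m)) = fun m => dla n e' (n, m) by apply/funext => m; have [->] := hlocal_rows ee' m.
have E2 : (fun m => dmu n e (n, m)) = fun m => dmu n e' (n, m) by apply/funext => m; have [_ ->] := hlocal_rows ee' m.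
have E3 : (fun m => dnu n e (n, m)) = fun m => dnu n e' (n, m) by apply/funext => m; have [_ _ ->] := hlocal_rows ee' m.
have S (g g' : nat -> R) : g = g' -> \sum_(m <- iota 0 n) g m ^+ 2 = \sum_(m <- iota 0 n) g' m ^+ 2 by move->.
have V (g g' : nat -> R) : g = g' -> vdm [seq g m | m <- iota 0 n] = vdm [seq g' m | m <- iota 0 n] by move->.
by rewrite (V _ _ E1) (V _ _ E2) (V _ _ E3) (S _ _ E1) (S _ _ E2) (S _ _ E3).
Qed.

Lemma hlocal_shive : hlocal n (shive n : env -> bool).
Proof.
move=> e e' ee'; have H x y : (x <= y)%N -> (y <= n)%N -> hv e x y = hv e' x y.
  by move=> xy yn; exact: hlocal_hv.
apply: eq_in_all => x _; apply: eq_in_all => y _.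
have E (c : bool) (a b a' b' : R) : (c -> a = a' /\ b = b') ->
    (if c then a < b else true) = (if c then a' < b' else true).
  by case: c => // /(_ isT)[-> ->].
by congr [&& _, _ & _]; apply: E => /andP[? ?]; rewrite !H//; lia.
Qed.

Lemma shive_decrn (e : env) : shive n e -> [/\ decrn n (gtrow (dla n e) n),
  decrn n (gtrow (dmu n e) n) & decrn n (gtrow (dnu n e) n)].
Proof.
move=> /shiveP[H1 H2 H3].
have la y : (y < n)%N -> dla n e (n, y) = hv e 0 y.+1 - hv e 0 y.
  by move=> yn; rewrite /dla /= yn leqnn /hiveval !subn0.
have mu y : (y < n)%N -> dmu n e (n, y) = hv e y.+1 n - hv e y n.
  by move=> yn; rewrite /dmu /= yn leqnn /hiveval !subnn.
have nu y : (y < n)%N -> dnu n e (n, y) = hv e y.+1 y.+1 - hv e y y.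
  by move=> yn; rewrite /dnu /= yn leqnn /hiveval.
split; apply/allP => y; rewrite mem_iota => /andP[_ yn]; rewrite /gtrow.
- by rewrite !la; try lia; have := H2 0%N y.+1 isT ltac:(lia); have := H3 0%N y isT ltac:(lia); lra.
- rewrite !mu; try lia; have := H1 y n.-1 ltac:(lia) ltac:(lia); have := H2 y n.-1 ltac:(lia) ltac:(lia).
  by rewrite prednK//; lra.
- by rewrite !nu; try lia; have := H1 y y.+1 (leqnn _) ltac:(lia); have := H3 y y (leqnn _) ltac:(lia); lra.
Qed.

End hive_coordinates.

(** * Densities of the shifted ensembles *)

Section laws.
Variables (R : realType) (K : eqType).
Local Notation env := (family R K).
Local Notation lam := (@lebesgue_measure R).
Local Notation MR := (measurableTypeR R).
Local Open Scope ereal_scope.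

Lemma II_prod (s : seq K) (g : K -> MR -> \bar R) b : uniq s ->
  (forall k, measurable_fun setT (g k)) -> (forall k t, 0 <= g k t) ->
  II s (fun e => \prod_(k <- s) g k (e k)) b = \prod_(k <- s) \int[lam]_t g k t.
Proof.
move=> us mg g0; elim: s us b => [|k s IH] /= => [_ b|/andP[ks us] b]; first by rewrite !big_nil.
have P0 s' (e : env) : 0 <= \prod_(j <- s') g j (e j).
  by apply: (big_ind (fun z => 0 <= z)) => //; [exact: mule_ge0].
have mP s' : measurable_fun setT (fun e : env => \prod_(j <- s') g j (e j)).
  elim: s' => [|j s' IHs]; first by under eq_fun do rewrite big_nil; exact: measurable_cst.
  under eq_fun do rewrite big_cons; apply: emeasurable_funM => //.
  exact: (measurable_comp_fun (mg j) (measurable_coord j)).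
have I0 : 0 <= \prod_(j <- s) \int[lam]_t g j t.
  by apply: (big_ind (fun z => 0 <= z)) => //; [exact: mule_ge0|move=> j _; exact: integral_ge0].
rewrite big_cons muleC -ge0_integralZl//.
apply: eq_integral => t _; rewrite -(IH us (upd b k t)) muleC -(IIZl _ _ (mP s))//.
apply: eq_II_in => e ee; rewrite big_cons; congr (_ * _).
by rewrite ee// updE.
Qed.

Lemma env_law d (T : measurableType d) (P : probability T R) (Z : T -> env)
    (s : seq K) (g : K -> MR -> R) b (F : env -> \bar R) : uniq s ->
  (forall k, measurable_fun setT (g k)) -> (forall k t, (0 <= g k t)%R) ->
  measurable_fun setT Z -> (forall om k, k \notin s -> Z om k = b k) ->
  (forall A : K -> set MR, (forall k, measurable (A k)) ->
     P [set om | forall k, k \in s -> A k (Z om k)] =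
     \prod_(k <- s) \int[lam]_(t in A k) (g k t)%:E) ->
  measurable_fun setT F -> (forall e, 0 <= F e) ->
  \int[P]_om F (Z om) = II s (fun e => F e * (\prod_(k <- s) g k (e k))%R%:E) b.
Proof.
move=> us mg g0 mZ Zb ZP mF F0.
pose N := size s; pose st := in_tuple s.
pose phi (t : N.-tuple MR) : env := fun k => if k \in s then nth 0%R t (index k s) else b k.
pose w (t : N.-tuple MR) : R := (\prod_(k <- s) g k (phi t k))%R.
have mphi : measurable_fun setT phi.
  apply: measurable_envP => k; rewrite /phi; case: (boolP (k \in s)) => ks; last exact: measurable_cst.
  rewrite (_ : (fun _ => _) = (@tnth N MR)^~ (Ordinal (n := N) (m := index k s) (etrans (index_mem k s) ks))).
    exact: measurable_tnth.
  by apply/funext => t; rewrite (tnth_nth 0%R).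
have mw : measurable_fun setT (EFin \o w).
  apply/measurable_EFinP; rewrite /w; elim: (s) => [|j s' IHs].
    by under eq_fun do rewrite big_nil; exact: measurable_cst.
  under eq_fun do rewrite big_cons; apply: measurable_funM => //.
  exact: (measurable_comp_fun (mg j) (measurable_comp_fun (measurable_coord j) mphi)).
have w0 t : (0 <= w t)%R by apply: prodr_ge0.
have m1 : measurable_fun setT (EFin \o (fun _ : T => 1%R : R)) by exact: measurable_cst.
pose M1 : {measure set env -> \bar R} := image_density P m1 (fun=> ler01) mZ.
pose M2 : {measure set env -> \bar R} := image_density (@lebesgue_tuple R N) mw w0 mphi.
have IM1 f : measurable_fun setT f -> (forall e, 0 <= f e) -> \int[M1]_e f e = \int[P]_om f (Z om).
  by move=> mf f0; rewrite integral_image_density//; apply: eq_integral => om _; rewrite mul1e.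
have IM2 f : measurable_fun setT f -> (forall e, 0 <= f e) ->
    \int[M2]_e f e = II s (fun e => f e * (\prod_(k <- s) g k (e k))%R%:E) b.
  move=> mf f0; rewrite integral_image_density//.
  rewrite (@integral_lebesgue_tuple R K N st (fun t => (w t)%:E * f (phi t)) b)//; last 2 first.
  - by apply: emeasurable_funM => //; exact: measurable_comp_fun mf mphi.
  - by move=> t; rewrite mule_ge0// lee_fin.
  apply: eq_II_in => e eb.
  have E : phi [tuple e (tnth st i) | i < N] = e.
    apply/funext => k; rewrite /phi; case: ifPn => [ks|/eb//].
    have H : (index k s < N)%N by rewrite index_mem.
    rewrite -(tnth_nth 0%R _ (Ordinal H)) tnth_mktuple (tnth_nth k) /= nth_index//.
  by rewrite /w E muleC.
rewrite -IM1// -IM2//; apply: eq_measure_integral => A mA _.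
pose box (L : seq K) (A : K -> set MR) := [set e : env | forall k, k \in L -> A k (e k)].
pose G := [set B | exists L A, (forall k, measurable (A k)) /\ B = box L A].
have mbox L A' : (forall k, measurable (A' k)) -> measurable (box L A').
  move=> mA'; elim: L => [|k L IH]; first by rewrite (_ : box _ _ = setT)//; apply/seteqP; split.
  rewrite (_ : box _ _ = (fun e : env => e k : MR) @^-1` A' k `&` box L A').
    by apply: measurableI => //; rewrite -[X in measurable X]setTI; exact: measurable_coord.
  apply/seteqP; split => e; first by move=> H; split; [apply: H; rewrite inE eqxx|move=> j jL; apply: H; rewrite inE jL orbT].
  by move=> [H1 H2] j; rewrite inE => /predU1P[->//|]; exact: H2.
have m1_ B : measurable B -> M1 B = \int[P]_om (\1_B (Z om))%:E.
  move=> mB; rewrite -(IM1 (fun e => (\1_B e)%:E)) ?integral_indic ?setIT//.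
  by apply/measurable_EFinP.
have m2_ B : measurable B -> M2 B = II s (fun e => (\1_B e)%:E * (\prod_(k <- s) g k (e k))%R%:E) b.
  move=> mB; rewrite -(IM2 (fun e => (\1_B e)%:E)) ?integral_indic ?setIT//.
  by apply/measurable_EFinP.
apply: (measure_unique G (fun=> setT)) => //.
- apply/seteqP; split; last first.
    apply: smallest_sub; first exact: smallest_sigma_algebra.
    by move=> _ [L [A' [mA' ->]]]; exact: mbox.
  apply: sub_smallest2r; first exact: smallest_sigma_algebra.
  move=> _ [k _ [B mB <-]]; exists [:: k], (fun=> B); split => //.
  apply/seteqP; split => e /=; first by move=> [_ Be] j; rewrite inE => /eqP->.
  by move=> H; split => //; apply: H; rewrite inE.
- move=> _ _ [L [A1 [mA1 ->]]] [L' [A2 [mA2 ->]]].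
  exists (L ++ L'), (fun k => (if k \in L then A1 k else setT) `&` (if k \in L' then A2 k else setT)).
  split; first by move=> k; apply: measurableI; case: ifP.
  apply/seteqP; split => e /=.
    by move=> [H1 H2] k kL; split; case: ifP => // H; [exact: H1|exact: H2].
  by move=> H; split => k kL; have := H k; rewrite mem_cat kL ?orbT => /(_ isT)[].
- by move=> _; exists [::], (fun=> setT); split => //; apply/seteqP; split.
- by rewrite bigcup_const.
- move=> _ [L [A' [mA' ->]]]; pose A2 k := if k \in L then A' k else setT.
  have mA2 k : measurable (A2 k) by rewrite /A2; case: ifP.
  rewrite m1_ ?m2_; try exact: mbox.
  have [c|nc] := pselect (forall k, k \in L -> k \notin s -> A' k (b k)); last first.
    have out (e : env) : (forall k, k \notin s -> e k = b k) -> \1_(box L A') e = 0%R :> R.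
      move=> eb; rewrite indicE memNset// => H; apply: nc => k kL ks.
      by rewrite -(eb k ks); exact: H.
    rewrite integral0_eq => [|om _]; last by rewrite out// => k; exact: Zb.
    rewrite -(@II0 R K s b); apply: eq_II_in => e eb.
    by rewrite out ?mul0e// => k ks; rewrite eb.
  have boxE (e : env) : (forall k, k \notin s -> e k = b k) ->
      (box L A' e) = (forall k, k \in s -> A2 k (e k)).
    move=> eb; apply/propext; split => H k ks; rewrite /A2.
      by case: ifP => // kL; exact: H.
    have [ks'|ks'] := boolP (k \in s); last by rewrite eb//; exact: c.
    by have := H k ks'; rewrite /A2 ks.
  transitivity (\prod_(k <- s) \int[lam]_(t in A2 k) (g k t)%:E).
    rewrite -ZP// -[LHS](_ : \int[P]_om (\1_(Z @^-1` box L A') om)%:E = _)//.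
    rewrite integral_indic ?setIT//; last by rewrite -[X in measurable X]setTI; exact: (mZ measurableT _ (mbox _ _ mA')).
    congr (P _); apply/seteqP; split => om /=; rewrite boxE//; exact: Zb.
  have IA k : \int[lam]_(t in A2 k) (g k t)%:E = \int[lam]_t ((g k t)%:E * (\1_(A2 k) t)%:E).
    rewrite integral_mkcond; apply: eq_integral => t _; rewrite /patch indicE.
    by case: ifP => _; rewrite ?mule1 ?mule0.
  transitivity (\prod_(k <- s) \int[lam]_t ((g k t)%:E * (\1_(A2 k) t)%:E)).
    by apply: eq_bigr => k _; exact: IA.
  rewrite -(@II_prod s (fun k t => (g k t)%:E * (\1_(A2 k) t)%:E) b us); last 2 first.
  - move=> k; apply: emeasurable_funM; first exact/measurable_EFinP.
    by apply/measurable_EFinP.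
  - by move=> k t; rewrite mule_ge0// lee_fin.
  apply: eq_II_in => e eb.
  transitivity ((\prod_(k <- s) (\1_(A2 k) (e k) : R))%R%:E * (\prod_(k <- s) g k (e k))%R%:E).
    rewrite -EFinM -big_split/= -prodEFin; apply: eq_bigr => k _; rewrite EFinM muleC//.
  congr (_%:E * _).
  have [H|H] := pselect (box L A' e).
    rewrite indicE mem_set//; move: (H); rewrite boxE// => H'.
    by rewrite big_seq big1// => k ks; rewrite indicE mem_set//; exact: H'.
  rewrite [RHS]indicE memNset//; move: H; rewrite boxE// => /existsNP[k /not_implyP[ks nA]].
  by rewrite (big_rem k)//= indicE memNset// mul0r.
- by move=> _; rewrite m1_// indicT; under eq_integral do rewrite /=; rewrite integral_cst// mul1e (le_lt_trans (probability_le1 _ _))// ltry.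
Qed.
End laws.

Lemma II_block (R : realType) (K K' : countType) (sg : K -> K') s s2
    (f : family R K -> family R K' -> \bar R) b : injective sg ->
  (forall k, sg k \notin s2) ->
  (forall g e e', (forall k, (forall j, k != sg j) -> e k = e' k) -> f g e = f g e') ->
  II (map sg s ++ s2) (fun e => f (e \o sg) e) b = II s (fun g => II s2 (f g) b) (b \o sg).
Proof.
move=> sgI sgs2 floc; rewrite -(II_map s (fun g => II s2 (f g) b) b sgI) II_cat.
apply: eq_II_in => e eb.
transitivity (II s2 (f (e \o sg)) e).
  apply: eq_II_in => e' ee'; congr f; apply/funext => k /=; exact: ee'.
apply: (@II_local R K' (fun k => `[< exists j, k = sg j >])).
  by move=> x x' xx'; apply: floc => k kn; apply: xx'; apply/asboolPn => -[j kj]; have := kn j; rewrite kj eqxx.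
by move=> k /asboolPn kn; apply: eb; apply/mapP => -[j _ kj]; apply: kn; exists j.
Qed.

(** * The joint law of four independent GUE matrices *)

Section gaussian_ensembles.
Variable R : realType.
Local Notation C := R[i].
Local Notation renv := (family R nat).
Local Notation env := (family R (nat * nat)).
Local Notation lam := (@lebesgue_measure R).
Local Notation MR := (measurableTypeR R).

Definition entry_sd (k : nat * nat) : R := if k.1 == k.2 then 1 else Num.sqrt (1 / 2).

Definition gue_const n : R := \prod_(k <- Mkeys n) normal_peak (entry_sd k).

Lemma entry_sd_gt0 k : 0 < entry_sd k.
Proof. by rewrite /entry_sd; case: ifP => // _; rewrite sqrtr_gt0; lra. Qed.

Lemma gue_const_gt0 n : 0 < gue_const n.
Proof. by apply: prodr_gt0 => k _; rewrite normal_peak_gt0// gt_eqF// entry_sd_gt0. Qed.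

(** The variance 1/2 off the diagonal matches the multiplicity 2 of these coordinates in the trace
    form. *)
Lemma prod_normal_pdf n (e : env) :
  \prod_(k <- Mkeys n) normal_pdf 0 (entry_sd k) (e k) = gue_const n * expR (- (hdot n e e / 2)).
Proof.
rewrite /gue_const /hdot mulr_suml -sumrN expR_sum -big_split; apply: eq_bigr => k _ /=.
rewrite normal_pdfE ?gt_eqF ?entry_sd_gt0//; congr (_ * expR _).
rewrite subr0.
rewrite /entry_sd /wt; case: ifP => _; first by rewrite expr1n mulr2n; field.
have -> : Num.sqrt (1 / 2) ^+ 2 = 1 / 2 :> R by rewrite sqr_sqrtr//; lra.
by rewrite mulr2n; field.
Qed.

Lemma prod_Mkeys n (f : nat * nat -> \bar R) :
  (\prod_(k : 'I_n * 'I_n) f (k.1 : nat, k.2 : nat) = \prod_(k <- Mkeys n) f k)%E.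
Proof.
rewrite -(big_map (fun k : 'I_n * 'I_n => (k.1 : nat, k.2 : nat)) xpredT f).
apply: perm_big; apply: uniq_perm; last move=> [i j].
- rewrite map_inj_uniq ?index_enum_uniq// => -[i j] [i' j'] [/val_inj-> /val_inj->] //.
- exact: uniq_Mkeys.
rewrite mem_Mkeys /=; apply/mapP/andP => [[[i' j'] _ [-> ->]] //|[Hi Hj]].
by exists (Ordinal Hi, Ordinal Hj); rewrite ?mem_index_enum.
Qed.

Lemma hcoord_out n (M : 'M[C]_n) k : k \notin Mkeys n -> hcoord M k = 0.
Proof.
by rewrite mem_Mkeys /hcoord; case: insubP => // i -> _ /=; case: insubP => // j ->.
Qed.

Section joint_law.
Context d (T : measurableType d) (P : probability T R) (n : nat).

Lemma measurable_hcoord (G : T -> 'M[C]_n) : is_GUE P G ->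
  measurable_fun setT (fun om => hcoord (G om) : env).
Proof.
move=> [_ mG _ _]; apply: measurable_envP => k; rewrite /hcoord.
case: insub => [i|]; last exact: measurable_cst.
by case: insub => [j|]; [exact: mG|exact: measurable_cst].
Qed.

Lemma GUE_box (G : T -> 'M[C]_n) (A : nat * nat -> set MR) : is_GUE P G ->
  (forall k, measurable (A k)) ->
  P [set om | forall k, k \in Mkeys n -> A k (hcoord (G om) k)] =
  (\prod_(k <- Mkeys n) \int[lam]_(t in A k) (normal_pdf 0 (entry_sd k) t)%:E)%E.
Proof.
move=> [_ mG iG nG] mA; rewrite -prod_Mkeys.
rewrite (_ : [set _ | _] = \bigcap_(k in [set` [set: 'I_n * 'I_n]%SET])
    (fun om => herm_coord (G om) k) @^-1` A (k.1 : nat, k.2 : nat)); last first.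
  apply/seteqP; split => om /= H => [[i j] _|[i j]].
    by rewrite /= -hcoordE; apply: H; rewrite mem_Mkeys /= !ltn_ord.
  rewrite mem_Mkeys /= => /andP[Hi Hj].
  by have := H (Ordinal Hi, Ordinal Hj); rewrite /= inE -hcoordE; apply.
rewrite iG; last by move=> k _; exists (A (k.1 : nat, k.2 : nat)); [exact: mA|rewrite setTI].
rewrite (eq_bigl xpredT); last by move=> k; rewrite inE.
by apply: eq_bigr => k _; rewrite nG; [|exact: mA].
Qed.

Lemma generated_sigma_box (G : T -> 'M[C]_n) (A : nat * nat -> set MR) :
  (forall k, measurable (A k)) ->
  generated_sigma (fun k om => herm_coord (G om) k)
    [set om | forall k, k \in Mkeys n -> A k (hcoord (G om) k)].
Proof.
move=> mA; rewrite /generated_sigma; set S := \bigcup_i _.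
rewrite (_ : [set _ | _] = \bigcap_(k in [set: 'I_n * 'I_n])
    (fun om => herm_coord (G om) k) @^-1` A (k.1 : nat, k.2 : nat)); last first.
  apply/seteqP; split => om /= H => [[i j] _|[i j]].
    by rewrite /= -hcoordE; apply: H; rewrite mem_Mkeys /= !ltn_ord.
  rewrite mem_Mkeys /= => /andP[Hi Hj].
  by have := H (Ordinal Hi, Ordinal Hj); rewrite /= -hcoordE; apply.
suff : @measurable _ (g_sigma_algebraType S) (\bigcap_(k in [set: 'I_n * 'I_n])
    (fun om => herm_coord (G om) k) @^-1` A (k.1 : nat, k.2 : nat)) by [].
apply: fin_bigcap_measurable => [|k _]; first exact: finite_finset.
apply: sub_sigma_algebra; exists k => //; exists (A (k.1 : nat, k.2 : nat)); [exact: mA|by rewrite setTI].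
Qed.

Definition jkey := ('I_4 * (nat * nat))%type.

Definition jenv (G : 'I_4 -> T -> 'M[C]_n) (om : T) : family R jkey :=
  fun k => hcoord (G k.1 om) k.2.

Definition jkeys : seq jkey := [seq (i, k) | i <- enum 'I_4, k <- Mkeys n].

Definition slot (i : 'I_4) (e : family R jkey) : env := fun k => e (i, k).

Lemma jenv_law (G : 'I_4 -> T -> 'M[C]_n) (F : family R jkey -> \bar R) :
  (forall i, is_GUE P (G i)) -> independent_matrices P G ->
  measurable_fun setT F -> (forall e, 0 <= F e)%E ->
  (\int[P]_om F (jenv G om) = II jkeys (fun e => F e *
     (\prod_(i < 4) (gue_const n * expR (- (hdot n (slot i e) (slot i e) / 2))))%R%:E) (fun=> 0%R))%E.
Proof.
move=> hG iG mF F0.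
have ujk : uniq jkeys by apply: allpairs_uniq; rewrite ?enum_uniq ?uniq_Mkeys// => -[i k] [j l] _ _ [-> ->].
have prodE (A : Type) (idx : A) (op : Monoid.com_law idx) (f : jkey -> A) :
    \big[op/idx]_(k <- jkeys) f k = \big[op/idx]_(i < 4) \big[op/idx]_(k <- Mkeys n) f (i, k).
  by rewrite /jkeys big_allpairs big_enum.
rewrite (@env_law R jkey _ _ P (jenv G) jkeys (fun k t => normal_pdf 0 (entry_sd k.2) t) (fun=> 0%R) F ujk)//.
- apply: eq_II => e; congr (F e * _%:E)%E; rewrite prodE; apply: eq_bigr => i _.
  exact: prod_normal_pdf.
- by move=> k; exact: measurable_normal_pdf.
- by move=> k t; exact: normal_pdf_ge0.
- by apply: measurable_envP => -[i k]; exact: (measurable_comp_fun (measurable_coord k) (measurable_hcoord (hG i))).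
- move=> om [i k] kn; apply: hcoord_out; apply: contraNN kn => kn.
  by apply/allpairsP; exists (i, k); rewrite mem_enum.
move=> A mA; rewrite prodE.
pose E (i : 'I_4) := [set om | forall k, k \in Mkeys n -> A (i, k) (hcoord (G i om) k)].
transitivity (\prod_(i < 4) P (E i))%E; last by apply: eq_bigr => i _; exact: GUE_box (hG i) (fun k => mA (i, k)).
transitivity (P (\bigcap_(i in [set` [set: 'I_4]%SET]) E i)).
  congr (P _); apply/seteqP; split => om /= H => [i _ k kn|[i k] ikn].
    by apply: (H (i, k)); apply/allpairsP; exists (i, k); rewrite mem_enum.
  by move: ikn => /allpairsP[[i' k'] /= [_ kn [-> ->]]]; apply: (H i') => //=; rewrite inE.
rewrite iG; last by move=> i _; exact: (@generated_sigma_box (G i) (fun k => A (i, k)) (fun k => mA (i, k))).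
by rewrite (eq_bigl xpredT)// => i; rewrite inE.
Qed.

(** The two shifts are integrated outermost, because the densities of the patterns are computed for
    fixed spectra of the shifts. *)
Lemma GUE_law (G G' Gt Gt' : T -> 'M[C]_n) (F : env -> env -> env -> env -> \bar R) :
  is_GUE P G -> is_GUE P G' -> is_GUE P Gt -> is_GUE P Gt' ->
  independent_matrices P (tnth [tuple G; G'; Gt; Gt']) ->
  measurable_fun setT (fun p : env * env * env * env => F p.1.1.1 p.1.1.2 p.1.2 p.2) ->
  (forall e1 e2 e3 e4, 0 <= F e1 e2 e3 e4)%E ->
  (\int[P]_om F (hcoord (G om)) (hcoord (G' om)) (hcoord (Gt om)) (hcoord (Gt' om)) =
   II (Mkeys n) (fun e3 => II (Mkeys n) (fun e4 => II (Mkeys n) (fun e1 => II (Mkeys n) (fun e2 =>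
     F e1 e2 e3 e4 * (gue_const n ^+ 4 * expR (- (hdot n e1 e1 + hdot n e2 e2 + hdot n e3 e3 + hdot n e4 e4) / 2))%:E)
     (fun=> 0%R)) (fun=> 0%R)) (fun=> 0%R)) (fun=> 0%R))%E.
Proof.
move=> g1 g2 g3 g4 ind mF F0.
pose o i : 'I_4 := inord i.
pose H e1 e2 e3 e4 := (F e1 e2 e3 e4 *
   (gue_const n ^+ 4 * expR (- (hdot n e1 e1 + hdot n e2 e2 + hdot n e3 e3 + hdot n e4 e4) / 2))%:E)%E.
pose FJ (e : family R jkey) := F (slot (o 0%N) e) (slot (o 1%N) e) (slot (o 2%N) e) (slot (o 3%N) e).
have mslot i : measurable_fun setT (slot i).
  by apply: measurable_envP => k; exact: measurable_coord.
have mFJ : measurable_fun setT FJ.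
  apply: (measurable_comp_fun mF (g := fun e => (slot (o 0%N) e, slot (o 1%N) e, slot (o 2%N) e, slot (o 3%N) e))).
  by do !apply: measurable_fun_pair; exact: mslot.
have GE : [/\ tnth [tuple G; G'; Gt; Gt'] (o 0%N) = G, tnth [tuple G; G'; Gt; Gt'] (o 1%N) = G',
   tnth [tuple G; G'; Gt; Gt'] (o 2%N) = Gt & tnth [tuple G; G'; Gt; Gt'] (o 3%N) = Gt'].
  by split; rewrite (tnth_nth G) /= inordK.
transitivity (\int[P]_om FJ (jenv (tnth [tuple G; G'; Gt; Gt']) om))%E.
  have [e0 e1 e2 e3] := GE.
  by apply: eq_integral => om _; rewrite /FJ /slot /jenv /= e0 e1 e2 e3.
have FJ0 e : (0 <= FJ e)%E by exact: F0.
rewrite jenv_law//; last first.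
  by case=> -[|[|[|[|m]]]] Hi //; rewrite (tnth_nth G).
have enumE : enum 'I_4 = [:: o 0%N; o 1%N; o 2%N; o 3%N].
  by apply: (inj_map val_inj); rewrite val_enum_ord /= !inordK.
have pj : perm_eq jkeys (map (pair (o 2%N)) (Mkeys n) ++ (map (pair (o 3%N)) (Mkeys n) ++
    (map (pair (o 0%N)) (Mkeys n) ++ (map (pair (o 1%N)) (Mkeys n) ++ [::])))).
  rewrite /jkeys enumE /= !cats0 catA [X in perm_eq _ X]catA; exact: permEl (perm_catC _ _).
rewrite (perm_II _ _ _ pj); last 2 first.
- apply: emeasurable_funM => //; apply/measurable_EFinP; under eq_fun do rewrite -big_enum /= enumE !big_cons big_nil.
  have mo i : measurable_fun setT (fun e : family R jkey => gue_const n * expR (- (hdot n (slot i e) (slot i e) / 2))).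
    apply: measurable_funM; first exact: measurable_cst.
    apply: (measurable_comp_fun (@measurable_expR _)); apply: measurableT_comp => //.
    by apply: measurable_funM; [exact: measurable_hdot|exact: measurable_cst].
  by do !apply: measurable_funM => //; exact: measurable_cst.
- move=> e; rewrite mule_ge0// lee_fin; apply: prodr_ge0 => i _.
  by rewrite mulr_ge0 ?expR_ge0// ltW// gue_const_gt0.
have oN i j : (i < 4)%N -> (j < 4)%N -> i != j -> o i != o j.
  by move=> i4 j4; apply: contraNneq => /(congr1 val); rewrite /= !inordK// => ->.
transitivity (II (map (pair (o 2%N)) (Mkeys n) ++ (map (pair (o 3%N)) (Mkeys n) ++
    (map (pair (o 0%N)) (Mkeys n) ++ (map (pair (o 1%N)) (Mkeys n) ++ [::]))))
    (fun e : family R jkey => H (slot (o 0%N) e) (slot (o 1%N) e) (e \o pair (o 2%N)) (slot (o 3%N) e)) (fun=> 0)).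
  apply: eq_II => e; rewrite /H /FJ; congr (_ * _%:E)%E.
  rewrite -big_enum /= enumE !big_cons big_nil mulr1.
  rewrite (_ : - (_ + _ + _ + _) / 2 = - (hdot n (slot (o 0%N) e) (slot (o 0%N) e) / 2) +
     (- (hdot n (slot (o 1%N) e) (slot (o 1%N) e) / 2) + (- (hdot n (slot (o 2%N) e) (slot (o 2%N) e) / 2) +
     - (hdot n (slot (o 3%N) e) (slot (o 3%N) e) / 2)))); last by rewrite /slot /=; ring.
  by rewrite !expRD; ring.
have pI i : injective (pair (o i) : nat * nat -> jkey) by move=> k l [].
have nm i j k : (i < 4)%N -> (j < 4)%N -> i != j -> (o i, k) \notin map (pair (o j)) (Mkeys n).
  by move=> i4 j4 ij; apply/mapP => -[l _ [E _]]; have := oN i j i4 j4 ij; rewrite E eqxx.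
have sl i j (e e' : family R jkey) : (i < 4)%N -> (j < 4)%N -> i != j ->
    (forall k, (forall l, k != (o i, l)) -> e k = e' k) -> slot (o j) e = slot (o j) e'.
  move=> i4 j4 ij ee'; apply/funext => k; apply: ee' => l; rewrite xpair_eqE negb_and oN// eq_sym//.
rewrite (@II_block R _ _ (pair (o 2%N)) _ _ (fun g e => H (slot (o 0%N) e) (slot (o 1%N) e) g (slot (o 3%N) e)))//; last 2 first.
- by move=> k; rewrite !mem_cat !negb_or !nm.
- by move=> g e e' ee'; rewrite !(@sl 2%N _ _ _ _ _ _ ee').
apply: eq_II => e3.
rewrite (@II_block R _ _ (pair (o 3%N)) _ _ (fun g e => H (slot (o 0%N) e) (slot (o 1%N) e) e3 g))//; last 2 first.
- by move=> k; rewrite !mem_cat !negb_or !nm.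
- by move=> g e e' ee'; rewrite !(@sl 3%N _ _ _ _ _ _ ee').
apply: eq_II => e4.
rewrite (@II_block R _ _ (pair (o 0%N)) _ _ (fun g e => H g (slot (o 1%N) e) e3 e4))//; last 2 first.
- by move=> k; rewrite !mem_cat !negb_or !nm.
- by move=> g e e' ee'; rewrite !(@sl 0%N _ _ _ _ _ _ ee').
apply: eq_II => e1.
by rewrite (@II_block R _ _ (pair (o 1%N)) _ _ (fun g e => H e1 g e3 e4)).
Qed.

End joint_law.
End gaussian_ensembles.

(** * Two minor processes as initial data of the recurrence *)

Section glued_patterns.
Variables (R : realType) (n : nat).
Local Notation C := R[i].
Local Notation renv := (family R nat).
Local Notation env := (family R (nat * nat)).
Local Notation cval := (@cellval R n).
Local Notation T := (@transport R n).

Lemma octahedron_ext (L L' M M' : nat -> nat -> R) :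
  (forall k m, (m <= k)%N -> (k <= n)%N -> L k m = L' k m) ->
  (forall k m, (m <= k)%N -> (k <= n)%N -> M k m = M' k m) ->
  forall i1 i3 i0 i2, (i0 + i1 + i2 + i3 = n)%N ->
  octahedron n L M i1 i3 i0 i2 = octahedron n L' M' i1 i3 i0 i2.
Proof.
move=> LL MM; elim=> [|i1 IH1]; elim=> [|i3 IH3] i0 i2 E /=; [by apply: LL; lia|by apply: MM; lia|by apply: LL; lia|].
by congr (Num.max (_ + _) (_ + _) - _); [apply: IH3|apply: IH1|apply: IH1|apply: IH3|apply: IH1]; lia.
Qed.

(** The inverse of the pair [dla], [dmu]: partial sums of the first pattern on one facet, and on the
    other those of the second pattern, continued from the full row sums of the first. *)
Definition glue (g1 g2 : env) : env := fun k =>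
  if (n <= k.1 + k.2)%N then \sum_(m <- iota 0 (n - k.1)) g1 (k.2, m)
  else \sum_(m <- iota 0 (n - k.1)) g1 ((n - k.1)%N, m) +
       \sum_(m <- iota 0 (n - k.1 - k.2)) g2 ((n - k.1)%N, m).

Lemma measurable_glue d (S : measurableType d) (g1 g2 : S -> env) :
  measurable_fun setT g1 -> measurable_fun setT g2 ->
  measurable_fun setT (fun x => glue (g1 x) (g2 x)).
Proof.
move=> m1 m2; apply: measurable_envP => k; rewrite /glue; case: (_ <= _)%N.
  by apply: measurable_sum => j; exact: measurable_app.
by apply: measurable_funD; apply: measurable_sum => j; exact: measurable_app.
Qed.

Lemma cval_glue1 g1 g2 k m : (m <= k)%N -> (k <= n)%N ->
  cval (glue g1 g2) (n - m) k = \sum_(j <- iota 0 m) g1 (k, j).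
Proof.
move=> mk kn; rewrite /cellval /glue /=; case: ifP => H.
  by rewrite ifT ?subKn//; lia.
by rewrite (_ : m = 0%N) ?big_nil//; lia.
Qed.

Lemma cval_glue2 g1 g2 k j : (j <= k)%N -> (k <= n)%N ->
  cval (glue g1 g2) (n - k) (k - j) = \sum_(m <- iota 0 k) g1 (k, m) + \sum_(m <- iota 0 j) g2 (k, m).
Proof.
move=> jk kn; rewrite /cellval /glue /=; case: ifP => H; last first.
  have -> : k = 0%N by lia.
  by rewrite (_ : j = 0%N) ?big_nil ?addr0//; lia.
case: ifP => H'.
  by rewrite (_ : j = 0%N) ?big_nil ?addr0 ?subn0 ?subKn//; lia.
by rewrite subKn// subKn.
Qed.

Lemma glue_dla_dmu e s r : (s <= n)%N -> (r <= n)%N -> cval (glue (dla n e) (dmu n e)) s r = cval e s r.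
Proof.
move=> sn rn; have [srn|srn] := leqP n (s + r).
  have := @cval_glue1 (dla n e) (dmu n e) r (n - s); rewrite subKn// => -> //; last by lia.
  rewrite sum_iota; transitivity (\sum_(m < n - s) (cval e (n - m.+1) r - cval e (n - m) r)).
    apply: eq_bigr => m _; rewrite /dla /= rn ifT//; have := ltn_ord m; lia.
  rewrite -(big_mkord xpredT (fun m => cval e (n - m.+1) r - cval e (n - m) r)) telescope_sumr//.
  by rewrite subn0 cval_n subr0 subKn.
have := @cval_glue2 (dla n e) (dmu n e) (n - s) (n - s - r); rewrite !subKn//; try lia.
move=> -> //; try lia; rewrite rowsum_dla; last by lia.
rewrite subKn// sum_iota.
transitivity (cval e s (n - s) + \sum_(m < n - s - r) (cval e s (n - s - m.+1) - cval e s (n - s - m))).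
  congr (_ + _); apply: eq_bigr => m _; rewrite /dmu /= ifT ?subKn//; have := ltn_ord m; lia.
rewrite -(big_mkord xpredT (fun m => cval e s (n - s - m.+1) - cval e s (n - s - m))) telescope_sumr//.
by rewrite subn0 subKn; [ring|lia].
Qed.

Lemma cval_transport_ext e e' : (forall s r, (s <= n)%N -> (r <= n)%N -> cval e s r = cval e' s r) ->
  forall s r, (s <= n)%N -> (r <= n)%N -> cval (T e) s r = cval (T e') s r.
Proof.
move=> ee' s r sn rn; rewrite !transportP// /octc /oct.
by apply: octahedron_ext => [k m mk kn|k m mk kn|]; [apply: ee'; lia|apply: ee'; lia|lia].
Qed.

Lemma hlocal_transport (A : Type) (Phi : env -> A) e e' : hlocal n Phi ->
  (forall s r, (s <= n)%N -> (r <= n)%N -> cval e s r = cval e' s r) -> Phi (T e) = Phi (T e').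
Proof.
move=> Ploc ee'; apply: Ploc => -[s r]; rewrite mem_hkeys /= => /and3P[sr sn rn].
by have := cval_transport_ext ee' (ltnW sn) rn; rewrite /cellval sn.
Qed.

Lemma spec_nw_minor (x : env) k m : (k <= n)%N ->
  (spec (nw_minor (mat x n) (inord k)))`_m = gtspec n x (k, m).
Proof.
move=> kn; have -> : nw_minor (mat x n) (inord k) = mat x (inord k : 'I_n.+1).
  by apply/matrixP => i j; rewrite !mxE.
by rewrite /gtspec /= kn inordK.
Qed.

Lemma minor_spec_sumE (x : env) k m : (k <= n)%N ->
  minor_spec_sum (mat x n) k m = \sum_(j <- iota 0 m) gtspec n x (k, j).
Proof.
by move=> kn; rewrite sum_iota; apply: eq_bigr => j _; rewrite spec_nw_minor.
Qed.

Lemma octahedron_hiveE (x y : env) a b : (a <= b)%N -> (b <= n)%N ->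
  octahedron_hive (mat x n) (mat y n) a b = hiveval n (T (glue (gtspec n x) (gtspec n y))) a b.
Proof.
move=> ab bn; rewrite /hiveval transportP//; try lia.
rewrite (minn_idPl _); last by lia.
rewrite /octc /oct /octahedron_hive /octahedron_F.
have -> : (n + (n - b) - (n - b + (n - a)) = a)%N by lia.
have -> : (n - a - (n - b) = b - a)%N by lia.
rewrite subnn; apply: octahedron_ext => [k m mk kn|k m mk kn|]; last by lia.
  by rewrite cval_glue1// minor_spec_sumE.
rewrite cval_glue2// minor_spec_sumE//; congr (_ + _).
rewrite rowsum_gtspec// sum_iota (big_ord_widen n (fun j => x (j, j)) kn).
by apply: eq_bigr => j _; rewrite /mat mxE /hent ltnn eqxx.
Qed.

End glued_patterns.

(** * Minor spectra of a shifted matrix *)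

Section shifted_ensemble.
Variables (R : realType) (n : nat).
Hypothesis n0 : (0 < n)%N.
Local Notation C := R[i].
Local Notation renv := (family R nat).
Local Notation env := (family R (nat * nat)).

Definition rdot (x d : renv) : R := \sum_(i <- iota 0 n) x i * d i.

Definition lin (a c : R) (e : env) (d : renv) : env := fun k =>
  if k \in Mkeys n then a * e k + (if k.1 == k.2 then c * d k.1 else 0) else e k.

Lemma measurable_lin d (U : measurableType d) (z c : R) (e : U -> env) (f : U -> renv) :
  measurable_fun setT e -> measurable_fun setT f -> measurable_fun setT (fun x => lin z c (e x) (f x)).
Proof.
move=> me mf; apply: measurable_envP => k; rewrite /lin; case: (_ \in _); last exact: measurable_app.
apply: measurable_funD; first by apply: measurable_funM; [exact: measurable_cst|exact: measurable_app].
by case: (_ == _); [apply: measurable_funM; [exact: measurable_cst|exact: measurable_app]|exact: measurable_cst].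
Qed.

Definition linc (a : R) : R := (\prod_(k <- Mkeys n) `|a|^-1) * star_const R n.

Lemma linc_gt0 a : a != 0 -> 0 < linc a.
Proof.
move=> a0; rewrite mulr_gt0 ?star_const_gt0// prodr_gt0// => k _.
by rewrite invr_gt0 normr_gt0.
Qed.

Lemma hdot_lin a c (e : env) d : a != 0 ->
  hdot n e e / 2 = hdot n (lin a c e d) (lin a c e d) / (2 * a ^+ 2) -
    c / a ^+ 2 * \sum_(i <- iota 0 n) lin a c e d (i, i) * d i + c ^+ 2 / (2 * a ^+ 2) * \sum_(i <- iota 0 n) d i ^+ 2.
Proof.
move=> a0; rewrite -(sum_Mkeys_diag n (fun i => lin a c e d (i, i) * d i)) -(sum_Mkeys_diag n (fun i => d i ^+ 2)).
rewrite /hdot !mulr_suml !mulr_sumr -sumrN -!big_split /=.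
rewrite big_seq [RHS]big_seq; apply: eq_bigr => -[i j] kM; rewrite /lin kM /wt /=.
case: eqP => [ij|_]; last by field.
by move: kM; rewrite -ij => kM; rewrite kM eqxx; field.
Qed.

(** In terms of the shifted matrix the Gaussian weight involves only its trace form, the pairing of
    its diagonal with [d], and [d] itself. The diagonal is the type, so everything depends on the
    minor spectra and [star] applies; the Jacobian of [lin] is contained in [linc]. *)
Lemma lin_star (a c : R) (d : renv) (Psi : env -> \bar R) : a != 0 ->
  measurable_fun setT Psi -> (forall g, 0 <= Psi g)%E ->
  (II (Mkeys n) (fun e => Psi (gtspec n (lin a c e d)) * (expR (- (hdot n e e / 2)))%:E) (fun=> 0%R) =
  (linc a)%:E * II (GTkeys n) (fun g => (gtweight n g)%:E * (Psi g *
    (expR (- (rsq n g / (2 * a ^+ 2)) + c / a ^+ 2 * rdot (gtype g) d -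
       c ^+ 2 / (2 * a ^+ 2) * \sum_(i <- iota 0 n) d i ^+ 2))%:E)) (fun=> 0%R))%E.
Proof.
move=> a0 mPsi Psi0.
pose F g := (Psi g * (expR (- (rsq n g / (2 * a ^+ 2)) + c / a ^+ 2 * rdot (gtype g) d -
       c ^+ 2 / (2 * a ^+ 2) * \sum_(i <- iota 0 n) d i ^+ 2))%:E)%E.
have mF : measurable_fun setT F.
  apply: emeasurable_funM => //; apply/measurable_EFinP.
  apply: (measurable_comp_fun (@measurable_expR _)); apply: measurable_funB; last exact: measurable_cst.
  apply: measurable_funD; last by apply: measurable_funM; [exact: measurable_cst|exact: measurable_gtypes].
  apply: measurableT_comp => //; apply: measurable_funM; [exact: measurable_rsq|exact: measurable_cst].
have F0 g : (0 <= F g)%E by rewrite mule_ge0// lee_fin expR_ge0.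
transitivity (II (Mkeys n) (fun e => F (gtspec n (lin a c e d))) (fun=> 0%R)).
  apply: eq_II => e; rewrite /F; congr (_ * (expR _)%:E)%E.
  rewrite (hdot_lin c e d a0) rsq_gtspec.
  have -> : rdot (gtype (gtspec n (lin a c e d))) d = \sum_(i <- iota 0 n) lin a c e d (i, i) * d i.
    by apply: eq_big_seq => i; rewrite mem_iota => /andP[_ i_n]; rewrite gtype_gtspec.
  by ring.
have ml : measurable_fun setT (fun e => lin a c e d).
  apply: measurable_envP => k; rewrite /lin; case: (_ \in _); last exact: measurable_coord.
  by apply: measurable_funD; [apply: measurable_funM; [exact: measurable_cst|exact: measurable_coord]|exact: measurable_cst].
have mFs : measurable_fun setT (fun e => F (gtspec n e)) by apply: (measurable_comp_fun mF); exact: measurable_gtspec.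
rewrite (II_triangular (c := fun=> a) (Phi := fun e => lin a c e d) (f := fun e => F (gtspec n e)))//.
- rewrite /linc EFinM -muleA; congr (_ * _)%E; exact: star.
- exact: uniq_Mkeys.
- by move=> k e kn; rewrite /lin (negbTE kn).
- move=> s1 k s2 e e' sE ee'; have kM : k \in Mkeys n by rewrite sE mem_cat inE eqxx orbT.
  by rewrite /lin kM; case: eqP => _; ring.
Qed.

Lemma rdotD x d d' : rdot x (fun i => d i + d' i) = rdot x d + rdot x d'.
Proof. by rewrite /rdot -big_split; apply: eq_bigr => i _; rewrite mulrDr. Qed.

Lemma rdotZ x (c : R) d : rdot x (fun i => c * d i) = c * rdot x d.
Proof. by rewrite /rdot mulr_sumr; apply: eq_bigr => i _; ring. Qed.

Lemma rdotDl x y d : rdot (fun i => x i + y i) d = rdot x d + rdot y d.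
Proof. by rewrite /rdot -big_split; apply: eq_bigr => i _; rewrite mulrDl. Qed.

Lemma measurable_rdot d (S : measurableType d) (x y : S -> renv) :
  measurable_fun setT x -> measurable_fun setT y -> measurable_fun setT (fun s => rdot (x s) (y s)).
Proof. by move=> mx my; apply: measurable_sum => i; apply: measurable_funM; exact: measurable_app. Qed.

Lemma measurable_gtypeenv d (S : measurableType d) (g : S -> env) :
  measurable_fun setT g -> measurable_fun setT (fun s => gtype (g s) : renv).
Proof.
by move=> mg; apply: measurable_envP => i; exact: (measurable_comp_fun (@measurable_gtype R i) mg).
Qed.

End shifted_ensemble.

(** * The coupled density and its tilts *)

Section hive_densities.
Variables (R : realType) (n : nat).
Hypothesis n0 : (0 < n)%N.
Local Notation C := R[i].
Local Notation renv := (family R nat).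
Local Notation env := (family R (nat * nat)).
Local Notation T := (@transport R n).
Variables (A B kap : R).
Hypotheses (A0 : 0 < A) (B0 : 0 < B).
Variable psi : env -> env.
Hypotheses (mpsi : measurable_fun setT psi) (psiK : cancel T psi).
Local Notation row := (iota 0 n).
Local Notation nsq d := (rdot n d d).

(** The density, up to a constant, of the ordered spectrum of a GUE matrix. *)
Definition gam (d : renv) : R := vdm2 n d * expR (- (nsq d / 2)).

Lemma gam_ge0 d : 0 <= gam d. Proof. by rewrite mulr_ge0 ?vdm2_ge0 ?expR_ge0. Qed.

Lemma measurable_gam : measurable_fun setT gam.
Proof.
apply: measurable_funM; first exact: measurable_vdm2.
apply: (measurable_comp_fun (@measurable_expR _)); apply: measurableT_comp => //.
by apply: measurable_funM; [apply: measurable_rdot; exact: measurable_id|exact: measurable_cst].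
Qed.

Definition hbase (e : env) : R :=
  (if shive n e then gtvdm n (dla n e) * gtvdm n (dmu n e) else 0) *
  expR (- (rsq n (dla n e) / (2 * A)) - rsq n (dmu n e) / (2 * B)).

(** The density, up to a constant, of the hive, the third pattern and the spectra when both matrices
    are shifted by [d]; the spectrum [d'] is then an independent spectator. *)
Definition paired (e : env) (d d' : renv) : R :=
  hbase e * (if gtint n (dnu n e) then 1 else 0) *
  expR (kap * rdot n (gtype (dnu n e)) d - kap ^+ 2 * (A + B) / 2 * nsq d) * gam d * gam d'.

(** The logarithm of the true density over [paired]. The second pattern is recovered by [psi] from
    the transported data. *)
Definition logratio (e : env) (d d' : renv) : R :=
  kap * rdot n (gtype (dmu n (psi e))) (fun i => d' i - d i) - kap ^+ 2 * B / 2 * (nsq d' - nsq d).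

Definition gtexp (V k : R) (g : env) (d : renv) : R :=
  expR (- (rsq n g / (2 * V)) + k * \sum_(i <- row) gtype g i * d i).

(** The logarithm of the ratio is linear in the type of the second pattern, so the tilt merges with
    the exponential factor of that pattern; this is where the interpolated shift appears. *)
Lemma paired_transport s e d d' :
  paired (T e) d d' * expR (s * logratio (T e) d d') =
  gtweight n (dla n e) * gtexp A kap (dla n e) d *
  (gtweight n (dmu n e) * gtexp B kap (dmu n e) (fun i => d i + s * (d' i - d i))) *
  (expR (- (kap ^+ 2 * (A + B) / 2 * nsq d) - s * (kap ^+ 2 * B / 2 * (nsq d' - nsq d))) *
   gam d * gam d').
Proof.
rewrite /paired /hbase /logratio /gtexp psiK.
have rowE (f g : env) : (forall m, f (n, m) = g (n, m)) -> gtvdm n f = gtvdm n g /\ rsq n f = rsq n g.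
  move=> fg; split; last by apply: eq_bigr => m _; rewrite fg.
  by rewrite /gtvdm; congr vdm; apply: eq_map => m; rewrite fg.
have [-> ->] := rowE _ _ (dla_transport n e); have [-> ->] := rowE _ _ (dmu_transport n e).
have := transport_support n e; rewrite /gtweight.
rewrite (_ : rdot n (gtype (dnu n (T e))) d = rdot n (gtype (dla n e)) d + rdot n (gtype (dmu n e)) d); last first.
  rewrite -rdotDl; apply: eq_big_seq => i; rewrite mem_iota => /andP[_ i_n].
  by rewrite gtype_transport.
rewrite (_ : \sum_(i <- row) gtype (dmu n e) i * (d i + s * (d' i - d i)) =
   rdot n (gtype (dmu n e)) d + s * rdot n (gtype (dmu n e)) (fun i => d' i - d i)); last first.
  by rewrite -rdotZ -rdotD.
rewrite -/(rdot n (gtype (dla n e)) d).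
case: (shive n (T e)); last first.
  by case: (gtint n (dla n e)) => /=; [move=> ->|]; rewrite !(mul0r, mulr0).
case: (gtint n (dnu n (T e))) => /=; last first.
  by case: (gtint n (dla n e)) => /=; [move=> ->|]; rewrite !(mul0r, mulr0).
move=> /andP[-> ->]; rewrite mulr1.
set V1 := gtvdm _ _; set V2 := gtvdm _ _; set g1 := gam d; set g2 := gam d'.
transitivity (V1 * V2 * g1 * g2 * (expR (- (rsq n (dla n e) / (2 * A)) - rsq n (dmu n e) / (2 * B)) *
  expR (kap * (rdot n (gtype (dla n e)) d + rdot n (gtype (dmu n e)) d) - kap ^+ 2 * (A + B) / 2 * nsq d) *
  expR (s * (kap * rdot n (gtype (dmu n e)) (fun i => d' i - d i) - kap ^+ 2 * B / 2 * (nsq d' - nsq d))))).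
  by ring.
rewrite -!expRD.
transitivity (V1 * V2 * g1 * g2 * (expR (- (rsq n (dla n e) / (2 * A)) + kap * rdot n (gtype (dla n e)) d) *
   expR (- (rsq n (dmu n e) / (2 * B)) + kap * (rdot n (gtype (dmu n e)) d + s * rdot n (gtype (dmu n e)) (fun i => d' i - d i))) *
   expR (- (kap ^+ 2 * (A + B) / 2 * nsq d) - s * (kap ^+ 2 * B / 2 * (nsq d' - nsq d))))); last by ring.
by rewrite -!expRD; congr (_ * expR _); ring.
Qed.

Lemma measurable_paired d (S : measurableType d) (e : S -> env) (d1 d2 : S -> renv) :
  measurable_fun setT e -> measurable_fun setT d1 -> measurable_fun setT d2 ->
  measurable_fun setT (fun s => paired (e s) (d1 s) (d2 s)).
Proof.
move=> me m1 m2.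
have mla := measurable_comp_fun (@measurable_dla R n) me.
have mmu := measurable_comp_fun (@measurable_dmu R n) me.
have mnu := measurable_comp_fun (@measurable_dnu R n) me.
apply: measurable_funM; last exact: (measurable_comp_fun measurable_gam m2).
apply: measurable_funM; last exact: (measurable_comp_fun measurable_gam m1).
apply: measurable_funM; last first.
  apply: (measurable_comp_fun (@measurable_expR _)); apply: measurable_funB.
    apply: measurable_funM; first exact: measurable_cst.
    by apply: measurable_rdot => //; exact: measurable_gtypeenv.
  by apply: measurable_funM; [exact: measurable_cst|exact: measurable_rdot].
apply: measurable_funM; last first.
  apply: measurable_fun_ifT; try exact: measurable_cst.
  exact: (measurable_comp_fun (@measurable_gtint R n) mnu).
rewrite /hbase; apply: measurable_funM.
  apply: measurable_fun_ifT; last exact: measurable_cst.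
    exact: (measurable_comp_fun (@measurable_shive R n) me).
  by apply: measurable_funM; exact: (measurable_comp_fun (@measurable_gtvdm R n)).
apply: (measurable_comp_fun (@measurable_expR _)); apply: measurable_funB.
  apply: measurableT_comp => //; apply: measurable_funM; last exact: measurable_cst.
  exact: (measurable_comp_fun (@measurable_rsq R n) mla).
apply: measurable_funM; last exact: measurable_cst.
exact: (measurable_comp_fun (@measurable_rsq R n) mmu).
Qed.

Lemma measurable_logratio d (S : measurableType d) (e : S -> env) (d1 d2 : S -> renv) :
  measurable_fun setT e -> measurable_fun setT d1 -> measurable_fun setT d2 ->
  measurable_fun setT (fun s => logratio (e s) (d1 s) (d2 s)).
Proof.
move=> me m1 m2; apply: measurable_funB.
  apply: measurable_funM; first exact: measurable_cst.
  apply: measurable_rdot.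
    apply: measurable_gtypeenv.
    exact: (measurable_comp_fun (@measurable_dmu R n) (measurable_comp_fun mpsi me)).
  by apply: measurable_envP => i; apply: measurable_funB; exact: measurable_app.
apply: measurable_funM; first exact: measurable_cst.
by apply: measurable_funB; exact: measurable_rdot.
Qed.

Lemma decrn_gtvdm_ge0 (g : env) : decrn n (gtrow g n) -> 0 <= gtvdm n g.
Proof. by move=> H; apply/ltW/gtdecr_vdm. Qed.

Lemma hbase_ge0 e : 0 <= hbase e.
Proof.
rewrite /hbase mulr_ge0 ?expR_ge0//; case: ifP => // /(shive_decrn n0)[H1 H2 _].
by rewrite mulr_ge0// decrn_gtvdm_ge0.
Qed.

Lemma paired_ge0 e d d' : 0 <= paired e d d'.
Proof.
rewrite /paired; have := hbase_ge0 e; set h := hbase e => h0.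
by do ![exact: h0 | exact: expR_ge0 | exact: gam_ge0 | apply: mulr_ge0]; case: ifP.
Qed.

Lemma II_paired s (d d' : renv) (Phi : env -> \bar R) :
  measurable_fun setT Phi -> (forall e, 0 <= Phi e)%E -> hlocal n Phi ->
  II (colkeys n) (fun e => (paired e d d' * expR (s * logratio e d d'))%:E * Phi e)%E (fun=> 0) =
  II (GTkeys n) (fun g1 => II (GTkeys n) (fun g2 => Phi (T (glue n g1 g2)) *
    (gtweight n g1 * gtexp A kap g1 d *
    (gtweight n g2 * gtexp B kap g2 (fun i => d i + s * (d' i - d i))) *
    (expR (- (kap ^+ 2 * (A + B) / 2 * nsq d) - s * (kap ^+ 2 * B / 2 * (nsq d' - nsq d))) *
     gam d * gam d'))%:E)%E (fun=> 0)) (fun=> 0).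
Proof.
move=> mPhi Phi0 Ploc; have [mT invT _] := @transport_iso R n.
pose W (g1 g2 : env) : R := gtweight n g1 * gtexp A kap g1 d *
    (gtweight n g2 * gtexp B kap g2 (fun i => d i + s * (d' i - d i))) *
    (expR (- (kap ^+ 2 * (A + B) / 2 * nsq d) - s * (kap ^+ 2 * B / 2 * (nsq d' - nsq d))) *
     gam d * gam d').
have W0 g1 g2 : 0 <= W g1 g2.
  by rewrite /W /gtexp; do ![exact: gtweight_ge0 | exact: expR_ge0 | exact: gam_ge0 | apply: mulr_ge0].
have mgt V k x : measurable_fun setT (fun g : env => gtexp V k g x).
  apply: (measurable_comp_fun (@measurable_expR _)); apply: measurable_funD.
    apply: measurableT_comp => //; apply: measurable_funM; [exact: measurable_rsq|exact: measurable_cst].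
  by apply: measurable_funM; [exact: measurable_cst|exact: measurable_gtypes].
have mW : measurable_fun setT (fun p : env * env => W p.1 p.2).
  apply: measurable_funM; last exact: measurable_cst.
  apply: measurable_funM; apply: measurable_funM.
  - exact: (measurable_comp_fun (@measurable_gtweight R n) measurable_fst).
  - exact: (measurable_comp_fun (mgt A kap d) measurable_fst).
  - exact: (measurable_comp_fun (@measurable_gtweight R n) measurable_snd).
  - exact: (measurable_comp_fun (mgt B kap _) measurable_snd).
rewrite -(invT (fun e => (paired e d d' * expR (s * logratio e d d'))%:E * Phi e)%E)//; last 2 first.
- apply: emeasurable_funM => //; apply/measurable_EFinP; apply: measurable_funM.
    by apply: measurable_paired; [exact: measurable_id|exact: measurable_cst|exact: measurable_cst].
  apply: (measurable_comp_fun (@measurable_expR _)); apply: measurable_funM; first exact: measurable_cst.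
  by apply: measurable_logratio; [exact: measurable_id|exact: measurable_cst|exact: measurable_cst].
- by move=> e; rewrite mule_ge0// lee_fin mulr_ge0 ?paired_ge0 ?expR_ge0.
rewrite (@II_GT_GT R n (fun g1 g2 => Phi (T (glue n g1 g2)) * (W g1 g2)%:E)%E (fun=> 0)); last 2 first.
- apply: emeasurable_funM; last exact/measurable_EFinP.
  apply: (measurable_comp_fun mPhi); apply: (measurable_comp_fun mT).
  by apply: measurable_glue; [exact: measurable_fst|exact: measurable_snd].
- by move=> g1 g2; rewrite mule_ge0// lee_fin.
apply: eq_II => e; rewrite paired_transport muleC; congr (_ * _)%E.
by apply: hlocal_transport => // a b an bn; rewrite glue_dla_dmu.
Qed.

Lemma II_mul (K K' : eqType) (s : seq K) (s' : seq K') (f : family R K -> \bar R)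
    (g : family R K' -> \bar R) c b b' : measurable_fun setT f -> measurable_fun setT g ->
  (forall x, 0 <= f x)%E -> (forall y, 0 <= g y)%E -> (0 <= c)%E ->
  (II s (fun x => II s' (fun y => c * (f x * g y)) b') b = c * (II s f b * II s' g b'))%E.
Proof.
move=> mf mg f0 g0 c0; have G0 : (0 <= II s' g b')%E by exact: II_ge0.
transitivity (II s (fun x => (c * II s' g b') * f x)%E b).
  apply: eq_II => x; transitivity (II s' (fun y => (c * f x) * g y)%E b').
    by apply: eq_II => y; rewrite muleA.
  by rewrite (IIZl _ _ mg)// ?mule_ge0// -muleA [(f x * _)%E]muleC muleA.
by rewrite (IIZl _ _ mf)// ?mule_ge0// -muleA [(II s' g b' * _)%E]muleC.
Qed.

Lemma measurable_gtexp V k x : measurable_fun setT (fun g : env => gtexp V k g x).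
Proof.
apply: (measurable_comp_fun (@measurable_expR _)); apply: measurable_funD.
  apply: measurableT_comp => //; apply: measurable_funM; [exact: measurable_rsq|exact: measurable_cst].
by apply: measurable_funM; [exact: measurable_cst|exact: measurable_gtypes].
Qed.

(** The Gaussian mass of the second pattern is exponential in [|d + s (d' - d)|^2]; combined with
    the terms of [paired] and [logratio] that involve the spectra alone, only the part in
    [s (s - 1)] survives. *)
Lemma II_paired_mass s (d d' : renv) :
  II (colkeys n) (fun e => (paired e d d' * expR (s * logratio e d d'))%:E) (fun=> 0) =
  (@gt_gauss_const R n A * @gt_gauss_const R n B *
   expR (kap ^+ 2 * B / 2 * (s * (s - 1)) * nsq (fun i => d' i - d i)) * gam d * gam d')%:E.
Proof.
transitivity (II (colkeys n) (fun e => (paired e d d' * expR (s * logratio e d d'))%:E * 1)%E (fun=> 0)).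
  by apply: eq_II => e; rewrite mule1.
rewrite (@II_paired s d d' (fun=> 1%E))//.
set dd := fun i => d i + s * (d' i - d i).
set c := expR _ * gam d * gam d'.
have c0 : (0 <= c%:E)%E by rewrite lee_fin; do ![exact: expR_ge0 | exact: gam_ge0 | apply: mulr_ge0].
have mf V k x : measurable_fun setT (fun g : env => (gtweight n g * gtexp V k g x)%:E)%E.
  apply/measurable_EFinP; apply: measurable_funM; [exact: measurable_gtweight|exact: measurable_gtexp].
have f0 V k x g : (0 <= (gtweight n g * gtexp V k g x)%:E)%E.
  by rewrite lee_fin; apply: mulr_ge0; [exact: gtweight_ge0|exact: expR_ge0].
have I1 V k x : 0 < V -> II (GTkeys n) (fun g => (gtweight n g * gtexp V k g x)%:E)%E (fun=> 0) =
   (@gt_gauss_const R n V * expR (k ^+ 2 * V / 2 * nsq x))%:E.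
  move=> V0; rewrite (_ : nsq x = \sum_(i <- row) x i ^+ 2); last by apply: eq_bigr => i _; rewrite expr2.
  by rewrite -(@II_gt_gauss R n V k x V0); apply: eq_II => g; rewrite EFinM.
transitivity (II (GTkeys n) (fun g1 => II (GTkeys n) (fun g2 => c%:E *
   ((gtweight n g1 * gtexp A kap g1 d)%:E * (gtweight n g2 * gtexp B kap g2 dd)%:E))%E (fun=> 0)) (fun=> 0)).
  by apply: eq_II => g1; apply: eq_II => g2; rewrite mul1e -!EFinM; congr (_%:E); rewrite /c; ring.
rewrite II_mul// !I1// -!EFinM; congr (_%:E); rewrite /c.
set E0 := expR _; set E1 := expR _; set E2 := expR _; set E3 := expR _.
suff -> : E3 = E0 * (E1 * E2) by ring.
rewrite /E0 /E1 /E2 /E3 -!expRD; congr expR.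
rewrite (_ : nsq dd = nsq d + 2 * s * rdot n d (fun i => d' i - d i) + s ^+ 2 * nsq (fun i => d' i - d i)); last first.
  by rewrite /rdot !mulr_sumr -!big_split /=; apply: eq_bigr => i _; rewrite /dd; ring.
rewrite (_ : nsq d' = nsq d + 2 * rdot n d (fun i => d' i - d i) + nsq (fun i => d' i - d i)); last first.
  by rewrite /rdot !mulr_sumr -!big_split /=; apply: eq_bigr => i _; ring.
by ring.
Qed.

Definition mixint (Phi : env -> \bar R) (d d' : renv) (g1 g2 : env) : \bar R :=
  (Phi (T (glue n g1 g2)) *
    (gtweight n g1 * gtexp A kap g1 d * (gtweight n g2 * gtexp B kap g2 d') *
    expR (- (kap ^+ 2 * A / 2 * nsq d) - kap ^+ 2 * B / 2 * nsq d' - (nsq d + nsq d') / 2))%:E)%E.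

(** In the true model, the unnormalised average of [Phi] over the two patterns for fixed spectra [d]
    and [d'], with the Gaussian weights of these spectra included. *)
Definition mixture (Phi : env -> \bar R) (d d' : renv) : \bar R :=
  II (GTkeys n) (fun g1 => II (GTkeys n) (mixint Phi d d' g1) (fun=> 0)) (fun=> 0).

Lemma measurable_gtexp2 dS (S : measurableType dS) V k (g : S -> env) (x : S -> renv) :
  measurable_fun setT g -> measurable_fun setT x ->
  measurable_fun setT (fun s => gtexp V k (g s) (x s)).
Proof.
move=> mg mx; apply: (measurable_comp_fun (@measurable_expR _)); apply: measurable_funD.
  apply: measurableT_comp => //; apply: measurable_funM; last exact: measurable_cst.
  exact: (measurable_comp_fun (@measurable_rsq R n) mg).
apply: measurable_funM; first exact: measurable_cst.
by apply: (@measurable_rdot R n) => //; exact: measurable_gtypeenv.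
Qed.

Lemma mixint_ge0 Phi d d' g1 g2 : (forall e, 0 <= Phi e)%E -> (0 <= mixint Phi d d' g1 g2)%E.
Proof.
move=> Phi0; rewrite mule_ge0// lee_fin /gtexp.
by do ![exact: gtweight_ge0 | exact: expR_ge0 | apply: mulr_ge0].
Qed.

Lemma mixture_ge0 Phi d d' : (forall e, 0 <= Phi e)%E -> (0 <= mixture Phi d d')%E.
Proof. by move=> Phi0; apply: II_ge0 => g1; apply: II_ge0 => g2; exact: mixint_ge0. Qed.

Lemma measurable_mixint Phi : measurable_fun setT Phi ->
  measurable_fun setT (fun p : renv * renv * env * env => mixint Phi p.1.1.1 p.1.1.2 p.1.2 p.2).
Proof.
move=> mPhi; have [mT _ _] := @transport_iso R n.
have m1 : measurable_fun setT (fun p : renv * renv * env * env => p.1.1.1).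
  exact: (measurable_comp_fun measurable_fst (measurable_comp_fun measurable_fst measurable_fst)).
have m2 : measurable_fun setT (fun p : renv * renv * env * env => p.1.1.2).
  exact: (measurable_comp_fun measurable_snd (measurable_comp_fun measurable_fst measurable_fst)).
have m3 : measurable_fun setT (fun p : renv * renv * env * env => p.1.2).
  exact: (measurable_comp_fun measurable_snd measurable_fst).
have m4 : measurable_fun setT (fun p : renv * renv * env * env => p.2) by exact: measurable_snd.
apply: emeasurable_funM.
  by apply: (measurable_comp_fun mPhi); apply: (measurable_comp_fun mT); exact: measurable_glue.
apply/measurable_EFinP; apply: measurable_funM.
  apply: measurable_funM; apply: measurable_funM; try exact: measurable_gtexp2;
    exact: (measurable_comp_fun (@measurable_gtweight R n)).
apply: (measurable_comp_fun (@measurable_expR _)).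
have mn (x : renv * renv * env * env -> renv) : measurable_fun setT x -> measurable_fun setT (fun p => nsq (x p)).
  by move=> mx; exact: (@measurable_rdot R n).
have mc (c : R) (f : renv * renv * env * env -> R) : measurable_fun setT f -> measurable_fun setT (fun p => c * f p).
  by move=> mf; apply: measurable_funM => //; exact: measurable_cst.
apply: measurable_funB; last first.
  by apply: measurable_funM; [apply: measurable_funD; exact: mn|exact: measurable_cst].
apply: measurable_funB; last by apply: mc; exact: mn.
by apply: measurableT_comp => //; apply: mc; exact: mn.
Qed.

Lemma measurable_mixture1 Phi : measurable_fun setT Phi -> (forall e, 0 <= Phi e)%E ->
  measurable_fun setT (fun p : renv * renv * env =>
    II (GTkeys n) (mixint Phi p.1.1 p.1.2 p.2) (fun=> 0)).
Proof.
move=> mPhi Phi0; apply: measurable_II_param; [exact: measurable_mixint|by move=> *; exact: mixint_ge0|exact: measurable_cst].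
Qed.

Lemma measurable_mixture Phi : measurable_fun setT Phi -> (forall e, 0 <= Phi e)%E ->
  measurable_fun setT (fun p : renv * renv => mixture Phi p.1 p.2).
Proof.
move=> mPhi Phi0; apply: measurable_II_param; [exact: measurable_mixture1| |exact: measurable_cst].
by move=> p g1; apply: II_ge0 => g2; exact: mixint_ge0.
Qed.

(** The case [s = 1] of [II_paired], with [II_spec] applied to each of the two shifts. *)
Lemma II_mixture Phi : measurable_fun setT Phi -> (forall e, 0 <= Phi e)%E -> hlocal n Phi ->
  II (Mkeys n) (fun e3 => II (Mkeys n) (fun e4 =>
    mixture Phi (specenv (mat e3 n)) (specenv (mat e4 n))) (fun=> 0)) (fun=> 0) =
  ((@spec_const R n ^+ 2)%:E * II row (fun d => II row (fun d' => II (colkeys n) (fun e =>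
     (paired e d d' * expR (logratio e d d'))%:E * Phi e) (fun=> 0%R)) (fun=> 0%R)) (fun=> 0%R))%E.
Proof.
move=> mPhi Phi0 Ploc.
have mM := measurable_mixture mPhi Phi0.
have mM1 d : measurable_fun setT (mixture Phi d).
  exact: (measurable_comp_fun mM (measurable_fun_pair (@measurable_cst _ _ _ _ _ d) (@measurable_id _ _ setT))).
have mV : measurable_fun setT (fun d : renv => (vdm2 n d)%:E) by apply/measurable_EFinP; exact: measurable_vdm2.
have V0 d : (0 <= (vdm2 n d : R)%:E)%E by rewrite lee_fin vdm2_ge0.
pose M2 d := II row (fun d' => (vdm2 n d')%:E * mixture Phi d d')%E (fun=> 0).
have mM2 : measurable_fun setT M2.
  apply: measurable_II_param; [|by move=> d d'; rewrite mule_ge0// mixture_ge0|exact: measurable_cst].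
  by apply: emeasurable_funM => //; exact: (measurable_comp_fun mV measurable_snd).
have M20 d : (0 <= M2 d)%E by apply: II_ge0 => d'; rewrite mule_ge0// mixture_ge0.
have sc0 : (0 <= (@spec_const R n)%:E)%E by rewrite lee_fin ltW// spec_const_gt0.
transitivity (II (Mkeys n) (fun e3 => ((@spec_const R n)%:E * M2 (specenv (mat e3 n)))%E) (fun=> 0)).
  by apply: eq_II => e3; rewrite II_spec// => d'; exact: mixture_ge0.
rewrite (@II_spec R n (fun d => (@spec_const R n)%:E * M2 d)%E)//; last 2 first.
- by apply: emeasurable_funM => //; exact: measurable_cst.
- by move=> d; rewrite mule_ge0.
transitivity ((@spec_const R n)%:E * ((@spec_const R n)%:E * II row (fun d => (vdm2 n d)%:E * M2 d) (fun=> 0%R)))%E.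
  congr (_ * _)%E; rewrite -IIZl//; last 2 first.
  - exact: emeasurable_funM.
  - by move=> d; rewrite mule_ge0.
  by apply: eq_II => d; rewrite muleCA.
rewrite muleA -EFinM -expr2; congr (_ * _)%E; apply: eq_II => d.
rewrite /M2 -(IIZl _ _ _ _ (V0 d)); last 2 first.
- by apply: emeasurable_funM => //; exact: mM1.
- by move=> d'; rewrite mule_ge0// mixture_ge0.
apply: eq_II => d'.
transitivity (II (colkeys n) (fun e => (paired e d d' * expR (1 * logratio e d d'))%:E * Phi e)%E (fun=> 0)); last first.
  by apply: eq_II => e; rewrite mul1r.
rewrite (@II_paired 1 d d')// muleA -EFinM /mixture.
have mC : (0 <= (vdm2 n d * vdm2 n d' : R)%:E)%E by rewrite lee_fin mulr_ge0 ?vdm2_ge0.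
rewrite -IIZl//; last 2 first.
- exact: (measurable_comp_fun (measurable_mixture1 mPhi Phi0)
    (measurable_fun_pair (@measurable_cst _ _ _ _ _ (d, d')) (@measurable_id _ _ setT))).
- by move=> g1; apply: II_ge0 => g2; exact: mixint_ge0.
apply: eq_II => g1; rewrite -IIZl//; last 2 first.
- exact: (measurable_comp_fun (measurable_mixint mPhi)
    (measurable_fun_pair (@measurable_cst _ _ _ _ _ (d, d', g1)) (@measurable_id _ _ setT))).
- by move=> g2; exact: mixint_ge0.
apply: eq_II => g2; rewrite /mixint muleCA -EFinM; congr (_ * _%:E)%E.
rewrite (_ : (fun i => d i + 1 * (d' i - d i)) = d'); last by apply/funext => i; ring.
rewrite /gam; set V1 := vdm2 n d; set V2 := vdm2 n d'; set x1 := gtweight _ _ * gtexp _ _ _ _; set x2 := gtweight _ _ * gtexp _ _ _ _.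
transitivity (V1 * V2 * x1 * x2 * (expR (- (kap ^+ 2 * (A + B) / 2 * nsq d) - 1 * (kap ^+ 2 * B / 2 * (nsq d' - nsq d))) *
  expR (- (nsq d / 2)) * expR (- (nsq d' / 2)))); last by ring.
rewrite -!expRD; transitivity (V1 * V2 * x1 * x2 * expR (- (kap ^+ 2 * A / 2 * nsq d) - kap ^+ 2 * B / 2 * nsq d' - (nsq d + nsq d') / 2)); first by ring.
by congr (_ * expR _); ring.
Qed.

(** For fixed shifts [lin_star] is applied to each of the two matrices, and [II_mixture] moves the
    result to the side of the hive. *)
Lemma hive_law dT (S : measurableType dT) (P : probability S R) (G G' Gt Gt' : S -> 'M[C]_n)
    (a a' : R) (Phi : env -> \bar R) :
  is_GUE P G -> is_GUE P G' -> is_GUE P Gt -> is_GUE P Gt' ->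
  independent_matrices P (tnth [tuple G; G'; Gt; Gt']) ->
  a != 0 -> a' != 0 -> a ^+ 2 = A -> a' ^+ 2 = B ->
  measurable_fun setT Phi -> (forall e, 0 <= Phi e)%E -> hlocal n Phi ->
  (\int[P]_om Phi (T (glue n
     (gtspec n (lin n a (kap * A) (hcoord (G om)) (specenv (mat (hcoord (Gt om)) n))))
     (gtspec n (lin n a' (kap * B) (hcoord (G' om)) (specenv (mat (hcoord (Gt' om)) n)))))) =
  (gue_const R n ^+ 4 * (linc n a * linc n a') * @spec_const R n ^+ 2)%:E *
   II row (fun d => II row (fun d' => II (colkeys n) (fun e =>
     (paired e d d' * expR (logratio e d d'))%:E * Phi e) (fun=> 0%R)) (fun=> 0%R)) (fun=> 0%R))%E.
Proof.
move=> h1 h2 h3 h4 ind an0 a'n0 aA aB mPhi Phi0 Ploc; have [mT _ _] := @transport_iso R n.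
pose F (e1 e2 e3 e4 : env) : \bar R := Phi (T (glue n
     (gtspec n (lin n a (kap * A) e1 (specenv (mat e3 n))))
     (gtspec n (lin n a' (kap * B) e2 (specenv (mat e4 n)))))).
have mgl dU (U : measurableType dU) (z c : R) (e e' : U -> env) : measurable_fun setT e -> measurable_fun setT e' ->
    measurable_fun setT (fun x => gtspec n (lin n z c (e x) (specenv (mat (e' x) n)))).
  move=> me me'; apply: (measurable_comp_fun (@measurable_gtspec R n)); apply: measurable_lin => //.
  exact: measurable_specenv.
have mPT dU (U : measurableType dU) (g1 g2 : U -> env) : measurable_fun setT g1 -> measurable_fun setT g2 ->
    measurable_fun setT (fun x => Phi (T (glue n (g1 x) (g2 x)))).
  by move=> m1 m2; apply: (measurable_comp_fun mPhi); apply: (measurable_comp_fun mT); exact: measurable_glue.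
have p1 : measurable_fun setT (fun p : env * env * env * env => p.1.1.1).
  exact: (measurable_comp_fun measurable_fst (measurable_comp_fun measurable_fst measurable_fst)).
have p2 : measurable_fun setT (fun p : env * env * env * env => p.1.1.2).
  exact: (measurable_comp_fun measurable_snd (measurable_comp_fun measurable_fst measurable_fst)).
have p3 : measurable_fun setT (fun p : env * env * env * env => p.1.2).
  exact: (measurable_comp_fun measurable_snd measurable_fst).
have p4 : measurable_fun setT (fun p : env * env * env * env => p.2) by exact: measurable_snd.
rewrite (@GUE_law R _ S P n G G' Gt Gt' F)//; [|by apply: mPT; exact: mgl|by move=> *; exact: Phi0].
set c1 := gue_const R n ^+ 4 * (linc n a * linc n a').
have c10 : (0 <= c1%:E)%E.
  rewrite lee_fin; apply: mulr_ge0; first by apply: exprn_ge0; apply: ltW; exact: gue_const_gt0.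
  by apply: mulr_ge0; apply: ltW; exact: linc_gt0.
have mspec : measurable_fun setT (fun e : env => specenv (mat e n)) by apply: measurable_specenv; exact: measurable_id.
have mmix := measurable_mixture mPhi Phi0.
transitivity (II (Mkeys n) (fun e3 => II (Mkeys n) (fun e4 =>
    c1%:E * mixture Phi (specenv (mat e3 n)) (specenv (mat e4 n)))%E (fun=> 0)) (fun=> 0)); last first.
  rewrite (EFinM c1) -muleA -II_mixture// -IIZl//; last 2 first.
  - apply: measurable_II_param; [|by move=> *; exact: mixture_ge0|exact: measurable_cst].
    exact: (measurable_comp_fun mmix (measurable_fun_pair (measurable_comp_fun mspec (@measurable_fst _ _ env env))
      (measurable_comp_fun mspec (@measurable_snd _ _ env env)))).
  - by move=> e3; apply: II_ge0 => e4; exact: mixture_ge0.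
  apply: eq_II => e3; rewrite -IIZl//; last by move=> *; exact: mixture_ge0.
  exact: (measurable_comp_fun mmix (measurable_fun_pair (@measurable_cst _ _ env _ setT (specenv (mat e3 n))) mspec)).
apply: eq_II => e3; apply: eq_II => e4.
have hE (e : env) : hdot n e e = nsq (specenv (mat e n)).
  rewrite -rsq_gtspec; apply: eq_bigr => m _.
  by rewrite /gtspec /= leqnn /specenv -expr2.
rewrite /F; under eq_II => e1 do under eq_II => e2 do rewrite (hE e3) (hE e4).
set d := specenv (mat e3 n); set d' := specenv (mat e4 n).
pose E1 g := expR (- (rsq n g / (2 * a ^+ 2)) + kap * A / a ^+ 2 * rdot n (gtype g) d -
       (kap * A) ^+ 2 / (2 * a ^+ 2) * \sum_(i <- iota 0 n) d i ^+ 2).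
pose E2 g := expR (- (rsq n g / (2 * a' ^+ 2)) + kap * B / a' ^+ 2 * rdot n (gtype g) d' -
       (kap * B) ^+ 2 / (2 * a' ^+ 2) * \sum_(i <- iota 0 n) d' i ^+ 2).
have sqE (x : renv) : \sum_(i <- row) x i ^+ 2 = nsq x by apply: eq_bigr => i _; rewrite expr2.
have E1E g : E1 g = gtexp A kap g d * expR (- (kap ^+ 2 * A / 2 * nsq d)).
  rewrite /E1 /gtexp -expRD aA sqE /rdot; congr expR; field; exact: lt0r_neq0.
have E2E g : E2 g = gtexp B kap g d' * expR (- (kap ^+ 2 * B / 2 * nsq d')).
  rewrite /E2 /gtexp -expRD aB sqE /rdot; congr expR; field; exact: lt0r_neq0.
have E20 g : (0 <= (E2 g)%:E)%E by rewrite lee_fin expR_ge0.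
have mE2 : measurable_fun setT (fun g => (E2 g)%:E).
  apply/measurable_EFinP; rewrite (funext E2E).
  by apply: measurable_funM; [exact: measurable_gtexp|exact: measurable_cst].
pose x0 : R := expR (- ((nsq d + nsq d') / 2)).
pose hh g1 g2 := ((gtweight n g2)%:E * (Phi (T (glue n g1 g2)) * (E2 g2)%:E))%E.
have mgw : measurable_fun setT (fun g : env => (gtweight n g)%:E) by apply/measurable_EFinP; exact: measurable_gtweight.
have gw0 g : (0 <= (gtweight n g : R)%:E)%E by rewrite lee_fin gtweight_ge0.
have mh2 : measurable_fun setT (fun p : env * env => hh p.1 p.2).
  apply: emeasurable_funM; first exact: (measurable_comp_fun mgw measurable_snd).
  apply: emeasurable_funM; first by apply: mPT; [exact: measurable_fst|exact: measurable_snd].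
  exact: (measurable_comp_fun mE2 measurable_snd).
have hh0 g1 g2 : (0 <= hh g1 g2)%E by rewrite !mule_ge0.
have mh21 g1 : measurable_fun setT (hh g1).
  exact: (measurable_comp_fun mh2 (measurable_fun_pair (@measurable_cst _ _ _ _ _ g1) (@measurable_id _ _ setT))).
pose H2 g1 := II (GTkeys n) (hh g1) (fun=> 0%R).
have mH2 : measurable_fun setT H2.
  by apply: measurable_II_param => //; exact: measurable_cst.
have H20 g1 : (0 <= H2 g1)%E by exact: II_ge0.
have mhd : measurable_fun setT (fun e : env => (expR (- (hdot n e e / 2)))%:E).
  apply/measurable_EFinP; apply: (measurable_comp_fun (@measurable_expR _)); apply: measurableT_comp => //.
  by apply: measurable_funM; [apply: measurable_hdot; exact: measurable_id|exact: measurable_cst].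
have hd0 (e : env) : (0 <= (expR (- (hdot n e e / 2)))%:E)%E by rewrite lee_fin expR_ge0.
pose l1 e1 := gtspec n (lin n a (kap * A) e1 d).
pose l2 e2 := gtspec n (lin n a' (kap * B) e2 d').
have ml1 : measurable_fun setT l1.
  by apply: (measurable_comp_fun (@measurable_gtspec R n)); apply: measurable_lin; [exact: measurable_id|exact: measurable_cst].
have ml2 : measurable_fun setT l2.
  by apply: (measurable_comp_fun (@measurable_gtspec R n)); apply: measurable_lin; [exact: measurable_id|exact: measurable_cst].
pose K2 := gue_const R n ^+ 4 * x0 * linc n a'.
have K20 : (0 <= K2%:E)%E.
  rewrite lee_fin; apply: mulr_ge0; last by apply: ltW; exact: linc_gt0.
  by apply: mulr_ge0; [apply: exprn_ge0; apply: ltW; exact: gue_const_gt0|exact: expR_ge0].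
transitivity (II (Mkeys n) (fun e1 => K2%:E * (H2 (l1 e1) * (expR (- (hdot n e1 e1 / 2)))%:E))%E (fun=> 0)).
  apply: eq_II => e1; set y1 := expR (- (hdot n e1 e1 / 2)).
  have y0 : (0 <= (gue_const R n ^+ 4 * x0 * y1)%:E)%E.
    rewrite lee_fin; apply: mulr_ge0; last exact: expR_ge0.
    by apply: mulr_ge0; [apply: exprn_ge0; apply: ltW; exact: gue_const_gt0|exact: expR_ge0].
  transitivity (II (Mkeys n) (fun e2 => (gue_const R n ^+ 4 * x0 * y1)%:E *
      (Phi (T (glue n (l1 e1) (l2 e2))) * (expR (- (hdot n e2 e2 / 2)))%:E))%E (fun=> 0)).
    apply: eq_II => e2; rewrite [RHS]muleCA -EFinM; congr (_ * _%:E)%E.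
    transitivity (gue_const R n ^+ 4 * (x0 * y1 * expR (- (hdot n e2 e2 / 2)))); last by ring.
    by congr (_ * _); rewrite /x0 /y1 -!expRD; congr expR; field.
  have mP2 : measurable_fun setT (fun g2 => Phi (T (glue n (l1 e1) g2))).
    by apply: mPT; [exact: measurable_cst|exact: measurable_id].
  rewrite IIZl//; last 2 first.
  - apply: emeasurable_funM => //; exact: (measurable_comp_fun mP2 ml2).
  - by move=> e2; rewrite mule_ge0.
  rewrite (@lin_star R n a' (kap * B) d' (fun g2 => Phi (T (glue n (l1 e1) g2))) a'n0 mP2)//.
  rewrite muleA -EFinM [RHS]muleCA [RHS]muleC -EFinM; congr (_%:E * _)%E; rewrite /K2; ring.
rewrite IIZl//; last 2 first.
- by apply: emeasurable_funM => //; exact: (measurable_comp_fun mH2 ml1).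
- by move=> e1; rewrite mule_ge0.
rewrite (@lin_star R n a (kap * A) d H2 an0 mH2 H20).
have E10 g : (0 <= (E1 g)%:E)%E by rewrite lee_fin expR_ge0.
have mE1 : measurable_fun setT (fun g => (E1 g)%:E).
  apply/measurable_EFinP; rewrite (funext E1E).
  by apply: measurable_funM; [exact: measurable_gtexp|exact: measurable_cst].
have -> : mixture Phi d d' = (x0%:E * II (GTkeys n) (fun g1 => (gtweight n g1)%:E * (H2 g1 * (E1 g1)%:E)) (fun=> 0%R))%E.
  rewrite -IIZl//; last 3 first.
  - by apply: emeasurable_funM => //; exact: emeasurable_funM.
  - by move=> g1; rewrite !mule_ge0.
  - by rewrite lee_fin expR_ge0.
  apply: eq_II => g1.
  have z0 : (0 <= (x0 * gtweight n g1 * E1 g1)%:E)%E.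
    by rewrite lee_fin !mulr_ge0 ?expR_ge0// gtweight_ge0.
  transitivity ((x0 * gtweight n g1 * E1 g1)%:E * H2 g1)%E.
    rewrite -(IIZl _ _ (mh21 g1))//; apply: eq_II => g2.
    rewrite /hh /mixint muleC [(Phi _ * (E2 g2)%:E)%E]muleC !muleA -!EFinM; congr (_%:E * _)%E.
    rewrite E1E E2E; set w1 := gtexp _ _ _ _; set w2 := gtexp _ _ _ _.
    transitivity (gtweight n g1 * gtweight n g2 * w1 * w2 * (x0 * expR (- (kap ^+ 2 * A / 2 * nsq d)) *
      expR (- (kap ^+ 2 * B / 2 * nsq d')))); last by ring.
    rewrite /x0 -!expRD (_ : expR _ = expR (- ((nsq d + nsq d') / 2) - kap ^+ 2 * A / 2 * nsq d - kap ^+ 2 * B / 2 * nsq d')).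
      by ring.
    by congr expR; field.
  by rewrite !EFinM -!muleA [(H2 g1 * _)%E]muleC.
rewrite !muleA -!EFinM; congr (_%:E * _)%E; rewrite /K2 /c1; ring.
Qed.

End hive_densities.

(** * Hidden variables *)

Section coupling_bound.
Variables (R : realType) (n : nat).
Local Notation renv := (family R nat).
Local Notation row := (iota 0 n).
Local Notation nsq d := (rdot n d d).

Definition rowlocal (A : Type) (F : renv -> A) := forall d d', {in row, d =1 d'} -> F d = F d'.

Lemma II_row_affine (F : renv -> \bar R) (c : R) (v : renv) : c != 0 ->
  measurable_fun setT F -> (forall d, 0 <= F d)%E -> rowlocal F ->
  (II row (fun d => F (fun i => c * d i + v i)%R) (fun=> 0%R) = (`|c|^-1 ^+ n)%:E * II row F (fun=> 0%R))%E.
Proof.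
move=> c0 mF F0 Floc.
pose Phi (d : renv) : renv := fun i => if i \in row then c * d i + v i else d i.
transitivity (II row (fun d => F (Phi d)) (fun=> 0)).
  by apply: eq_II => d; apply: Floc => i ir; rewrite /Phi ir.
rewrite (II_triangular (c := fun=> c) (Phi := Phi))//.
- by rewrite big_const_seq count_predT size_iota iter_mulr_1.
- exact: iota_uniq.
- apply: measurable_envP => i; rewrite /Phi; case: (i \in row); last exact: measurable_coord.
  by apply: measurable_funD; [apply: measurable_funM; [exact: measurable_cst|exact: measurable_coord]|exact: measurable_cst].
- by move=> i d ir; rewrite /Phi (negbTE ir).
- move=> s1 i s2 d d' sE _; have ir : i \in row by rewrite sE mem_cat inE eqxx orbT.
  by rewrite /Phi ir; ring.
Qed.

Lemma decrn_lt (d : renv) i j : decrn n d -> (i < j)%N -> (j < n)%N -> d j < d i.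
Proof.
move=> /allP H ij jn; apply: (@dec_chain _ d 0%N n.-1) => //; last by lia.
by move=> k _ kn; apply: H; rewrite mem_iota.
Qed.

Lemma vdm2E (d : renv) : decrn n d ->
  vdm2 n d = (\prod_(i < n) \prod_(j < n | (i < j)%N) (d i - d j)) ^+ 2.
Proof. by move=> H; rewrite /vdm2 H vdmE. Qed.

(* [V(m - a s) V(m + a s)] is a product of factors [(m_i - m_j)^2 - a^2 (s_i - s_j)^2],
   each of which decreases in [a]. *)
Lemma vdm2_pair_le (m s : renv) (a b : R) : 0 <= b -> b <= a ->
  vdm2 n (fun i => m i - a * s i) * vdm2 n (fun i => m i + a * s i) <=
  vdm2 n (fun i => m i - b * s i) * vdm2 n (fun i => m i + b * s i).
Proof.
move=> b0 ba.
have [H1|H1] := boolP (decrn n (fun i => m i - a * s i)); last first.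
  by rewrite /vdm2 (negbTE H1) mul0r mulr_ge0// vdm2_ge0.
have [H2|H2] := boolP (decrn n (fun i => m i + a * s i)); last first.
  by rewrite {2}/vdm2 (negbTE H2) mulr0 mulr_ge0// vdm2_ge0.
have key i j : (i < j)%N -> (j < n)%N ->
    (m j - b * s j < m i - b * s i) /\ (m j + b * s j < m i + b * s i).
  move=> ij jn; have K1 := decrn_lt H1 ij jn; have K2 := decrn_lt H2 ij jn.
  have {}K1 : a * (s i - s j) < m i - m j by move: K1 => /=; lra.
  have {}K2 : - (m i - m j) < a * (s i - s j) by move: K2 => /=; lra.
  have [S0|S0] := leP 0 (s i - s j).
    have := ler_wpM2r S0 ba; have : 0 <= b * (s i - s j) by rewrite mulr_ge0.
    by split; lra.
  have := ler_wnM2r (ltW S0) ba; have : b * (s i - s j) <= 0 by rewrite mulr_ge0_le0// ltW.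
  by split; lra.
have D1 : decrn n (fun i => m i - b * s i).
  by apply/allP => i; rewrite mem_iota => /andP[_ i_n]; have [] := key i i.+1 (ltnSn i) ltac:(lia).
have D2 : decrn n (fun i => m i + b * s i).
  by apply/allP => i; rewrite mem_iota => /andP[_ i_n]; have [] := key i i.+1 (ltnSn i) ltac:(lia).
rewrite !vdm2E// -!exprMn -!big_split /=.
have E (c : R) (i : 'I_n) : \prod_(j < n | (i < j)%N) (m i - c * s i - (m j - c * s j)) *
    \prod_(j < n | (i < j)%N) (m i + c * s i - (m j + c * s j)) =
    \prod_(j < n | (i < j)%N) ((m i - m j) ^+ 2 - c ^+ 2 * (s i - s j) ^+ 2).
  by rewrite -big_split; apply: eq_bigr => j _ /=; ring.
rewrite (eq_bigr _ (fun i _ => E a i)) (eq_bigr _ (fun i _ => E b i)).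
have pos (i j : 'I_n) : (i < j)%N -> 0 <= (m i - m j) ^+ 2 - a ^+ 2 * (s i - s j) ^+ 2.
  move=> ij; have K1 := decrn_lt H1 ij (ltn_ord j); have K2 := decrn_lt H2 ij (ltn_ord j).
  have -> : (m i - m j) ^+ 2 - a ^+ 2 * (s i - s j) ^+ 2 =
     (m i - a * s i - (m j - a * s j)) * (m i + a * s i - (m j + a * s j)) by ring.
  by rewrite mulr_ge0// subr_ge0 ltW.
apply: lerXn2r; rewrite ?nnegrE.
- by apply: prodr_ge0 => i _; apply: prodr_ge0 => j ij; exact: pos.
- apply: prodr_ge0 => i _; apply: prodr_ge0 => j ij; apply: le_trans (pos _ _ ij) _.
  by rewrite lerD2l lerN2 ler_wpM2r ?sqr_ge0// lerXn2r ?nnegrE// (le_trans b0).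
apply: ler_prod => i _; rewrite prodr_ge0//=; last by move=> j ij; exact: pos.
apply: ler_prod => j ij; rewrite pos//=.
by rewrite lerD2l lerN2 ler_wpM2r ?sqr_ge0// lerXn2r ?nnegrE// (le_trans b0).
Qed.

Lemma rowlocal_gam : rowlocal (@gam R n).
Proof.
move=> d d' dd'; have E i : (i < n)%N -> d i = d' i by move=> i_n; apply: dd'; rewrite mem_iota.
rewrite /gam /vdm2 (_ : decrn n d = decrn n d'); last first.
  by apply: eq_in_all => i; rewrite mem_iota => /andP[_ i_n]; rewrite !E; try lia.
rewrite (_ : [seq d i | i <- row] = [seq d' i | i <- row]); last by apply/eq_in_map.
by rewrite (_ : nsq d = nsq d')//; apply: eq_big_seq => i ir; rewrite dd'.
Qed.

(** Passage to the midpoint [m] and the half-difference [c * s] of the two arguments, done by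
    translations and one dilation of factor [2 * c]. *)
Lemma II_midpoint (F : renv -> renv -> \bar R) (c : R) : c != 0 ->
  measurable_fun setT (fun p : renv * renv => F p.1 p.2) -> (forall d d', 0 <= F d d')%E ->
  (forall d d' e e', {in row, d =1 e} -> {in row, d' =1 e'} -> F d d' = F e e') ->
  (II row (fun s => II row (fun m => F (fun i => m i - c * s i)%R (fun i => m i + c * s i)%R) (fun=> 0%R)) (fun=> 0%R) =
   (`|2 * c|^-1 ^+ n)%:E * II row (fun d => II row (F d) (fun=> 0%R)) (fun=> 0%R))%E.
Proof.
move=> c0 mF F0 Floc.
have mlin dS (S : measurableType dS) (x y : S -> renv) (a b : R) : measurable_fun setT x -> measurable_fun setT y ->
    measurable_fun setT (fun s => (fun i => a * x s i + b * y s i) : renv).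
  move=> mx my; apply: measurable_envP => i; apply: measurable_funD;
    by apply: measurable_funM; [exact: measurable_cst|exact: measurable_app].
have m1 (d : renv) : measurable_fun setT (F d).
  exact: (measurable_comp_fun mF (measurable_fun_pair (@measurable_cst _ _ renv _ setT d) (@measurable_id _ _ setT))).
pose J (t d : renv) := F d (fun i => t i + d i).
have mJ : measurable_fun setT (fun p : renv * renv => J p.1 p.2).
  apply: (measurable_comp_fun mF (g := fun p : renv * renv => (p.2, (fun i => p.1 i + p.2 i) : renv))).
  apply: measurable_fun_pair; first exact: measurable_snd.
  have := mlin _ _ (fun p : renv * renv => p.1) (fun p => p.2) 1 1 measurable_fst measurable_snd.
  by under eq_fun do under eq_fun do rewrite !mul1r.
have mJ1 (t : renv) : measurable_fun setT (J t).
  exact: (measurable_comp_fun mJ (measurable_fun_pair (@measurable_cst _ _ renv _ setT t) (@measurable_id _ _ setT))).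
have J0 t d : (0 <= J t d)%E by exact: F0.
pose H (t : renv) := II row (J t) (fun=> 0%R).
have mH : measurable_fun setT H by apply: measurable_II_param => //; exact: measurable_cst.
have H0 t : (0 <= H t)%E by exact: II_ge0.
have Hloc : rowlocal H.
  by move=> t t' tt'; apply: eq_II => d; apply: Floc => // i ir; rewrite tt'.
transitivity (II row (fun s => H (fun i => (2 * c) * s i + 0)) (fun=> 0)).
  apply: eq_II => s; rewrite /H.
  have := @II_row_affine (J (fun i => 2 * c * s i + 0)) 1 (fun i => - (c * s i)) (oner_neq0 _) (mJ1 _).
  rewrite normr1 invr1 expr1n mul1e => <- //; last first.
    by move=> d d' dd'; apply: Floc => // i ir; rewrite dd'.
  by apply: eq_II => m; rewrite /J; congr F; apply/funext => i; ring.
rewrite II_row_affine//; last by rewrite mulf_neq0// pnatr_eq0.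
congr (_ * _)%E; rewrite /H.
rewrite (II_II_swap _ _ _ _ mJ)//; apply: eq_II => d.
have Fdl : rowlocal (F d) by move=> x y xy; apply: Floc.
have := @II_row_affine (F d) 1 d (oner_neq0 _) (m1 d) (F0 d) Fdl.
rewrite normr1 invr1 expr1n mul1e => <-.
by apply: eq_II => t; rewrite /J; congr F; apply/funext => i; ring.
Qed.

(** Both integrals are written in midpoint coordinates, with [c = 1 / sqrt 2] on the left and
    [c = 1 / 2] on the right; the Jacobians differ by [sqrt 2 ^ n]. The coefficients of [|s|^2] in
    the exponents are [2 th - 1/2] and [- 1/4], whence the threshold 1/8, and the Vandermonde
    factors compare by [vdm2_pair_le]. *)
Lemma coupling_bound (th : R) : th <= 1 / 8 ->
  (II row (fun d => II row (fun d' => (gam n d * gam n d' * expR (th * nsq (fun i => d' i - d i)))%:E) (fun=> 0%R)) (fun=> 0%R) <=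
   (Num.sqrt 2 ^+ n)%:E * II row (fun d => II row (fun d' => (gam n d * gam n d')%:E) (fun=> 0%R)) (fun=> 0%R))%E.
Proof.
move=> th8.
pose F (d d' : renv) := (gam n d * gam n d' * expR (th * nsq (fun i => d' i - d i)))%:E.
pose F1 (d d' : renv) := (gam n d * gam n d')%:E.
have mg1 : measurable_fun setT (fun p : renv * renv => gam n p.1) by exact: (measurable_comp_fun (@measurable_gam R n) measurable_fst).
have mg2 : measurable_fun setT (fun p : renv * renv => gam n p.2) by exact: (measurable_comp_fun (@measurable_gam R n) measurable_snd).
have mF1 : measurable_fun setT (fun p : renv * renv => F1 p.1 p.2).
  by apply/measurable_EFinP; exact: measurable_funM.
have mF : measurable_fun setT (fun p : renv * renv => F p.1 p.2).
  apply/measurable_EFinP; apply: measurable_funM; first exact: measurable_funM.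
  apply: (measurable_comp_fun (@measurable_expR _)); apply: measurable_funM; first exact: measurable_cst.
  have mB : measurable_fun setT (fun p : renv * renv => (fun i => p.2 i - p.1 i) : renv).
    by apply: measurable_envP => i; apply: measurable_funB; apply: measurable_app; [exact: measurable_snd|exact: measurable_fst].
  by apply: measurable_rdot.
have F0 d d' : (0 <= F d d')%E.
  by rewrite lee_fin; do ![exact: gam_ge0 | exact: expR_ge0 | apply: mulr_ge0].
have F10 d d' : (0 <= F1 d d')%E by rewrite lee_fin mulr_ge0 ?gam_ge0.
pose c : R := (Num.sqrt 2)^-1.
have s2 : 0 < Num.sqrt 2 :> R by rewrite sqrtr_gt0.
have s22 : Num.sqrt 2 ^+ 2 = 2 :> R by rewrite sqr_sqrtr.
have c0 : c != 0 by rewrite invr_neq0// gt_eqF.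
have c2 : c ^+ 2 = 1 / 2 by rewrite exprVn s22 div1r.
have hc : 1 / 2 <= c.
  rewrite -(@ler_pXn2r _ 2%N)// ?nnegrE ?c2//; first by lra.
  by rewrite invr_ge0 ltW.
have two_c : `|2 * c|^-1 = (Num.sqrt 2)^-1.
  have -> : 2 * c = Num.sqrt 2 by apply: (mulIf (lt0r_neq0 s2)); rewrite /c divfK ?lt0r_neq0// -expr2 s22.
  by rewrite gtr0_norm.
have h0 : 1 / 2 != 0 :> R by lra.
have locE (x y : renv) : {in row, x =1 y} -> gam n x = gam n y by move=> xy; exact: rowlocal_gam.
have F1loc d d' e e' : {in row, d =1 e} -> {in row, d' =1 e'} -> F1 d d' = F1 e e'.
  by move=> de de'; rewrite /F1 (locE _ _ de) (locE _ _ de').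
have Floc d d' e e' : {in row, d =1 e} -> {in row, d' =1 e'} -> F d d' = F e e'.
  move=> de de'; rewrite /F (locE _ _ de) (locE _ _ de'); congr (_ * expR (_ * _))%:E.
  by apply: eq_big_seq => i ir; rewrite de// de'.
have M := @II_midpoint F c c0 mF F0 Floc.
have M1 := @II_midpoint F1 (1 / 2) h0 mF1 F10 F1loc.
rewrite (_ : `|2 * (1 / 2)|^-1 ^+ n = 1) in M1; last first.
  by rewrite (_ : 2 * (1 / 2) = 1) ?normr1 ?invr1 ?expr1n//; field.
rewrite mul1e in M1.
rewrite -[X in (_ <= _ * X)%E]/(II row (fun d => II row (F1 d) (fun=> 0)) (fun=> 0)) -M1.
rewrite -[X in (X <= _)%E]/(II row (fun d => II row (F d) (fun=> 0)) (fun=> 0)).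
have := congr1 (fun z => (Num.sqrt 2 ^+ n)%:E * z)%E M.
rewrite muleA -EFinM two_c -exprMn mulfV ?gt_eqF// expr1n mul1e => <-.
apply: lee_wpmul2l; first by rewrite lee_fin exprn_ge0// ltW.
have mlin dS (S : measurableType dS) (x y : S -> renv) (a : R) : measurable_fun setT x -> measurable_fun setT y ->
    measurable_fun setT (fun s => (fun i => x s i + a * y s i) : renv).
  move=> mx my; apply: measurable_envP => i; apply: measurable_funD; first exact: measurable_app.
  by apply: measurable_funM; [exact: measurable_cst|exact: measurable_app].
have mid (G : renv -> renv -> \bar R) (a : R) : measurable_fun setT (fun p : renv * renv => G p.1 p.2) ->
    measurable_fun setT (fun p : renv * renv => G (fun i => p.2 i - a * p.1 i) (fun i => p.2 i + a * p.1 i)).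
  move=> mG; apply: (measurable_comp_fun mG (g := fun p : renv * renv => ((fun i => p.2 i - a * p.1 i) : renv, (fun i => p.2 i + a * p.1 i) : renv))).
  apply: measurable_fun_pair; last exact: (mlin _ _ _ _ a measurable_snd measurable_fst).
  have := mlin _ _ _ _ (- a) (@measurable_snd _ _ renv renv) (@measurable_fst _ _ renv renv).
  by under eq_fun do under eq_fun do rewrite mulNr.
have mid1 (G : renv -> renv -> \bar R) (a : R) (s : renv) : measurable_fun setT (fun p : renv * renv => G p.1 p.2) ->
    measurable_fun setT (fun m : renv => G (fun i => m i - a * s i) (fun i => m i + a * s i)).
  move=> mG; exact: (measurable_comp_fun (mid G a mG) (measurable_fun_pair (@measurable_cst _ _ renv _ setT s) (@measurable_id _ _ setT))).
apply: le_II.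
- apply: measurable_II_param; [exact: mid|by []|exact: measurable_cst].
- apply: measurable_II_param; [exact: mid|by []|exact: measurable_cst].
- by move=> s; exact: II_ge0.
move=> s; apply: le_II; [exact: mid1|exact: mid1|by []|].
move=> m; rewrite lee_fin /gam; set v1 := vdm2 n _; set v2 := vdm2 n _.
rewrite (_ : nsq (fun i => m i - c * s i) = nsq m - 2 * c * rdot n m s + c ^+ 2 * nsq s); last first.
  by rewrite /rdot !mulr_sumr -sumrB -big_split /=; apply: eq_bigr => i _; ring.
rewrite (_ : nsq (fun i => m i + c * s i) = nsq m + 2 * c * rdot n m s + c ^+ 2 * nsq s); last first.
  by rewrite /rdot !mulr_sumr -!big_split /=; apply: eq_bigr => i _; ring.
rewrite (_ : nsq (fun i => m i - 1 / 2 * s i) = nsq m - rdot n m s + 1 / 4 * nsq s); last first.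
  by rewrite /rdot !mulr_sumr -sumrB -big_split /=; apply: eq_bigr => i _; field.
rewrite (_ : nsq (fun i => m i + 1 / 2 * s i) = nsq m + rdot n m s + 1 / 4 * nsq s); last first.
  by rewrite /rdot !mulr_sumr -!big_split /=; apply: eq_bigr => i _; field.
rewrite (_ : nsq (fun i => m i + c * s i - (m i - c * s i)) = 4 * c ^+ 2 * nsq s); last first.
  by rewrite /rdot !mulr_sumr; apply: eq_bigr => i _; ring.
rewrite c2; set N := nsq m; set S := nsq s; set X := rdot n m s.
have S0 : 0 <= S by apply: sumr_ge0 => i _; rewrite -expr2 sqr_ge0.
have := @vdm2_pair_le m s c (1 / 2) ltac:(lra) hc; rewrite -/v1 -/v2 => Hv.
set v3 := vdm2 n (fun i => m i - _); set v4 := vdm2 n (fun i => m i + _).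
have -> : v1 * expR (- ((N - 2 * c * X + 1 / 2 * S) / 2)) * (v2 * expR (- ((N + 2 * c * X + 1 / 2 * S) / 2))) * expR (th * (4 * (1 / 2) * S)) =
   v1 * v2 * expR (- N - S / 2 + 2 * th * S).
  transitivity (v1 * v2 * (expR (- ((N - 2 * c * X + 1 / 2 * S) / 2)) * expR (- ((N + 2 * c * X + 1 / 2 * S) / 2)) * expR (th * (4 * (1 / 2) * S)))).
    by ring.
  by rewrite -!expRD; congr (_ * expR _); field.
have -> : v3 * expR (- ((N - X + 1 / 4 * S) / 2)) * (v4 * expR (- ((N + X + 1 / 4 * S) / 2))) = v3 * v4 * expR (- N - S / 4).
  transitivity (v3 * v4 * (expR (- ((N - X + 1 / 4 * S) / 2)) * expR (- ((N + X + 1 / 4 * S) / 2)))); first by ring.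
  by rewrite -!expRD; congr (_ * expR _); field.
apply: ler_pM; rewrite ?expR_ge0//; first by rewrite mulr_ge0// vdm2_ge0.
by rewrite ler_expR; have := ler_wpM2r S0 th8; lra.
Qed.

End coupling_bound.

(** * Marginals on the hive *)

Section hidden_variables.
Variables (R : realType) (n : nat).
Hypothesis n0 : (0 < n)%N.
Local Notation renv := (family R nat).
Local Notation env := (family R (nat * nat)).
Local Notation row := (iota 0 n).
Implicit Type H : env -> renv -> renv -> \bar R.

Definition nkeys := [seq k <- colkeys n | ~~ (k.1 <= k.2)%N].

Definition hmask (e : env) : env := fun k => if k \in hkeys n then e k else 0.

(** Integrates the spectra of the shifts only; [hid] also integrates the cells that belong to the
    third pattern alone, and [hmask] makes its result depend on nothing but the hive. *)
Definition visible H (e : env) := II row (fun d => II row (H e d) (fun=> 0)) (fun=> 0).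

Definition hid H (e : env) : \bar R := II nkeys (visible H) (hmask e).

Definition measurableH H := measurable_fun setT (fun p : env * renv * renv => H p.1.1 p.1.2 p.2).

Lemma mem_nkeys k : k \in nkeys -> k \notin hkeys n.
Proof. by rewrite mem_filter mem_hkeys => /andP[/negbTE->]. Qed.

Lemma hlocal_hid H : hlocal n (hid H).
Proof.
move=> e e' ee'; rewrite /hid; congr II; apply/funext => k; rewrite /hmask.
by case: ifP => // kh; exact: ee'.
Qed.

Lemma measurable_hmask : measurable_fun setT hmask.
Proof.
by apply: measurable_envP => k; rewrite /hmask; case: (k \in _); [exact: measurable_coord|exact: measurable_cst].
Qed.

Section nonnegative.
Variable H : env -> renv -> renv -> \bar R.
Hypotheses (mH : measurableH H) (H0 : forall e d d', (0 <= H e d d')%E).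

Lemma visible_ge0 e : (0 <= visible H e)%E.
Proof. by apply: II_ge0 => d; exact: II_ge0. Qed.

Lemma measurable_visible1 : measurable_fun setT (fun p : env * renv => II row (H p.1 p.2) (fun=> 0)).
Proof. by apply: measurable_II_param; [exact: mH|by []|exact: measurable_cst]. Qed.

Lemma measurable_visible : measurable_fun setT (visible H).
Proof.
apply: measurable_II_param; [exact: measurable_visible1| |exact: measurable_cst].
by move=> e d; exact: II_ge0.
Qed.

Lemma measurable_hid : measurable_fun setT (hid H).
Proof.
apply: measurable_II_param; [|by move=> *; exact: visible_ge0|exact: measurable_hmask].
exact: (measurable_comp_fun measurable_visible measurable_snd).
Qed.

Lemma hid_ge0 e : (0 <= hid H e)%E.
Proof. by apply: II_ge0 => e'; exact: visible_ge0. Qed.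

Lemma measurableH_d e : measurable_fun setT (fun p : renv * renv => H e p.1 p.2).
Proof.
apply: (measurable_comp_fun mH (g := fun p : renv * renv => (e, p.1, p.2))).
apply: measurable_fun_pair; last exact: measurable_snd.
by apply: measurable_fun_pair; [exact: measurable_cst|exact: measurable_fst].
Qed.

Lemma measurableH_dd e d : measurable_fun setT (H e d).
Proof.
exact: (measurable_comp_fun (measurableH_d e) (measurable_fun_pair (@measurable_cst _ _ renv _ setT d) (@measurable_id _ _ setT))).
Qed.

Lemma visibleZ (c : \bar R) e : (0 <= c)%E -> visible (fun e d d' => c * H e d d')%E e = (c * visible H e)%E.
Proof.
move=> c0; rewrite /visible -IIZl//; last 2 first.
- by apply: measurable_II_param; [exact: measurableH_d|by []|exact: measurable_cst].
- by move=> d; exact: II_ge0.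
by apply: eq_II => d; rewrite -IIZl//; exact: measurableH_dd.
Qed.

Lemma hidZ (c : \bar R) e : (0 <= c)%E -> hid (fun e d d' => c * H e d d')%E e = (c * hid H e)%E.
Proof.
move=> c0; rewrite /hid -IIZl//; [|exact: measurable_visible|by move=> *; exact: visible_ge0].
by apply: eq_II => e'; rewrite visibleZ.
Qed.

Lemma hid_eq0 e : (forall e d d', ~~ shive n e -> H e d d' = 0%E) -> ~~ shive n e -> hid H e = 0%E.
Proof.
move=> Hs se; rewrite -[RHS](@II0 R _ nkeys (hmask e)); apply: eq_II_in => e' ee'.
rewrite /visible -[RHS](@II0 R _ row (fun=> 0)); apply: eq_II => d.
rewrite -[RHS](@II0 R _ row (fun=> 0)); apply: eq_II => d'; apply: Hs.
rewrite (_ : shive n e' = shive n e)//; apply: (hlocal_shive n0) => k kh.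
by rewrite ee' ?/hmask ?kh//; apply/negP => /mem_nkeys; rewrite kh.
Qed.

Lemma visible_law (Phi : env -> \bar R) : measurable_fun setT Phi -> (forall e, 0 <= Phi e)%E ->
  (II (colkeys n) (fun e => visible H e * Phi e) (fun=> 0%R) =
  II row (fun d => II row (fun d' => II (colkeys n) (fun e => H e d d' * Phi e) (fun=> 0%R)) (fun=> 0%R)) (fun=> 0%R))%E.
Proof.
move=> mPhi Phi0.
have mHP : measurable_fun setT (fun p : renv * renv * env => H p.2 p.1.1 p.1.2 * Phi p.2)%E.
  apply: emeasurable_funM; last exact: (measurable_comp_fun mPhi measurable_snd).
  apply: (measurable_comp_fun mH (g := fun p : renv * renv * env => (p.2, p.1.1, p.1.2))).
  apply: measurable_fun_pair; last exact: (measurable_comp_fun measurable_snd measurable_fst).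
  by apply: measurable_fun_pair; [exact: measurable_snd|exact: (measurable_comp_fun measurable_fst measurable_fst)].
have HP0 e d d' : (0 <= H e d d' * Phi e)%E by rewrite mule_ge0.
have mHP1 d : measurable_fun setT (fun p : renv * env => H p.2 d p.1 * Phi p.2)%E.
  apply: (measurable_comp_fun mHP (g := fun p : renv * env => (d, p.1, p.2))).
  apply: measurable_fun_pair; last exact: measurable_snd.
  by apply: measurable_fun_pair; [exact: measurable_cst|exact: measurable_fst].
have mHP2 : measurable_fun setT (fun p : renv * env => II row (fun d' => H p.2 p.1 d' * Phi p.2)%E (fun=> 0)).
  apply: measurable_II_param; [|by []|exact: measurable_cst].
  apply: (measurable_comp_fun mHP (g := fun p : renv * env * renv => (p.1.1, p.2, p.1.2))).
  apply: measurable_fun_pair; last exact: (measurable_comp_fun measurable_snd measurable_fst).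
  by apply: measurable_fun_pair; [exact: (measurable_comp_fun measurable_fst measurable_fst)|exact: measurable_snd].
transitivity (II row (fun d => II (colkeys n) (fun e => II row (fun d' => H e d d' * Phi e)%E (fun=> 0)) (fun=> 0)) (fun=> 0)); last first.
  by apply: eq_II => d; rewrite [RHS](II_II_swap _ _ _ _ (mHP1 d)).
rewrite [RHS](II_II_swap _ _ _ _ mHP2); last by move=> d e; exact: II_ge0.
apply: eq_II => e; rewrite muleC -visibleZ//; apply: eq_II => d; apply: eq_II => d'.
by rewrite muleC.
Qed.

Lemma hid_law (Phi : env -> \bar R) : measurable_fun setT Phi -> (forall e, 0 <= Phi e)%E -> hlocal n Phi ->
  (II (hkeys n) (fun e => hid H e * Phi e) (fun=> 0%R) =
  II row (fun d => II row (fun d' => II (colkeys n) (fun e => H e d d' * Phi e) (fun=> 0%R)) (fun=> 0%R)) (fun=> 0%R))%E.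
Proof.
move=> mPhi Phi0 Ploc; rewrite -visible_law//.
have mvP : measurable_fun setT (fun e => visible H e * Phi e)%E by apply: emeasurable_funM => //; exact: measurable_visible.
have pk : perm_eq (colkeys n) (hkeys n ++ nkeys) by rewrite perm_sym; exact/permEl/perm_filterC.
rewrite (perm_II _ mvP _ pk); last by move=> e; rewrite mule_ge0// visible_ge0.
rewrite II_cat; apply: eq_II_in => e0 e00.
have -> : hid H e0 = II nkeys (visible H) e0.
  rewrite /hid; congr II; apply/funext => k; rewrite /hmask; case: ifPn => // kn; by rewrite e00.
rewrite muleC -IIZl//; [|exact: measurable_visible|by move=> *; exact: visible_ge0].
apply: eq_II_in => e ee0; rewrite muleC; congr (_ * _)%E; apply: Ploc => k kh.
by rewrite ee0//; apply/negP => /mem_nkeys; rewrite kh.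
Qed.

Lemma measurable_hive_coords : measurable_fun setT (fun e : env => hive_coords n (hiveval n e)).
Proof.
apply/measurable_fun_tnthP => i; rewrite (_ : _ \o _ = fun e : env => hdiff n e (ckey (enum_val i))).
  exact: (measurable_comp_fun (measurable_coord (ckey (enum_val i))) (measurable_hdiff n)).
by apply/funext => e /=; rewrite hive_coords_hdiff.
Qed.

Lemma hlocal_hive_coords : hlocal n (fun e : env => hive_coords n (hiveval n e)).
Proof.
move=> e e' ee'; apply/eq_from_tnth => i; rewrite !hive_coords_hdiff//.
have kh : ckey (enum_val i) \in hkeys n.
  by rewrite -(perm_mem (perm_ckey n0)); apply/mapP; exists i; rewrite ?mem_enum.
move: kh; case: (ckey _) => [s r] kh; rewrite /hdiff kh ee'//; move: kh; rewrite mem_hkeys /= => /and3P[sr sn rn].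
have E x y : (x <= y)%N -> (y <= n)%N -> cellval n e x y = cellval n e' x y by move=> ? ?; exact: hlocal_cval.
case: eqP => [r_n|r_n]; first by rewrite E.
case: eqP => [s_0|s_0]; first by rewrite E//; lia.
by case: eqP => [s_r|//]; rewrite E//; lia.
Qed.

Lemma integral_hid (A : set (hive_space n)) : measurable A ->
  (\int[lebesgue_tuple #|coord_index n|]_(v in A) hid H (tenv v) =
  II row (fun d => II row (fun d' => II (colkeys n) (fun e => H e d d' *
    (\1_A (hive_coords n (hiveval n e)))%:E) (fun=> 0%R)) (fun=> 0%R)) (fun=> 0%R))%E.
Proof.
move=> mA; rewrite integral_mkcond.
transitivity (\int[lebesgue_tuple #|coord_index n|]_v (hid H (tenv v) * (\1_A v)%:E))%E.
  by apply: eq_integral => v _; rewrite /patch indicE; case: ifP => _; rewrite ?mule1 ?mule0.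
have mI : measurable_fun setT (fun v : hive_space n => (\1_A v : R)%:E) by apply/measurable_EFinP.
rewrite (integral_hive_space n0 (fun=> 0)); last 2 first.
- apply: emeasurable_funM => //; exact: (measurable_comp_fun measurable_hid (@measurable_tenv R n)).
- by move=> v; rewrite mule_ge0 ?hid_ge0// lee_fin.
rewrite -(@hid_law (fun e => (\1_A (hive_coords n (hiveval n e)))%:E)).
- apply: eq_II => e; congr (_ * _)%E; apply: hlocal_hid; exact: tenvK.
- exact: (measurable_comp_fun mI measurable_hive_coords).
- by move=> e; rewrite lee_fin.
- by move=> e e' ee'; rewrite (hlocal_hive_coords ee').
Qed.

End nonnegative.

End hidden_variables.

(** * Relative entropy *)

Section divergence_bound.
Context d (T : measurableType d) (R : realType) (mu : {measure set T -> \bar R}).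

Lemma measurable_KL_integrand (q p : T -> R) :
  measurable_fun setT q -> measurable_fun setT p ->
  measurable_fun setT (fun v => KL_integrand (q v) (p v)).
Proof.
move=> mq mp; rewrite /KL_integrand; apply: measurable_fun_ifT; [|exact: measurable_cst|].
  by apply: measurable_fun_eqr => //; exact: measurable_cst.
apply: measurable_fun_ifT; [|exact: measurable_cst|].
  by apply: measurable_fun_eqr => //; exact: measurable_cst.
apply/measurable_EFinP; apply: measurable_funM => //.
apply: (measurable_comp_fun (@measurable_ln R)); apply: measurable_funM => //.
exact: (measurable_comp_fun (@measurable_inv R) mp).
Qed.

(** From [1 + x <= exp x] at [x = ln (p / q)]. *)
Lemma xlnx_ge (q p : R) : 0 <= q -> 0 < p -> q - p <= q * ln (q / p).
Proof.
move=> q0 p0; have [->|qn0] := eqVneq q 0; first by rewrite !mul0r; lra.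
have {}q0 : 0 < q by rewrite lt_neqAle eq_sym qn0.
have pq : 0 < p / q by rewrite divr_gt0.
have := expR_ge1Dx (ln (p / q)); rewrite lnK ?posrE// => H.
rewrite -[q / p]invf_div lnV ?posrE//.
have := ler_wpM2l (ltW q0) H; rewrite [q * (p / q)]mulrC divfK ?gt_eqF//; lra.
Qed.

(** Integrating the pointwise bound gives [KL + (1 - m) / eps <= 1 / eps]. The work lies in
    integrability: the integrand is squeezed between [q - p] and a bound built from [J] and [q]. *)
Lemma KL_integral_le (D : set T) (q p : T -> R) (J : T -> \bar R) (m eps : R) :
  measurable D -> measurable_fun setT q -> measurable_fun setT p -> measurable_fun setT J ->
  (forall v, 0 <= q v) -> (forall v, 0 <= p v) -> (forall v, 0 <= J v)%E -> 0 < eps ->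
  (\int[mu]_(v in D) (q v)%:E = 1)%E -> (\int[mu]_(v in D) (p v)%:E < +oo)%E ->
  (\int[mu]_(v in D) J v <= (expR m)%:E)%E ->
  {ae mu, forall v, D v -> 0 < p v /\
    ((q v * ln (q v / p v) + (1 - m) / eps * q v)%:E <= (expR (- m) / eps)%:E * J v)%E} ->
  (\int[mu]_(v in D) KL_integrand (q v) (p v) <= (m / eps)%:E)%E.
Proof.
move=> mD mq mp mJ q0 p0 J0 eps0 q1 pfin Jm ae_good.
pose k v := q v * ln (q v / p v).
pose V v := ((expR (- m) / eps)%:E * J v)%E.
have cV0 : 0 <= expR (- m) / eps by rewrite divr_ge0 ?expR_ge0// ltW.
have V0 v : (0 <= V v)%E by rewrite mule_ge0.
have mV : measurable_fun setT V by apply: emeasurable_funM => //; exact: measurable_cst.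
have mk : measurable_fun setT k.
  apply: measurable_funM => //; apply: (measurable_comp_fun (@measurable_ln R)).
  by apply: measurable_funM => //; exact: (measurable_comp_fun (@measurable_inv R) mp).
pose c := (1 - m) / eps.
(* Truncation to the points where the pointwise bound holds makes the estimates valid everywhere and
   changes no integral. *)
pose good v := (0 < p v)%R && ((k v + c * q v)%:E <= V v)%E.
have mgood : measurable_fun setT good.
  apply: measurable_and; first by apply: measurable_fun_ltr => //; exact: measurable_cst.
  apply: measurable_fun_lee => //; apply/measurable_EFinP; apply: measurable_funD => //.
  by apply: measurable_funM => //; exact: measurable_cst.
pose k' v := if good v then k v else 0.
pose q' v := if good v then q v else 0.
have mk' : measurable_fun setT k' by apply: measurable_fun_ifT => //; exact: measurable_cst.
have mq' : measurable_fun setT q' by apply: measurable_fun_ifT => //; exact: measurable_cst.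
have mD_ (f : T -> \bar R) : measurable_fun setT f -> measurable_fun D f by exact: measurable_funS.
have KLk : (\int[mu]_(v in D) KL_integrand (q v) (p v) = \int[mu]_(v in D) (k' v)%:E)%E.
  apply: ae_eq_integral => //; try apply: mD_.
  - exact: measurable_KL_integrand.
  - exact/measurable_EFinP.
  apply: filterS ae_good => v H Dv; have [pv le] := H Dv.
  rewrite /k' /good pv le /= /KL_integrand (gt_eqF pv) /k.
  by case: eqP => // ->; rewrite mul0r.
have qq : (\int[mu]_(v in D) (q' v)%:E = 1)%E.
  rewrite -q1; apply: ae_eq_integral => //; try (by apply: mD_; exact/measurable_EFinP).
  by apply: filterS ae_good => v H Dv; have [pv le] := H Dv; rewrite /q' /good pv le.
have Vfin : (\int[mu]_(v in D) V v <= (eps^-1)%:E)%E.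
  rewrite ge0_integralZl_EFin//; last exact: mD_.
  apply: (@le_trans _ _ ((expR (- m) / eps)%:E * (expR m)%:E)%E).
    by apply: lee_wpmul2l; rewrite ?lee_fin.
  by rewrite -EFinM lee_fin mulrAC -expRD addNr expR0 div1r.
have iV : mu.-integrable D V.
  apply/integrableP; split; first exact: mD_.
  under eq_integral do rewrite gee0_abs//.
  by apply: le_lt_trans Vfin _; rewrite ltry.
have iq : mu.-integrable D (EFin \o q).
  apply/integrableP; split; first by apply: mD_; exact/measurable_EFinP.
  under eq_integral do rewrite /= ger0_norm//.
  by rewrite q1 ltry.
have ip : mu.-integrable D (EFin \o p).
  apply/integrableP; split; first by apply: mD_; exact/measurable_EFinP.
  by under eq_integral do rewrite /= ger0_norm//.
have iq' : mu.-integrable D (EFin \o q').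
  apply: (le_integrable mD _ _ iq); first by apply: mD_; exact/measurable_EFinP.
  move=> v _ /=; rewrite lee_fin /q'; case: ifP => // _; by rewrite normr0 normr_ge0.
have ib : mu.-integrable D (fun v => V v + ((1 + `|c|) * q v)%:E + (p v)%:E)%E.
  apply: integrableD => //; apply: integrableD => //.
  by rewrite (_ : (fun v => _) = (fun v => (1 + `|c|)%:E * (EFin \o q) v)%E)//; exact: integrableZl.
have ik' : mu.-integrable D (EFin \o k').
  apply: (le_integrable mD _ _ ib); first by apply: mD_; exact/measurable_EFinP.
  have b0 v : (0 <= V v + ((1 + `|c|) * q v)%:E + (p v)%:E)%E.
    by apply: adde_ge0; rewrite ?lee_fin//; apply: adde_ge0; rewrite ?lee_fin// mulr_ge0// addr_ge0.
  move=> v _ /=; rewrite [leRHS]gee0_abs; last exact: b0.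
  rewrite /k' /good; case: ifP => [/andP[pv le]|_]; last first.
    by rewrite normr0; exact: b0.
  have L := xlnx_ge (q0 v) pv; rewrite -/(k v) in L.
  have cq : - (`|c| * q v) <= c * q v.
    by rewrite -mulNr ler_wpM2r// lerNl -normrN ler_norm.
  have cq' : 0 <= `|c| * q v by rewrite mulr_ge0.
  move: le (V0 v); case: (V v) => [r| |]//=; rewrite ?lee_fin => le r0; last by rewrite !addye// leey.
  by rewrite ler_norml mulrDl mul1r; have := q0 v; have := p0 v; lra.
rewrite KLk.
have S : (\int[mu]_(v in D) ((k' v)%:E + (c * q' v)%:E) <= \int[mu]_(v in D) V v)%E.
  apply: le_integral => //.
    apply: integrableD => //.
    by rewrite (_ : (fun v => _) = (fun v => c%:E * (EFin \o q') v)%E)//; exact: integrableZl.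
  move=> v _; rewrite -EFinD /k' /q' /good; case: ifP => [/andP[]//|_].
  by rewrite mulr0 addr0.
have icq : mu.-integrable D (EFin \o (fun v => c * q' v)).
  by rewrite (_ : _ \o _ = (fun v => c%:E * (EFin \o q') v)%E)//; exact: integrableZl.
rewrite (integralD_EFin mD ik' icq) in S.
have E : (\int[mu]_(v in D) (c * q' v)%:E = c%:E)%E.
  transitivity (c%:E * \int[mu]_(v in D) (q' v)%:E)%E; last by rewrite qq mule1.
  by rewrite -integralZl.
have {}S := le_trans S Vfin; rewrite /= E in S.
have : (\int[mu]_(v in D) (k' v)%:E \is a fin_num)%E by exact: integrable_fin_num.
move: S; case: (\int[mu]_(v in D) (k' v)%:E)%E => [r| |]//=; rewrite -EFinD !lee_fin => S _.
move: S; rewrite /c mulrBl div1r; lra.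
Qed.

End divergence_bound.

(** * Tilted densities and their marginals *)

Section hidden_densities.
Variables (R : realType) (n : nat).
Hypothesis n0 : (0 < n)%N.
Local Notation renv := (family R nat).
Local Notation env := (family R (nat * nat)).
Local Notation T := (@transport R n).
Local Notation row := (iota 0 n).
Local Notation nsq d := (rdot n d d).
Local Notation N := #|coord_index n|.
Variables (A B kap : R).
Hypotheses (A0 : 0 < A) (B0 : 0 < B).
Variable psi : env -> env.
Hypotheses (mpsi : measurable_fun setT psi) (psiK : cancel T psi).
Local Notation prd := (paired n A B kap).
Local Notation ell := (logratio n B kap psi).

Definition tilted (s : R) (e : env) (d d' : renv) : \bar R := (prd e d d' * expR (s * ell e d d'))%:E.

Lemma tilted_ge0 s e d d' : (0 <= tilted s e d d')%E.
Proof. by rewrite lee_fin; apply: mulr_ge0; [exact: paired_ge0|exact: expR_ge0]. Qed.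

Lemma measurable_tilted s : measurableH (tilted s).
Proof.
have m1 : measurable_fun setT (fun p : env * renv * renv => p.1.1) by exact: (measurable_comp_fun measurable_fst measurable_fst).
have m2 : measurable_fun setT (fun p : env * renv * renv => p.1.2) by exact: (measurable_comp_fun measurable_snd measurable_fst).
have m3 : measurable_fun setT (fun p : env * renv * renv => p.2) by exact: measurable_snd.
apply/measurable_EFinP; apply: measurable_funM; first exact: measurable_paired.
apply: (measurable_comp_fun (@measurable_expR _)); apply: measurable_funM; first exact: measurable_cst.
exact: measurable_logratio.
Qed.

Lemma tilted_shive s e d d' : ~~ shive n e -> tilted s e d d' = 0%E.
Proof. by move=> /negbTE H; rewrite /tilted /paired /hbase H !mul0r. Qed.

Definition gam2 : \bar R := II row (fun d => II row (fun d' => (gam n d * gam n d')%:E) (fun=> 0)) (fun=> 0).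

Definition gZ : R := @gt_gauss_const R n A * @gt_gauss_const R n B.

Lemma gZ_gt0 : 0 < gZ. Proof. by rewrite mulr_gt0// gt_gauss_const_gt0. Qed.

Lemma measurable_gam2 th : measurable_fun setT
  (fun p : renv * renv => (gam n p.1 * gam n p.2 * expR (th * nsq (fun i => p.2 i - p.1 i)))%:E).
Proof.
apply/measurable_EFinP; apply: measurable_funM.
  apply: measurable_funM; first exact: (measurable_comp_fun (@measurable_gam R n) measurable_fst).
  exact: (measurable_comp_fun (@measurable_gam R n) measurable_snd).
apply: (measurable_comp_fun (@measurable_expR _)); apply: measurable_funM; first exact: measurable_cst.
have mB : measurable_fun setT (fun p : renv * renv => (fun i => p.2 i - p.1 i) : renv).
  by apply: measurable_envP => i; apply: measurable_funB; apply: measurable_app; [exact: measurable_snd|exact: measurable_fst].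
exact: measurable_rdot.
Qed.

Lemma tilted_mass s : (\int[lebesgue_tuple N]_v hid n (tilted s) (tenv v) = gZ%:E *
  II row (fun d => II row (fun d' => (gam n d * gam n d' *
    expR (kap ^+ 2 * B / 2 * (s * (s - 1)) * nsq (fun i => d' i - d i)))%:E) (fun=> 0%R)) (fun=> 0%R))%E.
Proof.
rewrite (integral_hid n0 (measurable_tilted s))//; last exact: tilted_ge0.
set th := kap ^+ 2 * B / 2 * _.
have G0 d d' : (0 <= (gam n d * gam n d' * expR (th * nsq (fun i => d' i - d i)))%:E)%E.
  by rewrite lee_fin; do ![exact: gam_ge0 | exact: expR_ge0 | apply: mulr_ge0].
have mG := measurable_gam2 th.
have gZ0 : (0 <= gZ%:E)%E by rewrite lee_fin ltW// gZ_gt0.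
rewrite -IIZl//; last 2 first.
- by apply: measurable_II_param; [exact: mG|by move=> d d'; exact: G0|exact: measurable_cst].
- by move=> d; apply: II_ge0 => d'; exact: G0.
apply: eq_II => d; rewrite -IIZl//; last first.
  exact: (measurable_comp_fun mG (measurable_fun_pair (@measurable_cst _ _ renv _ setT d) (@measurable_id _ _ setT))).
apply: eq_II => d'; rewrite -EFinM.
transitivity (II (colkeys n) (fun e => (prd e d d' * expR (s * ell e d d'))%:E) (fun=> 0)).
  by apply: eq_II => e; rewrite /tilted indicT mule1.
by rewrite II_paired_mass// /gZ; congr (_%:E); ring.
Qed.

(** The coupled and the true density thus have the same total mass, and it cancels from their
    ratio. *)
Lemma tilted_mass01 s : s * (s - 1) = 0 -> (\int[lebesgue_tuple N]_v hid n (tilted s) (tenv v) = gZ%:E * gam2)%E.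
Proof.
move=> s0; rewrite tilted_mass; congr (_ * _)%E; apply: eq_II => d; apply: eq_II => d'.
by rewrite s0 mulr0 mul0r expR0 mulr1.
Qed.

Lemma tilted_mass_le s : kap ^+ 2 * B / 2 * (s * (s - 1)) <= 1 / 8 ->
  (\int[lebesgue_tuple N]_v hid n (tilted s) (tenv v) <= (Num.sqrt 2 ^+ n)%:E * (gZ%:E * gam2))%E.
Proof.
move=> s8; rewrite tilted_mass muleCA; apply: lee_wpmul2l; first by rewrite lee_fin ltW// gZ_gt0.
exact: coupling_bound.
Qed.

Lemma le_hid (H1 H2 : env -> renv -> renv -> \bar R) e : measurableH H1 -> measurableH H2 ->
  (forall e d d', 0 <= H1 e d d')%E -> (forall e d d', H1 e d d' <= H2 e d d')%E -> (hid n H1 e <= hid n H2 e)%E.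
Proof.
move=> m1 m2 H10 H12; have H20 e' d d' : (0 <= H2 e' d d')%E by exact: le_trans (H12 _ _ _).
apply: le_II; [exact: measurable_visible|exact: measurable_visible|by move=> *; exact: visible_ge0|].
move=> e'; apply: le_II => //.
- by apply: measurable_II_param; [exact: measurableH_d|by []|exact: measurable_cst].
- by apply: measurable_II_param; [exact: measurableH_d|by []|exact: measurable_cst].
- by move=> d; exact: II_ge0.
by move=> d; apply: le_II => //; exact: measurableH_dd.
Qed.

Lemma hidD (H1 H2 : env -> renv -> renv -> \bar R) e : measurableH H1 -> measurableH H2 ->
  (forall e d d', 0 <= H1 e d d')%E -> (forall e d d', 0 <= H2 e d d')%E ->
  hid n (fun e d d' => H1 e d d' + H2 e d d')%E e = (hid n H1 e + hid n H2 e)%E.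
Proof.
move=> m1 m2 H10 H20; rewrite /hid -IID; try exact: measurable_visible; try (by move=> *; exact: visible_ge0).
apply: eq_II => e'; rewrite /visible -IID//; first last.
- by move=> d; exact: II_ge0.
- by move=> d; exact: II_ge0.
- by apply: measurable_II_param; [exact: measurableH_d|by []|exact: measurable_cst].
- by apply: measurable_II_param; [exact: measurableH_d|by []|exact: measurable_cst].
by apply: eq_II => d; rewrite -IID//; exact: measurableH_dd.
Qed.

(* Integrated form of the log-sum inequality combined with Young's inequality for the
   exponential: both follow from [1 + x <= exp x]. *)
Lemma hid_logsum (e : env) (q p m eps : R) : 0 < eps -> 0 < q -> 0 < p ->
  hid n (tilted 1) e = q%:E -> hid n (tilted 0) e = p%:E ->
  ((q * ln (q / p) + (1 - m) / eps * q)%:E <= (expR (- m) / eps)%:E * hid n (tilted (1 + eps)) e)%E.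
Proof.
move=> eps0 q0 p0 hq hp.
have J0 : (0 <= hid n (tilted (1 + eps)) e)%E by apply: hid_ge0 => *; exact: tilted_ge0.
set rho := ln (q / p); pose c := rho + 1 + (1 - m) / eps.
have cm0 : 0 <= expR (- m) / eps by rewrite divr_ge0 ?expR_ge0// ltW.
have pe : expR rho * p = q by rewrite /rho lnK ?posrE ?divr_gt0// divfK// gt_eqF.
(* For [c < 0] the left-hand side is at most 0; otherwise [c%:E] is nonnegative and can be moved
   through the integrals. *)
have [c0|c0] := ltP c 0.
  apply: (@le_trans _ _ 0%E); last by rewrite mule_ge0.
  rewrite lee_fin; have : c * q <= 0 by rewrite mulr_le0_ge0// ltW.
  by rewrite /c !mulrDl; nra.
(* After division by [expR l] this is [1 + x <= exp x] at [rho - l], plus the same at [eps * l - m]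
   divided by [eps]. *)
have ineq l : expR l * c <= expR (- m) / eps * expR ((1 + eps) * l) + expR rho.
  have H1 := expR_ge1Dx (rho - l); have H2 := expR_ge1Dx (eps * l - m).
  have -> : expR (- m) / eps * expR ((1 + eps) * l) + expR rho =
     expR l * (expR (eps * l - m) / eps + expR (rho - l)).
    rewrite mulrDr mulrA -!expRD mulrAC -expRD; congr (expR _ / _ + expR _); ring.
  rewrite ler_wpM2l ?expR_ge0//.
  have : (1 + (eps * l - m)) / eps <= expR (eps * l - m) / eps by rewrite ler_wpM2r// invr_ge0 ltW.
  rewrite (_ : (1 + (eps * l - m)) / eps = l + (1 - m) / eps); last by field; rewrite gt_eqF.
  by rewrite /c; lra.
have mZ (a : R) s : 0 <= a -> measurableH (fun e d d' => a%:E * tilted s e d d')%E.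
  by move=> _; apply: emeasurable_funM; [exact: measurable_cst|exact: measurable_tilted].
have Z0 (a : R) s e' d d' : 0 <= a -> (0 <= a%:E * tilted s e' d d')%E.
  by move=> a0; rewrite mule_ge0// tilted_ge0.
have hZ (a : R) s : 0 <= a -> hid n (fun e d d' => a%:E * tilted s e d d')%E e = (a%:E * hid n (tilted s) e)%E.
  by move=> a0; rewrite hidZ//; [exact: measurable_tilted|exact: tilted_ge0].
have K : (c%:E * hid n (tilted 1) e <= (expR (- m) / eps)%:E * hid n (tilted (1 + eps)) e + (expR rho)%:E * hid n (tilted 0) e)%E.
  rewrite -!hZ ?expR_ge0// -hidD; [|exact: mZ|by apply: mZ; exact: expR_ge0|by move=> *; exact: Z0|by move=> *; apply: Z0; exact: expR_ge0].
  apply: le_hid; [exact: mZ| |by move=> *; exact: Z0|].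
    by apply: emeasurable_funD; apply: mZ => //; exact: expR_ge0.
  move=> e' d d'; rewrite /tilted -!EFinM -EFinD lee_fin mul1r mul0r expR0 mulr1.
  have := ler_wpM2l (paired_ge0 n0 A B kap e' d d') (ineq (ell e' d d')).
  move=> H; apply: le_trans (le_trans _ H) _; rewrite le_eqVlt; apply/orP; left; apply/eqP; ring.
move: K; rewrite hq hp -!EFinM pe; move: J0; case: (hid n (tilted (1 + eps)) e) => [r| |]//=.
  by rewrite -!EFinM -EFinD !lee_fin /c => _ K; lra.
by move=> _ _; rewrite gt0_muley ?leey// lte_fin divr_gt0 ?expR_gt0.
Qed.

(** The variance parameter of the common shift: its own weight [exp (- |d|^2 / 2)] combined with the
    factor [exp (- kap^2 (A + B) |d|^2 / 2)] of [paired]. It yields [1 / C = - kap^2 vnu]. *)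
Definition vnu : R := (1 + kap ^+ 2 * (A + B))^-1.

Lemma vnu_gt0 : 0 < vnu.
Proof. by rewrite invr_gt0 ltr_wpDr// mulr_ge0 ?sqr_ge0// addr_ge0// ltW. Qed.

Definition hwt (e : env) : R := if shive n e then hweight n A B (- (kap ^+ 2 * vnu)) e else 0.

Definition gam1 : \bar R := II row (fun d => (gam n d)%:E) (fun=> 0).

(** The coupled density factors: [d'] contributes its total mass, and [d] the average [type_gauss]
    of the third pattern. *)
Lemma visible_paired e : visible n (tilted 0) e =
  (gam1 * ((hbase n A B e)%:E * ((if gtint n (dnu n e) then 1 else 0)%:E * type_gauss n vnu kap (dnu n e))))%E.
Proof.
have mg : measurable_fun setT (fun d : renv => (gam n d)%:E) by apply/measurable_EFinP; exact: measurable_gam.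
have g0 d : (0 <= (gam n d : R)%:E)%E by rewrite lee_fin gam_ge0.
have G0 : (0 <= gam1)%E by exact: II_ge0.
set c : R := if _ then 1 else 0.
have c0 : 0 <= c by rewrite /c; case: ifP.
have hb0 : 0 <= hbase n A B e * c by rewrite mulr_ge0// hbase_ge0.
pose t (d : renv) : R := vdm2 n d * expR (- (\sum_(i <- iota 0 n) d i ^+ 2 / (2 * vnu)) +
    kap * \sum_(i <- iota 0 n) gtype (dnu n e) i * d i).
have t0 d : 0 <= t d by rewrite mulr_ge0 ?vdm2_ge0 ?expR_ge0.
have mt : measurable_fun setT (fun d => (t d)%:E).
  apply/measurable_EFinP; apply: measurable_funM; first exact: measurable_vdm2.
  by mR.
have -> : ((hbase n A B e)%:E * (c%:E * type_gauss n vnu kap (dnu n e)) =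
    (hbase n A B e * c)%:E * type_gauss n vnu kap (dnu n e))%E by rewrite EFinM muleA.
transitivity (gam1 * II row (fun d => (hbase n A B e * c)%:E * (t d)%:E) (fun=> 0%R))%E; last first.
  by rewrite (IIZl _ _ mt).
rewrite -IIZl//; last 2 first.
- by apply: emeasurable_funM => //; exact: measurable_cst.
- by move=> d; rewrite mule_ge0 ?lee_fin.
apply: eq_II => d; rewrite -EFinM muleC -(IIZl _ _ mg)//; last by rewrite lee_fin mulr_ge0.
apply: eq_II => d'; rewrite /tilted -EFinM mul0r expR0 mulr1 /paired -/c; congr (_%:E).
set E1 := expR _; have H : E1 * gam n d = t d.
  rewrite /gam /t mulrCA -expRD; congr (_ * expR _).
  rewrite -/(rdot n (gtype (dnu n e)) d) -mulr_suml (_ : \sum_(i <- row) d i ^+ 2 = nsq d); last first.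
    by apply: eq_bigr => i _; rewrite expr2.
  by rewrite /vnu invfM invrK; field.
by rewrite -H; ring.
Qed.

Lemma hwtE e : hwt e = hbase n A B e * nu_weight n vnu kap (gtrow (dnu n e) n).
Proof.
rewrite /hwt /hbase /nu_weight; case: ifPn => [sh|_]; last by rewrite !mul0r.
have [_ _ ->] := shive_decrn n0 sh; rewrite /hweight.
rewrite (_ : vdm _ = gtvdm n (dnu n e))// (_ : \sum_(i <- row) _ = rsq n (dnu n e))//.
set V1 := gtvdm n (dla n e); set V2 := gtvdm n (dmu n e); set V3 := gtvdm n (dnu n e).
transitivity (V1 * V2 * V3 * (expR (- (rsq n (dla n e) / (2 * A)) - rsq n (dmu n e) / (2 * B)) *
   expR (kap ^+ 2 * vnu / 2 * rsq n (dnu n e)))); last by ring.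
rewrite -expRD; congr (_ * expR _); field.
by rewrite !gt_eqF.
Qed.

Lemma hwt_ge0 e : 0 <= hwt e.
Proof. by rewrite hwtE mulr_ge0 ?hbase_ge0// nu_weight_ge0. Qed.

Lemma hlocal_hbase : hlocal n (hbase n A B).
Proof.
move=> e e' ee'; rewrite /hbase (hlocal_shive n0 ee').
have rowE (f g : env) : (forall m, f (n, m) = g (n, m)) -> gtvdm n f = gtvdm n g /\ rsq n f = rsq n g.
  move=> fg; split; last by apply: eq_bigr => m _; rewrite fg.
  by rewrite /gtvdm; congr vdm; apply: eq_map => m; rewrite fg.
have [-> ->] : gtvdm n (dla n e) = gtvdm n (dla n e') /\ rsq n (dla n e) = rsq n (dla n e').
  by apply: rowE => m; have [-> _ _] := hlocal_rows n0 ee' m.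
by have [-> ->] : gtvdm n (dmu n e) = gtvdm n (dmu n e') /\ rsq n (dmu n e) = rsq n (dmu n e')
  by apply: rowE => m; have [_ -> _] := hlocal_rows n0 ee' m.
Qed.

Lemma measurable_hbase : measurable_fun setT (hbase n A B).
Proof.
apply: measurable_funM.
  apply: measurable_fun_ifT; [exact: measurable_shive| |exact: measurable_cst].
  by apply: measurable_funM; apply: (measurable_comp_fun (@measurable_gtvdm R n));
    [exact: measurable_dla|exact: measurable_dmu].
apply: (measurable_comp_fun (@measurable_expR _)); apply: measurable_funB.
  apply: measurableT_comp => //; apply: measurable_funM; last exact: measurable_cst.
  exact: (measurable_comp_fun (@measurable_rsq R n) (@measurable_dla R n)).
apply: measurable_funM; last exact: measurable_cst.
exact: (measurable_comp_fun (@measurable_rsq R n) (@measurable_dmu R n)).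
Qed.

Lemma measurable_hwt : measurable_fun setT hwt.
Proof.
rewrite (funext hwtE); apply: measurable_funM; first exact: measurable_hbase.
apply: (measurable_comp_fun (@measurable_nu_weight R n vnu kap)).
by apply: measurable_gtrow; exact: measurable_dnu.
Qed.

Definition marginal_const : \bar R := (gam1 * (@herm_gauss_const R n vnu * @vol_const R n)%:E)%E.

Lemma marginal_const_ge0 : (0 <= marginal_const)%E.
Proof.
rewrite mule_ge0//; first by apply: II_ge0 => d; rewrite lee_fin gam_ge0.
by rewrite lee_fin mulr_ge0// ltW// ?vol_const_gt0// herm_gauss_const_gt0// vnu_gt0.
Qed.

(** Proportionality of the coupled marginal and the weight of the hive law, in the form of integrals
    over sets; [ae_tilt0] turns it into a pointwise statement. *)
Lemma paired_marginal (D : set (hive_space n)) : measurable D ->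
  (\int[lebesgue_tuple N]_(v in D) hid n (tilted 0) (tenv v) =
   marginal_const * \int[lebesgue_tuple N]_(v in D) (hwt (tenv v))%:E)%E.
Proof.
move=> mD; rewrite (integral_hid n0 (measurable_tilted 0) (tilted_ge0 0) mD).
pose Phi (e : env) : \bar R := (\1_D (hive_coords n (hiveval n e)))%:E.
have mI : measurable_fun setT (fun v : hive_space n => (\1_D v : R)%:E) by apply/measurable_EFinP.
have mPhi : measurable_fun setT Phi by apply: (measurable_comp_fun mI); exact: measurable_hive_coords.
have Phi0 e : (0 <= Phi e)%E by rewrite lee_fin.
have Ploc : hlocal n Phi by move=> e e' ee'; rewrite /Phi (hlocal_hive_coords n0 ee').
transitivity (II (colkeys n) (fun e => visible n (tilted 0) e * Phi e)%E (fun=> 0)).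
  by rewrite visible_law//; [exact: measurable_tilted|exact: tilted_ge0].
pose X e := ((hbase n A B e)%:E * Phi e)%E.
have mhb : measurable_fun setT (fun e => (hbase n A B e)%:E) by apply/measurable_EFinP; exact: measurable_hbase.
have hb0 e : (0 <= (hbase n A B e)%:E)%E by rewrite lee_fin hbase_ge0.
have mX : measurable_fun setT X by exact: emeasurable_funM.
have X0 e : (0 <= X e)%E by rewrite mule_ge0.
have Xloc : hlocal n X by move=> e e' ee'; rewrite /X (hlocal_hbase ee') (Ploc _ _ ee').
have G0 : (0 <= gam1)%E by apply: II_ge0 => d; rewrite lee_fin gam_ge0.
have mtg : measurable_fun setT (fun e : env => ((if gtint n (dnu n e) then 1 else 0)%:E * type_gauss n vnu kap (dnu n e))%E).
  apply: emeasurable_funM; last exact: (measurable_comp_fun (measurable_type_gauss n vnu kap) (@measurable_dnu R n)).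
  apply/measurable_EFinP; apply: measurable_fun_ifT; try exact: measurable_cst.
  exact: (measurable_comp_fun (@measurable_gtint R n) (@measurable_dnu R n)).
have tg0 e : (0 <= (if gtint n (dnu n e) then 1 else 0)%:E * type_gauss n vnu kap (dnu n e))%E.
  by rewrite mule_ge0 ?type_gauss_ge0//; case: ifP.
transitivity (gam1 * II (colkeys n) (fun e => X e * ((if gtint n (dnu n e) then 1 else 0)%:E * type_gauss n vnu kap (dnu n e))) (fun=> 0%R))%E.
  rewrite -IIZl//; [|exact: emeasurable_funM|by move=> e; rewrite mule_ge0].
  by apply: eq_II => e; rewrite visible_paired /X -!muleA; congr (_ * (_ * _))%E; rewrite muleA muleC.
rewrite II_nu_gauss ?vnu_gt0// /marginal_const -muleA; congr (_ * (_ * _))%E.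
rewrite integral_mkcond.
have mhw : measurable_fun setT (fun e => (hwt e)%:E) by apply/measurable_EFinP; exact: measurable_hwt.
have hlw : hlocal n hwt.
  by move=> e e' ee'; rewrite /hwt (hlocal_shive n0 ee') (hlocal_hweight n0 A B _ ee').
transitivity (\int[lebesgue_tuple N]_v ((hwt (tenv v))%:E * (\1_D v)%:E))%E; last first.
  by apply: eq_integral => v _; rewrite /patch indicE; case: ifP => _; rewrite ?mule1 ?mule0.
rewrite (integral_hive_space n0 (fun=> 0)); last 2 first.
- apply: emeasurable_funM => //; exact: (measurable_comp_fun mhw (@measurable_tenv R n)).
- by move=> v; rewrite mule_ge0// lee_fin// hwt_ge0.
apply: eq_II => e; rewrite (hlw _ _ (tenvK n0 e)) hwtE EFinM /X muleAC//.
Qed.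

End hidden_densities.

(** * From the law of the hive to its densities *)

Section hive_density.
Variables (R : realType) (n : nat).
Hypothesis n0 : (0 < n)%N.
Local Notation renv := (family R nat).
Local Notation env := (family R (nat * nat)).
Local Notation T := (@transport R n).
Local Notation N := #|coord_index n|.
Local Notation mu := (@lebesgue_tuple R N).
Local Notation space := (@hive_space R n).
Local Notation cone := (@coord_cone R n).
Variables (A B kap : R).
Hypotheses (A0 : 0 < A) (B0 : 0 < B).
Variable psi : env -> env.
Hypotheses (mpsi : measurable_fun setT psi) (psiK : cancel T psi).
Local Notation tilt s := (fun v : space => hid n (tilted n A B kap psi s) (tenv v)).
Local Notation hw := (fun v : space => hwt n A B kap (tenv v)).
Local Notation iC := (- (kap ^+ 2 * vnu A B kap)).

Variables (dS : measure_display) (S : measurableType dS) (P : probability S R) (Hc : S -> space) (c : R).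
Hypothesis mHc : measurable_fun setT Hc.
Hypothesis law : forall D, measurable D -> P (Hc @^-1` D) = (c%:E * \int[mu]_(v in D) tilt 1 v)%E.

Let mtilt s : measurable_fun setT (tilt s).
Proof.
apply: (measurable_comp_fun (measurable_hid n (measurable_tilted n A B kap mpsi s) (tilted_ge0 n0 A B kap psi s))).
exact: measurable_tenv.
Qed.

Let tilt0 s v : (0 <= tilt s v)%E.
Proof. by apply: hid_ge0; exact: tilted_ge0. Qed.

Let mhw : measurable_fun setT hw.
Proof. exact: (measurable_comp_fun (measurable_hwt n0 kap A0 B0) (@measurable_tenv R n)). Qed.

Let mcone : measurable cone. Proof. exact: measurable_coord_cone. Qed.

Lemma hlocal_nondegenerate : hlocal n (nondegenerate n : env -> bool).
Proof.
move=> e e' ee'; have H x y : (x <= y)%N -> (y <= n)%N -> hiveval n e x y = hiveval n e' x y.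
  by move=> xy yn; exact: hlocal_hv.
apply: eq_in_all => x _; apply: eq_in_all => y _.
have E (b : bool) (x1 x2 y1 y2 : R) : (b -> x1 = y1 /\ x2 = y2) ->
    (if b then x1 != x2 else true) = (if b then y1 != y2 else true).
  by case: b => // /(_ isT)[-> ->].
by congr [&& _, _ & _]; apply: E => /andP[? ?]; rewrite !H//; lia.
Qed.

Lemma ae_cone_shive : {ae mu, forall v, cone v -> shive n (tenv v)}.
Proof.
pose D := [set v : space | ~~ nondegenerate n (tenv v)].
have mnd : measurable_fun setT (fun v : space => nondegenerate n (tenv v)).
  exact: (measurable_comp_fun (@measurable_nondegenerate R n) (@measurable_tenv R n)).
have mD : measurable D.
  rewrite (_ : D = (fun v => ~~ nondegenerate n (tenv v)) @^-1` [set true]); last by apply/seteqP; split.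
  by rewrite -[X in measurable X]setTI; apply: measurable_neg.
exists D; split => //.
  rewrite -[D]setIT -integral_indic//.
  rewrite -(II_degenerate n0 (fun=> 0)) -(integral_tenv n0)//.
  - apply: eq_integral => v _; rewrite indicE; case: ifPn => H; last by rewrite mem_set.
    by rewrite memNset// /D /= H.
  - apply/measurable_EFinP; apply: measurable_fun_ifT; [exact: measurable_nondegenerate|exact: measurable_cst|exact: measurable_cst].
  - by move=> e; case: ifP.
  - by move=> e e' ee'; rewrite (hlocal_nondegenerate ee').
move=> v /= /not_implyP[cv sv]; apply/negP => nd; apply: sv.
by rewrite shive_whive nd andbT; apply/(coord_coneP n0).
Qed.

Lemma tilt_out s v : ~ cone v -> tilt s v = 0%E.
Proof.
move=> cv; apply: hid_eq0 => //.
  by move=> e d d'; exact: tilted_shive.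
by apply/negP; rewrite shive_whive => /andP[/(coord_coneP n0)].
Qed.

Local Notation Mtot := (\int[mu]_v tilt 1 v)%E.

Let c_Mtot : (c%:E * Mtot = 1)%E.
Proof. by rewrite -law// preimage_setT probability_setT. Qed.

Definition total := fine Mtot.

(** Since the law has mass 1, the tilted mass is finite: an infinite mass times a real number cannot
    be 1. The same identity determines the constant [c]. *)
Lemma total_spec : Mtot = total%:E /\ c * total = 1.
Proof.
have M0 : (0 <= Mtot)%E by exact: integral_ge0.
rewrite /total; move: c_Mtot M0; case: Mtot => [r| |]//=; first by move=> [cr] _.
by move=> + _; have [c0|c0|->] := ltgtP c 0; [rewrite lt0_muley|rewrite gt0_muley|rewrite mul0e => -[]/eqP; rewrite eq_sym oner_eq0].
Qed.

Lemma total_gt0 : 0 < total.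
Proof.
have [ME cM] := total_spec; rewrite lt_neqAle; apply/andP; split.
  by apply/eqP => T0; move: cM; rewrite -T0 mulr0 => /eqP; rewrite eq_sym oner_eq0.
by rewrite -lee_fin -ME integral_ge0.
Qed.

Lemma c_total : c = total^-1.
Proof. by have [_ /eqP] := total_spec; move=> /eqP H; apply: (mulIf (lt0r_neq0 total_gt0)); rewrite H mulVf// gt_eqF// total_gt0. Qed.

Definition dens (v : space) : R := fine (tilt 1 v) / total.

Lemma dens_ge0 v : 0 <= dens v.
Proof. by apply: divr_ge0; [apply: fine_ge0; exact: tilt0|exact/ltW/total_gt0]. Qed.

Lemma measurable_dens : measurable_fun setT dens.
Proof.
apply: measurable_funM; last exact: measurable_cst.
exact: (measurable_comp_fun (fine_measurable measurableT) (mtilt 1)).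
Qed.

Lemma integrable_tilt s : s * (s - 1) = 0 -> mu.-integrable setT (tilt s).
Proof.
move=> s0; apply/integrableP; split => //.
under eq_integral do rewrite gee0_abs//.
rewrite (tilted_mass01 n0 kap A0 B0 mpsi psiK s0) -(tilted_mass01 n0 kap A0 B0 mpsi psiK (s := 1)); last by rewrite subrr mulr0.
by have [-> _] := total_spec; rewrite ltry.
Qed.

Lemma tilt_mass s : s * (s - 1) = 0 -> (\int[mu]_v tilt s v = total%:E)%E.
Proof.
move=> s0; rewrite (tilted_mass01 n0 kap A0 B0 mpsi psiK s0) -(tilted_mass01 n0 kap A0 B0 mpsi psiK (s := 1)); last by rewrite subrr mulr0.
by have [-> _] := total_spec.
Qed.

Let s10 : 1 * (1 - 1) = 0 :> R. Proof. by rewrite subrr mulr0. Qed.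
Let s00 : 0 * (0 - 1) = 0 :> R. Proof. by rewrite mul0r. Qed.

Lemma ae_tilt_dens : {ae mu, forall v, tilt 1 v = (total * dens v)%:E}.
Proof.
apply: filterS (integrable_ae measurableT (integrable_tilt s10)) => v /(_ I) H.
by rewrite /dens mulrC divfK ?gt_eqF ?total_gt0// fineK.
Qed.

Lemma integral_dens D : measurable D ->
  (\int[mu]_(v in D `&` cone) (dens v)%:E = P (Hc @^-1` D))%E.
Proof.
move=> mD; rewrite law// c_total.
transitivity (total^-1%:E * \int[mu]_(v in D `&` cone) tilt 1 v)%E.
  rewrite -ge0_integralZl_EFin//; [|exact: measurableI|exact: measurable_funS (mtilt 1)|by rewrite invr_ge0 ltW// total_gt0].
  apply: ge0_ae_eq_integral; first exact: measurableI.
  - by apply/measurable_EFinP; exact: measurable_funS measurable_dens.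
  - apply: measurable_funS measurableT _ _ => //; apply: emeasurable_funM => //; exact: measurable_cst.
  - by move=> v _; rewrite lee_fin dens_ge0.
  - by move=> v _; rewrite mule_ge0// lee_fin invr_ge0 ltW// total_gt0.
  apply: filterS ae_tilt_dens => v -> _; rewrite -EFinM mulrA mulVf ?mul1r// gt_eqF//.
  exact: total_gt0.
congr (_ * _)%E; rewrite integral_mkcondr; apply: eq_integral => v _; rewrite /patch.
by case: ifPn => // /negP H; rewrite tilt_out// => cv; apply: H; rewrite inE.
Qed.

Lemma density_unique (q : space -> R) : measurable_fun cone q -> (forall v, cone v -> 0 <= q v) ->
  (forall D, measurable D -> P (Hc @^-1` D) = \int[mu]_(v in D `&` cone) (q v)%:E)%E ->
  {ae mu, forall v, cone v -> q v = dens v}.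
Proof.
move=> mq q0 qlaw.
have id : mu.-integrable cone (EFin \o dens).
  apply/integrableP; split; first by apply/measurable_EFinP; exact: measurable_funS measurable_dens.
  under eq_integral do rewrite /= ger0_norm ?dens_ge0//.
  have := integral_dens measurableT; rewrite setTI => ->.
  by rewrite (le_lt_trans (probability_le1 _ _)) ?ltry// -[X in measurable X]setTI; exact: mHc.
have : ae_eq mu cone (EFin \o dens) (EFin \o q).
  apply: integral_ae_eq => //; first exact/measurable_EFinP.
  move=> E Ec mE; have := integral_dens mE; rewrite qlaw// (setIidl Ec) => ->.
  by [].
by apply: filterS => v H cv; have [->] := H cv.
Qed.

Lemma hive_weight_pos v : shive n (tenv v) -> 0 < hw v.
Proof.
move=> sh; have [H1 H2 H3] := shive_decrn n0 sh.
by rewrite /hwt sh /hweight !mulr_gt0 ?expR_gt0//; exact: gtdecr_vdm.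
Qed.

Definition Wtot := (\int[mu]_v (hw v)%:E)%E.

Lemma marginal_total : (marginal_const n A B kap * Wtot = total%:E)%E.
Proof. by rewrite -(paired_marginal n0 kap A0 B0 mpsi measurableT) tilt_mass. Qed.

(** A finite positive product of two nonnegative extended reals has finite positive factors. *)
Lemma Wtot_spec : exists2 mc : R, marginal_const n A B kap = mc%:E & 0 < mc /\ Wtot = (total / mc)%:E.
Proof.
have mc0 : (0 <= marginal_const n A B kap)%E by exact: marginal_const_ge0.
have W0 : (0 <= Wtot)%E by apply: integral_ge0 => v _; rewrite lee_fin hwt_ge0.
have t0 := total_gt0; move: marginal_total mc0 W0.
case: (marginal_const n A B kap) => [mc| |]//; case: Wtot => [W| |]//.
- move=> [E]; rewrite !lee_fin => mc0 W0; exists mc => //.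
  have mc1 : 0 < mc by rewrite lt_neqAle mc0 andbT; apply/eqP => mcE; move: t0; rewrite -E -mcE mul0r ltxx.
  by split => //; rewrite -E mulrC mulKf// gt_eqF.
- move=> + + _; rewrite le_eqVlt => + /predU1P[|mc0]; last by rewrite gt0_muley.
  by move=> /[swap] <-; rewrite mul0e => -[E]; move: t0; rewrite -E ltxx.
- move=> + _; rewrite le_eqVlt => + /predU1P[|W0]; last by rewrite gt0_mulye.
  by move=> /[swap] <-; rewrite mule0 => -[E]; move: t0; rewrite -E ltxx.
Qed.

(** Two functions with equal integrals over all measurable sets, one of them integrable, agree
    almost everywhere. *)
Lemma ae_tilt0 : {ae mu, forall v, tilt 0 v = (total * (hw v / fine Wtot))%:E}.
Proof.
have [mc mcE [mc0 WE]] := Wtot_spec; have t0 := total_gt0.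
have : ae_eq mu setT (tilt 0) (fun v => mc%:E * (hw v)%:E)%E.
  apply: integral_ae_eq => //; first exact: integrable_tilt.
    by apply: emeasurable_funM; [exact: measurable_cst|exact/measurable_EFinP].
  move=> E _ mE; rewrite (paired_marginal n0 kap A0 B0 mpsi mE) mcE ge0_integralZl_EFin//; last 2 first.
  - by apply/measurable_EFinP; exact: measurable_funS mhw.
  - exact: ltW.
  - by move=> v _; rewrite lee_fin hwt_ge0.
apply: filterS => v /(_ I) ->; rewrite -EFinM WE /=; congr (_%:E).
by field; rewrite !gt_eqF.
Qed.

Lemma ae_hive_weight : {ae mu, forall v, cone v -> hive_weight A B iC v = hw v}.
Proof.
by apply: filterS ae_cone_shive => v H /H sh; rewrite hive_weightE// /hwt sh.
Qed.

Lemma measurable_hive_weight iC : measurable_fun setT (fun v : space => hive_weight A B iC v).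
Proof.
rewrite (funext (hive_weightE n0 A B iC)).
apply: (measurable_comp_fun (f := hweight n A B iC)); last exact: measurable_tenv.
have mv (f : env -> env) : measurable_fun setT f -> measurable_fun setT (fun e : env => gtvdm n (f e)).
  by move=> mf; exact: (measurable_comp_fun (@measurable_gtvdm R n) mf).
have mr (f : env -> env) x : measurable_fun setT f -> measurable_fun setT (fun e : env => rsq n (f e) * x).
  move=> mf; apply: measurable_funM; last exact: measurable_cst.
  exact: (measurable_comp_fun (@measurable_rsq R n) mf).
have mla : measurable_fun setT (fun e : env => dla n e) := @measurable_dla R n.
have mmu : measurable_fun setT (fun e : env => dmu n e) := @measurable_dmu R n.
have mnu : measurable_fun setT (fun e : env => dnu n e) := @measurable_dnu R n.
apply: measurable_funM; first by apply: measurable_funM; [apply: measurable_funM|]; apply: mv.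
apply: (measurable_comp_fun (@measurable_expR _)); apply: measurable_funM; first exact: measurable_cst.
by apply: measurable_funD; [apply: measurable_funD|]; exact: mr.
Qed.

Lemma integral_hive_weight : (\int[mu]_(v in cone) (hive_weight A B iC v)%:E = Wtot)%E.
Proof.
transitivity (\int[mu]_(v in cone) (hw v)%:E)%E; last first.
  rewrite /Wtot integral_mkcond; apply: eq_integral => v _; rewrite /patch.
  case: ifPn => // /negP H; rewrite /hwt ifF// shive_whive; apply/negbTE/negP => /andP[wh _].
  by apply: H; rewrite inE; apply/(coord_coneP n0).
apply: ae_eq_integral => //.
- by apply/measurable_EFinP; apply: measurable_funS (measurable_hive_weight _).
- by apply/measurable_EFinP; exact: measurable_funS mhw.
- by apply: filterS ae_hive_weight => v H /H ->.
Qed.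

(** The pointwise hypothesis of [KL_integral_le] is [hid_logsum] with both densities scaled by the
    common mass [total]; [m] is the logarithm of the bound on the relative mass at [1 + eps]. *)
Lemma KL_hive_weight_le (q : space -> R) (m eps : R) : 0 < eps ->
  kap ^+ 2 * B / 2 * ((1 + eps) * eps) <= 1 / 8 -> expR m = Num.sqrt 2 ^+ n ->
  measurable_fun cone q -> (forall v, cone v -> 0 <= q v) ->
  (forall D, measurable D -> P (Hc @^-1` D) = \int[mu]_(v in D `&` cone) (q v)%:E)%E ->
  (KL q (fun v => (hive_weight A B iC v / fine (\int[mu]_(w in cone) (hive_weight A B iC w)%:E))%R)
   <= (m / eps)%:E)%E.
Proof.
move=> eps0 small mE mq q0 qlaw; rewrite integral_hive_weight /KL.
have t0 := total_gt0; have [mc mcE [mc0 WE]] := Wtot_spec.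
have W0 : 0 < fine Wtot by rewrite WE divr_gt0.
set W := fine Wtot in W0 *.
have mp : measurable_fun setT (fun v : space => hw v / W) by apply: measurable_funM; last exact: measurable_cst.
have p0 v : 0 <= hw v / W by rewrite divr_ge0 ?(hwt_ge0 n0 _ A0 B0)// ltW.
rewrite (_ : (\int[mu]_(v in cone) _ = \int[mu]_(v in cone) KL_integrand (dens v) (hw v / W))%E); last first.
  apply: ae_eq_integral => //.
  (* The function [q] is given as measurable on the cone; its extension by 0 is measurable
     everywhere. *)
  - apply: (eq_measurable_fun (fun v : space => KL_integrand ((q \_ cone) v) (hive_weight A B iC v / W))).
      by move=> v cv; rewrite /patch cv.
    apply: measurable_funTS; apply: measurable_KL_integrand.
      exact/(measurable_restrictT _ mcone).
    by apply: measurable_funM; [exact: measurable_hive_weight|exact: measurable_cst].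
  - by apply: measurable_funTS; apply: measurable_KL_integrand => //; exact: measurable_dens.
  by apply: filterS2 (density_unique mq q0 qlaw) ae_hive_weight => v H1 H2 cv; rewrite H1// H2.
pose J (v : space) := ((total^-1)%:E * tilt (1 + eps) v)%E.
have J0 v : (0 <= J v)%E by rewrite mule_ge0// lee_fin invr_ge0 ltW.
apply: (KL_integral_le (J := J) mcone measurable_dens mp _ dens_ge0 p0 J0 eps0).
- by apply: emeasurable_funM; [exact: measurable_cst|exact: mtilt].
- by have := integral_dens measurableT; rewrite setTI preimage_setT probability_setT.
- rewrite (@le_lt_trans _ _ (\int[mu]_v (hw v / W)%:E)%E)//.
    by apply: ge0_subset_integral => //; [exact/measurable_EFinP|move=> v _; rewrite lee_fin].
  under eq_integral do rewrite mulrC EFinM.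
  rewrite ge0_integralZl_EFin//.
  - by rewrite -/Wtot WE -EFinM ltry.
  - by move=> v _; rewrite lee_fin (hwt_ge0 n0 _ A0 B0).
  - exact/measurable_EFinP.
  - by rewrite invr_ge0 ltW.
- apply: (@le_trans _ _ (\int[mu]_v J v)%E).
    apply: ge0_subset_integral => //.
    by apply: emeasurable_funM; [exact: measurable_cst|exact: mtilt].
  have -> : (\int[mu]_v J v = total^-1%:E * \int[mu]_v tilt (1 + eps) v)%E.
    apply: ge0_integralZl_EFin; [exact: measurableT|by move=> v _; exact: tilt0|exact: mtilt|].
    by rewrite invr_ge0 ltW.
  have H := @tilted_mass_le R n n0 A B kap A0 B0 psi mpsi psiK (1 + eps).
  have GE : ((@gZ R n A B)%:E * @gam2 R n = total%:E)%E.
    by rewrite -(tilt_mass s10) (tilted_mass01 n0 kap A0 B0 mpsi psiK s10).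
  rewrite GE (_ : 1 + eps - 1 = eps) in H; last by rewrite addrAC subrr add0r.
  apply: (@le_trans _ _ (total^-1%:E * ((Num.sqrt 2 ^+ n)%:E * total%:E))%E).
    by apply: lee_wpmul2l; [rewrite lee_fin invr_ge0 ltW|exact: H].
  by rewrite mE -!EFinM lee_fin mulrCA mulVf ?mulr1// gt_eqF.
- apply: filterS3 ae_cone_shive ae_tilt_dens ae_tilt0 => v sh q1 p1 cv.
  have hw0 := hive_weight_pos (sh cv).
  split; first by rewrite divr_gt0.
  have [qv|qv] := eqVneq (dens v) 0.
    by rewrite qv mul0r mulr0 addr0 mule_ge0// lee_fin divr_ge0 ?expR_ge0// ltW.
  have qv0 : 0 < dens v by rewrite lt_neqAle eq_sym qv dens_ge0.
  have pv0 : 0 < hw v / W by rewrite divr_gt0.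
  have := hid_logsum n0 mpsi m eps0 (mulr_gt0 t0 qv0) (mulr_gt0 t0 pv0) q1 p1.
  rewrite -mulf_div divff ?gt_eqF// mul1r => H.
  have := lee_wpmul2l _ H; move=> /(_ total^-1%:E); rewrite lee_fin invr_ge0 ltW// => /(_ isT).
  rewrite muleCA -EFinM; congr (_ <= _)%E; congr (_%:E); field; rewrite !gt_eqF//.
Qed.

Lemma exists_density : exists q : space -> R, [/\ measurable_fun cone q, forall v, cone v -> 0 <= q v &
  forall D, measurable D -> P (Hc @^-1` D) = (\int[mu]_(v in D `&` cone) (q v)%:E)%E].
Proof.
exists dens; split.
- exact: measurable_funS measurable_dens.
- by move=> v _; exact: dens_ge0.
- by move=> D mD; rewrite integral_dens.
Qed.

End hive_density.

(** * Side lengths *)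

Section triangle_parameters.
Variable R : realType.
Implicit Types a b c A B iC : R.

(** The relations invert explicitly: [al], [be] and [ga] are the products of two parameters over the
    sum of all three, [D] is the product of all three over that sum, and the quotients give back the
    parameters. *)
Lemma is_triangle_param_unique a b c A B iC A' B' iC' :
  is_triangle_param a b c A B iC -> is_triangle_param a b c A' B' iC' -> (A, B, iC) = (A', B', iC').
Proof.
rewrite /is_triangle_param; case: eqP => _; first by move=> [-> -> ->] [-> -> ->].
pose al := (b ^+ 2 + c ^+ 2 - a ^+ 2) / 2; pose be := (c ^+ 2 + a ^+ 2 - b ^+ 2) / 2.
pose ga := (a ^+ 2 + b ^+ 2 - c ^+ 2) / 2; pose D := al * be + be * ga + ga * al.
suff E A0 B0 C0 : [/\ 0 < A0, 0 < B0 & 0 < C0] \/ [/\ 0 < A0, 0 < B0 & A0 + B0 < - C0] ->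
    [/\ a ^+ 2 = A0 * (B0 + C0) / (A0 + B0 + C0), b ^+ 2 = B0 * (C0 + A0) / (A0 + B0 + C0) &
        c ^+ 2 = C0 * (A0 + B0) / (A0 + B0 + C0)] -> [/\ A0 = D / al, B0 = D / be & C0 = D / ga].
  by move=> [C [-> h1 h2]] [C' [-> h1' h2']]; have [-> -> ->] := E _ _ _ h1 h2; have [-> -> ->] := E _ _ _ h1' h2'.
move=> sgn [Ea Eb Ec].
have [A0p B0p C0n S0n] : [/\ A0 != 0, B0 != 0, C0 != 0 & A0 + B0 + C0 != 0].
  case: sgn => -[A0p B0p C0p]; split; first [by rewrite gt_eqF//|rewrite gt_eqF//; lra|rewrite lt_eqF//; lra].
have alE : al = B0 * C0 / (A0 + B0 + C0) by rewrite /al Ea Eb Ec; field.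
have beE : be = A0 * C0 / (A0 + B0 + C0) by rewrite /be Ea Eb Ec; field.
have gaE : ga = A0 * B0 / (A0 + B0 + C0) by rewrite /ga Ea Eb Ec; field.
by rewrite /D alE beE gaE; split; field; rewrite ?A0p ?B0p ?C0n ?S0n.
Qed.

Lemma triangle_paramE a b c A B iC : is_triangle_param a b c A B iC -> triangle_param a b c = (A, B, iC).
Proof.
move=> h; rewrite /triangle_param; apply: xget_unique => // -[[A' B'] iC'] /= h'.
exact: is_triangle_param_unique h' h.
Qed.

(* Both sides solve [2 x^2 (x - p) = delta^2 (x^2 - q^2)]; subtracting leaves the factor
   [x^2 y^2 - q^2 (x^2 + x y + y^2 - p (x + y))], positive for [q^2 < p^2] and [x, y >= p]. *)
Lemma opposite_side_unique (p q x y del : R) : 0 < p -> q ^+ 2 < p ^+ 2 -> p <= x -> p <= y ->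
  del * (x ^+ 2 - q ^+ 2) = 2 * x ^+ 2 * (x - p) -> del * (y ^+ 2 - q ^+ 2) = 2 * y ^+ 2 * (y - p) -> x = y.
Proof.
move=> p0 qp px py Ex Ey; apply/eqP; rewrite -subr_eq0.
pose br := x ^+ 2 * y ^+ 2 - q ^+ 2 * (x ^+ 2 + x * y + y ^+ 2 - p * (x + y)).
have : (x - y) * br = 0.
  have E1 : 2 * x ^+ 2 * (x - p) * (y ^+ 2 - q ^+ 2) = 2 * y ^+ 2 * (y - p) * (x ^+ 2 - q ^+ 2).
    by rewrite -Ex -Ey; ring.
  rewrite (_ : _ * br = (2 * x ^+ 2 * (x - p) * (y ^+ 2 - q ^+ 2) - 2 * y ^+ 2 * (y - p) * (x ^+ 2 - q ^+ 2)) / 2).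
    by rewrite E1 subrr mul0r.
  by rewrite /br; field.
have Q0 : 0 < x ^+ 2 + x * y + y ^+ 2 - p * (x + y) by nra.
have br0 : 0 < br.
  have H1 : 0 <= (x - p) * (y - p) * ((x + p) * (y + p) - p ^+ 2).
    by apply: mulr_ge0; [apply: mulr_ge0; lra|nra].
  have H2 : 0 < (p ^+ 2 - q ^+ 2) * (x ^+ 2 + x * y + y ^+ 2 - p * (x + y)) by rewrite mulr_gt0// subr_gt0.
  have -> : br = (x - p) * (y - p) * ((x + p) * (y + p) - p ^+ 2) +
     (p ^+ 2 - q ^+ 2) * (x ^+ 2 + x * y + y ^+ 2 - p * (x + y)) by rewrite /br; ring.
  by rewrite ltr_wpDl.
by move=> /eqP; rewrite mulf_eq0 (gt_eqF br0) orbF.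
Qed.

End triangle_parameters.

(** * The random hive in column coordinates *)

Section random_hive.
Variables (R : realType) (n : nat).
Hypothesis n0 : (0 < n)%N.
Local Notation C := R[i].
Local Notation renv := (family R nat).
Local Notation env := (family R (nat * nat)).
Local Notation T := (@transport R n).

Lemma lin_mat (s w u : R) (G Gt : 'M[C]_n) : G \is hermsymmx -> Gt \is hermsymmx ->
  s%:C *: (w%:C *: G + u%:C *: spec_diag_mx Gt) =
  mat (lin n (s * w) (s * u) (hcoord G) (specenv (mat (hcoord Gt) n))) n.
Proof.
move=> hG hGt; rewrite (mat_hcoord hGt (hcoordE Gt)).
rewrite -[in LHS](mat_hcoord hG (hcoordE G)); apply/matrixP => i j.
rewrite !mxE /hent /lin !mem_Mkeys /= !ltn_ord /= -(inj_eq val_inj) /specenv (tnth_nth 0).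
have [ij|ij|ij] := ltngtP i j; rewrite ?(gtn_eqF ij) ?(ltn_eqF ij) /=.
- by simpc; congr (_ +i* _); ring.
- by simpc; congr (_ +i* _); ring.
- by rewrite ij eqxx /=; simpc; congr (_ +i* _); ring.
Qed.

Lemma eq_hive_coords (h h' : nat -> nat -> R) : (forall x y, (x <= y)%N -> (y <= n)%N -> h x y = h' x y) ->
  hive_coords n h = hive_coords n h'.
Proof.
move=> hh; apply: eq_from_tnth => k; rewrite !tnth_mktuple.
case: (enum_val k) => [[[i|i]|i]|[[i j] /= ij]]; have := ltn_ord i.
- by move=> ?; rewrite /hive_la !hh//; lia.
- by move=> ?; rewrite /hive_mu !hh//; lia.
- by move=> ?; rewrite !hh//; lia.
- by move=> ?; have := ltn_ord j; move: ij => /andP[? ?] ?; rewrite hh//; lia.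
Qed.

Variables (dS : measure_display) (S : measurableType dS) (P : probability S R).
Variables G G' Gt Gt' : S -> 'M[C]_n.
Hypotheses (gG : is_GUE P G) (gG' : is_GUE P G') (gGt : is_GUE P Gt) (gGt' : is_GUE P Gt').
Hypothesis ind : independent_matrices P (tnth [tuple G; G'; Gt; Gt']).
Variables (s w w' u u' A B kap : R) (psi : env -> env).
Hypotheses (A0 : 0 < A) (B0 : 0 < B) (mpsi : measurable_fun setT psi) (psiK : cancel T psi).
Hypotheses (sw : s * w != 0) (sw' : s * w' != 0) (AE : (s * w) ^+ 2 = A) (BE : (s * w') ^+ 2 = B).
Hypotheses (uE : s * u = kap * A) (uE' : s * u' = kap * B).

Let Hc om : hive_space n := hive_coords n (octahedron_hive
  (s%:C *: (w%:C *: G om + u%:C *: spec_diag_mx (Gt om)))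
  (s%:C *: (w'%:C *: G' om + u'%:C *: spec_diag_mx (Gt' om)))).

Let model om := T (glue n
  (gtspec n (lin n (s * w) (kap * A) (hcoord (G om)) (specenv (mat (hcoord (Gt om)) n))))
  (gtspec n (lin n (s * w') (kap * B) (hcoord (G' om)) (specenv (mat (hcoord (Gt' om)) n))))).

Let HcE om : Hc om = hive_coords n (hiveval n (model om)).
Proof.
have [hG _ _ _] := gG; have [hG' _ _ _] := gG'; have [hGt _ _ _] := gGt; have [hGt' _ _ _] := gGt'.
have XE := lin_mat s w u (hG om) (hGt om); have YE := lin_mat s w' u' (hG' om) (hGt' om).
rewrite uE in XE; rewrite uE' in YE; apply: eq_hive_coords => x y xy yn.
by apply: etrans (octahedron_hiveE _ _ xy yn); exact: (f_equal2 (fun M N => octahedron_hive M N x y) XE YE).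
Qed.

Lemma measurable_random_hive : measurable_fun setT Hc.
Proof.
have [mT _ _] := @transport_iso R n.
have mg z c (X Y : S -> 'M[C]_n) : is_GUE P X -> is_GUE P Y -> measurable_fun setT
    (fun om => gtspec n (lin n z c (hcoord (X om)) (specenv (mat (hcoord (Y om)) n)))).
  move=> gX gY; apply: (measurable_comp_fun (@measurable_gtspec R n)).
  apply: measurable_lin; first exact: measurable_hcoord gX.
  by apply: measurable_specenv; exact: measurable_hcoord gY.
have mm : measurable_fun setT model.
  by apply: (measurable_comp_fun mT); apply: measurable_glue; exact: mg.
by rewrite (funext HcE); exact: (measurable_comp_fun (@measurable_hive_coords R n n0) mm).
Qed.

Lemma random_hive_law : exists c : R, forall D, measurable D ->
  (P (Hc @^-1` D) = c%:E * \int[lebesgue_tuple #|coord_index n|]_(v in D) hid n (tilted n A B kap psi 1) (tenv v))%E.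
Proof.
eexists => D mD.
pose Phi (e : env) : \bar R := (\1_D (hive_coords n (hiveval n e)))%:E.
have mI : measurable_fun setT (fun v : hive_space n => (\1_D v : R)%:E) by apply/measurable_EFinP.
have mPhi : measurable_fun setT Phi by apply: (measurable_comp_fun mI); exact: measurable_hive_coords.
have Phi0 e : (0 <= Phi e)%E by rewrite lee_fin.
have Ploc : hlocal n Phi by move=> e e' ee'; rewrite /Phi (hlocal_hive_coords n0 ee').
have mHD : measurable (Hc @^-1` D) by rewrite -[X in measurable X]setTI; exact: measurable_random_hive.
rewrite (integral_hid n0 (measurable_tilted n A B kap mpsi 1) (tilted_ge0 n0 A B kap psi 1) mD).
transitivity (\int[P]_om Phi (model om))%E.
  by rewrite -[Hc @^-1` D]setIT -integral_indic//; apply: eq_integral => om _; rewrite /Phi -HcE.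
rewrite (hive_law n0 kap A0 B0 mpsi psiK gG gG' gGt gGt' ind sw sw' AE BE mPhi Phi0 Ploc).
congr (_ * _)%E; apply: eq_II => d; apply: eq_II => d'; apply: eq_II => e.
by rewrite /tilted mul1r.
Qed.

End random_hive.

Lemma obtuse_gaps (R : realType) (x y z : R) : 0 < x -> 0 < y -> x + y <= z ->
  0 < z + x - y /\ 0 < z - x + y.
Proof. by move=> x0 y0 xyz; split; lra. Qed.

(** * The third side and its parameters *)

Section limit_hive.
Variables (R : realType) (w w' u u' a b c : R).
Hypotheses (w_gt0 : 0 < w) (w'_gt0 : 0 < w').
Hypothesis ratio : u / w ^+ 2 = u' / w' ^+ 2.
Hypotheses (a_gt0 : 0 < a) (b_gt0 : 0 < b).
Hypotheses (a2E : a ^+ 2 = w ^+ 2 + u ^+ 2) (b2E : b ^+ 2 = w' ^+ 2 + u' ^+ 2).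
Hypotheses (c2_ge : a ^+ 2 + b ^+ 2 <= c ^+ 2).
Hypothesis cE : (u + u') ^+ 2 = 2 * c ^+ 4 * (c ^+ 2 - a ^+ 2 - b ^+ 2) /
  ((c ^+ 2 - a ^+ 2 + b ^+ 2) * (c ^+ 2 + a ^+ 2 - b ^+ 2)).
Local Notation r := (u / w ^+ 2).
Local Notation S2 := (w ^+ 2 + w' ^+ 2).

Let uE : u = r * w ^+ 2. Proof. by field; rewrite gt_eqF. Qed.
Let u'E : u' = r * w' ^+ 2. Proof. by rewrite ratio; field; rewrite gt_eqF. Qed.
Let w2 : 0 < w ^+ 2. Proof. exact: exprn_gt0. Qed.
Let w'2 : 0 < w' ^+ 2. Proof. exact: exprn_gt0. Qed.

(** With [r] the common ratio, the right-hand side solves the equation defining [c^2] and is at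
    least [a^2 + b^2], so [opposite_side_unique] identifies it. *)
Lemma third_side : c ^+ 2 = S2 + r ^+ 2 * S2 ^+ 2.
Proof.
have a2 : 0 < a ^+ 2 by exact: exprn_gt0. have b2 : 0 < b ^+ 2 by exact: exprn_gt0.
have [d1 d2] := obtuse_gaps a2 b2 c2_ge.
have rr : 0 <= r ^+ 2 by exact: sqr_ge0.
have aE : a ^+ 2 = w ^+ 2 + r ^+ 2 * (w ^+ 2) ^+ 2 by rewrite a2E {1}uE; ring.
have bE : b ^+ 2 = w' ^+ 2 + r ^+ 2 * (w' ^+ 2) ^+ 2 by rewrite b2E {1}u'E; ring.
have prod0 : 0 < a ^+ 2 * b ^+ 2 by exact: mulr_gt0.
apply: (@opposite_side_unique R (a ^+ 2 + b ^+ 2) (a ^+ 2 - b ^+ 2) _ _ ((u + u') ^+ 2)) => //; first lra.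
- by rewrite -subr_gt0 (_ : _ - _ = 4 * (a ^+ 2 * b ^+ 2)); [lra|ring].
- rewrite aE bE -subr_ge0 (_ : _ - _ = 2 * (r ^+ 2 * (w ^+ 2 * w' ^+ 2))); last by ring.
  by rewrite mulr_ge0// mulr_ge0// mulr_ge0// ltW.
- rewrite cE; field.
  by rewrite !gt_eqF.
- have -> : (u + u') ^+ 2 = r ^+ 2 * S2 ^+ 2 by rewrite {1}uE {1}u'E; ring.
  by rewrite aE bE; ring.
Qed.

(** The number [- kap^2 vnu] is 0 exactly when there is no shift, the right-angled case; otherwise
    [C] is negative and the angle opposite [c] is obtuse. *)
Lemma limit_triangle_param s : 0 < s ->
  let kap := r / s in let A := (s * w) ^+ 2 in let B := (s * w') ^+ 2 in
  triangle_param (a * s) (b * s) (c * s) = (A, B, - (kap ^+ 2 * vnu A B kap)).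
Proof.
move=> s0 kap A B; apply: triangle_paramE; rewrite /is_triangle_param.
have sn : s != 0 by rewrite gt_eqF.
have aE : a ^+ 2 = w ^+ 2 + r ^+ 2 * (w ^+ 2) ^+ 2 by rewrite a2E {1}uE; ring.
have bE : b ^+ 2 = w' ^+ 2 + r ^+ 2 * (w' ^+ 2) ^+ 2 by rewrite b2E {1}u'E; ring.
have vE : vnu A B kap = (1 + r ^+ 2 * S2)^-1.
  by rewrite /vnu /kap /A /B; congr (_^-1); set t := r; field.
have [rz|rn] := eqVneq r 0.
  rewrite /kap rz mul0r expr0n mul0r oppr0 /A /B !exprMn third_side aE bE rz.
  rewrite !expr0n /= !mul0r !addr0 -mulrDl eqxx; split => //; ring.
have rr : 0 < r ^+ 2 by rewrite exprn_even_gt0.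
have s2 : 0 < s ^+ 2 by exact: exprn_gt0.
rewrite ifF; last first.
  apply/eqP => /eqP; rewrite !exprMn third_side aE bE -subr_eq0.
  rewrite (_ : _ - _ = 2 * (r ^+ 2 * (w ^+ 2 * w' ^+ 2)) * s ^+ 2); last by ring.
  by rewrite gt_eqF//; do !apply: mulr_gt0 => //.
pose t := r; rewrite -/t in rr rn aE bE vE.
have kE : kap = t / s by [].
have third : c ^+ 2 = S2 + t ^+ 2 * S2 ^+ 2 := third_side.
clearbody t kap.
have D0 : 0 < 1 + t ^+ 2 * S2 by rewrite addr_gt0// mulr_gt0// addr_gt0.
(* This is [- 1 / (kap^2 vnu)] with [kap = t / s]. *)
exists (- (s ^+ 2 * (1 + t ^+ 2 * S2) / t ^+ 2)); split.
- by rewrite vE kE; field; rewrite rn sn gt_eqF.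
- right; split; [by rewrite exprn_gt0// mulr_gt0|by rewrite exprn_gt0// mulr_gt0|].
  rewrite opprK /A /B -subr_gt0 (_ : _ - _ = s ^+ 2 / t ^+ 2); last by field.
  by rewrite divr_gt0.
have SE : A + B + - (s ^+ 2 * (1 + t ^+ 2 * S2) / t ^+ 2) = - (s ^+ 2 / t ^+ 2) by rewrite /A /B; field.
by rewrite SE !exprMn aE bE third /A /B; split; field; rewrite sn rn.
Qed.

End limit_hive.

(** * Relative entropy of the random hive with respect to the hive law *)

Unset Implicit Arguments.

Theorem theorem20 (R : realType) (w w' u u' a b delta c : R)
    (w_gt0 : 0 < w) (w'_gt0 : 0 < w') (u_ge0 : 0 <= u) (u'_ge0 : 0 <= u')
    (ratio : u / w ^+ 2 = u' / w' ^+ 2)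
    (a_gt0 : 0 < a) (b_gt0 : 0 < b)
    (a2E : a ^+ 2 = w ^+ 2 + u ^+ 2) (b2E : b ^+ 2 = w' ^+ 2 + u' ^+ 2)
    (deltaE : delta = u + u')
    (c_gt0 : 0 < c) (c2_ge : a ^+ 2 + b ^+ 2 <= c ^+ 2)
    (cE : delta ^+ 2 =
          2 * c ^+ 4 * (c ^+ 2 - a ^+ 2 - b ^+ 2) /
          ((c ^+ 2 - a ^+ 2 + b ^+ 2) * (c ^+ 2 + a ^+ 2 - b ^+ 2))) :
  exists K : R, \forall n \near \oo,
    forall (d : measure_display) (T : measurableType d) (P : probability T R)
           (G G' Gt Gt' : T -> 'M[R[i]]_n),
      is_GUE P G -> is_GUE P G' -> is_GUE P Gt -> is_GUE P Gt' ->
      independent_matrices P (tnth [tuple G; G'; Gt; Gt']) ->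
      let sn := Num.sqrt n%:R : R in
      let X om := sn%:C *: (w%:C *: G om + u%:C *: spec_diag_mx (Gt om)) in
      let Y om := sn%:C *: (w'%:C *: G' om + u'%:C *: spec_diag_mx (Gt' om)) in
      let h om := octahedron_hive (X om) (Y om) in
      let p := @hive_law_density R (a * sn) (b * sn) (c * sn) n in
      (exists q : hive_space n -> R, is_hive_density P h q) /\
      (forall q : hive_space n -> R, is_hive_density P h q ->
        (KL q p <= (K * (n%:R * ln n%:R))%:E)%E).

Proof.
(* This is the value of [kap^2 * B], in which the factors of [n] cancel. *)
pose tau := (u' / w') ^+ 2; have tau0 : 0 <= tau by exact: sqr_ge0.
(* Small enough for [tau * eps * (1 + eps) / 2 <= 1/8], the threshold of [coupling_bound]. *)
pose eps := (8 * (tau + 1))^-1.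
have eps0 : 0 < eps by rewrite invr_gt0 mulr_gt0// ltr_wpDl.
have epsE : eps * (8 * (tau + 1)) = 1 by rewrite mulVf// gt_eqF// mulr_gt0// ltr_wpDl.
(* The bound obtained is [n ln (sqrt 2) / eps], which is at most [n ln n / eps] from [n = 2] on. *)
exists eps^-1; apply: filterS (nbhs_infty_ge 2) => n n2 dT S P G G' Gt Gt' gG gG' gGt gGt' ind.
have n0 : (0 < n)%N by exact: leq_trans n2.
have nR : 0 < n%:R :> R by rewrite ltr0n.
have s0 : 0 < Num.sqrt (n%:R : R) by rewrite sqrtr_gt0.
set s := Num.sqrt _ in s0 *.
have [_ _ [psi mpsi psiK]] := @transport_iso R n.
pose kap := u / w ^+ 2 / s; pose A := (s * w) ^+ 2; pose B := (s * w') ^+ 2.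
have sw : s * w != 0 by rewrite gt_eqF// mulr_gt0.
have sw' : s * w' != 0 by rewrite gt_eqF// mulr_gt0.
have A0 : 0 < A by rewrite exprn_even_gt0.
have B0 : 0 < B by rewrite exprn_even_gt0.
have uE : s * u = kap * A by rewrite /kap /A; field; rewrite !gt_eqF.
have u'E : s * u' = kap * B by rewrite /kap /B ratio; field; rewrite !gt_eqF.
have mHc := measurable_random_hive n0 gG gG' gGt gGt' w w' uE u'E.
have [k law] := random_hive_law n0 gG gG' gGt gGt' ind A0 B0 mpsi psiK sw sw' erefl erefl uE u'E.
split.
  have [q [mq q0 qlaw]] := exists_density n0 A0 B0 mpsi psiK law.
  by exists q; split.
move=> q [_ mq q0 qlaw].
have -> : @hive_law_density R (a * s) (b * s) (c * s) n = (fun v : hive_space n => hive_weight A B (- (kap ^+ 2 * vnu A B kap)) v /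
   fine (\int[lebesgue_tuple #|coord_index n|]_(v in coord_cone n)
     (hive_weight A B (- (kap ^+ 2 * vnu A B kap)) v)%:E)%E).
  apply/funext => v; rewrite /hive_law_density.
  by rewrite (limit_triangle_param w_gt0 w'_gt0 ratio a_gt0 b_gt0 a2E b2E c2_ge _ s0)// -deltaE.
have small : kap ^+ 2 * B / 2 * ((1 + eps) * eps) <= 1 / 8.
  rewrite (_ : kap ^+ 2 * B = tau); first by nra.
  by rewrite /kap ratio /B /tau; field; rewrite !gt_eqF.
have mE : expR (n%:R * ln (Num.sqrt 2 : R)) = Num.sqrt 2 ^+ n.
  by rewrite expRM_natl lnK// posrE sqrtr_gt0.
apply: le_trans (KL_hive_weight_le n0 A0 B0 mpsi psiK mHc law eps0 small mE mq q0 qlaw) _.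
rewrite lee_fin mulrC; apply: ler_wpM2l; first by rewrite invr_ge0 ltW.
apply: ler_wpM2l => //; rewrite ler_ln ?posrE ?sqrtr_gt0//.
apply: (@le_trans _ _ 2); last by rewrite ler_nat.
rewrite -[leRHS]ger0_norm// -sqrtr_sqr ler_wsqrtr//; nra.
Qed.
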